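(* Let $\mathcal{N}_{A_1A_2\to B}$ be a quantum multiple access channel (with finite-dimensional systems). Define $\mathcal{R}_{\mathrm{in}}(\mathcal{N})$ as the union, over all finite alphabets $\mathcal{U},\mathcal{V}_1,\mathcal{X}_1,\mathcal{V}_2,\mathcal{X}_2$, all distributions $p_U(u)p_{V_1X_1|U}(v_1,x_1|u)p_{V_2X_2|U}(v_2,x_2|u)$ (so that $(V_1,X_1)-U-(V_2,X_2)$ is a Markov chain), all collections of states $\{\theta_{A_1}^{x_1}\}_{x_1}$, $\{\varphi_{A_2}^{x_2}\}_{x_2}$, and all quantum instruments $\Gamma_{B\to\bar BZ_1Z_2}$ with finite classical outcome registers $Z_1,Z_2$, of the set of rate pairs $(R_1,R_2)$ satisfying \begin{align*} R_1&\le I(X_1;\bar BZ_1Z_2|UV_1X_2)_\omega+I(V_1;Z_2|UX_2)_\omega,\\ R_2&\le I(X_2;\bar BZ_1Z_2|UV_2X_1)_\omega+I(V_2;Z_1|UX_1)_\omega,\\ R_1+R_2&\le I(V_1;Z_2|X_2U)_\omega+I(V_2;Z_1|X_1U)_\omega+I(X_1X_2;\bar BZ_1Z_2|UV_1V_2)_\omega,\\ R_1+R_2&\le I(X_1X_2;\bar BZ_1Z_2)_\omega, \end{align*} where all quantities are evaluated on the classical-quantum state \[ \omega=\sum_{u,v_1,x_1,v_2,x_2}p_U(u)p_{V_1X_1|U}(v_1,x_1|u)p_{V_2X_2|U}(v_2,x_2|u)\,|u,v_1,x_1,v_2,x_2\rangle\langle u,v_1,x_1,v_2,x_2|\otimes(\Gamma_{B\to\bar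 BZ_1Z_2}\circ\mathcal{N}_{A_1A_2\to B})(\theta^{x_1}_{A_1}\otimes\varphi^{x_2}_{A_2}). \] Then $\mathcal{C}_{\text{cl-fb}}(\mathcal{N})\supseteq\mathcal{R}_{\mathrm{in}}(\mathcal{N})$.
   Context: A quantum instrument $\Gamma_{B\to\bar BZ}$ is a channel of the form $\Gamma(\rho)=\sum_z\Gamma_z(\rho)\otimes|z\rangle\langle z|_Z$ with $\{\Gamma_z\}$ completely positive trace-non-increasing maps summing to a trace-preserving map; here the outcome is a pair $z=(z_1,z_2)$ stored in classical registers $Z_1,Z_2$, and $\bar B$ is the post-measurement system. Mutual informations are quantum (von Neumann) mutual informations; those involving only classical registers reduce to classical mutual informations of the induced joint distribution. Code with classical feedback: a $(2^{nR_1},2^{nR_2},n)$ code for $\mathcal{N}_{A_1A_2\to B}$ consists of: message sets $\mathcal{M}_k=[1:2^{nR_k}]$, $k=1,2$; for each $k$ and $i\in[1:n]$ an encoding map $\mathcal{F}^{(k,i)}:\mathcal{M}_k\times\mathcal{Z}_k^{i-1}\to\mathfrak{D}(\mathcal{H}_{A_k}^{\otimes i})$ (strictly causal in the feedback) that is backward compatible, i.e. $\mathrm{Tr}_{A_{k,i}}\mathcal{F}^{(k,i)}(m_k,z_k^{i-1})=\mathcal{F}^{(k,i-1)}(m_k,z_k^{i-2})$; a sequence of feedback quantum instruments $\mathcal{D}^{(i)}_{B_i\bar B^{i-1}\to\bar B^iZ_{1,i}Z_{2,i}}$ applied by the receiver at time $i$ to the channel output $B_i$ and the stored post-measurement systems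 $\bar B^{i-1}$, with outcome $z_{k,i}$ sent noiselessly to transmitter $k$ and available to it from time $i+1$ on; and a decoding POVM $\{\Delta_{m_1,m_2|z_1^{n-1},z_2^{n-1}}\}$ on $\mathcal{H}_{\bar B}^{\otimes(n-1)}\otimes\mathcal{H}_B$ applied to $\bar B^{n-1}B_n$. At time $i$ the channel acts on the $i$-th inputs $A_{1,i}A_{2,i}$. The average error probability is the probability, with messages uniform and feedback outcomes distributed according to the Born rule, that the decoded pair differs from $(m_1,m_2)$. A rate pair $(R_1,R_2)$ is achievable if for every $\varepsilon,\delta>0$ and all sufficiently large $n$ there is a $(2^{n(R_1-\delta)},2^{n(R_2-\delta)},n)$ code with average error probability at most $\varepsilon$. The capacity region $\mathcal{C}_{\text{cl-fb}}(\mathcal{N})$ is the closure of the set of achievable rate pairs. *)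

(* Defs.v *)
From HB Require Import structures.
From mathcomp Require Import all_boot all_order all_algebra.
From mathcomp Require Import complex.
From mathcomp Require Import all_classical all_reals all_analysis.
Set Implicit Arguments. Unset Strict Implicit. Unset Printing Implicit Defensive.
Import Order.TTheory GRing.Theory Num.Theory.
Import numFieldNormedType.Exports.
Local Open Scope ring_scope.

(* Finite-dimensional quantum systems.  A system with orthonormal basis
   indexed by a finite type I is H = C^I; an operator on H is a matrix
   indexed by I x I.  Tensor products of systems are products of index
   types; the i-fold tensor power of H_A is indexed by tup A i.        *)

Definition op (R : realType) (I : finType) := I -> I -> R[i].
Arguments op R I%_type.
Definition tup (A : finType) (i : nat) := {ffun 'I_i -> A}.

Definition trace (R : realType) (I : finType) (X : op R I) : R[i] :=
  \sum_(k : I) X k k.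

Definition trmul (R : realType) (I : finType) (X Y : op R I) : R[i] :=
  \sum_(k : I) \sum_(l : I) X k l * Y l k.

Definition idop (R : realType) (I : finType) : op R I := fun k l => (k == l)%:R.

Definition munit (R : realType) (I : finType) (p q : I) : op R I :=
  fun k l => ((k == p) && (l == q))%:R.

(* positive semidefinite: <v, X v> >= 0 for every vector v (in the
   partial order of C, this means real and nonnegative) *)
Definition psd (R : realType) (I : finType) (X : op R I) : Prop :=
  forall v : I -> R[i], 0 <= \sum_(k : I) \sum_(l : I) (v k)^* * X k l * v l.

Definition density (R : realType) (I : finType) (X : op R I) : Prop :=
  psd X /\ trace X = 1.

Definition tens (R : realType) (I J : finType) (X : op R I) (Y : op R J)
  : op R (I * J) := fun p q => X p.1 q.1 * Y p.2 q.2.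

Definition linmap (R : realType) (I J : finType) (Phi : op R I -> op R J) : Prop :=
  forall (a : R[i]) (X Y : op R I),
    Phi (fun k l => a * X k l + Y k l) = (fun k l => a * Phi X k l + Phi Y k l).

(* Phi (x) id_K  and  id_K (x) Phi, for a linear Phi *)
Definition applyL (R : realType) (I J K : finType) (Phi : op R I -> op R J)
  (X : op R (I * K)) : op R (J * K) :=
  fun p q => Phi (fun i i' => X (i, p.2) (i', q.2)) p.1 q.1.
Definition applyR (R : realType) (I J K : finType) (Phi : op R I -> op R J)
  (X : op R (K * I)) : op R (K * J) :=
  fun p q => Phi (fun i i' => X (p.1, i) (q.1, i')) p.2 q.2.

Definition compos (R : realType) (I J : finType) (Phi : op R I -> op R J) : Prop :=
  forall (K : finType) (X : op R (K * I)), psd X -> psd (applyR Phi X).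

Definition trpres (R : realType) (I J : finType) (Phi : op R I -> op R J) : Prop :=
  forall X : op R I, trace (Phi X) = trace X.

Definition trnonincr (R : realType) (I J : finType) (Phi : op R I -> op R J) : Prop :=
  forall X : op R I, psd X -> trace (Phi X) <= trace X.

Definition channel (R : realType) (I J : finType) (Phi : op R I -> op R J) : Prop :=
  [/\ linmap Phi, compos Phi & trpres Phi].

Definition instrument (R : realType) (I J Z1 Z2 : finType)
  (G : Z1 -> Z2 -> op R I -> op R J) : Prop :=
  [/\ forall z1 z2, linmap (G z1 z2),
      forall z1 z2, compos (G z1 z2),
      forall z1 z2, trnonincr (G z1 z2) &
      trpres (fun X => fun k l => \sum_(z1 : Z1) \sum_(z2 : Z2) G z1 z2 X k l)].

Definition opmx (R : realType) (I : finType) (X : op R I) : 'M[R[i]]_#|I| :=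
  \matrix_(k, l) X (enum_val k) (enum_val l).

Lemma eigen_exists (R : realType) (n : nat) (M : 'M[R[i]]_n) :
  {rs : seq R[i] | char_poly M = \prod_(z <- rs) ('X - z%:P)}.
Proof.
have [rs Hrs] := closed_field_poly_normal (char_poly M).
exists rs; rewrite {1}Hrs.
by have /monicP -> := char_poly_monic M; rewrite scale1r.
Qed.

Definition eigenvalues (R : realType) (n : nat) (M : 'M[R[i]]_n) : seq R[i] :=
  sval (eigen_exists M).

Definition log2 (R : realType) (x : R) : R := ln x / ln 2.

Definition etaf (R : realType) (x : R) : R :=
  if x == 0 then 0 else - (x * log2 x).

(* S(X) = - Tr X log2 X = sum over eigenvalues of eta *)
Definition vN (R : realType) (I : finType) (X : op R I) : R :=
  \sum_(z <- eigenvalues (opmx X)) etaf (complex.Re z).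

(* partial trace: f selects the kept subsystem, g the traced-out one
   ((f,g) : T -> S * E being a bijection) *)
Definition reduce (R : realType) (T S E : finType) (f : T -> S) (g : T -> E)
  (X : op R T) : op R S :=
  fun s s' => \sum_(t : T) \sum_(t' : T)
    ((f t == s) && (f t' == s') && (g t == g t'))%:R * X t t'.

(* The 8-register classical-quantum state omega on
     U V1 X1 V2 X2 Bbar Z1 Z2   (registers numbered 0 .. 7)           *)

Definition sel (b : bool) (X : finType) : finType := if b then X else unit.
Definition selp (b : bool) (X : finType) : X -> sel b X :=
  match b as b' return X -> sel b' X with
  | true => fun x => x
  | false => fun _ => tt
  end.

Definition reg8 (U V1 X1 V2 X2 Bb Z1 Z2 : finType) : finType :=
  (U * V1 * X1 * V2 * X2 * Bb * Z1 * Z2)%type.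

Definition sub8 (U V1 X1 V2 X2 Bb Z1 Z2 : finType) (m : nat -> bool) : finType :=
  (sel (m 0%N) U * sel (m 1%N) V1 * sel (m 2%N) X1 * sel (m 3%N) V2 *
   sel (m 4%N) X2 * sel (m 5%N) Bb * sel (m 6%N) Z1 * sel (m 7%N) Z2)%type.

Definition proj8 (U V1 X1 V2 X2 Bb Z1 Z2 : finType) (m : nat -> bool)
  (t : reg8 U V1 X1 V2 X2 Bb Z1 Z2) : sub8 U V1 X1 V2 X2 Bb Z1 Z2 m :=
  let: (u, v1, x1, v2, x2, b, z1, z2) := t in
  (selp (m 0%N) u, selp (m 1%N) v1, selp (m 2%N) x1, selp (m 3%N) v2,
   selp (m 4%N) x2, selp (m 5%N) b, selp (m 6%N) z1, selp (m 7%N) z2).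

Definition Hsub (R : realType) (U V1 X1 V2 X2 Bb Z1 Z2 : finType)
  (w : op R (reg8 U V1 X1 V2 X2 Bb Z1 Z2)) (S : seq nat) : R :=
  vN (reduce (@proj8 U V1 X1 V2 X2 Bb Z1 Z2 (fun k => k \in S))
             (@proj8 U V1 X1 V2 X2 Bb Z1 Z2 (fun k => k \notin S)) w).

Definition CMI (R : realType) (U V1 X1 V2 X2 Bb Z1 Z2 : finType)
  (w : op R (reg8 U V1 X1 V2 X2 Bb Z1 Z2)) (A B C : seq nat) : R :=
  Hsub w (A ++ C) + Hsub w (B ++ C) - Hsub w (A ++ B ++ C) - Hsub w C.

Definition omega (R : realType) (A1 A2 B : finType) (N : op R (A1 * A2) -> op R B)
  (U V1 X1 V2 X2 Bb Z1 Z2 : finType) (pU : U -> R)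
  (p1 : U -> V1 -> X1 -> R) (p2 : U -> V2 -> X2 -> R)
  (th : X1 -> op R A1) (ph : X2 -> op R A2)
  (G : Z1 -> Z2 -> op R B -> op R Bb) : op R (reg8 U V1 X1 V2 X2 Bb Z1 Z2) :=
  fun t t' =>
    let: (u, v1, x1, v2, x2, b, z1, z2) := t in
    let: (u', v1', x1', v2', x2', b', z1', z2') := t' in
    ((u == u') && (v1 == v1') && (x1 == x1') && (v2 == v2') && (x2 == x2')
      && (z1 == z1') && (z2 == z2'))%:R *
    (real_complex R (pU u * p1 u v1 x1 * p2 u v2 x2) *
     G z1 z2 (N (tens (th x1) (ph x2))) b b').

Definition distr (R : realType) (T : finType) (p : T -> R) : Prop :=
  (forall t, 0 <= p t) /\ \sum_(t : T) p t = 1.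
Definition cdistr (R : realType) (U V X : finType) (p : U -> V -> X -> R) : Prop :=
  forall u, (forall v x, 0 <= p u v x) /\ \sum_(v : V) \sum_(x : X) p u v x = 1.

Definition Rin (R : realType) (A1 A2 B : finType) (N : op R (A1 * A2) -> op R B)
  (R1 R2 : R) : Prop :=
  exists (U V1 X1 V2 X2 Bb Z1 Z2 : finType) (pU : U -> R)
    (p1 : U -> V1 -> X1 -> R) (p2 : U -> V2 -> X2 -> R)
    (th : X1 -> op R A1) (ph : X2 -> op R A2)
    (G : Z1 -> Z2 -> op R B -> op R Bb),
    [/\ distr pU, cdistr p1, cdistr p2,
        (forall x1, density (th x1)) & (forall x2, density (ph x2))] /\
    instrument G /\
        (let w := omega N pU p1 p2 th ph G in
        [/\ R1 <= CMI w [:: 2%N] [:: 5%N; 6%N; 7%N] [:: 0%N; 1%N; 4%N]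
                 + CMI w [:: 1%N] [:: 7%N] [:: 0%N; 4%N],
            R2 <= CMI w [:: 4%N] [:: 5%N; 6%N; 7%N] [:: 0%N; 3%N; 2%N]
                 + CMI w [:: 3%N] [:: 6%N] [:: 0%N; 2%N],
            R1 + R2 <= CMI w [:: 1%N] [:: 7%N] [:: 4%N; 0%N]
                      + CMI w [:: 3%N] [:: 6%N] [:: 2%N; 0%N]
                      + CMI w [:: 2%N; 4%N] [:: 5%N; 6%N; 7%N] [:: 0%N; 1%N; 3%N] &
            R1 + R2 <= CMI w [:: 2%N; 4%N] [:: 5%N; 6%N; 7%N] [::]]).

(* Codes with classical feedback.  Block length n = k.+1; times are
   1..n; feedback instruments act at times 1..n-1 (= k of them); the
   instrument at time j+1 (0-based j < k) is D j.                      *)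

(* message set size |[1:2^{n r}]| = 2^{ceil(n r)} (0 exponent if n r <= 0) *)
Definition msgsize (R : realType) (n : nat) (r : R) : nat :=
  (2 ^ `|Num.max 0%R (Num.ceil (n%:R * r))|)%N.

Definition snoc (A : finType) (i : nat) (s : tup A i) (a : A) : tup A i.+1 :=
  [ffun t : 'I_i.+1 => if unlift ord_max t is Some t' then s t' else a].
Definition ptrace_last (R : realType) (A : finType) (i : nat) (X : op R (tup A i.+1))
  : op R (tup A i) :=
  fun s s' => \sum_(a : A) X (snoc s a) (snoc s' a).

(* N^{(x) n} applied to X1 (x) X2 (the i-th channel use acts on A_{1,i} A_{2,i}) *)
Definition chan_n (R : realType) (A1 A2 B : finType) (N : op R (A1 * A2) -> op R B)
  (n : nat) (X1 : op R (tup A1 n)) (X2 : op R (tup A2 n)) : op R (tup B n) :=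
  fun b b' => \sum_(a1 : tup A1 n) \sum_(a1' : tup A1 n)
              \sum_(a2 : tup A2 n) \sum_(a2' : tup A2 n)
      X1 a1 a1' * X2 a2 a2' *
      \prod_(t < n) N (@munit R _ (a1 t, a2 t) (a1' t, a2' t)) (b t) (b' t).

Definition cons_tup (A : finType) (r : nat) (a : A) (s : tup A r) : tup A r.+1 :=
  [ffun t : 'I_r.+1 => if unlift ord0 t is Some t' then s t' else a].

Definition splitHead (R : realType) (Y B : finType) (r : nat)
  (X : op R (Y * tup B r.+1)) : op R ((Y * B) * tup B r) :=
  fun p q => X (p.1.1, cons_tup p.1.2 p.2) (q.1.1, cons_tup q.1.2 q.2).

Definition collapse1 (R : realType) (Y B : finType) (X : op R (Y * tup B 1))
  : op R (Y * B) :=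
  fun p q => X (p.1, [ffun _ => p.2]) (q.1, [ffun _ => q.2]).

Definition cast_tup (A : finType) (a b : nat) (e : a = b) (s : tup A b) : tup A a :=
  [ffun t => s (cast_ord e t)].
Definition castop (R : realType) (Bb B : finType) (a b : nat) (e : a = b)
  (X : op R (tup Bb a * B)) : op R (tup Bb b * B) :=
  fun p q => X (cast_tup e p.1, p.2) (cast_tup e q.1, q.2).

Definition Dat (R : realType) (B Bb Z1 Z2 : finType) (k : nat)
  (D : forall j : nat, Z1 -> Z2 -> op R (tup Bb j * B) -> op R (tup Bb j.+1))
  (h1 : tup Z1 k) (h2 : tup Z2 k) (j : nat) (X : op R (tup Bb j * B))
  : op R (tup Bb j.+1) :=
  match (insub j : option 'I_k) with
  | Some t => D j (h1 t) (h2 t) X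
  | None => fun _ _ => 0
  end.

Fixpoint run (R : realType) (B Bb Z1 Z2 : finType) (k : nat)
  (D : forall j : nat, Z1 -> Z2 -> op R (tup Bb j * B) -> op R (tup Bb j.+1))
  (h1 : tup Z1 k) (h2 : tup Z2 k) (r : nat) {struct r}
  : forall j : nat, op R (tup Bb j * tup B r.+1) -> op R (tup Bb (r + j) * B) :=
  match r return forall j : nat, op R (tup Bb j * tup B r.+1)
                   -> op R (tup Bb (r + j) * B) with
  | 0 => fun j X => collapse1 X
  | r'.+1 => fun j X =>
      castop (addnS r' j)
        (@run R B Bb Z1 Z2 k D h1 h2 r' j.+1 (applyL (Dat D h1 h2 (j := j)) (splitHead X)))
  end.

(* unnormalized final state on Bbar^{n-1} B_n for outcome histories h1 h2 *)
Definition final_state (R : realType) (A1 A2 B Bb Z1 Z2 : finType)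
  (N : op R (A1 * A2) -> op R B) (k : nat) (M1 M2 : nat)
  (F1 : forall i : nat, 'I_M1 -> tup Z1 k -> op R (tup A1 i))
  (F2 : forall i : nat, 'I_M2 -> tup Z2 k -> op R (tup A2 i))
  (D : forall j : nat, Z1 -> Z2 -> op R (tup Bb j * B) -> op R (tup Bb j.+1))
  (m1 : 'I_M1) (m2 : 'I_M2) (h1 : tup Z1 k) (h2 : tup Z2 k) : op R (tup Bb k * B) :=
  let X0 := chan_n N (F1 k.+1 m1 h1) (F2 k.+1 m2 h2) in
  let X1 : op R (tup Bb 0 * tup B k.+1) := fun p q => X0 p.2 q.2 in
  castop (addn0 k) (@run R B Bb Z1 Z2 k D h1 h2 k 0 X1).

Definition err_prob (R : realType) (A1 A2 B Bb Z1 Z2 : finType)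
  (N : op R (A1 * A2) -> op R B) (k : nat) (M1 M2 : nat)
  (F1 : forall i : nat, 'I_M1 -> tup Z1 k -> op R (tup A1 i))
  (F2 : forall i : nat, 'I_M2 -> tup Z2 k -> op R (tup A2 i))
  (D : forall j : nat, Z1 -> Z2 -> op R (tup Bb j * B) -> op R (tup Bb j.+1))
  (Dec : tup Z1 k -> tup Z2 k -> 'I_M1 -> 'I_M2 -> op R (tup Bb k * B)) : R :=
  1 - complex.Re ((M1 * M2)%:R^-1 *
        \sum_(m1 : 'I_M1) \sum_(m2 : 'I_M2) \sum_(h1 : tup Z1 k) \sum_(h2 : tup Z2 k)
          trmul (Dec h1 h2 m1 m2) (final_state N F1 F2 D m1 m2 h1 h2)).

Definition encoder (R : realType) (A Z : finType) (k M : nat)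
  (F : forall i : nat, 'I_M -> tup Z k -> op R (tup A i)) : Prop :=
  [/\
      (forall i m h, (1 <= i <= k.+1)%N -> density (F i m h)),
      (* strictly causal: F^{(i)} depends only on z^{i-1} *)
      (forall i m (h h' : tup Z k), (1 <= i <= k.+1)%N ->
         (forall t : 'I_k, (t.+1 < i)%N -> h t = h' t) -> F i m h = F i m h') &
      (forall i m h, (1 <= i <= k)%N -> ptrace_last (F i.+1 m h) = F i m h)].

Definition povm (R : realType) (Y M1 M2 : finType) (P : M1 -> M2 -> op R Y) : Prop :=
  (forall m1 m2, psd (P m1 m2)) /\
  (fun s s' => \sum_(m1 : M1) \sum_(m2 : M2) P m1 m2 s s') = @idop R Y.

Definition fb_code_exists (R : realType) (A1 A2 B : finType)
  (N : op R (A1 * A2) -> op R B) (k M1 M2 : nat) (eps : R) : Prop :=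
  exists (Bb Z1 Z2 : finType)
    (F1 : forall i : nat, 'I_M1 -> tup Z1 k -> op R (tup A1 i))
    (F2 : forall i : nat, 'I_M2 -> tup Z2 k -> op R (tup A2 i))
    (D : forall j : nat, Z1 -> Z2 -> op R (tup Bb j * B) -> op R (tup Bb j.+1))
    (Dec : tup Z1 k -> tup Z2 k -> 'I_M1 -> 'I_M2 -> op R (tup Bb k * B)),
    [/\ encoder F1, encoder F2,
        (forall j, (j < k)%N -> instrument (D j)),
        (forall h1 h2, povm (Dec h1 h2)) &
        err_prob N F1 F2 D Dec <= eps].

Definition achievable (R : realType) (A1 A2 B : finType)
  (N : op R (A1 * A2) -> op R B) (R1 R2 : R) : Prop :=
  forall eps delta : R, 0 < eps -> 0 < delta ->
    exists n0 : nat, forall k : nat, (n0 <= k.+1)%N ->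
      fb_code_exists N k (msgsize k.+1 (R1 - delta)) (msgsize k.+1 (R2 - delta)) eps.

Definition cap_fb (R : realType) (A1 A2 B : finType)
  (N : op R (A1 * A2) -> op R B) : set (R * R)%type :=
  closure [set p : (R * R)%type | achievable N p.1 p.2].

(* Main.v *)
(* Random block-Markov coding, with the instrument used memorylessly.  In each block a superposition
   code is sent: a cloud layer U, layers V1 and V2, and layers X1 and X2.  The V-layers carry fresh
   symbols a1, a2; from the feedback of the block, sender 2 decodes a1 out of Z2 and sender 1
   decodes a2 out of Z1, so that in the next block both senders know the pair (a1, a2) and jointly
   resend it to the receiver by the cloud index and by whatever the upper layers do not need for
   fresh messages.  The receiver works through the blocks backwards, so the V-layer symbols of a
   block are already known when its cloud, X1 and X2 indices are decoded one after the other by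
   projective tests; Gao's union bound controls the total disturbance.

   Simultaneous decoding is avoided by splitting X1 in two: an intermediate layer reveals x1 with
   probability lam, and the rest of x1 is decoded after x2.  As lam varies, successive decoding
   sweeps the sum-rate face of the region.  That all rates involved are nonnegative, and that a
   negative rate can be replaced by 0, only uses concavity of the entropy. *)
Require Import Defs.
From HB Require Import structures.
From mathcomp Require Import all_boot all_order all_algebra.
From mathcomp Require Import complex spectral.
From mathcomp Require Import all_classical all_reals all_analysis.
From mathcomp Require Import ring lra.
Set Implicit Arguments. Unset Strict Implicit. Unset Printing Implicit Defensive.
Import Order.TTheory GRing.Theory Num.Theory.
Import numFieldNormedType.Exports.
Local Open Scope ring_scope.

(** * Operators *)

(** The inputs depend on the feedback, so the received state is not a product codeword state and
    random coding does not apply to it directly. It is compared with the state that would arise if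
    both senders always held the right pair. Instrument outcomes are kept as diagonal registers, so
    this state is block diagonal in the feedback histories, and on every history that leads both
    senders to the right guesses the true unnormalized state is exactly its block. Prepending the
    diagonal projector on these histories to the receiver's tests lets one application of the union
    bound cover feedback and decoding errors alike.

    Since the V-indices are known when the cloud is tested, a wrong cloud index meets the fully
    averaged output, and the rates of the four tests add up to [I(X1 X2; Bbar Z1 Z2)] without
    conditioning on [U]. This is the last bound of the region.

    One book serves all blocks: the error is bounded by a sum over blocks, so only its expectation
    over the book matters. The final block without fresh symbols costs a factor [L / (L + 1)] in
    rate; hence [L] is fixed before the block length grows. *)

Section OpAlgebra.
Variable R : realType.
Local Notation C := R[i].
Implicit Types (I J K : finType).

Definition opmul I (X Y : op R I) : op R I := fun k l => \sum_(j : I) X k j * Y j l.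
Definition adj I (X : op R I) : op R I := fun k l => (X l k)^*.
Definition opB I (X Y : op R I) : op R I := fun k l => X k l - Y k l.

Lemma cjD (x y : C) : (x + y)^* = x^* + y^*. Proof. exact: rmorphD. Qed.
Lemma cjM (x y : C) : (x * y)^* = x^* * y^*. Proof. exact: rmorphM. Qed.
Lemma cj1 : (1 : C)^* = 1. Proof. exact: rmorph1. Qed.
Lemma cj0 : (0 : C)^* = 0. Proof. exact: rmorph0. Qed.
Lemma cjn (n : nat) : (n%:R : C)^* = n%:R. Proof. exact: rmorph_nat. Qed.
Lemma cj_sum (T : Type) (r : seq T) (P : pred T) (F : T -> C) :
  (\sum_(i <- r | P i) F i)^* = \sum_(i <- r | P i) (F i)^*.
Proof. exact: rmorph_sum. Qed.
Lemma cj_prod (T : Type) (r : seq T) (P : pred T) (F : T -> C) :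
  (\prod_(i <- r | P i) F i)^* = \prod_(i <- r | P i) (F i)^*.
Proof. exact: rmorph_prod. Qed.
Lemma cjr (x : R) : (real_complex R x)^* = real_complex R x.
Proof. by apply/eqP; rewrite eq_complex /= eqxx oppr0 eqxx. Qed.

Lemma opP I (X Y : op R I) : (forall k l, X k l = Y k l) -> X = Y.
Proof. by move=> h; apply/funext => k; apply/funext => l. Qed.

Lemma opmulA I (X Y Z : op R I) : opmul (opmul X Y) Z = opmul X (opmul Y Z).
Proof.
apply: opP => k l; rewrite /opmul.
under eq_bigr do rewrite big_distrl /=.
rewrite exchange_big /=; apply: eq_bigr => j _.
by rewrite big_distrr /=; apply: eq_bigr => i _; rewrite mulrA.
Qed.

Lemma op1mul I (X : op R I) : opmul (@idop R I) X = X.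
Proof.
apply: opP => k l; rewrite /opmul /idop (bigD1 k) //= eqxx mul1r big1 ?addr0 // => j.
by rewrite eq_sym => /negbTE ->; rewrite mul0r.
Qed.

Lemma opmul1 I (X : op R I) : opmul X (@idop R I) = X.
Proof.
apply: opP => k l; rewrite /opmul /idop (bigD1 l) //= eqxx mulr1 big1 ?addr0 // => j.
by move=> /negbTE ->; rewrite mulr0.
Qed.

Lemma opmulBl I (X Y Z : op R I) : opmul (opB X Y) Z = opB (opmul X Z) (opmul Y Z).
Proof.
apply: opP => k l; rewrite /opmul /opB -sumrB.
by apply: eq_bigr => j _; rewrite mulrBl.
Qed.

Lemma opmulBr I (X Y Z : op R I) : opmul Z (opB X Y) = opB (opmul Z X) (opmul Z Y).
Proof.
apply: opP => k l; rewrite /opmul /opB -sumrB.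
by apply: eq_bigr => j _; rewrite mulrBr.
Qed.

Lemma adjM I (X Y : op R I) : adj (opmul X Y) = opmul (adj Y) (adj X).
Proof.
apply: opP => k l; rewrite /opmul /adj cj_sum.
by apply: eq_bigr => j _; rewrite cjM mulrC.
Qed.

Lemma adjK I (X : op R I) : adj (adj X) = X.
Proof. by apply: opP => k l; rewrite /adj conjCK. Qed.

Lemma adj1 I : adj (@idop R I) = @idop R I.
Proof. by apply: opP => k l; rewrite /adj /idop conjC_nat eq_sym. Qed.

Lemma adjB I (X Y : op R I) : adj (opB X Y) = opB (adj X) (adj Y).
Proof. by apply: opP => k l; rewrite /adj /opB rmorphB. Qed.

Lemma trmulE I (X Y : op R I) : trmul X Y = trace (opmul X Y).
Proof. by []. Qed.

Lemma trmulC I (X Y : op R I) : trmul X Y = trmul Y X.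
Proof.
rewrite /trmul exchange_big /=; apply: eq_bigr => k _; apply: eq_bigr => l _.
by rewrite mulrC.
Qed.

Lemma trmulBl I (X Y Z : op R I) : trmul (opB X Y) Z = trmul X Z - trmul Y Z.
Proof.
rewrite /trmul -sumrB; apply: eq_bigr => k _; rewrite -sumrB.
by apply: eq_bigr => l _; rewrite /opB mulrBl.
Qed.

Lemma trmul1l I (X : op R I) : trmul (@idop R I) X = trace X.
Proof. by rewrite trmulE op1mul. Qed.

Definition isproj I (P : op R I) := adj P = P /\ opmul P P = P.
Definition compl I (P : op R I) : op R I := opB (@idop R I) P.

Lemma complE I (P X : op R I) : opmul (compl P) X = opB X (opmul P X).
Proof. by rewrite /compl opmulBl op1mul. Qed.

Lemma complK I (P : op R I) : compl (compl P) = P.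
Proof. by apply: opP => k l; rewrite /compl /opB opprB addrC subrK. Qed.

Lemma isproj_compl I (P : op R I) : isproj P -> isproj (compl P).
Proof.
move=> [h1 h2]; split; first by rewrite /compl adjB adj1 h1.
by rewrite complE {2 3}/compl opmulBr opmul1 h2; apply: opP => k l; rewrite /opB subrr subr0.
Qed.

(** The semi-inner product of operators weighted by [rho]. For a product [K] of projectors,
    [bform rho K K] is the probability that all the tests accept in turn. *)
Definition bform I (rho X Y : op R I) : R := complex.Re (trmul (opmul (adj X) Y) rho).

Lemma cReB (x y : C) : complex.Re (x - y) = complex.Re x - complex.Re y.
Proof. by case: x => a b; case: y. Qed.

Lemma cReD (x y : C) : complex.Re (x + y) = complex.Re x + complex.Re y.
Proof. by case: x => a b; case: y. Qed.

Lemma cRe_sum (T : Type) (r : seq T) (P : pred T) (F : T -> C) :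
  complex.Re (\sum_(i <- r | P i) F i) = \sum_(i <- r | P i) complex.Re (F i).
Proof. exact: (big_morph (@complex.Re R) cReD). Qed.

Lemma cReM (a : R) (x : C) : complex.Re (real_complex R a * x) = a * complex.Re x.
Proof. by case: x => x y; rewrite /= mul0r subr0. Qed.

Lemma cRe_ge0 (x : C) : 0 <= x -> 0 <= complex.Re x.
Proof. by rewrite lecE /= => /andP[]. Qed.

Lemma cRe_conj (x : C) : complex.Re (x^*) = complex.Re x.
Proof. by case: x. Qed.

Lemma bformBl I (rho X Y Z : op R I) : bform rho (opB X Y) Z = bform rho X Z - bform rho Y Z.
Proof. by rewrite /bform adjB opmulBl trmulBl cReB. Qed.

Lemma bformBr I (rho X Y Z : op R I) : bform rho Z (opB X Y) = bform rho Z X - bform rho Z Y.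
Proof. by rewrite /bform opmulBr trmulBl cReB. Qed.

Lemma bform_ge0 I (rho X : op R I) : psd rho -> 0 <= bform rho X X.
Proof.
move=> h; rewrite /bform.
have -> : trmul (opmul (adj X) X) rho =
  \sum_(i : I) \sum_(k : I) \sum_(l : I) ((X i k)^*)^* * rho k l * (X i l)^*.
  rewrite trmulC /trmul.
  transitivity (\sum_k \sum_l \sum_i ((X i k)^*)^* * rho k l * (X i l)^*).
    apply: eq_bigr => k _; apply: eq_bigr => l _; rewrite /opmul big_distrr /=.
    by apply: eq_bigr => i _; rewrite /adj conjCK mulrA mulrAC (mulrC (rho _ _)) mulrAC.
  under eq_bigr do rewrite exchange_big /=.
  by rewrite exchange_big.
rewrite cRe_sum; apply: sumr_ge0 => i _; apply: cRe_ge0; exact: h.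
Qed.

Lemma psd_form2 I (rho : op R I) (k l : I) (a b : C) : psd rho ->
  0 <= a^* * rho k k * a + a^* * rho k l * b + (b^* * rho l k * a + b^* * rho l l * b).
Proof.
move=> /(_ (fun j => (j == k)%:R * a + (j == l)%:R * b)).
suff -> : forall F : I -> I -> C, \sum_i \sum_j ((i == k)%:R * a + (i == l)%:R * b)^* * F i j * ((j == k)%:R * a + (j == l)%:R * b) = a^* * F k k * a + a^* * F k l * b + (b^* * F l k * a + b^* * F l l * b) by [].
move=> F.
have sel (G : I -> C) (q : I) : \sum_i (i == q)%:R * G i = G q.
  rewrite (bigD1 q) //= eqxx mul1r big1 ?addr0 // => i /negbTE ->.
  by rewrite mul0r.
transitivity (\sum_i ((i == k)%:R * (a^* * F i k * a + a^* * F i l * b) + (i == l)%:R * (b^* * F i k * a + b^* * F i l * b))).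
  apply: eq_bigr => i _.
  transitivity (\sum_j ((j == k)%:R * (((i == k)%:R * a + (i == l)%:R * b)^* * F i j * a) + (j == l)%:R * (((i == k)%:R * a + (i == l)%:R * b)^* * F i j * b))).
    by apply: eq_bigr => j _; ring.
  by rewrite big_split /= !sel cjD !cjM !cjn; ring.
by rewrite big_split /= !sel.
Qed.

Lemma psd_herm I (rho : op R I) : psd rho -> adj rho = rho.
Proof.
move=> h; apply: opP => k l; rewrite /adj.
have im0 (z : C) : 0 <= z -> complex.Im z = 0.
  by rewrite lecE /= => /andP[/eqP].
have rkk j : complex.Im (rho j j) = 0.
  have := im0 _ (psd_form2 j j 1 0 h); rewrite !cj1 cj0 !mul1r !mulr1 !mul0r !mulr0.
  by rewrite !addr0.
(* The form is real on [e_k + e_l] and on [e_k + i e_l]: the first makes the imaginary parts of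
   [rho k l] and [rho l k] opposite, the second makes their real parts equal. *)
have := im0 _ (psd_form2 k l 1 1 h); have := im0 _ (psd_form2 k l 1 'i%C h).
rewrite !cj1 !mul1r !mulr1.
have := rkk k; have := rkk l.
case: (rho k l) => a b; case: (rho l k) => a' b'.
case: (rho k k) => a1 b1; case: (rho l l) => a2 b2 /= -> ->.
by rewrite ?(mul0r, mulr0, mul1r, mulr1, add0r, addr0, subr0, sub0r) => e1 e2;
  apply/eqP; rewrite eq_complex /=; apply/andP; split; apply/eqP; lra.
Qed.
End OpAlgebra.

(** * Sequences of projective tests *)

Section GentleSequences.
Variable R : realType.
Local Notation C := R[i].
Implicit Types (I J K : finType).

Definition opsum I (J : Type) (r : seq J) (F : J -> op R I) : op R I :=
  fun k l => \sum_(j <- r) F j k l.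
Definition ptr I (rho P : op R I) : R := complex.Re (trmul P rho).

Lemma bform_sym I (rho X Y : op R I) : psd rho -> bform rho X Y = bform rho Y X.
Proof.
move=> /psd_herm h; rewrite /bform -cRe_conj trmulE /trace cj_sum.
rewrite -[in RHS]h trmulC trmulE /trace; congr (complex.Re _); apply: eq_bigr => k _.
have <- : adj (opmul (opmul (adj X) Y) rho) = opmul (adj rho) (opmul (adj Y) X).
  by rewrite !adjM adjK.
by [].
Qed.

Lemma bform_projr I (rho X Y Q : op R I) : isproj Q ->
  bform rho X (opmul Q Y) = bform rho (opmul Q X) (opmul Q Y).
Proof.
move=> [h1 h2]; by rewrite /bform adjM h1 opmulA -(opmulA Q Q) h2.
Qed.

Lemma bform_proj I (rho Q : op R I) : isproj Q -> bform rho Q Q = ptr rho Q.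
Proof. by move=> [h1 h2]; rewrite /bform /ptr h1 h2. Qed.

Lemma bform_compl I (rho Y P : op R I) : psd rho -> isproj P ->
  bform rho (opmul (compl P) Y) (opmul (compl P) Y) =
  bform rho Y Y - bform rho (opmul P Y) (opmul P Y).
Proof.
move=> hr hP; rewrite complE bformBr 2!bformBl -(bform_projr _ Y Y hP).
by rewrite (bform_sym (opmul P Y) Y hr) opprB subrr addr0.
Qed.

(** Positivity of the square of [2 X - Y]. The small weight on [Y] is what allows the drop of the
    norm to be absorbed in [gao_union_bound]. *)
Lemma bform_amgm I (rho X Y : op R I) : psd rho ->
  bform rho X Y <= bform rho X X + bform rho Y Y / 4.
Proof.
move=> hr; have := bform_ge0 (opB X (opB Y X)) hr.
rewrite !(bformBr, bformBl) (bform_sym Y X hr); lra.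
Qed.

(** The head of the list is measured first, hence stands rightmost in the product. *)
Fixpoint prodK I (l : seq (op R I)) : op R I :=
  if l is P :: l' then opmul (prodK l') P else @idop R I.

Lemma prodK_cat I (l1 l2 : seq (op R I)) :
  prodK (l1 ++ l2) = opmul (prodK l2) (prodK l1).
Proof. by elim: l1 => [|P l1 IH] /=; rewrite ?opmul1 // IH opmulA. Qed.

(* Induction on the list: the cross term produced by the first projector is absorbed by AM-GM into
   the drop of the squared norm, which telescopes. *)
Lemma gao_union_bound_step I (rho : op R I) (l : seq (op R I)) (A : op R I) : psd rho ->
  List.Forall (@isproj R I) l ->
  bform rho (@idop R I) A - bform rho (@idop R I) (opmul (prodK l) A) <=
  \sum_(P <- l) ptr rho (compl P) +
  (bform rho A A - bform rho (opmul (prodK l) A) (opmul (prodK l) A)) / 4.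
Proof.
move=> hr; elim: l A => [|P l IH] A hl.
  by rewrite /= op1mul big_nil !subrr mul0r addr0.
inversion hl as [|? ? hP hl']; subst.
rewrite /= opmulA big_cons; have := IH (opmul P A) hl'.
have hq := isproj_compl hP.
have h1 : bform rho (@idop R I) A - bform rho (@idop R I) (opmul P A) =
  bform rho (compl P) (opmul (compl P) A).
  by rewrite -bformBr -complE (bform_projr _ _ _ hq) opmul1.
have := bform_amgm (compl P) (opmul (compl P) A) hr.
rewrite (bform_proj _ hq) (bform_compl A hr hP) -h1; lra.
Qed.

Lemma gao_union_bound I (rho : op R I) (l : seq (op R I)) : psd rho -> trace rho = 1 ->
  List.Forall (@isproj R I) l ->
  1 - bform rho (prodK l) (prodK l) <= 4 * \sum_(P <- l) ptr rho (compl P).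
Proof.
move=> hr ht hl; have := gao_union_bound_step (@idop R I) hr hl.
have := bform_ge0 (opB (@idop R I) (prodK l)) hr.
rewrite opmul1 !(bformBr, bformBl) (bform_sym _ (@idop R I) hr).
have -> : bform rho (@idop R I) (@idop R I) = 1.
  by rewrite /bform adj1 op1mul trmul1l ht.
lra.
Qed.

Lemma psdD I (X Y : op R I) : psd X -> psd Y -> psd (fun k l => X k l + Y k l).
Proof.
move=> hX hY v; have -> : \sum_k \sum_l (v k)^* * (X k l + Y k l) * v l =
  \sum_k \sum_l (v k)^* * X k l * v l + \sum_k \sum_l (v k)^* * Y k l * v l.
  rewrite -big_split /=; apply: eq_bigr => k _; rewrite -big_split /=.
  by apply: eq_bigr => l _; ring.
by rewrite addr_ge0.
Qed.

Lemma psd0 I : psd (fun k l : I => 0 : C).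
Proof. by move=> v; rewrite big1 // => k _; rewrite big1 // => l _; rewrite mulr0 mul0r. Qed.

Lemma psd_sum I (J : Type) (r : seq J) (F : J -> op R I) :
  (forall j, psd (F j)) -> psd (opsum r F).
Proof.
move=> hF; elim: r => [|j r IH].
  have -> : opsum [::] F = (fun k l : I => 0) by apply: opP => k l; rewrite /opsum big_nil.
  exact: psd0.
have -> : opsum (j :: r) F = (fun k l => F j k l + opsum r F k l).
  by apply: opP => k l; rewrite /opsum big_cons.
exact: psdD.
Qed.

Lemma psd_conj I (X A : op R I) : psd X -> psd (opmul (adj A) (opmul X A)).
Proof.
move=> hX v; have -> : \sum_k \sum_l (v k)^* * opmul (adj A) (opmul X A) k l * v l =
  \sum_k \sum_l (\sum_j A k j * v j)^* * X k l * (\sum_j A l j * v j).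
  transitivity (\sum_k \sum_l \sum_i \sum_j (v i)^* * (A k i)^* * X k l * A l j * v j).
    transitivity (\sum_i \sum_j \sum_k \sum_l (v i)^* * (A k i)^* * X k l * A l j * v j).
      apply: eq_bigr => i _; apply: eq_bigr => j _; rewrite /opmul /adj.
      rewrite mulr_sumr mulr_suml; apply: eq_bigr => k _.
      rewrite !mulr_sumr mulr_suml; apply: eq_bigr => l _; ring.
    under eq_bigr do rewrite exchange_big /=.
    rewrite exchange_big /=; apply: eq_bigr => k _.
    under eq_bigr do rewrite exchange_big /=.
    by rewrite exchange_big.
  apply: eq_bigr => k _; apply: eq_bigr => l _; rewrite cj_sum !mulr_suml.
  apply: eq_bigr => i _; rewrite mulr_sumr; apply: eq_bigr => j _; rewrite cjM; ring.
exact: hX.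
Qed.

Lemma psd_id I : psd (@idop R I).
Proof.
move=> v; apply: sumr_ge0 => k _; rewrite (bigD1 k) //= big1 ?addr0.
  by rewrite /idop eqxx mulr1 mulrC mul_conjC_ge0.
by move=> l hl; rewrite /idop eq_sym (negbTE hl) mulr0 mul0r.
Qed.

Lemma psd_adjmul I (A : op R I) : psd (opmul (adj A) A).
Proof. by have := psd_conj A (@psd_id I); rewrite op1mul. Qed.

(** Sum of the effects of the outcome sequences [L j]. Positivity of its difference to the identity
    says that these effects form a sub-POVM. *)
Definition gram I (J : Type) (r : seq J) (L : J -> seq (op R I)) : op R I :=
  opsum r (fun j => opmul (adj (prodK (L j))) (prodK (L j))).

Lemma opmul_suml I (J : Type) (r : seq J) (F : J -> op R I) X :
  opmul (opsum r F) X = opsum r (fun j => opmul (F j) X).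
Proof.
apply: opP => k l; rewrite /opmul /opsum exchange_big /=; apply: eq_bigr => j _.
by rewrite mulr_suml.
Qed.

Lemma opmul_sumr I (J : Type) (r : seq J) (F : J -> op R I) X :
  opmul X (opsum r F) = opsum r (fun j => opmul X (F j)).
Proof.
apply: opP => k l; rewrite /opmul /opsum exchange_big /=; apply: eq_bigr => j _.
by rewrite mulr_sumr.
Qed.

(* The tests of [r] are run in order until one accepts; [scan P r s] is the list of
   outcomes along which [s] is accepted first. *)
Fixpoint scan I (S : eqType) (P : S -> op R I) (r : seq S) (s : S) : seq (op R I) :=
  if r is a :: r' then
    if a == s then [:: P a] else compl (P a) :: scan P r' s
  else [::].

(** With [Q = 1 - P a] and [G] the sum for the remaining tests, [1 - P a - Q G Q = Q (1 - G) Q]. *)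
Lemma scan_gram I (S : eqType) (P : S -> op R I) (r : seq S) :
  uniq r -> (forall s, isproj (P s)) -> psd (opB (@idop R I) (gram r (scan P r))).
Proof.
move=> hu hP; elim: r hu => [|a r IH] /= => [_|/andP[har hu]].
  have -> : opB (@idop R I) (gram [::] (scan P [::])) = @idop R I.
    by apply: opP => k l; rewrite /opB /gram /opsum big_nil subr0.
  exact: psd_id.
have := psd_conj (compl (P a)) (IH hu).
have [hQ1 hQ2] := isproj_compl (hP a); set Q := compl (P a) in hQ1 hQ2 *.
rewrite hQ1 [opmul (opB _ (gram _ _)) Q]opmulBl op1mul [opmul Q (opB Q _)]opmulBr hQ2.
suff -> : opB (idop R (I:=I)) (gram (a :: r) (scan P (a :: r))) =
  opB Q (opmul Q (opmul (gram r (scan P r)) Q)) by [].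
rewrite opmul_suml opmul_sumr; apply: opP => k l.
rewrite /opB /gram /opsum big_cons /= eqxx /= op1mul.
have [hp1 hp2] := hP a; rewrite hp1 hp2 opprD addrA /Q /compl /opB; congr (_ - _).
rewrite big_seq [RHS]big_seq; apply: eq_bigr => s hs; case: eqVneq => [e|_] /=; first by rewrite e hs in har.
by rewrite adjM hQ1 !opmulA.
Qed.

Lemma scan_proj I (S : eqType) (P : S -> op R I) r s : (forall s, isproj (P s)) ->
  List.Forall (@isproj R I) (scan P r s).
Proof.
move=> hP; elim: r => [|a r IH] //=; case: eqP => _.
  by constructor.
by constructor => //; apply: isproj_compl.
Qed.

Lemma ptr_ge0 I (rho P : op R I) : psd rho -> isproj P -> 0 <= ptr rho P.
Proof. by move=> hr hP; rewrite -bform_proj // bform_ge0. Qed.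

(** The complement of a rejection that precedes [s] is the acceptance of a wrong index; the sum over
    these is enlarged to all wrong indices, which removes the dependence on the order of the
    tests. *)
Lemma scan_error I (S : finType) (P : S -> op R I) (rho : op R I) s :
  psd rho -> (forall s, isproj (P s)) ->
  \sum_(Q <- scan P (index_enum S) s) ptr rho (compl Q) <=
  ptr rho (compl (P s)) + \sum_(s' | s' != s) ptr rho (P s').
Proof.
move=> hr hP; elim: (index_enum S) (mem_index_enum s) (index_enum_uniq S) => // a r IH /=.
rewrite inE => hin /andP[har hu]; case: eqVneq => [e|hne].
  by rewrite big_seq1 e lerDl; apply: sumr_ge0 => *; exact: ptr_ge0.
rewrite big_cons complK big_cons hne addrCA; apply: lerD => //.
by apply: IH => //; move: hin; rewrite eq_sym (negbTE hne).
Qed.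

(** The second measurement may depend on the outcome of the first: with [K] the product of [L1 j]
    and [G2 j] the second sum, the deficiency is [1 - G1] plus the sum over [j] of [1 - G2 j]
    conjugated by [K]. *)
Lemma gram_compose I (J1 J2 : finType) (L1 : J1 -> seq (op R I))
  (L2 : J1 -> J2 -> seq (op R I)) :
  psd (opB (@idop R I) (gram (index_enum J1) L1)) ->
  (forall j, psd (opB (@idop R I) (gram (index_enum J2) (L2 j)))) ->
  psd (opB (@idop R I)
    (gram (index_enum (J1 * J2)%type) (fun j => L1 j.1 ++ L2 j.1 j.2))).
Proof.
move=> h1 h2.
have hs : psd (opsum (index_enum J1) (fun j => opmul (adj (prodK (L1 j)))
  (opmul (opB (@idop R I) (gram (index_enum J2) (L2 j))) (prodK (L1 j))))).
  by apply: psd_sum => j; apply: psd_conj.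
have := psdD h1 hs; congr (psd _); apply: opP => k l.
rewrite /opB /gram /opsum -(pair_bigA _ (fun j1 j2 => opmul
  (adj (prodK (L1 j1 ++ L2 j1 j2))) (prodK (L1 j1 ++ L2 j1 j2)) k l)) /=.
rewrite -addrA; congr (_ + _); rewrite -sumrN -big_split /= -sumrN; apply: eq_bigr => j _.
set K := prodK (L1 j); set G := (fun k l : I => _ : C).
have -> : G = opB (idop R (I:=I)) (gram (index_enum J2) (L2 j)) by [].
rewrite opmulBl op1mul opmulBr {1}/opB addKr; congr (- _).
rewrite opmul_suml opmul_sumr /opsum; apply: eq_bigr => j2 _.
by rewrite prodK_cat adjM !opmulA.
Qed.
End GentleSequences.

(** * Spectral decomposition and the packing test *)

Section Spectral.
Variable R : realType.
Local Notation C := R[i].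
Local Notation rc := (real_complex R).
Implicit Types (I J K : finType).

(** The eigenvectors are indexed by [I] itself, so that products and direct sums of systems inherit
    an eigenbasis by index. Orthonormality and completeness are both recorded, which spares deducing
    one from the other in each construction. *)
Definition eigd I (X : op R I) (la : I -> R) (e : I -> I -> C) : Prop :=
  [/\ forall y y', \sum_k (e y k)^* * e y' k = (y == y')%:R,
      forall k l, \sum_y e y k * (e y l)^* = (k == l)%:R &
      forall k l, X k l = \sum_y rc (la y) * (e y k * (e y l)^*)].

Lemma sum_enum_val (V : nmodType) I (F : I -> V) :
  \sum_k F k = \sum_(j < #|I|) F (enum_val j).
Proof.
rewrite (reindex_onto (@enum_val I I) enum_rank) /= => [|j _]; last by rewrite enum_rankK.
by apply: eq_bigl => j; rewrite enum_valK eqxx.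
Qed.

Lemma eigd_exists I (X : op R I) : psd X -> exists la e, eigd X la e.
Proof.
move=> hX; have hh := psd_herm hX.
pose M := opmx X.
have Mh : M \is hermsymmx.
  apply/is_hermitianmxP; rewrite expr0 scale1r; apply/matrixP => i j; rewrite !mxE.
  by rewrite -[in LHS]hh.
have hr := hermitian_spectral_diag_real Mh.
have /orthomx_spectralP := hermitian_normalmx Mh.
set P := spectralmx M; set sp := spectral_diag M => hM.
have hP : P \is unitarymx := spectral_unitarymx M.
have hP1 := unitarymxP hP.
have hP2 := unitarymxP (etrans (trmxC_unitary P) hP).
rewrite (invmx_unitary hP) in hM.
pose rk (y : I) := enum_rank y.
exists (fun y => complex.Re (sp 0 (rk y))), (fun y k => (P (rk y) (rk k))^*); split.
- move=> y y'; have /matrixP /(_ (rk y) (rk y')) := hP1.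
  rewrite !mxE (inj_eq enum_rank_inj) => <-.
  rewrite sum_enum_val.
  by apply: eq_bigr => j _; rewrite !mxE /rk enum_valK conjCK.
- move=> k l; have /matrixP /(_ (rk k) (rk l)) := hP2.
  rewrite !mxE (inj_eq enum_rank_inj) => <-.
  rewrite sum_enum_val.
  by apply: eq_bigr => j _; rewrite !mxE /rk enum_valK.
- move=> k l; have /matrixP /(_ (rk k) (rk l)) := hM.
  rewrite /M /opmx !mxE !enum_rankK => ->.
  rewrite [RHS]sum_enum_val.
  apply: eq_bigr => j _; rewrite !mxE /rk enum_valK conjCK.
  rewrite (bigD1 j) //= big1 ?addr0 => [|i /negbTE hi]; last by rewrite !mxE hi mulr0n mulr0.
  rewrite !mxE eqxx mulr1n (RRe_real (mxOverP hr 0 j)).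
  by rewrite mulrA; congr (_ * _); rewrite mulrC.
Qed.

Lemma char_poly_similar n (Q P D : 'M[C]_n) : P *m Q = 1%:M ->
  char_poly (Q *m D *m P) = char_poly D.
Proof.
move=> h; have h' := mulmx1C h.
rewrite /char_poly /char_poly_mx !map_mxM.
set q := map_mx _ Q; set p := map_mx _ P; set d := map_mx _ D.
have hqp : q *m p = 1%:M by rewrite -map_mxM h' map_mx1.
have -> : 'X%:M - q *m d *m p = q *m ('X%:M - d) *m p.
  by rewrite mulmxBr mulmxBl; congr (_ - _); rewrite scalar_mxC -mulmxA hqp mulmx1.
by rewrite !det_mulmx mulrAC -det_mulmx hqp det1 mul1r.
Qed.

(** The characteristic polynomial is invariant under similarity and factors uniquely up to order, so
    the roots chosen in [eigenvalues] are a permutation of any spectrum. *)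
Lemma vN_eigd I (X : op R I) la e : eigd X la e -> vN X = \sum_y etaf (la y).
Proof.
move=> [h1 h2 h3]; rewrite /vN /eigenvalues; case: eigen_exists => rs /= hrs.
pose Q : 'M[C]_#|I| := \matrix_(k, y) e (enum_val y) (enum_val k).
pose P : 'M[C]_#|I| := \matrix_(y, k) (e (enum_val y) (enum_val k))^*.
pose D : 'M[C]_#|I| := diag_mx (\row_y rc (la (enum_val y))).
have hPQ : P *m Q = 1%:M.
  apply/matrixP => y y'; rewrite !mxE.
  rewrite -(inj_eq enum_val_inj) -h1 [RHS]sum_enum_val.
  by apply: eq_bigr => j _; rewrite !mxE.
have hX : opmx X = Q *m D *m P.
  apply/matrixP => k l; rewrite !mxE h3.
  rewrite [LHS]sum_enum_val.
  apply: eq_bigr => j _; rewrite !mxE (bigD1 j) //= big1 ?addr0.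
    by rewrite !mxE eqxx mulr1n; ring.
  by move=> i /negbTE hi; rewrite !mxE hi mulr0n mulr0.
move: hrs; rewrite hX char_poly_similar // char_poly_trig ?diag_mx_is_trig //.
have -> : \prod_(i < #|I|) ('X - (D i i)%:P) =
   \prod_(z <- [seq rc (la y) | y <- index_enum I]) ('X - z%:P).
  rewrite big_map [RHS](reindex_onto (@enum_val I I) enum_rank) /= => [|j _]; last by rewrite enum_rankK.
  rewrite [RHS](eq_bigl predT) => [|j]; last by rewrite enum_valK eqxx.
  by apply: eq_bigr => i _; rewrite !mxE eqxx mulr1n.
move=> /prod_XsubC_eq hp; rewrite -(perm_big _ hp) big_map.
by apply: eq_bigr => y _.
Qed.

Definition ap I (T : op R I) (v : I -> C) : I -> C := fun k => \sum_l T k l * v l.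
Definition dotv I (v w : I -> C) : C := \sum_k (v k)^* * w k.
Definition nrm I (v : I -> C) : R := complex.Re (dotv v v).
Definition qv I (T : op R I) (v : I -> C) : R := complex.Re (dotv v (ap T v)).

Lemma apM I (S T : op R I) v : ap (opmul S T) v = ap S (ap T v).
Proof.
apply/funext => k; rewrite /ap /opmul.
under eq_bigr do rewrite mulr_suml.
rewrite exchange_big /=; apply: eq_bigr => j _; rewrite mulr_sumr.
by apply: eq_bigr => l _; rewrite mulrA.
Qed.

Lemma dotv_ap I (T : op R I) v w : dotv v (ap T w) = dotv (ap (adj T) v) w.
Proof.
rewrite /dotv /ap; under eq_bigr do rewrite mulr_sumr.
rewrite exchange_big /=; apply: eq_bigr => l _; rewrite cj_sum mulr_suml.
by apply: eq_bigr => k _; rewrite /adj cjM conjCK; ring.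
Qed.

Lemma nrm_ge0 I (v : I -> C) : 0 <= nrm v.
Proof.
apply: cRe_ge0; apply: sumr_ge0 => k _; rewrite mulrC; exact: mul_conjC_ge0.
Qed.

Lemma dotvv_ge0 I (v : I -> C) : 0 <= dotv v v.
Proof. by apply: sumr_ge0 => k _; rewrite mulrC; exact: mul_conjC_ge0. Qed.

Lemma nrmE I (v : I -> C) : dotv v v = rc (nrm v).
Proof. by rewrite /nrm RRe_real // ger0_real // dotvv_ge0. Qed.

Lemma nrm_eq0 I (v : I -> C) : nrm v = 0 -> forall k, v k = 0.
Proof.
move=> h k; have := nrmE v; rewrite h => /eqP.
rewrite psumr_eq0 => [/allP /(_ k (mem_index_enum k))|j _]; last first.
  by rewrite mulrC; exact: mul_conjC_ge0.
by rewrite mulrC mul_conjC_eq0 => /eqP.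
Qed.

Lemma qv_proj I (T : op R I) v : isproj T -> qv T v = nrm (ap T v).
Proof. by move=> [h1 h2]; rewrite /qv /nrm -{1}h2 apM dotv_ap h1. Qed.

Lemma ap_opB I (S T : op R I) v : ap (opB S T) v = fun k => ap S v k - ap T v k.
Proof.
apply/funext => k; rewrite /ap /opB -sumrB; apply: eq_bigr => l _.
by rewrite mulrBl.
Qed.

Lemma ap1 I (v : I -> C) : ap (@idop R I) v = v.
Proof.
apply/funext => k; rewrite /ap /idop (bigD1 k) //= eqxx mul1r big1 ?addr0 // => j.
by rewrite eq_sym => /negbTE ->; rewrite mul0r.
Qed.

Lemma dotvBr I (u v w : I -> C) : dotv u (fun k => v k - w k) = dotv u v - dotv u w.
Proof. by rewrite /dotv -sumrB; apply: eq_bigr => k _; rewrite mulrBr. Qed.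

Lemma qv_compl I (T : op R I) v : qv (compl T) v = nrm v - qv T v.
Proof. by rewrite /qv /compl ap_opB ap1 dotvBr cReB. Qed.

Lemma qv_proj_ge0 I (T : op R I) v : isproj T -> 0 <= qv T v.
Proof. by move=> h; rewrite qv_proj // nrm_ge0. Qed.

Lemma qv_proj_le I (T : op R I) v : isproj T -> qv T v <= nrm v.
Proof.
by move=> h; rewrite -subr_ge0 -qv_compl; apply: qv_proj_ge0; apply: isproj_compl.
Qed.

Lemma ptr_eigd I (rho T : op R I) la e : eigd rho la e ->
  ptr rho T = \sum_y la y * qv T (e y).
Proof.
move=> [_ _ h3]; rewrite /ptr.
have -> : trmul T rho = \sum_y rc (la y) * dotv (e y) (ap T (e y)).
  transitivity (\sum_k \sum_l \sum_y rc (la y) * ((e y k)^* * (T k l * e y l))).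
    apply: eq_bigr => k _; apply: eq_bigr => l _; rewrite h3 mulr_sumr.
    by apply: eq_bigr => y _; ring.
  under eq_bigr do rewrite exchange_big /=.
  rewrite exchange_big /=; apply: eq_bigr => y _; rewrite /dotv mulr_sumr.
  by apply: eq_bigr => k _; rewrite /ap !mulr_sumr.
by rewrite cRe_sum; apply: eq_bigr => y _; rewrite cReM.
Qed.
Definition outer I (v w : I -> C) : op R I := fun k l => v k * (w l)^*.

(** Gram-Schmidt: the part [w] of a new vector orthogonal to the range of [T] is dropped if it
    vanishes, and otherwise its normalized projector [O] is added. The last clause is minimality; in
    [packing_test] it places [T] under the spectral projector of [sigma]. *)
Lemma span_proj I (Y : eqType) (V : Y -> I -> C) (r : seq Y) :
  exists T : op R I, [/\ isproj T, forall y, y \in r -> ap T (V y) = V y,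
    complex.Re (trace T) <= (size r)%:R &
    forall P, isproj P -> (forall y, y \in r -> ap P (V y) = V y) -> opmul P T = T].
Proof.
elim: r => [|y r [T [[hT1 hT2] hV htr hP]]].
  exists (fun _ _ => 0); split => //; last 2 first.
  - by rewrite /trace big1.
  - move=> P _ _; apply: opP => k l; rewrite /opmul big1 // => j _; exact: mulr0.
  split; apply: opP => k l; first by rewrite /adj cj0.
  by rewrite /opmul big1 // => j _; exact: mulr0.
pose w k := V y k - ap T (V y) k.
have hTw : ap T w = fun=> 0.
  rewrite /w; apply/funext => k.
  transitivity (ap T (V y) k - ap (opmul T T) (V y) k); last by rewrite hT2 subrr.
  by rewrite apM /ap -sumrB; apply: eq_bigr => l _; rewrite -mulrBr.
case: (eqVneq (nrm w) 0) => [/nrm_eq0 w0|wn0].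
  exists T; split => //.
  - move=> z; rewrite inE => /orP[/eqP ->|/hV //]; apply/funext => k.
    by have /eqP := w0 k; rewrite subr_eq0 => /eqP.
  - by apply: (le_trans htr); rewrite ler_nat.
  - by move=> P h1 h2; apply: hP => // z hz; apply: h2; rewrite inE hz orbT.
pose c := rc (nrm w)^-1; have hc : c * dotv w w = 1.
  by rewrite nrmE /c -rmorphM /= mulVf.
have hwT v : dotv w (ap T v) = 0.
  by rewrite dotv_ap hT1 hTw /dotv big1 // => k _; rewrite cj0 mul0r.
pose O k l := c * outer w w k l.
have hapO v k : ap O v k = c * dotv w v * w k.
  rewrite /ap /O /outer -mulrA mulr_suml mulr_sumr.
  by apply: eq_bigr => l _; ring.
have hap v k : ap (fun k l => T k l + O k l) v k = ap T v k + c * dotv w v * w k.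
  by rewrite -hapO /ap -big_split /=; apply: eq_bigr => l _; rewrite mulrDl.
have hTy : dotv w (V y) = dotv w w.
  have -> : V y = fun k => ap T (V y) k - (- w k).
    by apply/funext => k; rewrite opprK /w addrC subrK.
  rewrite dotvBr hwT sub0r /dotv -sumrN; apply: eq_bigr => k _; ring.
have hTO : opmul T O = fun _ _ => 0.
  apply: opP => k l; transitivity (ap T w k * (c * (w l)^*)); last by rewrite hTw mul0r.
  by rewrite /opmul /ap /O /outer mulr_suml; apply: eq_bigr => j _; ring.
have hOT : opmul O T = fun _ _ => 0.
  apply: opP => k l; transitivity (c * w k * (ap T w l)^*); last by rewrite hTw cj0 mulr0.
  rewrite /opmul /ap /O /outer cj_sum mulr_sumr; apply: eq_bigr => j _.
  by rewrite -[in LHS]hT1 /adj cjM; ring.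
have hOO : opmul O O = O.
  apply: opP => k l; transitivity (c * dotv w w * O k l); last by rewrite hc mul1r.
  rewrite /opmul /O /outer /dotv mulr_sumr mulr_suml.
  by apply: eq_bigr => j _; ring.
have cc : c^* = c by rewrite cjr.
exists (fun k l => T k l + O k l); split.
- split; apply: opP => k l.
    by rewrite /adj cjD /O /outer !cjM cc conjCK -[in RHS]hT1 /adj; congr (_ + _); ring.
  transitivity (opmul T T k l + opmul T O k l + (opmul O T k l + opmul O O k l)).
    by rewrite /opmul -!big_split /=; apply: eq_bigr => j _; ring.
  by rewrite hT2 hTO hOT hOO addr0 add0r.
- move=> z; rewrite inE => /orP[/eqP ->|hz]; apply/funext => k; rewrite hap.
    by rewrite hTy hc mul1r /w addrC subrK.
  by rewrite -{2}(hV z hz) hwT mulr0 mul0r addr0 hV.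
- have -> : trace (fun k l => T k l + O k l) = trace T + 1.
    rewrite /trace big_split /=; congr (_ + _); rewrite -hc mulr_sumr.
    by apply: eq_bigr => k _; rewrite /O /outer; ring.
  by rewrite cReD /= -natr1 lerD2r.
- move=> P hPp hPV; apply: opP => k l.
  have hPT : opmul P T = T by apply: hP => // z hz; apply: hPV; rewrite inE hz orbT.
  have hPw : ap P w = w.
    have {1}-> : w = fun k => V y k - ap T (V y) k by [].
    apply/funext => i; rewrite {1}/ap; under eq_bigr do rewrite mulrBr.
    rewrite sumrB; have -> : \sum_j P i j * V y j = ap P (V y) i by [].
    have -> : \sum_j P i j * ap T (V y) j = ap P (ap T (V y)) i by [].
    by rewrite -apM hPT hPV ?inE ?eqxx.
  transitivity (opmul P T k l + opmul P O k l).
    by rewrite /opmul -big_split /=; apply: eq_bigr => j _; ring.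
  rewrite hPT; congr (_ + _).
  transitivity (ap P w k * (c * (w l)^*)); last by rewrite hPw /O /outer; ring.
  by rewrite /opmul /ap /O /outer mulr_suml; apply: eq_bigr => j _; ring.
Qed.

Lemma psd_eigd_ge0 I (X : op R I) la e y : psd X -> eigd X la e -> 0 <= la y.
Proof.
move=> hX [h1 _ h3].
suff -> : la y = complex.Re (\sum_k \sum_l (e y k)^* * X k l * e y l) by apply/cRe_ge0/hX.
have -> : \sum_k \sum_l (e y k)^* * X k l * e y l =
    \sum_z rc (la z) * (dotv (e y) (e z) * dotv (e z) (e y)).
  transitivity (\sum_k \sum_l \sum_z rc (la z) * ((e y k)^* * e z k * ((e z l)^* * e y l))).
    apply: eq_bigr => k _; apply: eq_bigr => l _; rewrite h3 mulr_sumr mulr_suml.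
    by apply: eq_bigr => z _; ring.
  under eq_bigr do rewrite exchange_big /=.
  rewrite exchange_big /=; apply: eq_bigr => z _; rewrite /dotv mulr_suml mulr_sumr.
  by apply: eq_bigr => k _; rewrite !mulr_sumr.
rewrite (bigD1 y) //= big1 => [|z hz]; first by rewrite /dotv !h1 eqxx !mulr1 addr0.
by rewrite /dotv !h1 eq_sym (negbTE hz) mul0r mulr0.
Qed.

Lemma trace_eigd I (X : op R I) la e : eigd X la e -> complex.Re (trace X) = \sum_y la y.
Proof.
move=> h; have := ptr_eigd (@idop R I) h; rewrite /ptr trmul1l => ->.
apply: eq_bigr => y _; rewrite /qv ap1; have [h1 _ _] := h.
by rewrite /dotv h1 eqxx mulr1.
Qed.

Lemma nrm_eigd I (X : op R I) la e y : eigd X la e -> nrm (e y) = 1.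
Proof. by move=> [h _ _]; rewrite /nrm /dotv h eqxx. Qed.

(* [T] projects onto the span of the vectors [P e_y], [lam y >= a], where [P] is the spectral
   projector of [sigma] on its eigenvalues at most [b]; the rank of [T] is at most [1 / a]. *)
Lemma packing_test I (rho sigma : op R I) lam e mu f (a b : R) :
  psd rho -> trace rho = 1 -> psd sigma -> eigd rho lam e -> eigd sigma mu f -> 0 < a -> 0 <= b ->
  forall P : op R I, P = (fun k l => \sum_(y | mu y <= b) f y k * (f y l)^*) ->
  exists T, [/\ isproj T, ptr sigma T <= b / a &
    ptr rho (compl T) <= \sum_(y | lam y < a) lam y + ptr rho (compl P)].
Proof.
move=> hr htr hs er es a0 b0 P hPE.
have [f1 f2 f3] := es; have [e1 e2 e3] := er.
have lam0 y : 0 <= lam y by apply: psd_eigd_ge0 hr er.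
have mu0 y : 0 <= mu y by apply: psd_eigd_ge0 hs es.
have hP : isproj P.
  rewrite hPE; split; apply: opP => k l.
    by rewrite /adj cj_sum; apply: eq_bigr => y _; rewrite cjM conjCK mulrC.
  rewrite /opmul; transitivity (\sum_(y | mu y <= b) \sum_(z | mu z <= b)
     f y k * (f z l)^* * \sum_j (f y j)^* * f z j).
    under eq_bigr do rewrite mulr_suml.
    rewrite exchange_big /=; apply: eq_bigr => y _.
    under eq_bigr do rewrite mulr_sumr.
    rewrite exchange_big /=; apply: eq_bigr => z _; rewrite mulr_sumr.
    by apply: eq_bigr => j _; ring.
  apply: eq_bigr => y hy; rewrite (bigD1 y) //= f1 eqxx mulr1 big1 ?addr0 // => z /andP[_ hz].
  by rewrite f1 eq_sym (negbTE hz) mulr0.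
have hPf y : ~~ (mu y <= b) -> ap P (f y) = fun=> 0.
  move=> hy; apply/funext => k; rewrite /ap hPE.
  under eq_bigr do rewrite mulr_suml.
  rewrite exchange_big /= big1 // => z hz.
  transitivity (f z k * \sum_j (f z j)^* * f y j).
    by rewrite mulr_sumr; apply: eq_bigr => j _; ring.
  by rewrite f1; case: eqVneq hz => [->|_ _]; rewrite ?(negbTE hy) ?mulr0.
pose r := [seq y <- enum I | a <= lam y].
have [T [hT hTV htT hTP]] := span_proj (fun y => ap P (e y)) r.
exists T; split => //.
- have hPT : opmul P T = T.
    by apply: hTP => // y _; rewrite -apM hP.2.
  have hTP' : opmul T P = T by rewrite -{1}hT.1 -{1}hP.1 -adjM hPT hT.1.
  (* [T] lies under [P], where [sigma] is at most [b]. *)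
  have hle : ptr sigma T <= b * complex.Re (trace T).
    have -> : complex.Re (trace T) = \sum_y qv T (f y).
      have e1' : eigd (@idop R I) (fun=> 1) f.
        split=> // k l; rewrite /idop -f2; apply: eq_bigr => y _; by rewrite mul1r.
      by have := ptr_eigd T e1'; rewrite /ptr trmulC trmul1l => ->; apply: eq_bigr => y _; rewrite mul1r.
    rewrite (ptr_eigd _ es) mulr_sumr; apply: ler_sum => y _.
    have := qv_proj_ge0 (f y) hT.
    case: (boolP (mu y <= b)) => [hy h0|hy _]; first exact: ler_wpM2r.
    suff -> : qv T (f y) = 0 by rewrite !mulr0.
    rewrite (qv_proj _ hT) -hTP' apM (hPf _ hy) /nrm /dotv big1 // => k _.
    by rewrite /ap big1 ?mulr0 // => l _; rewrite mulr0.
  apply: (le_trans hle); apply: ler_wpM2l => //; apply: (le_trans htT).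
  (* At most [1 / a] eigenvalues of a state can reach [a], which bounds the rank of [T]. *)
  have ht1 : \sum_y lam y = 1 by rewrite -(trace_eigd er) htr.
  rewrite -(ler_pM2r a0) mulVf ?gt_eqF //; apply: le_trans (_ : \sum_y lam y <= 1); last by rewrite ht1.
  rewrite (bigID (fun y => a <= lam y)) /=; apply: ler_wpDr; first by apply: sumr_ge0.
  have -> : \sum_(y | a <= lam y) lam y = \sum_(y <- r) lam y.
    by rewrite /r big_filter big_enum_cond.
  rewrite mulrC; have : all (fun y => a <= lam y) r by exact: filter_all.
  elim: (r) => [|y s IH] /=; first by rewrite mulr0 big_nil.
  move=> /andP[h1 h2]; by rewrite big_cons -addn1 natrD mulrDr mulr1 addrC lerD // IH.
- rewrite !(ptr_eigd _ er) [X in X + _]big_mkcond -big_split /=.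
  apply: ler_sum => y _; have n1 := nrm_eigd y er.
  case: ltP => hy.
    rewrite -[X in X <= _]addr0; apply: lerD.
      by rewrite -[leRHS]mulr1 -n1; apply: ler_wpM2l => //; apply: qv_proj_le; apply: isproj_compl.
    by apply: mulr_ge0 => //; apply: qv_proj_ge0; apply: isproj_compl.
  rewrite add0r; apply: ler_wpM2l => //.
  have hQ := isproj_compl hT.
  (* [T] fixes [P e_y], so [1 - T] sees only the part of [e_y] that [P] cuts off. *)
  have -> : qv (compl T) (e y) = qv (compl T) (ap (compl P) (e y)).
    have -> : ap (compl P) (e y) = fun k => e y k - ap P (e y) k by rewrite /compl ap_opB ap1.
    rewrite !(qv_proj _ hQ); congr nrm.
    have hz : ap (compl T) (ap P (e y)) = fun=> 0.
      rewrite /compl ap_opB ap1 hTV; last by rewrite mem_filter hy mem_enum.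
      by apply/funext => k; rewrite subrr.
    apply/funext => k; rewrite -[LHS]subr0 -[X in _ - X](congr1 (fun g => g k) hz) /ap -sumrB.
    by apply: eq_bigr => l _; rewrite -mulrBr.
  by rewrite [leRHS]qv_proj; [exact: qv_proj_le|exact: isproj_compl].
Qed.
End Spectral.

(** * Typical sequences *)

Section LargeNumbers.
Variable R : realType.
Implicit Types (I J K : finType).

Lemma sum_tup_prod (V : comPzSemiRingType) I m (F : 'I_m -> I -> V) :
  \sum_(y : tup I m) \prod_t F t (y t) = \prod_t \sum_i F t i.
Proof. by rewrite bigA_distr_bigA. Qed.

Definition tfst I J m (w : tup (I * J)%type m) : tup I m := [ffun t => (w t).1].
Definition tsnd I J m (w : tup (I * J)%type m) : tup J m := [ffun t => (w t).2].
Definition tzip I J m (c : tup I m) (y : tup J m) : tup (I * J)%type m :=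
  [ffun t => (c t, y t)].

Lemma sum_tzip (V : nmodType) I J m (F : tup I m -> tup J m -> V) :
  \sum_c \sum_y F c y = \sum_(w : tup (I * J)%type m) F (tfst w) (tsnd w).
Proof.
rewrite pair_bigA /= (reindex (fun w : tup (I * J)%type m => (tfst w, tsnd w))) //=.
exists (fun q => tzip q.1 q.2) => [w _|[c y] _] /=.
  by apply/ffunP => t; rewrite !ffunE; case: (w t).
by congr pair; apply/ffunP => t; rewrite !ffunE.
Qed.

Lemma exp_decay (eta e : R) : 0 < eta -> 0 < e ->
  exists m0 : nat, forall m, (m0 <= m)%N -> expR (- (eta * m%:R)) <= e.
Proof.
move=> h0 e0; exists (Num.bound ((eta * e)^-1)) => m hm.
have h1 : (eta * e)^-1 < m%:R.
  apply: lt_le_trans (_ : (Num.bound ((eta * e)^-1))%:R <= m%:R); last by rewrite ler_nat.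
  by apply: archi_boundP; rewrite invr_ge0 mulr_ge0 ?ltW.
rewrite expRN -[leRHS]invrK lef_pV2 ?posrE ?expR_gt0 ?invr_gt0 //.
apply: (le_trans _ (expR_ge1Dx _)).
have : e^-1 < eta * m%:R.
  by move: h1; rewrite invfM -ltr_pdivrMl ?invr_gt0 // ?invrK mulrC // ltr_pdivrMr // mulrC.
lra.
Qed.

Lemma expR_quad (x : R) : `|x| <= 2^-1 -> expR x <= 1 + x + 2 * x ^+ 2.
Proof.
rewrite ler_norml => /andP[h1 h2].
have h3 : 0 < 1 - x by lra.
have h4 : expR x <= (1 - x)^-1.
  rewrite -[expR x]invrK lef_pV2 ?posrE ?invr_gt0 ?expR_gt0 // -expRN.
  by apply: le_trans (expR_ge1Dx _); rewrite lexx.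
apply: (le_trans h4); rewrite -(ler_pM2l h3) mulfV ?gt_eqF // expr2.
have : 0 <= x * x * (1 - 2 * x) by apply: mulr_ge0; [rewrite -expr2; exact: sqr_ge0|lra].
lra.
Qed.

(* Chernoff's bound, with the moment generating function estimated by its Taylor polynomial. *)
Lemma weak_law I (q g : I -> R) (d e : R) : distr q -> 0 < d -> 0 < e ->
  exists m0 : nat, forall m, (m0 <= m)%N ->
   \sum_(w : tup I m | m%:R * (\sum_i q i * g i + d) <= \sum_t g (w t)) \prod_t q (w t) <= e.
Proof.
move=> [q0 q1] d0 e0; set E := \sum_i q i * g i.
pose h i := g i - E - d.
pose M : R := 1 + \sum_i `|h i|.
have hM i : `|h i| <= M.
  by rewrite /M (bigD1 i) //=; have : 0 <= \sum_(j | j != i) `|h j| := sumr_ge0 _ (fun _ _ => normr_ge0 _); lra.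
have M1 : 1 <= M by rewrite /M lerDl; apply: sumr_ge0.
(* The first bound keeps [s h] within the range of [expR_quad]; the second keeps the quadratic term
   below half of the drift [s d], which leaves the decay [s d / 2] per letter. *)
pose s := Num.min (2 * M)^-1 (d / (4 * M ^+ 2)).
have s0 : 0 < s.
  rewrite lt_min; apply/andP; split; first by rewrite invr_gt0; lra.
  by apply: divr_gt0 => //; apply: mulr_gt0 => //; apply: exprn_gt0; lra.
have hs1 : s * M <= 2^-1.
  have M0 : 0 < M by lra.
  have : s <= (2 * M)^-1 by rewrite ge_min lexx.
  have hM2 : (2 * M)^-1 * M = 2^-1 by field; lra.
  by rewrite -hM2 ler_pM2r.
have hs2 : 2 * (s * M ^+ 2) <= d / 2.
  have hs : s <= d / (4 * M ^+ 2) by rewrite ge_min lexx orbT.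
  have M2 : 0 < M ^+ 2 by apply: exprn_gt0; lra.
  have hM2 : d / (4 * M ^+ 2) * M ^+ 2 = d / 4 by field; lra.
  have := ler_wpM2r (ltW M2) hs; rewrite hM2; lra.
have [m0 hm0] := exp_decay (mulr_gt0 s0 (divr_gt0 d0 (ltr0n R 2))) e0.
exists m0 => m hm; apply: le_trans (hm0 m hm).
have hr : \sum_i q i * expR (s * h i) <= expR (- (s * (d / 2))).
  apply: le_trans (expR_ge1Dx _).
  apply: (@le_trans _ _ (\sum_i (q i * (1 + s * h i + 2 * (s * h i) ^+ 2)))).
    apply: ler_sum => i _; apply: ler_wpM2l => //; apply: expR_quad.
    by rewrite normrM gtr0_norm //; apply: le_trans hs1; apply: ler_wpM2l => //; exact: ltW.
  apply: (@le_trans _ _ (\sum_i (q i * (1 - s * d + 2 * (s * M) ^+ 2) + s * (q i * g i - E * q i)))).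
    apply: ler_sum => i _; have -> : q i * (1 + s * h i + 2 * (s * h i) ^+ 2) =
      q i * (1 - s * d + 2 * (s * h i) ^+ 2) + s * (q i * g i - E * q i) by rewrite /h; ring.
    apply: lerD => //; apply: ler_wpM2l => //; rewrite lerD2l ler_pM2l //.
    rewrite -[leLHS]real_normK ?num_real // lerXn2r ?nnegrE //; first by apply: mulr_ge0; lra.
    by rewrite normrM gtr0_norm //; apply: ler_wpM2l => //; exact: ltW.
  rewrite big_split /= -mulr_suml q1 mul1r -mulr_sumr sumrB -/E -mulr_sumr q1 mulr1 subrr mulr0 addr0.
  have : s * (2 * (s * M ^+ 2)) <= s * (d / 2) by rewrite ler_pM2l.
  rewrite exprMn expr2; lra.
apply: (@le_trans _ _ (\sum_(w : tup I m) \prod_t (q (w t) * expR (s * h (w t))))).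
  rewrite big_mkcond /=; apply: ler_sum => w _; rewrite big_split /=.
  have p0 : 0 <= \prod_t q (w t) by apply: prodr_ge0.
  have e1 : 0 <= \prod_t expR (s * h (w t)) by apply: prodr_ge0 => t _; exact: expR_ge0.
  case: ifP => hw; last by apply: mulr_ge0.
  rewrite ler_peMr // -expR_sum -expR0 ler_expR -mulr_sumr; apply: mulr_ge0; first exact: ltW.
  rewrite /h !sumrB !sumr_const !card_ord -[E *+ _]mulr_natl -[d *+ _]mulr_natl.
  move: hw; rewrite mulrDr; lra.
rewrite (sum_tup_prod (fun _ i => q i * expR (s * h i))) prodr_const card_ord.
rewrite -mulNr expRM_natr; apply: lerXn2r; rewrite ?nnegrE ?expR_ge0 //.
by apply: sumr_ge0 => i _; apply: mulr_ge0 => //; exact: expR_ge0.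
Qed.

Lemma etafE (x : R) : etaf x = - (x * ln x) / ln 2.
Proof.
rewrite /etaf /log2; case: eqP => [->|_]; first by rewrite mul0r oppr0 mul0r.
by rewrite mulrA mulNr.
Qed.

Lemma ln2_gt0 : 0 < ln 2 :> R.
Proof. by rewrite ln_gt0 //; lra. Qed.

Definition centropy I J (p : I -> R) (mu : I -> J -> R) : R :=
  \sum_c p c * \sum_y etaf (mu c y).

Lemma centropyE I J (p : I -> R) (mu : I -> J -> R) :
  \sum_(w : I * J) (p w.1 * mu w.1 w.2) * ln (mu w.1 w.2) = - (ln 2 * centropy p mu).
Proof.
rewrite -(pair_bigA _ (fun c y => (p c * mu c y) * ln (mu c y))) /= /centropy mulr_sumr -sumrN.
apply: eq_bigr => c _; rewrite !mulr_sumr -sumrN; apply: eq_bigr => y _.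
by rewrite etafE; field; rewrite gt_eqF // ln2_gt0.
Qed.

Lemma distr_joint I J (p : I -> R) (mu : I -> J -> R) : distr p -> (forall c, distr (mu c)) ->
  distr (fun w : I * J => p w.1 * mu w.1 w.2).
Proof.
move=> [p0 p1] h; split; first by move=> w; apply: mulr_ge0 => //; case: (h w.1).
rewrite -(pair_bigA _ (fun c y => p c * mu c y)) /= -[RHS]p1; apply: eq_bigr => c _.
by rewrite -mulr_sumr; case: (h c) => _ ->; rewrite mulr1.
Qed.

Lemma ln_prod I (r : seq I) (F : I -> R) : (forall i, 0 < F i) ->
  ln (\prod_(i <- r) F i) = \sum_(i <- r) ln (F i).
Proof.
move=> h; elim: r => [|i r IH]; first by rewrite !big_nil ln1.
by rewrite !big_cons lnM ?posrE ?IH // prodr_gt0.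
Qed.

(** The weak law for [ln mu] and for [- ln mu] under the joint law of a letter. Both tails are
    averaged over the conditioning word [c], so no typicality of [c] is asked for. *)
Lemma aep I J (p : I -> R) (mu : I -> J -> R) (d e : R) :
  distr p -> (forall c, distr (mu c)) -> 0 < d -> 0 < e ->
  exists m0 : nat, forall m, (m0 <= m)%N ->
    \sum_(c : tup I m) (\prod_t p (c t)) *
      (\sum_(y : tup J m | expR (- (m%:R * (ln 2 * (centropy p mu - d)))) < \prod_t mu (c t) (y t))
         \prod_t mu (c t) (y t)) <= e /\
    \sum_(c : tup I m) (\prod_t p (c t)) *
      (\sum_(y : tup J m | \prod_t mu (c t) (y t) < expR (- (m%:R * (ln 2 * (centropy p mu + d)))))
         \prod_t mu (c t) (y t)) <= e.
Proof.
move=> hp hmu d0 e0; have hq := distr_joint hp hmu.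
have d1 := mulr_gt0 ln2_gt0 d0.
have [m1 h1] := weak_law (fun w : I * J => ln (mu w.1 w.2)) hq d1 e0.
have [m2 h2] := weak_law (fun w : I * J => - ln (mu w.1 w.2)) hq d1 e0.
exists (maxn m1 m2) => m; rewrite geq_max => /andP[hm1 hm2].
(* A word with a vanishing factor has probability zero, so the two events are compared only where
   all factors are positive and [ln] turns the product into a sum. *)
have key (P : pred R) (Q : pred (tup (I * J)%type m)) :
  (forall w : tup (I * J)%type m, (forall t, 0 < mu (w t).1 (w t).2) ->
      P (\prod_t mu (w t).1 (w t).2) -> Q w) ->
  \sum_(c : tup I m) (\prod_t p (c t)) *
      (\sum_(y : tup J m | P (\prod_t mu (c t) (y t))) \prod_t mu (c t) (y t)) <=
  \sum_(w | Q w) \prod_t (p (w t).1 * mu (w t).1 (w t).2).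
  move=> hPQ; pose F (c : tup I m) (y : tup J m) := (\prod_t p (c t)) *
    (if P (\prod_t mu (c t) (y t)) then \prod_t mu (c t) (y t) else 0).
  rewrite (eq_bigr (fun c => \sum_y F c y)) => [|c _]; last by rewrite [X in _ * X]big_mkcond mulr_sumr.
  rewrite sum_tzip [leRHS]big_mkcond; apply: ler_sum => w _; rewrite /F.
  have hw : 0 <= \prod_t (p (w t).1 * mu (w t).1 (w t).2).
    by apply: prodr_ge0 => t _; case: hq => + _; apply.
  have -> : \prod_t p (tfst w t) = \prod_t p (w t).1 by apply: eq_bigr => t _; rewrite ffunE.
  have -> : \prod_t mu (tfst w t) (tsnd w t) = \prod_t mu (w t).1 (w t).2.
    by apply: eq_bigr => t _; rewrite !ffunE.
  case: ifP => hPw; last by rewrite mulr0; case: ifP.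
  rewrite -big_split /=; case: (boolP [forall t, 0 < mu (w t).1 (w t).2]) => [/forallP hpos|].
    by rewrite (hPQ _ hpos hPw).
  rewrite negb_forall => /existsP[t ht]; have -> : \prod_t0 (p (w t0).1 * mu (w t0).1 (w t0).2) = 0.
    rewrite (bigD1 t) //=; suff -> : mu (w t).1 (w t).2 = 0 by rewrite mulr0 mul0r.
    by apply/eqP; rewrite eq_le leNgt ht /=; case: (hmu (w t).1) => ->.
  by case: ifP.
split.
  apply: le_trans (key (fun z => _ < z) _ _) (h1 m hm1) => w hpos.
  rewrite -[X in _ < X](@lnK R) ?posrE ?prodr_gt0 // ltr_expR (ln_prod _ (fun t => hpos t)) centropyE.
  move=> h; apply/ltW; apply: le_lt_trans h; lra.
apply: le_trans (key (fun z => z < _) _ _) (h2 m hm2) => w hpos.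
rewrite -[X in X < _](@lnK R) ?posrE ?prodr_gt0 // ltr_expR (ln_prod _ (fun t => hpos t)).
have -> : \sum_(w0 : I * J) (p w0.1 * mu w0.1 w0.2) * - ln (mu w0.1 w0.2) =
    ln 2 * centropy p mu.
  rewrite -[RHS]opprK -centropyE -sumrN; apply: eq_bigr => ? _; exact: mulrN.
rewrite sumrN => h; lra.
Qed.
End LargeNumbers.

(** * Tests for product states *)

Section ProductStates.
Variable R : realType.
Local Notation C := R[i].
Local Notation rc := (real_complex R).
Implicit Types (I J K : finType).

Definition prodop I m (rho : 'I_m -> op R I) : op R (tup I m) :=
  fun p q => \prod_t rho t (p t) (q t).
Definition mixop I J (w : J -> R) (r : J -> op R I) : op R I :=
  fun a b => \sum_x rc (w x) * r x a b.

Lemma prod_eqb I m (y y' : tup I m) : \prod_t ((y t == y' t)%:R : C) = (y == y')%:R.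
Proof.
case: (eqVneq y y') => [->|h]; first by rewrite big1 // => t _; rewrite eqxx.
have /existsP[t ht] : [exists t, y t != y' t].
  by apply: contraNT h; rewrite negb_exists => /forallP h; apply/eqP/ffunP => t; have := h t; rewrite negbK => /eqP.
by rewrite (bigD1 t) //= (negbTE ht) mul0r.
Qed.

Lemma rc_prod (T : Type) (r : seq T) (F : T -> R) :
  rc (\prod_(i <- r) F i) = \prod_(i <- r) rc (F i).
Proof. exact: rmorph_prod. Qed.

Lemma rc_sum (T : Type) (r : seq T) (P : pred T) (F : T -> R) :
  rc (\sum_(i <- r | P i) F i) = \sum_(i <- r | P i) rc (F i).
Proof. exact: rmorph_sum. Qed.

Lemma eigd_prod I m (rho : 'I_m -> op R I) la e : (forall t, eigd (rho t) (la t) (e t)) ->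
  eigd (prodop rho) (fun y : tup I m => \prod_t la t (y t))
    (fun (y k : tup I m) => \prod_t e t (y t) (k t)).
Proof.
move=> h; split.
- move=> y y'; under eq_bigr do rewrite cj_prod -big_split /=.
  rewrite (sum_tup_prod (fun t i => (e t (y t) i)^* * e t (y' t) i)) -prod_eqb.
  by apply: eq_bigr => t _; case: (h t) => ->.
- move=> k l; under eq_bigr do rewrite cj_prod -big_split /=.
  rewrite (sum_tup_prod (fun t i => e t i (k t) * (e t i (l t))^*)) -prod_eqb.
  by apply: eq_bigr => t _; case: (h t) => _ ->.
- move=> k l; rewrite /prodop.
  under [RHS]eq_bigr do rewrite cj_prod rc_prod -!big_split /=.
  rewrite (sum_tup_prod (fun t i => rc (la t i) * (e t i (k t) * (e t i (l t))^*))).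
  by apply: eq_bigr => t _; case: (h t) => _ _ ->.
Qed.

Lemma eigd_psd I (X : op R I) la e : eigd X la e -> (forall y, 0 <= la y) -> psd X.
Proof.
move=> [_ _ h3] la0 v.
have -> : \sum_k \sum_l (v k)^* * X k l * v l = \sum_y rc (la y) * (dotv v (e y) * (dotv v (e y))^*).
  transitivity (\sum_k \sum_l \sum_y rc (la y) * ((v k)^* * e y k * ((e y l)^* * v l))).
    apply: eq_bigr => k _; apply: eq_bigr => l _; rewrite h3 mulr_sumr mulr_suml.
    by apply: eq_bigr => z _; ring.
  under eq_bigr do rewrite exchange_big /=.
  rewrite exchange_big /=; apply: eq_bigr => z _; rewrite /dotv cj_sum mulr_suml mulr_sumr.
  apply: eq_bigr => k _; rewrite mulrA mulr_sumr; apply: eq_bigr => l _.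
  by rewrite cjM conjCK; ring.
apply: sumr_ge0 => y _; apply: mulr_ge0; last exact: mul_conjC_ge0.
by rewrite ler0c.
Qed.

Lemma psd_prodop I m (rho : 'I_m -> op R I) : (forall t, psd (rho t)) -> psd (prodop rho).
Proof.
move=> h; have /choice [la hla] t := eigd_exists (h t).
have /choice [e he] := hla.
apply: (eigd_psd (eigd_prod he)) => y; apply: prodr_ge0 => t _.
exact: psd_eigd_ge0 (h t) (he t).
Qed.

Lemma trace_prodop I m (rho : 'I_m -> op R I) : trace (prodop rho) = \prod_t trace (rho t).
Proof. by rewrite /trace -sum_tup_prod. Qed.

Lemma density_prodop I m (rho : 'I_m -> op R I) :
  (forall t, density (rho t)) -> density (prodop rho).
Proof.
move=> h; split; first by apply: psd_prodop => t; case: (h t).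
by rewrite trace_prodop big1 // => t _; case: (h t).
Qed.

Lemma ptr_mix I J (w : J -> R) (r : J -> op R I) T :
  ptr (mixop w r) T = \sum_x w x * ptr (r x) T.
Proof.
rewrite /ptr /trmul /mixop -(eq_bigr _ (fun x _ => cReM _ _)) -cRe_sum; congr complex.Re.
under [RHS]eq_bigr do rewrite mulr_sumr.
rewrite [RHS]exchange_big /=; apply: eq_bigr => k _.
under [RHS]eq_bigr do rewrite mulr_sumr.
rewrite [RHS]exchange_big /=; apply: eq_bigr => l _.
by rewrite mulr_sumr; apply: eq_bigr => x _; ring.
Qed.

Lemma prodop_mix I J m (w : 'I_m -> J -> R) (r : 'I_m -> J -> op R I) :
  prodop (fun t => mixop (w t) (r t)) =
  mixop (fun x : tup J m => \prod_t w t (x t)) (fun x => prodop (fun t => r t (x t))).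
Proof.
apply: opP => p q; rewrite /prodop /mixop.
under [RHS]eq_bigr do rewrite rc_prod -big_split /=.
by rewrite (sum_tup_prod (fun t x => rc (w t x) * r t x (p t) (q t))).
Qed.

Lemma psd_mix I J (w : J -> R) (r : J -> op R I) : (forall x, 0 <= w x) ->
  (forall x, psd (r x)) -> psd (mixop w r).
Proof.
move=> w0 h v.
have -> : \sum_k \sum_l (v k)^* * mixop w r k l * v l =
  \sum_x rc (w x) * \sum_k \sum_l (v k)^* * r x k l * v l.
  transitivity (\sum_k \sum_l \sum_x rc (w x) * ((v k)^* * r x k l * v l)).
    apply: eq_bigr => k _; apply: eq_bigr => l _; rewrite mulr_sumr mulr_suml.
    by apply: eq_bigr => z _; ring.
  under eq_bigr do rewrite exchange_big /=.
  rewrite exchange_big /=; apply: eq_bigr => x _; rewrite mulr_sumr.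
  by apply: eq_bigr => k _; rewrite mulr_sumr.
by apply: sumr_ge0 => x _; apply: mulr_ge0; [rewrite ler0c|exact: h].
Qed.

Lemma density_mix I J (w : J -> R) (r : J -> op R I) : distr w ->
  (forall x, density (r x)) -> density (mixop w r).
Proof.
move=> [w0 w1] h; split; first by apply: psd_mix => // x; case: (h x).
rewrite /trace /mixop exchange_big /= -[RHS](_ : rc 1 = 1) // -w1 rc_sum.
apply: eq_bigr => x _; rewrite -mulr_sumr; case: (h x) => _; rewrite /trace => ->.
by rewrite mulr1.
Qed.

Lemma eigd_distr I (X : op R I) la e : density X -> eigd X la e -> distr la.
Proof.
move=> [h1 h2] he; split; first by move=> y; exact: psd_eigd_ge0 h1 he.
by rewrite -(trace_eigd he) h2.
Qed.

Lemma ptr_compl_spectral I (X : op R I) la f (Q : pred I) : eigd X la f ->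
  ptr X (compl (fun k l => \sum_(y | Q y) f y k * (f y l)^*)) = \sum_(y | ~~ Q y) la y.
Proof.
move=> h; rewrite (ptr_eigd _ h) [RHS]big_mkcond; apply: eq_bigr => y _.
rewrite qv_compl (nrm_eigd y h).
suff -> : qv (fun k l => \sum_(y | Q y) f y k * (f y l)^*) (f y) = (Q y)%:R :> R.
  by case: (Q y); rewrite /= ?subrr ?subr0 ?mulr0 ?mulr1.
rewrite /qv; have -> : ap (fun k l => \sum_(y | Q y) f y k * (f y l)^*) (f y) = fun k => (Q y)%:R * f y k.
  apply/funext => k; rewrite /ap; under eq_bigr do rewrite mulr_suml.
  rewrite exchange_big /= (eq_bigr (fun z => f z k * (z == y)%:R)) => [|z _]; last first.
    by case: h => <- _ _; rewrite mulr_sumr; apply: eq_bigr => l _; ring.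
  rewrite big_mkcond (bigD1 y) //= big1 => [|z /negbTE ->]; last by rewrite mulr0; case: ifP.
  by rewrite eqxx mulr1 addr0; case: (Q y); rewrite ?mul1r ?mul0r.
have n1 := nrm_eigd y h; rewrite /dotv.
case: (Q y); last by rewrite big1 // => k _; rewrite mul0r mulr0.
by rewrite -[RHS]n1 /nrm /dotv; congr complex.Re; apply: eq_bigr => k _; rewrite mul1r.
Qed.

(** [packing_test] with its thresholds at the typical eigenvalues, each off by half of [d]: [b]
    comes from the averaged states, [a] from the individual ones, and [b / a] has the conditional
    Holevo information as exponent. The two kinds of states need not commute, which is why the test
    is a span projector. The word [c] is already known, the word [x] is the one tested. *)
Lemma quantum_tests I J K (p : J -> R) (k : J -> K -> R) (rho : J -> K -> op R I) (d e : R) :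
  distr p -> (forall c, distr (k c)) -> (forall c x, density (rho c x)) -> 0 < d -> 0 < e ->
  exists m0 : nat, forall m, (m0 <= m)%N ->
  exists T : tup J m -> tup K m -> op R (tup I m),
  [/\ forall c x, isproj (T c x),
    forall (c : tup J m) (x : tup K m), ptr (prodop (fun t => mixop (k (c t)) (rho (c t)))) (T c x) <=
      expR (- (m%:R * (ln 2 * (\sum_c p c * vN (mixop (k c) (rho c)) -
         \sum_c p c * \sum_x k c x * vN (rho c x) - d)))) &
    \sum_(c : tup J m) \sum_(x : tup K m) (\prod_t p (c t)) * (\prod_t k (c t) (x t)) *
      ptr (prodop (fun t => rho (c t) (x t))) (compl (T c x)) <= e].
Proof.
move=> hp hk hr d0 e0; pose sigma c := mixop (k c) (rho c).
have hs c : density (sigma c) by apply: density_mix.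
have /choice [mu hmu] c := eigd_exists (hs c).1.
have /choice [f hf] := hmu.
have hcx : forall w : J * K, exists le, eigd (rho w.1 w.2) le.1 le.2.
  by move=> [c x]; have [la [ev h]] := eigd_exists (hr c x).1; exists (la, ev).
have /choice [le hle] := hcx.
pose lam w := (le w).1; pose ev w := (le w).2.
have dmu c : distr (mu c) := eigd_distr (hs c) (hf c).
have dlam w : distr (lam w) := eigd_distr (hr w.1 w.2) (hle w).
have d2 : 0 < d / 2 by lra.
have e2 : 0 < e / 2 by lra.
pose q (w : J * K) := p w.1 * k w.1 w.2.
have hq : distr q := distr_joint hp hk.
have [m1 h1] := aep hp dmu d2 e2.
have [m2 h2] := aep hq dlam d2 e2.
exists (maxn m1 m2) => m; rewrite geq_max => /andP[/h1 {h1}[h1 _] /h2 {h2}[_ h2]].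
set H1 := \sum_c p c * vN (sigma c); set H2 := \sum_c _.
have eH1 : centropy p mu = H1 by apply: eq_bigr => c _; rewrite (vN_eigd (hf c)).
have eH2 : centropy q lam = H2.
  transitivity (\sum_c \sum_x p c * k c x * \sum_y etaf (lam (c, x) y)).
    by rewrite pair_bigA; apply: eq_bigr => -[].
  apply: eq_bigr => c _; rewrite mulr_sumr; apply: eq_bigr => x _.
  by rewrite (vN_eigd (hle (c, x))) mulrA.
pose b := expR (- (m%:R * (ln 2 * (centropy p mu - d / 2)))).
pose a := expR (- (m%:R * (ln 2 * (centropy q lam + d / 2)))).
pose sig (c : tup J m) := prodop (fun t => sigma (c t)).
pose rh (c : tup J m) (x : tup K m) := prodop (fun t => rho (c t) (x t)).
pose P (c : tup J m) : op R (tup I m) := fun kk l =>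
  \sum_(y : tup I m | \prod_t mu (c t) (y t) <= b)
    (\prod_t f (c t) (y t) (kk t)) * (\prod_t f (c t) (y t) (l t))^*.
have dsig c : density (sig c) by apply: density_prodop.
have drh c x : density (rh c x) by apply: density_prodop.
have esig c := eigd_prod (fun t : 'I_m => hf ((c : tup J m) t)).
have erh (c : tup J m) (x : tup K m) := eigd_prod (fun t : 'I_m => hle (c t, x t)).
have hT : forall cx : tup J m * tup K m, exists T, [/\ isproj T, ptr (sig cx.1) T <= b / a &
    ptr (rh cx.1 cx.2) (compl T) <= \sum_(y : tup I m | \prod_t lam (cx.1 t, cx.2 t) (y t) < a)
       \prod_t lam (cx.1 t, cx.2 t) (y t) + ptr (rh cx.1 cx.2) (compl (P cx.1))].
  move=> [c x] /=; apply: (packing_test (drh c x).1 (drh c x).2 (dsig c).1 (erh c x) (esig c)) => //.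
  + exact: expR_gt0.
  + exact: expR_ge0.
have /choice [T hT'] := hT.
exists (fun c x => T (c, x)); split.
- by move=> c x; case: (hT' (c, x)).
- move=> c x; case: (hT' (c, x)) => _ /= + _; rewrite /b /a -expRN -expRD eH1 eH2.
  move/le_trans; apply; rewrite ler_expR le_eqVlt; apply/orP; left; apply/eqP.
  by rewrite [in RHS](_ : d = d / 2 + d / 2); [ring|lra].
have p0 (c : tup J m) : 0 <= \prod_t p (c t) by apply: prodr_ge0 => t _; case: hp.
have k0 (c : tup J m) (x : tup K m) : 0 <= \prod_t k (c t) (x t).
  by apply: prodr_ge0 => t _; case: (hk (c t)).
have -> : e = e / 2 + e / 2 by lra.
apply: le_trans (_ : _ <= \sum_(c : tup J m) \sum_(x : tup K m) ((\prod_t p (c t)) * (\prod_t k (c t) (x t)) *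
  (\sum_(y : tup I m | \prod_t lam (c t, x t) (y t) < a) \prod_t lam (c t, x t) (y t)) +
  (\prod_t p (c t)) * (\prod_t k (c t) (x t)) * ptr (rh c x) (compl (P c)))) _.
  apply: ler_sum => c _; apply: ler_sum => x _; rewrite -mulrDr; apply: ler_wpM2l.
    exact: mulr_ge0.
  by case: (hT' (c, x)).
under eq_bigr do rewrite big_split /=.
rewrite big_split /=; apply: lerD.
  move: h2; rewrite -/a; apply: le_trans.
  rewrite (sum_tzip (fun c x => \prod_t p (c t) * \prod_t k (c t) (x t) *
    \sum_(y : tup I m | \prod_t lam (c t, x t) (y t) < a) \prod_t lam (c t, x t) (y t))).
  rewrite le_eqVlt; apply/orP; left; apply/eqP; apply: eq_bigr => w _.
  have hw t : (tfst w t, tsnd w t) = w t by rewrite !ffunE; case: (w t).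
  congr (_ * _).
    by rewrite -big_split; apply: eq_bigr => t _; rewrite /q !ffunE.
  by apply: eq_big => [y|y _]; [congr (_ < _)|]; apply: eq_bigr => t _; rewrite hw.
move: h1; rewrite -/b; apply: le_trans.
apply: ler_sum => c _; under eq_bigr do rewrite -mulrA.
rewrite -mulr_sumr; apply: ler_wpM2l => //.
(* The cut [P] depends on [c] alone, so by linearity its error averaged over [x] is that of the
   averaged state, of which [P] is a spectral projector. *)
rewrite -(ptr_mix (fun x : tup K m => \prod_t k (c t) (x t)) (rh c)).
have -> : mixop (fun x : tup K m => \prod_t k (c t) (x t)) (rh c) = sig c.
  exact: esym (prodop_mix (fun t => k (c t)) (fun t => rho (c t))).
by rewrite (ptr_compl_spectral _ (esig c)) le_eqVlt; apply/orP; left; apply/eqP;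
  apply: eq_bigl => y; rewrite ltNge.
Qed.
End ProductStates.

(** * Random books *)

Section ClassicalTests.
Variable R : realType.

(** Counterpart of [quantum_tests] for a sender, who sees outcomes only. An accepted [z] has
    averaged likelihood at most [b] and own likelihood at least [a], so the former is at most
    [b / a] times the latter, which sums to one. *)
Lemma classical_tests (J K Z : finType) (p : J -> R) (k : J -> K -> R) (Q : J -> K -> Z -> R) (d e : R) :
  distr p -> (forall c, distr (k c)) -> (forall c x, distr (Q c x)) -> 0 < d -> 0 < e ->
  exists m0 : nat, forall m, (m0 <= m)%N ->
  exists S : tup J m -> tup K m -> pred (tup Z m),
  (forall (c : tup J m) (x : tup K m),
      \sum_(z : tup Z m | S c x z) \prod_t (\sum_x k (c t) x * Q (c t) x (z t)) <=
      expR (- (m%:R * (ln 2 * (centropy p (fun c z => \sum_x k c x * Q c x z) -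
         \sum_c p c * \sum_x k c x * \sum_z etaf (Q c x z) - d))))) /\
    \sum_(c : tup J m) \sum_(x : tup K m) (\prod_t p (c t)) * (\prod_t k (c t) (x t)) *
      (\sum_(z : tup Z m | ~~ S c x z) \prod_t Q (c t) (x t) (z t)) <= e.
Proof.
move=> hp hk hQ d0 e0; pose Qb c z := \sum_x k c x * Q c x z.
have hQb c : distr (Qb c).
  split; first by move=> z; apply: sumr_ge0 => x _; apply: mulr_ge0; [case: (hk c)|case: (hQ c x)].
  rewrite exchange_big /=; case: (hk c) => _ <-; apply: eq_bigr => x _.
  by rewrite -mulr_sumr; case: (hQ c x) => _ ->; rewrite mulr1.
have d2 : 0 < d / 2 by lra.
have e2 : 0 < e / 2 by lra.
pose q (w : J * K) := p w.1 * k w.1 w.2.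
pose lam (w : J * K) := Q w.1 w.2.
have hq : distr q := distr_joint hp hk.
have dlam w : distr (lam w) by exact: hQ.
have [m1 h1] := aep hp hQb d2 e2.
have [m2 h2] := aep hq dlam d2 e2.
exists (maxn m1 m2) => m; rewrite geq_max => /andP[/h1 {h1}[h1 _] /h2 {h2}[_ h2]].
set H1 := centropy p _; set H2 := \sum_c _.
have eH2 : centropy q lam = H2.
  transitivity (\sum_c \sum_x p c * k c x * \sum_y etaf (lam (c, x) y)).
    by rewrite pair_bigA; apply: eq_bigr => -[].
  by apply: eq_bigr => c _; rewrite mulr_sumr; apply: eq_bigr => x _; rewrite mulrA.
pose b := expR (- (m%:R * (ln 2 * (centropy p Qb - d / 2)))).
pose a := expR (- (m%:R * (ln 2 * (centropy q lam + d / 2)))).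
have Q0 (c : tup J m) (x : tup K m) (z : tup Z m) : 0 <= \prod_t Q (c t) (x t) (z t).
  by apply: prodr_ge0 => t _; case: (hQ (c t) (x t)).
have Qb0 (c : tup J m) (z : tup Z m) : 0 <= \prod_t Qb (c t) (z t).
  by apply: prodr_ge0 => t _; case: (hQb (c t)).
exists (fun c x z => (\prod_t Qb (c t) (z t) <= b) && (a <= \prod_t Q (c t) (x t) (z t))); split.
  move=> c x; have a0 : 0 < a by exact: expR_gt0.
  have -> : expR (- (m%:R * (ln 2 * (H1 - H2 - d)))) = b / a.
    rewrite /b /a -expRN -expRD eH2 -/H1; congr expR.
    by rewrite [in LHS](_ : d = d / 2 + d / 2); [ring|lra].
  have hs1 : \sum_(z : tup Z m) \prod_t Q (c t) (x t) (z t) = 1.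
    by rewrite (sum_tup_prod (fun t z => Q (c t) (x t) z)) big1 // => t _; case: (hQ (c t) (x t)).
  apply: le_trans (_ : b / a * \sum_(z : tup Z m) \prod_t Q (c t) (x t) (z t) <= _); last first.
    by rewrite hs1 mulr1.
  rewrite mulr_sumr big_mkcond; apply: ler_sum => z _.
  case: ifP => [/andP[hb ha]|_]; last by rewrite !mulr_ge0 ?invr_ge0 // expR_ge0.
  apply: (le_trans hb); rewrite -mulrA ler_peMr ?expR_ge0 //.
  by rewrite mulrC ler_pdivlMr // mul1r.
have p0 (c : tup J m) : 0 <= \prod_t p (c t) by apply: prodr_ge0 => t _; case: hp.
have k0 (c : tup J m) (x : tup K m) : 0 <= \prod_t k (c t) (x t).
  by apply: prodr_ge0 => t _; case: (hk (c t)).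
have -> : e = e / 2 + e / 2 by lra.
apply: le_trans (_ : _ <= \sum_(c : tup J m) \sum_(x : tup K m) ((\prod_t p (c t)) * (\prod_t k (c t) (x t)) *
  (\sum_(y : tup Z m | \prod_t lam (c t, x t) (y t) < a) \prod_t lam (c t, x t) (y t)) +
  (\prod_t p (c t)) * (\prod_t k (c t) (x t)) *
    \sum_(z : tup Z m | b < \prod_t Qb (c t) (z t)) \prod_t Q (c t) (x t) (z t))) _.
  apply: ler_sum => c _; apply: ler_sum => x _; rewrite -mulrDr; apply: ler_wpM2l.
    exact: mulr_ge0.
  rewrite big_mkcond [X in _ <= X + _]big_mkcond [X in _ <= _ + X]big_mkcond -big_split /=.
  apply: ler_sum => z _; rewrite /lam /= negb_and -!ltNge.
  have := Q0 c x z; case: (b < _); case: (_ < a) => /=; lra.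
under eq_bigr do rewrite big_split /=.
rewrite big_split /=; apply: lerD.
  move: h2; rewrite -/a; apply: le_trans.
  rewrite (sum_tzip (fun c x => \prod_t p (c t) * \prod_t k (c t) (x t) *
    \sum_(y : tup Z m | \prod_t lam (c t, x t) (y t) < a) \prod_t lam (c t, x t) (y t))).
  rewrite le_eqVlt; apply/orP; left; apply/eqP; apply: eq_bigr => w _.
  have hw t : (tfst w t, tsnd w t) = w t by rewrite !ffunE; case: (w t).
  congr (_ * _).
    by rewrite -big_split; apply: eq_bigr => t _; rewrite /q !ffunE.
  by apply: eq_big => [y|y _]; [congr (_ < _)|]; apply: eq_bigr => t _; rewrite hw.
move: h1; rewrite -/b; apply: le_trans.
apply: ler_sum => c _; under eq_bigr do rewrite -mulrA.
rewrite -mulr_sumr; apply: ler_wpM2l => //.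
under eq_bigr do rewrite mulr_sumr.
rewrite exchange_big /= le_eqVlt; apply/orP; left; apply/eqP.
apply: eq_bigr => z _; under eq_bigr do rewrite -big_split /=.
by rewrite (sum_tup_prod (fun t x => k (c t) x * Q (c t) x (z t))).
Qed.
End ClassicalTests.

(** * Expectations over books with independent entries *)

Section RandomBooks.
Variable R : realType.
Implicit Types (D X : finType).

Definition upd D X (b : {ffun D -> X}) (d : D) (x : X) : {ffun D -> X} :=
  [ffun d' => if d' == d then x else b d'].

(* Expectation over a random book [b] with independent entries, [b d] of law [K d]. *)
Definition Ebk D X (K : D -> X -> R) (F : {ffun D -> X} -> R) : R :=
  \sum_(b : {ffun D -> X}) (\prod_d K d (b d)) * F b.

Lemma Ebk_law D X (K : D -> X -> R) : (forall d, distr (K d)) ->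
  distr (fun b : {ffun D -> X} => \prod_d K d (b d)).
Proof.
move=> h; split; first by move=> b; apply: prodr_ge0 => d _; case: (h d).
by rewrite -bigA_distr_bigA big1 // => d _; case: (h d).
Qed.

Lemma Ebk_le D X (K : D -> X -> R) F G : (forall d, distr (K d)) ->
  (forall b, F b <= G b) -> Ebk K F <= Ebk K G.
Proof.
by move=> h hFG; apply: ler_sum => b _; apply: ler_wpM2l => //; case: (Ebk_law h).
Qed.

Lemma eq_Ebk D X (K : D -> X -> R) F G : (forall b, F b = G b) -> Ebk K F = Ebk K G.
Proof. by move=> h; apply: eq_bigr => b _; rewrite h. Qed.

Lemma Ebk_cst D X (K : D -> X -> R) a : (forall d, distr (K d)) -> Ebk K (fun=> a) = a.
Proof. by move=> h; rewrite /Ebk -mulr_suml; case: (Ebk_law h) => _ ->; rewrite mul1r. Qed.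

Lemma Ebk_le_cst D X (K : D -> X -> R) F a : (forall d, distr (K d)) ->
  (forall b, F b <= a) -> Ebk K F <= a.
Proof. by move=> h hF; rewrite -[leRHS](Ebk_cst a h); apply: Ebk_le. Qed.

Lemma Ebk_sum D X (K : D -> X -> R) (T : Type) (r : seq T) (P : pred T) (w : T -> R) F :
  Ebk K (fun b => \sum_(i <- r | P i) w i * F i b) = \sum_(i <- r | P i) w i * Ebk K (F i).
Proof.
rewrite /Ebk; under eq_bigr do rewrite mulr_sumr.
rewrite exchange_big /=; apply: eq_bigr => i _; rewrite mulr_sumr.
by apply: eq_bigr => b _; rewrite mulrCA.
Qed.

Lemma Ebk_exists D X (K : D -> X -> R) F : (forall d, distr (K d)) -> exists b, F b <= Ebk K F.
Proof.
move=> h; have [w0 w1] := Ebk_law h; apply: contrapT => hn.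
have hlt b : Ebk K F < F b by rewrite ltNge; apply/negP => hb; apply: hn; exists b.
have : \sum_(b : {ffun D -> X}) (\prod_d K d (b d)) * (F b - Ebk K F) = 0.
  under eq_bigr do rewrite mulrBr.
  by rewrite sumrB -mulr_suml w1 mul1r subrr.
move=> /eqP; rewrite psumr_eq0 => [/allP hall|b _]; last first.
  by apply: mulr_ge0 => //; rewrite subr_ge0 ltW.
suff : \sum_(b : {ffun D -> X}) \prod_d K d (b d) = 0 by rewrite w1 => /eqP; rewrite oner_eq0.
apply: big1 => b _; have := hall b (mem_index_enum b).
by rewrite /= mulf_eq0 subr_eq0 => /orP[/eqP //|/eqP e]; have := hlt b; rewrite e ltxx.
Qed.

(** If [G] reads the book at entries other than [d] only, the entry at [d] may be replaced by a
    fresh sample. This is the independence of the sent word from the words under wrong indices. *)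
Lemma Ebk_resample D X (K : D -> X -> R) (d : D) (G : {ffun D -> X} -> X -> R) :
  (forall d, distr (K d)) -> (forall b x y, G (upd b d x) y = G b y) ->
  Ebk K (fun b => G b (b d)) = Ebk K (fun b => \sum_x K d x * G b x).
Proof.
move=> h hG; rewrite /Ebk.
transitivity (\sum_(b : {ffun D -> X}) \sum_x (\prod_d K d (b d)) * K d x * G b (b d)).
  apply: eq_bigr => b _; rewrite -mulr_suml -mulr_sumr.
  by case: (h d) => _ ->; rewrite mulr1.
under [RHS]eq_bigr do rewrite mulr_sumr.
rewrite !pair_bigA /=.
(* Exchanging the entry at [d] with the fresh symbol is an involution that preserves the joint
   law. *)
pose f (q : {ffun D -> X} * X) := (upd q.1 d q.2, q.1 d).
have fK : involutive f.
  move=> [b x]; rewrite /f /= /upd; congr pair; last by rewrite ffunE eqxx.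
  by apply/ffunP => d'; rewrite !ffunE; case: eqP => [->|].
rewrite [RHS](reindex_inj (inv_inj fK)) /=; apply: eq_bigr => -[b x] _ /=.
rewrite hG mulrA; congr (_ * _).
rewrite (bigD1 d) //= [in RHS](bigD1 d) //= ffunE eqxx.
have -> : \prod_(i | i != d) K i (upd b d x i) = \prod_(i | i != d) K i (b i).
  by apply: eq_bigr => d' /negbTE hd; rewrite ffunE hd.
by ring.
Qed.

Lemma Ebk_marginal D X (K : D -> X -> R) (d : D) (G : X -> R) :
  (forall d, distr (K d)) -> Ebk K (fun b => G (b d)) = \sum_x K d x * G x.
Proof. by move=> h; rewrite (@Ebk_resample _ _ K d (fun=> G)) // Ebk_cst. Qed.

Lemma upd_neq D X (b : {ffun D -> X}) d x d' : d' != d -> upd b d x d' = b d'.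
Proof. by move=> /negbTE h; rewrite ffunE h. Qed.
End RandomBooks.

(** * The random code of one block *)

Section BlockCode.
Variable R : realType.
Variables (U V1 V2 XA X1 X2 Y Z1 Z2 : finType).
Variables (pu : U -> R) (k1 : U -> V1 -> R) (k2 : U -> V2 -> R) (ka : U -> V1 -> XA -> R)
  (kx1 : U -> V1 -> XA -> X1 -> R) (kx2 : U -> V2 -> X2 -> R).
Variables (rho : X1 -> X2 -> op R Y) (zf1 : Y -> Z1) (zf2 : Y -> Z2).
Variables (W0 A1 A2 Sa Sb S2 : finType).

(* The entry of a book at (index, context) is the symbol sent under that index when the lower
   layers of the superposition code have produced that context. *)
Record book := Book {
  bu : {ffun W0 -> U};
  bv1 : {ffun W0 * A1 * U -> V1};
  bv2 : {ffun W0 * A2 * U -> V2};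
  ba : {ffun W0 * A1 * Sa * (U * V1) -> XA};
  bx2 : {ffun W0 * A2 * S2 * (U * V2) -> X2};
  bx1 : {ffun W0 * A1 * Sa * Sb * (U * V1 * XA) -> X1} }.

Definition cv1 cd w0 a1 : V1 := bv1 cd (w0, a1, bu cd w0).
Definition cv2 cd w0 a2 : V2 := bv2 cd (w0, a2, bu cd w0).
Definition cxa cd w0 a1 sa : XA := ba cd (w0, a1, sa, (bu cd w0, cv1 cd w0 a1)).
Definition cx2 cd w0 a2 s2 : X2 := bx2 cd (w0, a2, s2, (bu cd w0, cv2 cd w0 a2)).
Definition cx1 cd w0 a1 sa sb : X1 :=
  bx1 cd (w0, a1, sa, sb, (bu cd w0, cv1 cd w0 a1, cxa cd w0 a1 sa)).

(* [m3], [m2], [m1], [m0] are the states met by the receiver's successive tests (of [x1], [x2], [xa]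
   and of the cloud) under a wrong index; [n2'] and [n1'] those met by the senders' feedback tests. *)
Definition m3 u v1 xa x2 := mixop (kx1 u v1 xa) (fun x1 => rho x1 x2).
Definition m2 u v1 v2 xa := mixop (kx2 u v2) (m3 u v1 xa).
Definition m1 u v1 v2 := mixop (ka u v1) (m2 u v1 v2).
Definition mu0 u := mixop (k1 u) (fun v1 => mixop (k2 u) (m1 u v1)).
Definition m0 := mixop pu mu0.
Definition n2 u v1 x2 := mixop (ka u v1) (fun xa => m3 u v1 xa x2).
Definition n2' u x2 := mixop (k1 u) (fun v1 => n2 u v1 x2).
Definition n1 u v2 x1 := mixop (kx2 u v2) (rho x1).
Definition n1' u x1 := mixop (k2 u) (fun v2 => n1 u v2 x1).

Definition prb (r : op R Y) (A : pred Y) : R := \sum_(y | A y) complex.Re (r y y).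

(** Lets the same averaging lemmas serve the receiver's projectors ([ptr]) and the senders' outcome
    predicates ([prb]). *)
Definition mixlinear (phi : op R Y -> R) := forall (J : finType) (w : J -> R) (r : J -> op R Y),
  phi (mixop w r) = \sum_x w x * phi (r x).

Lemma mixlinear_ptr T : mixlinear (fun r => ptr r T).
Proof. by move=> J w r; exact: ptr_mix. Qed.

Lemma mixlinear_prb A : mixlinear (fun r => prb r A).
Proof.
move=> J w r; rewrite /prb /mixop.
under eq_bigr do rewrite cRe_sum (eq_bigr _ (fun x _ => cReM _ _)).
by rewrite exchange_big /=; apply: eq_bigr => x _; rewrite mulr_sumr.
Qed.

Hypotheses (hpu : distr pu) (hk1 : forall u, distr (k1 u)) (hk2 : forall u, distr (k2 u))
  (hka : forall u v1, distr (ka u v1)) (hkx1 : forall u v1 xa, distr (kx1 u v1 xa))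
  (hkx2 : forall u v2, distr (kx2 u v2)).

Definition KU (_ : W0) := pu.
Definition KV1 (d : W0 * A1 * U) := k1 d.2.
Definition KV2 (d : W0 * A2 * U) := k2 d.2.
Definition KA (d : W0 * A1 * Sa * (U * V1)) := ka d.2.1 d.2.2.
Definition KX2 (d : W0 * A2 * S2 * (U * V2)) := kx2 d.2.1 d.2.2.
Definition KX1 (d : W0 * A1 * Sa * Sb * (U * V1 * XA)) := kx1 d.2.1.1 d.2.1.2 d.2.2.

Let hKU d : distr (KU d). Proof. exact: hpu. Qed.
Let hKV1 d : distr (KV1 d). Proof. exact: hk1. Qed.
Let hKV2 d : distr (KV2 d). Proof. exact: hk2. Qed.
Let hKA d : distr (KA d). Proof. exact: hka. Qed.
Let hKX2 d : distr (KX2 d). Proof. exact: hkx2. Qed.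
Let hKX1 d : distr (KX1 d). Proof. exact: hkx1. Qed.

(** The books are nested from the lowest layer up, so that a layer is averaged while the contexts at
    which it is read are fixed. *)
Definition E6 (F : book -> R) : R :=
  Ebk KU (fun b0 => Ebk KV1 (fun b1 => Ebk KV2 (fun b2 => Ebk KA (fun b3 =>
    Ebk KX2 (fun b4 => Ebk KX1 (fun b5 => F (Book b0 b1 b2 b3 b4 b5))))))).

Lemma E6_sum (T : Type) (r : seq T) (P : pred T) (w : T -> R) (F : T -> book -> R) :
  E6 (fun cd => \sum_(i <- r | P i) w i * F i cd) = \sum_(i <- r | P i) w i * E6 (F i).
Proof.
rewrite /E6 -Ebk_sum; apply: eq_Ebk => b0; rewrite -Ebk_sum; apply: eq_Ebk => b1.
rewrite -Ebk_sum; apply: eq_Ebk => b2; rewrite -Ebk_sum; apply: eq_Ebk => b3.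
by rewrite -Ebk_sum; apply: eq_Ebk => b4; rewrite -Ebk_sum.
Qed.

Lemma E6D (F G : book -> R) : E6 (fun cd => F cd + G cd) = E6 F + E6 G.
Proof.
have := E6_sum [:: true; false] xpredT (fun=> 1) (fun b : bool => if b then F else G).
rewrite !big_cons big_nil addr0 !mul1r => <-; congr E6; apply/funext => cd.
by rewrite !big_cons big_nil addr0 !mul1r.
Qed.

Lemma E6_exists F : exists cd, F cd <= E6 F.
Proof.
have [b0 h0] := Ebk_exists (fun b0 => Ebk KV1 (fun b1 => Ebk KV2 (fun b2 => Ebk KA (fun b3 =>
    Ebk KX2 (fun b4 => Ebk KX1 (fun b5 => F (Book b0 b1 b2 b3 b4 b5))))))) hKU.
have [b1 h1] := Ebk_exists (fun b1 => Ebk KV2 (fun b2 => Ebk KA (fun b3 =>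
    Ebk KX2 (fun b4 => Ebk KX1 (fun b5 => F (Book b0 b1 b2 b3 b4 b5)))))) hKV1.
have [b2 h2] := Ebk_exists (fun b2 => Ebk KA (fun b3 =>
    Ebk KX2 (fun b4 => Ebk KX1 (fun b5 => F (Book b0 b1 b2 b3 b4 b5))))) hKV2.
have [b3 h3] := Ebk_exists (fun b3 =>
    Ebk KX2 (fun b4 => Ebk KX1 (fun b5 => F (Book b0 b1 b2 b3 b4 b5)))) hKA.
have [b4 h4] := Ebk_exists (fun b4 => Ebk KX1 (fun b5 => F (Book b0 b1 b2 b3 b4 b5))) hKX2.
have [b5 h5] := Ebk_exists (fun b5 => F (Book b0 b1 b2 b3 b4 b5)) hKX1.
exists (Book b0 b1 b2 b3 b4 b5).
exact: le_trans h5 (le_trans h4 (le_trans h3 (le_trans h2 (le_trans h1 h0)))).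
Qed.

Lemma E6_true (F : U -> V1 -> V2 -> XA -> X2 -> X1 -> R) w0 a1 a2 sa sb s2 :
  E6 (fun cd => F (bu cd w0) (cv1 cd w0 a1) (cv2 cd w0 a2) (cxa cd w0 a1 sa) (cx2 cd w0 a2 s2)
     (cx1 cd w0 a1 sa sb)) =
  \sum_u pu u * \sum_v1 k1 u v1 * \sum_v2 k2 u v2 * \sum_xa ka u v1 xa *
    \sum_x2 kx2 u v2 x2 * \sum_x1 kx1 u v1 xa x1 * F u v1 v2 xa x2 x1.
Proof.
apply: etrans (Ebk_marginal w0 _ hKU); apply: eq_Ebk => b0; set u := b0 w0.
apply: etrans (Ebk_marginal (w0, a1, u) _ hKV1); apply: eq_Ebk => b1; set v1 := b1 _.
apply: etrans (Ebk_marginal (w0, a2, u) _ hKV2); apply: eq_Ebk => b2; set v2 := b2 _.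
apply: etrans (Ebk_marginal (w0, a1, sa, (u, v1)) _ hKA); apply: eq_Ebk => b3; set xa := b3 _.
apply: etrans (Ebk_marginal (w0, a2, s2, (u, v2)) _ hKX2); apply: eq_Ebk => b4; set x2 := b4 _.
exact: (Ebk_marginal (w0, a1, sa, sb, (u, v1, xa)) _ hKX1).
Qed.

Section Linear.
Variables (phi : op R Y -> R) (hphi : mixlinear phi).

Lemma E_x1 d x2 : Ebk KX1 (fun b => phi (rho (b d) x2)) = phi (m3 d.2.1.1 d.2.1.2 d.2.2 x2).
Proof. by rewrite hphi; exact: (Ebk_marginal d (fun x => phi (rho x x2)) hKX1). Qed.

Lemma E_x2 d u v1 xa : Ebk KX2 (fun b => phi (m3 u v1 xa (b d))) =
  phi (mixop (kx2 d.2.1 d.2.2) (m3 u v1 xa)).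
Proof. by rewrite hphi; exact: (Ebk_marginal d (fun x => phi (m3 u v1 xa x)) hKX2). Qed.

Lemma E_xa d v2 : Ebk KA (fun b => phi (m2 d.2.1 d.2.2 v2 (b d))) = phi (m1 d.2.1 d.2.2 v2).
Proof. by rewrite hphi; exact: (Ebk_marginal d (fun x => phi (m2 d.2.1 d.2.2 v2 x)) hKA). Qed.

Lemma E_upper u v1 v2 w0 a1 a2 sa sb s2 : Ebk KA (fun b3 => Ebk KX2 (fun b4 => Ebk KX1 (fun b5 =>
    phi (rho (b5 (w0, a1, sa, sb, (u, v1, b3 (w0, a1, sa, (u, v1))))) (b4 (w0, a2, s2, (u, v2))))))) =
  phi (m1 u v1 v2).
Proof.
rewrite -(E_xa (w0, a1, sa, (u, v1)) v2); apply: eq_Ebk => b3.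
rewrite /m2 -(E_x2 (w0, a2, s2, (u, v2))); apply: eq_Ebk => b4.
by rewrite E_x1.
Qed.
End Linear.

Variables (T0 : U -> V1 -> V2 -> op R Y) (T1 : U -> V1 -> V2 -> XA -> op R Y)
  (T2 : U -> V1 -> V2 -> XA -> X2 -> op R Y) (T3 : U -> V1 -> V2 -> XA -> X2 -> X1 -> op R Y)
  (D2 : U -> V2 -> X2 -> V1 -> pred Z2) (D1 : U -> V1 -> XA -> X1 -> V2 -> pred Z1).
Variables (e be0 be1 be2 be3 ga1 ga2 : R).

Hypotheses
 (hb0 : forall u v1 v2, ptr m0 (T0 u v1 v2) <= be0)
 (hb1 : forall u v1 v2 xa, ptr (m1 u v1 v2) (T1 u v1 v2 xa) <= be1)
 (hb2 : forall u v1 v2 xa x2, ptr (m2 u v1 v2 xa) (T2 u v1 v2 xa x2) <= be2)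
 (hb3 : forall u v1 v2 xa x2 x1, ptr (m3 u v1 xa x2) (T3 u v1 v2 xa x2 x1) <= be3)
 (hg2 : forall u v2 x2 v1, prb (n2' u x2) (fun y => D2 u v2 x2 v1 (zf2 y)) <= ga2)
 (hg1 : forall u v1 xa x1 v2, prb (n1' u x1) (fun y => D1 u v1 xa x1 v2 (zf1 y)) <= ga1)
 (he0 : \sum_u pu u * \sum_v1 k1 u v1 * \sum_v2 k2 u v2 * ptr (m1 u v1 v2) (compl (T0 u v1 v2)) <= e)
 (he1 : \sum_u pu u * \sum_v1 k1 u v1 * \sum_v2 k2 u v2 * \sum_xa ka u v1 xa *
    ptr (m2 u v1 v2 xa) (compl (T1 u v1 v2 xa)) <= e)
 (he2 : \sum_u pu u * \sum_v1 k1 u v1 * \sum_v2 k2 u v2 * \sum_xa ka u v1 xa *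
    \sum_x2 kx2 u v2 x2 * ptr (m3 u v1 xa x2) (compl (T2 u v1 v2 xa x2)) <= e)
 (he3 : \sum_u pu u * \sum_v1 k1 u v1 * \sum_v2 k2 u v2 * \sum_xa ka u v1 xa *
    \sum_x2 kx2 u v2 x2 * \sum_x1 kx1 u v1 xa x1 * ptr (rho x1 x2) (compl (T3 u v1 v2 xa x2 x1)) <= e)
 (hd2 : \sum_u pu u * \sum_v1 k1 u v1 * \sum_v2 k2 u v2 * \sum_x2 kx2 u v2 x2 *
    prb (n2 u v1 x2) (fun y => ~~ D2 u v2 x2 v1 (zf2 y)) <= e)
 (hd1 : \sum_u pu u * \sum_v1 k1 u v1 * \sum_v2 k2 u v2 * \sum_xa ka u v1 xa *
    \sum_x1 kx1 u v1 xa x1 * prb (n1 u v2 x1) (fun y => ~~ D1 u v1 xa x1 v2 (zf1 y)) <= e).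

(** The indices [a1] and [a2] stay the true ones even under a wrong cloud index [w], since the
    receiver knows them from the following block. *)
Definition qerr cd w0 a1 a2 sa sb s2 : R :=
  let r := rho (cx1 cd w0 a1 sa sb) (cx2 cd w0 a2 s2) in
  let u := bu cd w0 in let v1 := cv1 cd w0 a1 in let v2 := cv2 cd w0 a2 in
  let xa := cxa cd w0 a1 sa in let x2 := cx2 cd w0 a2 s2 in let x1 := cx1 cd w0 a1 sa sb in
  (ptr r (compl (T0 u v1 v2)) +
     \sum_(w | w != w0) ptr r (T0 (bu cd w) (cv1 cd w a1) (cv2 cd w a2))) +
  (ptr r (compl (T1 u v1 v2 xa)) +
     \sum_(s | s != sa) ptr r (T1 u v1 v2 (cxa cd w0 a1 s))) +
  (ptr r (compl (T2 u v1 v2 xa x2)) +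
     \sum_(s | s != s2) ptr r (T2 u v1 v2 xa (cx2 cd w0 a2 s))) +
  (ptr r (compl (T3 u v1 v2 xa x2 x1)) +
     \sum_(s | s != sb) ptr r (T3 u v1 v2 xa x2 (cx1 cd w0 a1 sa s))).

Definition cerr cd w0 a1 a2 sa sb s2 : R :=
  let r := rho (cx1 cd w0 a1 sa sb) (cx2 cd w0 a2 s2) in
  let u := bu cd w0 in let v1 := cv1 cd w0 a1 in let v2 := cv2 cd w0 a2 in
  let xa := cxa cd w0 a1 sa in let x2 := cx2 cd w0 a2 s2 in let x1 := cx1 cd w0 a1 sa sb in
  (prb r (fun y => ~~ D2 u v2 x2 v1 (zf2 y)) +
     \sum_(a | a != a1) prb r (fun y => D2 u v2 x2 (cv1 cd w0 a) (zf2 y))) +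
  (prb r (fun y => ~~ D1 u v1 xa x1 v2 (zf1 y)) +
     \sum_(a | a != a2) prb r (fun y => D1 u v1 xa x1 (cv2 cd w0 a) (zf1 y))).

Lemma E6_sum_le (T : finType) (i0 : T) (F : T -> book -> R) be :
  (forall i, i != i0 -> E6 (F i) <= be) ->
  E6 (fun cd => \sum_(i | i != i0) F i cd) <= (#|T|.-1)%:R * be.
Proof.
move=> h; have -> : E6 (fun cd => \sum_(i | i != i0) F i cd) =
    E6 (fun cd => \sum_(i | i != i0) 1 * F i cd).
  by congr E6; apply/funext => cd; apply: eq_bigr => i _; rewrite mul1r.
rewrite E6_sum mulr_natl -(cardC1 i0) -sumr_const; apply: ler_sum => i hi.
by rewrite mul1r h.
Qed.

(** The wrong index is read at another entry of the same book, so the sent entry can be resampled,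
    and its average is the state [m3]. The other wrong-index bounds follow this pattern after the
    layers above the tested one have been averaged out. *)
Lemma E6_T3 w0 a1 a2 sa sb s2 s : s != sb ->
  E6 (fun cd => ptr (rho (cx1 cd w0 a1 sa sb) (cx2 cd w0 a2 s2))
    (T3 (bu cd w0) (cv1 cd w0 a1) (cv2 cd w0 a2) (cxa cd w0 a1 sa) (cx2 cd w0 a2 s2)
       (cx1 cd w0 a1 sa s))) <= be3.
Proof.
move=> hs; apply: Ebk_le_cst => // b0; apply: Ebk_le_cst => // b1; apply: Ebk_le_cst => // b2;
  apply: Ebk_le_cst => // b3; apply: Ebk_le_cst => // b4.
rewrite /cx1 /cxa /cx2 /cv1 /cv2 /=; set u := b0 w0; set v1 := b1 (w0, a1, u).
set v2 := b2 (w0, a2, u); set xa := b3 (w0, a1, sa, _); set x2 := b4 (w0, a2, s2, _).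
rewrite (Ebk_resample (d := (w0, a1, sa, sb, (u, v1, xa)))
  (G := fun b x => ptr (rho x x2) (T3 u v1 v2 xa x2 (b (w0, a1, sa, s, (u, v1, xa)))))) //.
  by apply: Ebk_le_cst => // b; rewrite -(ptr_mix _ (fun x => rho x x2)); exact: hb3.
by move=> b x y; rewrite upd_neq // !xpair_eqE (negbTE hs) !andbF.
Qed.

Lemma E6_T2 w0 a1 a2 sa sb s2 s : s != s2 ->
  E6 (fun cd => ptr (rho (cx1 cd w0 a1 sa sb) (cx2 cd w0 a2 s2))
    (T2 (bu cd w0) (cv1 cd w0 a1) (cv2 cd w0 a2) (cxa cd w0 a1 sa) (cx2 cd w0 a2 s))) <= be2.
Proof.
move=> hs; apply: Ebk_le_cst => // b0; apply: Ebk_le_cst => // b1; apply: Ebk_le_cst => // b2;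
  apply: Ebk_le_cst => // b3.
rewrite /cx1 /cxa /cx2 /cv1 /cv2 /=; set u := b0 w0; set v1 := b1 (w0, a1, u).
set v2 := b2 (w0, a2, u); set xa := b3 (w0, a1, sa, _).
under eq_Ebk => b4 do rewrite (E_x1 (mixlinear_ptr _)) /=.
rewrite (Ebk_resample (d := (w0, a2, s2, (u, v2)))
  (G := fun b x => ptr (m3 u v1 xa x) (T2 u v1 v2 xa (b (w0, a2, s, (u, v2)))))) //.
  by apply: Ebk_le_cst => // b; rewrite -(ptr_mix _ (m3 u v1 xa)); exact: hb2.
by move=> b x y; rewrite upd_neq // !xpair_eqE (negbTE hs) !andbF.
Qed.

Lemma E6_T1 w0 a1 a2 sa sb s2 s : s != sa ->
  E6 (fun cd => ptr (rho (cx1 cd w0 a1 sa sb) (cx2 cd w0 a2 s2))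
    (T1 (bu cd w0) (cv1 cd w0 a1) (cv2 cd w0 a2) (cxa cd w0 a1 s))) <= be1.
Proof.
move=> hs; apply: Ebk_le_cst => // b0; apply: Ebk_le_cst => // b1; apply: Ebk_le_cst => // b2.
rewrite /cx1 /cxa /cx2 /cv1 /cv2 /=; set u := b0 w0; set v1 := b1 (w0, a1, u).
set v2 := b2 (w0, a2, u).
under eq_Ebk => b3.
  under eq_Ebk => b4 do rewrite (E_x1 (mixlinear_ptr _)) /=.
  rewrite (E_x2 (mixlinear_ptr _)) /=; over.
rewrite (Ebk_resample (d := (w0, a1, sa, (u, v1)))
  (G := fun b x => ptr (m2 u v1 v2 x) (T1 u v1 v2 (b (w0, a1, s, (u, v1)))))) //.
  by apply: Ebk_le_cst => // b; rewrite -(ptr_mix _ (m2 u v1 v2)); exact: hb1.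
by move=> b x y; rewrite upd_neq // !xpair_eqE (negbTE hs) !andbF.
Qed.

(** A wrong cloud index changes every entry that the test reads, in the books of U, V1 and V2 alike.
    All layers of the sent word are therefore averaged, and the test meets [m0] rather than a state
    conditioned on U. *)
Lemma E6_T0 w0 a1 a2 sa sb s2 w : w != w0 ->
  E6 (fun cd => ptr (rho (cx1 cd w0 a1 sa sb) (cx2 cd w0 a2 s2))
    (T0 (bu cd w) (cv1 cd w a1) (cv2 cd w a2))) <= be0.
Proof.
move=> hw; rewrite /E6 /cx1 /cxa /cx2 /cv1 /cv2 /=.
pose TT b0 b1 b2 := T0 (b0 w) (b1 (w, a1, b0 w)) (b2 (w, a2, b0 w)).
have -> : Ebk KU (fun b0 => Ebk KV1 (fun b1 => Ebk KV2 (fun b2 => Ebk KA (fun b3 =>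
    Ebk KX2 (fun b4 => Ebk KX1 (fun b5 => ptr (rho
      (b5 (w0, a1, sa, sb, (b0 w0, b1 (w0, a1, b0 w0), b3 (w0, a1, sa, (b0 w0, b1 (w0, a1, b0 w0))))))
      (b4 (w0, a2, s2, (b0 w0, b2 (w0, a2, b0 w0))))) (TT b0 b1 b2))))))) =
  Ebk KU (fun b0 => Ebk KV1 (fun b1 => Ebk KV2 (fun b2 => ptr m0 (TT b0 b1 b2)))).
  transitivity (Ebk KU (fun b0 => Ebk KV1 (fun b1 => Ebk KV2 (fun b2 =>
      ptr (mu0 (b0 w0)) (TT b0 b1 b2))))).
    apply: eq_Ebk => b0; set u := b0 w0.
    transitivity (Ebk KV1 (fun b1 => Ebk KV2 (fun b2 =>
      ptr (mixop (k2 u) (m1 u (b1 (w0, a1, u)))) (TT b0 b1 b2)))).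
      apply: eq_Ebk => b1; set v1 := b1 (w0, a1, u).
      transitivity (Ebk KV2 (fun b2 => ptr (m1 u v1 (b2 (w0, a2, u))) (TT b0 b1 b2))).
        by apply: eq_Ebk => b2; rewrite (E_upper (mixlinear_ptr _)).
      rewrite (Ebk_resample (d := (w0, a2, u)) (G := fun b x => ptr (m1 u v1 x) (TT b0 b1 b))) //.
        by apply: eq_Ebk => b2; rewrite ptr_mix.
      by move=> b x y; rewrite /TT upd_neq // !xpair_eqE (negbTE hw).
    rewrite (Ebk_resample (d := (w0, a1, u)) (G := fun b x => Ebk KV2 (fun b2 =>
      ptr (mixop (k2 u) (m1 u x)) (TT b0 b b2)))) //.
      by apply: eq_Ebk => b1; rewrite -Ebk_sum; apply: eq_Ebk => b2; rewrite -ptr_mix.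
    by move=> b x y; rewrite /TT upd_neq // !xpair_eqE (negbTE hw).
  rewrite (Ebk_resample (d := w0) (G := fun b x => Ebk KV1 (fun b1 => Ebk KV2 (fun b2 =>
      ptr (mu0 x) (TT b b1 b2))))) //.
    apply: eq_Ebk => b0; rewrite -Ebk_sum; apply: eq_Ebk => b1; rewrite -Ebk_sum.
    by apply: eq_Ebk => b2; rewrite -ptr_mix.
  by move=> b x y; rewrite /TT upd_neq.
by do 3 (apply: Ebk_le_cst => // ?); exact: hb0.
Qed.

(** The words [v2] and [x2] are known to sender 2 and stay fixed; only [x1], [xa] and [v1] are
    averaged, which gives [n2']. *)
Lemma E6_D2 w0 a1 a2 sa sb s2 a : a != a1 ->
  E6 (fun cd => prb (rho (cx1 cd w0 a1 sa sb) (cx2 cd w0 a2 s2))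
    (fun y => D2 (bu cd w0) (cv2 cd w0 a2) (cx2 cd w0 a2 s2) (cv1 cd w0 a) (zf2 y))) <= ga2.
Proof.
move=> ha; apply: Ebk_le_cst => // b0; rewrite /cx1 /cxa /cx2 /cv1 /cv2 /=; set u := b0 w0.
have -> : Ebk KV1 (fun b1 => Ebk KV2 (fun b2 => Ebk KA (fun b3 => Ebk KX2 (fun b4 =>
    Ebk KX1 (fun b5 => prb (rho
      (b5 (w0, a1, sa, sb, (u, b1 (w0, a1, u), b3 (w0, a1, sa, (u, b1 (w0, a1, u))))))
      (b4 (w0, a2, s2, (u, b2 (w0, a2, u)))))
    (fun y => D2 u (b2 (w0, a2, u)) (b4 (w0, a2, s2, (u, b2 (w0, a2, u)))) (b1 (w0, a, u)) (zf2 y))))))) =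
  Ebk KV1 (fun b1 => Ebk KV2 (fun b2 => Ebk KX2 (fun b4 =>
    prb (n2' u (b4 (w0, a2, s2, (u, b2 (w0, a2, u)))))
     (fun y => D2 u (b2 (w0, a2, u)) (b4 (w0, a2, s2, (u, b2 (w0, a2, u)))) (b1 (w0, a, u)) (zf2 y))))).
  pose F b1 b2 (b4 : {ffun W0 * A2 * S2 * (U * V2) -> X2}) v1 :=
    prb (n2 u v1 (b4 (w0, a2, s2, (u, b2 (w0, a2, u)))))
     (fun y => D2 u (b2 (w0, a2, u)) (b4 (w0, a2, s2, (u, b2 (w0, a2, u)))) (b1 (w0, a, u)) (zf2 y)).
  transitivity (Ebk KV1 (fun b1 => Ebk KV2 (fun b2 => Ebk KX2 (fun b4 => F b1 b2 b4 (b1 (w0, a1, u)))))).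
    apply: eq_Ebk => b1; apply: eq_Ebk => b2; set v1 := b1 (w0, a1, u); set v2 := b2 (w0, a2, u).
    transitivity (Ebk KA (fun b3 => Ebk KX2 (fun b4 =>
      prb (m3 u v1 (b3 (w0, a1, sa, (u, v1))) (b4 (w0, a2, s2, (u, v2))))
       (fun y => D2 u v2 (b4 (w0, a2, s2, (u, v2))) (b1 (w0, a, u)) (zf2 y))))).
      by apply: eq_Ebk => b3; apply: eq_Ebk => b4; rewrite (E_x1 (mixlinear_prb _)).
    apply: etrans (Ebk_marginal (w0, a1, sa, (u, v1)) (fun xa => Ebk KX2 (fun b4 =>
      prb (m3 u v1 xa (b4 (w0, a2, s2, (u, v2))))
       (fun y => D2 u v2 (b4 (w0, a2, s2, (u, v2))) (b1 (w0, a, u)) (zf2 y)))) hKA) _.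
    by rewrite -Ebk_sum; apply: eq_Ebk => b4; rewrite -(mixlinear_prb _).
  rewrite (Ebk_resample (d := (w0, a1, u)) (G := fun b x => Ebk KV2 (fun b2 =>
      Ebk KX2 (fun b4 => F b b2 b4 x)))) //.
    apply: eq_Ebk => b1; rewrite -Ebk_sum; apply: eq_Ebk => b2; rewrite -Ebk_sum.
    by apply: eq_Ebk => b4; rewrite -(mixlinear_prb _).
  by move=> b x y; rewrite /F upd_neq // !xpair_eqE (negbTE ha) !andbF.
apply: Ebk_le_cst => // b1; apply: Ebk_le_cst => // b2; apply: Ebk_le_cst => // b4; exact: hg2.
Qed.

Lemma E6_D1 w0 a1 a2 sa sb s2 a : a != a2 ->
  E6 (fun cd => prb (rho (cx1 cd w0 a1 sa sb) (cx2 cd w0 a2 s2))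
    (fun y => D1 (bu cd w0) (cv1 cd w0 a1) (cxa cd w0 a1 sa) (cx1 cd w0 a1 sa sb)
       (cv2 cd w0 a) (zf1 y))) <= ga1.
Proof.
move=> ha; apply: Ebk_le_cst => // b0; apply: Ebk_le_cst => // b1.
rewrite /cx1 /cxa /cx2 /cv1 /cv2 /=; set u := b0 w0; set v1 := b1 (w0, a1, u).
pose F (b2 : {ffun W0 * A2 * U -> V2}) xa x1 v2 :=
  prb (n1 u v2 x1) (fun y => D1 u v1 xa x1 (b2 (w0, a, u)) (zf1 y)).
have -> : Ebk KV2 (fun b2 => Ebk KA (fun b3 => Ebk KX2 (fun b4 =>
    Ebk KX1 (fun b5 => prb (rho
      (b5 (w0, a1, sa, sb, (u, v1, b3 (w0, a1, sa, (u, v1)))))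
      (b4 (w0, a2, s2, (u, b2 (w0, a2, u)))))
    (fun y => D1 u v1 (b3 (w0, a1, sa, (u, v1)))
      (b5 (w0, a1, sa, sb, (u, v1, b3 (w0, a1, sa, (u, v1))))) (b2 (w0, a, u)) (zf1 y)))))) =
  Ebk KV2 (fun b2 => Ebk KA (fun b3 => Ebk KX1 (fun b5 =>
    F b2 (b3 (w0, a1, sa, (u, v1))) (b5 (w0, a1, sa, sb, (u, v1, b3 (w0, a1, sa, (u, v1)))))
      (b2 (w0, a2, u))))).
  apply: eq_Ebk => b2; apply: eq_Ebk => b3; set xa := b3 _; set v2 := b2 (w0, a2, u).
  apply: etrans (Ebk_marginal (w0, a2, s2, (u, v2)) (fun x2 => Ebk KX1 (fun b5 =>
    prb (rho (b5 (w0, a1, sa, sb, (u, v1, xa))) x2)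
      (fun y => D1 u v1 xa (b5 (w0, a1, sa, sb, (u, v1, xa))) (b2 (w0, a, u)) (zf1 y)))) hKX2) _.
  by rewrite -Ebk_sum; apply: eq_Ebk => b5; rewrite -(mixlinear_prb _).
rewrite (Ebk_resample (d := (w0, a2, u)) (G := fun b x => Ebk KA (fun b3 => Ebk KX1 (fun b5 =>
  F b (b3 (w0, a1, sa, (u, v1))) (b5 (w0, a1, sa, sb, (u, v1, b3 (w0, a1, sa, (u, v1))))) x)))) //.
  apply: Ebk_le_cst => // b2; rewrite -Ebk_sum; apply: Ebk_le_cst => // b3; rewrite -Ebk_sum.
  by apply: Ebk_le_cst => // b5; rewrite -(mixlinear_prb _); exact: hg1.
by move=> b x y; rewrite /F upd_neq // !xpair_eqE (negbTE ha) !andbF.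
Qed.

Lemma E6_err w0 a1 a2 sa sb s2 :
  E6 (fun cd => qerr cd w0 a1 a2 sa sb s2 + cerr cd w0 a1 a2 sa sb s2) <=
  6 * e + ((#|W0|.-1)%:R * be0 + (#|Sa|.-1)%:R * be1 + (#|S2|.-1)%:R * be2 + (#|Sb|.-1)%:R * be3) +
  ((#|A1|.-1)%:R * ga2 + (#|A2|.-1)%:R * ga1).
Proof.
have sumd1 (T : finType) (w : T -> R) (a : R) : distr w -> \sum_x w x * a = a.
  by move=> [_ h]; rewrite -mulr_suml h mul1r.
rewrite /qerr /cerr /= !E6D.
have t0 : E6 (fun cd => ptr (rho (cx1 cd w0 a1 sa sb) (cx2 cd w0 a2 s2))
    (compl (T0 (bu cd w0) (cv1 cd w0 a1) (cv2 cd w0 a2)))) <= e.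
  rewrite (E6_true (fun u v1 v2 xa x2 x1 => ptr (rho x1 x2) (compl (T0 u v1 v2)))).
  apply: le_trans he0; apply: ler_sum => u _; apply: ler_wpM2l; first by case: hpu.
  apply: ler_sum => v1 _; apply: ler_wpM2l; first by case: (hk1 u).
  apply: ler_sum => v2 _; apply: ler_wpM2l; first by case: (hk2 u).
  rewrite /m1 ptr_mix; apply: ler_sum => xa _; rewrite /m2 ptr_mix.
  by under eq_bigr do rewrite -ptr_mix.
have t1 : E6 (fun cd => ptr (rho (cx1 cd w0 a1 sa sb) (cx2 cd w0 a2 s2))
    (compl (T1 (bu cd w0) (cv1 cd w0 a1) (cv2 cd w0 a2) (cxa cd w0 a1 sa)))) <= e.
  rewrite (E6_true (fun u v1 v2 xa x2 x1 => ptr (rho x1 x2) (compl (T1 u v1 v2 xa)))).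
  apply: le_trans he1; apply: ler_sum => u _; apply: ler_wpM2l; first by case: hpu.
  apply: ler_sum => v1 _; apply: ler_wpM2l; first by case: (hk1 u).
  apply: ler_sum => v2 _; apply: ler_wpM2l; first by case: (hk2 u).
  apply: ler_sum => xa _; rewrite /m2 ptr_mix.
  by under eq_bigr do rewrite -ptr_mix.
have t2 : E6 (fun cd => ptr (rho (cx1 cd w0 a1 sa sb) (cx2 cd w0 a2 s2))
    (compl (T2 (bu cd w0) (cv1 cd w0 a1) (cv2 cd w0 a2) (cxa cd w0 a1 sa) (cx2 cd w0 a2 s2)))) <= e.
  rewrite (E6_true (fun u v1 v2 xa x2 x1 => ptr (rho x1 x2) (compl (T2 u v1 v2 xa x2)))).
  apply: le_trans he2; apply: ler_sum => u _; apply: ler_wpM2l; first by case: hpu.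
  apply: ler_sum => v1 _; apply: ler_wpM2l; first by case: (hk1 u).
  apply: ler_sum => v2 _; apply: ler_wpM2l; first by case: (hk2 u).
  apply: ler_sum => xa _; by under eq_bigr do rewrite -ptr_mix.
have t3 : E6 (fun cd => ptr (rho (cx1 cd w0 a1 sa sb) (cx2 cd w0 a2 s2))
    (compl (T3 (bu cd w0) (cv1 cd w0 a1) (cv2 cd w0 a2) (cxa cd w0 a1 sa) (cx2 cd w0 a2 s2)
       (cx1 cd w0 a1 sa sb)))) <= e.
  by rewrite (E6_true (fun u v1 v2 xa x2 x1 => ptr (rho x1 x2) (compl (T3 u v1 v2 xa x2 x1)))).
have t4 : E6 (fun cd => prb (rho (cx1 cd w0 a1 sa sb) (cx2 cd w0 a2 s2))
    (fun y => ~~ D2 (bu cd w0) (cv2 cd w0 a2) (cx2 cd w0 a2 s2) (cv1 cd w0 a1) (zf2 y))) <= e.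
  rewrite (E6_true (fun u v1 v2 xa x2 x1 => prb (rho x1 x2) (fun y => ~~ D2 u v2 x2 v1 (zf2 y)))).
  apply: le_trans hd2; apply: ler_sum => u _; apply: ler_wpM2l; first by case: hpu.
  apply: ler_sum => v1 _; apply: ler_wpM2l; first by case: (hk1 u).
  apply: ler_sum => v2 _; apply: ler_wpM2l; first by case: (hk2 u).
  under eq_bigr do rewrite mulr_sumr.
  rewrite exchange_big /=; apply: ler_sum => x2 _.
  rewrite /n2 (mixlinear_prb _) mulr_sumr; apply: ler_sum => xa _.
  by rewrite mulrCA /m3 (mixlinear_prb _).
have t5 : E6 (fun cd => prb (rho (cx1 cd w0 a1 sa sb) (cx2 cd w0 a2 s2))
    (fun y => ~~ D1 (bu cd w0) (cv1 cd w0 a1) (cxa cd w0 a1 sa) (cx1 cd w0 a1 sa sb)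
       (cv2 cd w0 a2) (zf1 y))) <= e.
  rewrite (E6_true (fun u v1 v2 xa x2 x1 => prb (rho x1 x2) (fun y => ~~ D1 u v1 xa x1 v2 (zf1 y)))).
  apply: le_trans hd1; apply: ler_sum => u _; apply: ler_wpM2l; first by case: hpu.
  apply: ler_sum => v1 _; apply: ler_wpM2l; first by case: (hk1 u).
  apply: ler_sum => v2 _; apply: ler_wpM2l; first by case: (hk2 u).
  apply: ler_sum => xa _; apply: ler_wpM2l; first by case: (hka u v1).
  under eq_bigr do rewrite mulr_sumr.
  rewrite exchange_big /=; apply: ler_sum => x1 _.
  rewrite /n1 (mixlinear_prb _) mulr_sumr; apply: ler_sum => x2 _.
  by rewrite mulrCA.
have s0 := E6_sum_le (fun w hw => E6_T0 a1 a2 sa sb s2 hw).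
have s1 := E6_sum_le (fun w hw => E6_T1 w0 a1 a2 sb s2 hw).
have s2' := E6_sum_le (fun w hw => E6_T2 w0 a1 a2 sa sb hw).
have s3 := E6_sum_le (fun w hw => E6_T3 w0 a1 a2 sa s2 hw).
have s4 := E6_sum_le (fun w hw => E6_D2 w0 a2 sa sb s2 hw).
have s5 := E6_sum_le (fun w hw => E6_D1 w0 a1 sa sb s2 hw).
move: t0 t1 t2 t3 t4 t5 (s0 w0) (s1 sa) (s2' s2) (s3 sb) (s4 a1) (s5 a2); lra.
Qed.
End BlockCode.

(** * Memoryless instruments and product inputs *)

Section LinearMaps.
Variable R : realType.
Local Notation C := R[i].
Implicit Types (I J K : finType).

Lemma lin0 I J (Phi : op R I -> op R J) : linmap Phi -> Phi (fun _ _ => 0) = fun _ _ => 0.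
Proof.
move=> h; have := h 1 (fun _ _ => 0) (fun _ _ => 0).
have -> : (fun k l : I => 1 * 0 + 0 : C) = fun _ _ => 0.
  by apply: opP => k l; rewrite mulr0 addr0.
move=> e; apply: opP => k l; have := congr1 (fun X : op R J => X k l) e.
rewrite /= mul1r => e'; apply: (addrI (Phi (fun _ _ => 0) k l)).
by rewrite addr0 -e'.
Qed.

Lemma lin_scale I J (Phi : op R I -> op R J) a X : linmap Phi ->
  Phi (fun k l => a * X k l) = fun k l => a * Phi X k l.
Proof.
move=> h; have := h a X (fun _ _ => 0); rewrite (lin0 h).
have -> : (fun k l => a * X k l + 0) = (fun k l => a * X k l) by apply: opP => k l; rewrite addr0.
by move=> ->; apply: opP => k l; rewrite addr0.
Qed.

Lemma lin_sum I J (Phi : op R I -> op R J) (T : Type) (r : seq T) (c : T -> C) (E : T -> op R I) :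
  linmap Phi -> Phi (fun k l => \sum_(i <- r) c i * E i k l) =
  fun k l => \sum_(i <- r) c i * Phi (E i) k l.
Proof.
move=> h; elim: r => [|i r IH].
  have -> : (fun k l => \sum_(i <- [::]) c i * E i k l) = fun _ _ => 0.
    by apply: opP => k l; rewrite big_nil.
  by rewrite (lin0 h); apply: opP => k l; rewrite big_nil.
have -> : (fun k l => \sum_(i <- i :: r) c i * E i k l) =
  (fun k l => c i * E i k l + (fun k l => \sum_(i <- r) c i * E i k l) k l).
  by apply: opP => k l; rewrite big_cons.
by rewrite h IH; apply: opP => k l; rewrite big_cons.
Qed.

Lemma lin_expand I J (Phi : op R I -> op R J) X : linmap Phi ->
  Phi X = fun k l => \sum_(p : I * I) X p.1 p.2 * Phi (@munit R I p.1 p.2) k l.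
Proof.
move=> h; rewrite -(lin_sum _ _ _ h); congr Phi; apply: opP => k l.
rewrite (bigD1 (k, l)) //= /munit !eqxx mulr1 big1 ?addr0 // => -[p q] /=.
rewrite xpair_eqE (eq_sym k) (eq_sym l) => /negbTE; rewrite /= => ->; exact: mulr0.
Qed.

Lemma psd_reindex I J (f : J -> I) (X : op R I) : bijective f -> psd X ->
  psd (fun p q => X (f p) (f q)).
Proof.
move=> [g fK gK] hX v; have := hX (fun i => v (g i)).
rewrite (reindex f) /=; last by apply: onW_bij; exists g.
congr (0 <= _); apply: eq_bigr => k _; rewrite fK (reindex f) /=; last first.
  by apply: onW_bij; exists g.
by apply: eq_bigr => l _; rewrite fK.
Qed.

Lemma compos_psd I J (Phi : op R I -> op R J) X : compos Phi -> psd X -> psd (Phi X).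
Proof.
move=> h hX.
have hb : bijective (fun p : unit * I => p.2) by exists (fun i => (tt, i)) => [[[] i]|i].
have := h unit _ (psd_reindex hb hX).
have hb' : bijective (fun j : J => (tt, j)) by exists snd => [j|[[] j]].
by move/(psd_reindex hb').
Qed.

Lemma psd_tens (A1 A2 : finType) (X : op R A1) (Y : op R A2) :
  psd X -> psd Y -> psd (tens X Y).
Proof.
move=> hX hY.
have [la [e he]] := eigd_exists hX; have [mu [f hf]] := eigd_exists hY.
have [e1 e2 e3] := he; have [f1 f2 f3] := hf.
have hd : eigd (tens X Y) (fun p => la p.1 * mu p.2) (fun p q => e p.1 q.1 * f p.2 q.2).
  split.
  - move=> [y1 y2] [z1 z2] /=; rewrite xpair_eqE -mulnb natrM -e1 -f1 mulr_suml.
    rewrite -(pair_bigA _ (fun i j => (e y1 i * f y2 j)^* * (e z1 i * f z2 j))) /=.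
    by apply: eq_bigr => i _; rewrite mulr_sumr; apply: eq_bigr => j _; rewrite cjM; ring.
  - move=> [y1 y2] [z1 z2] /=; rewrite xpair_eqE -mulnb natrM -e2 -f2 mulr_suml.
    rewrite -(pair_bigA _ (fun i j => (e i y1 * f j y2) * (e i z1 * f j z2)^*)) /=.
    by apply: eq_bigr => i _; rewrite mulr_sumr; apply: eq_bigr => j _; rewrite cjM; ring.
  - move=> [y1 y2] [z1 z2]; rewrite /tens /= e3 f3 mulr_suml.
    rewrite -(pair_bigA _ (fun i j => real_complex R (la i * mu j) * ((e i y1 * f j y2) * (e i z1 * f j z2)^*))) /=.
    apply: eq_bigr => i _; rewrite mulr_sumr; apply: eq_bigr => j _.
    by rewrite cjM rmorphM /=; ring.
apply: (eigd_psd hd) => y; apply: mulr_ge0; [exact: psd_eigd_ge0 hX he|exact: psd_eigd_ge0 hY hf].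
Qed.

Lemma density_tens (A1 A2 : finType) (X : op R A1) (Y : op R A2) :
  density X -> density Y -> density (tens X Y).
Proof.
move=> [hX tX] [hY tY]; split; first exact: psd_tens.
rewrite /trace /tens -(pair_bigA _ (fun i j => X i i * Y j j)) /=.
rewrite -[RHS]mulr1 -{1}tX -tY /trace mulr_suml; apply: eq_bigr => i _.
by rewrite mulr_sumr.
Qed.

Lemma chan_n_prodop (A1 A2 B : finType) (N : op R (A1 * A2) -> op R B) n
  (th : 'I_n -> op R A1) (ph : 'I_n -> op R A2) : linmap N ->
  chan_n N (prodop th) (prodop ph) = prodop (fun t => N (tens (th t) (ph t))).
Proof.
move=> hN; apply: opP => b b'; rewrite /chan_n /prodop.
transitivity (\prod_t \sum_a1 \sum_a1' \sum_a2 \sum_a2' th t a1 a1' * ph t a2 a2' *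
   N (@munit R _ (a1, a2) (a1', a2')) (b t) (b' t)).
  rewrite -(sum_tup_prod (fun t a1 => \sum_a1' \sum_a2 \sum_a2' th t a1 a1' * ph t a2 a2' *
   N (@munit R _ (a1, a2) (a1', a2')) (b t) (b' t))); apply: eq_bigr => a1 _.
  rewrite -(sum_tup_prod (fun t a1' => \sum_a2 \sum_a2' th t (a1 t) a1' * ph t a2 a2' *
   N (@munit R _ (a1 t, a2) (a1', a2')) (b t) (b' t))); apply: eq_bigr => a1' _.
  rewrite -(sum_tup_prod (fun t a2 => \sum_a2' th t (a1 t) (a1' t) * ph t a2 a2' *
   N (@munit R _ (a1 t, a2) (a1' t, a2')) (b t) (b' t))); apply: eq_bigr => a2 _.
  rewrite -(sum_tup_prod (fun t a2' => th t (a1 t) (a1' t) * ph t (a2 t) a2' *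
   N (@munit R _ (a1 t, a2 t) (a1' t, a2')) (b t) (b' t))); apply: eq_bigr => a2' _.
  by rewrite !big_split.
apply: eq_bigr => t _; rewrite (lin_expand _ hN).
rewrite -(pair_bigA _ (fun p q => tens (th t) (ph t) p q * N (@munit R _ p q) (b t) (b' t))) /=.
rewrite -(pair_bigA _ (fun a1 a2 => \sum_q tens (th t) (ph t) (a1, a2) q * N (@munit R _ (a1, a2) q) (b t) (b' t))) /=.
apply: eq_bigr => a1 _; rewrite exchange_big /=; apply: eq_bigr => a2 _.
by rewrite -(pair_bigA _ (fun a1' a2' => tens (th t) (ph t) (a1, a2) (a1', a2') *
  N (@munit R _ (a1, a2) (a1', a2')) (b t) (b' t))).
Qed.
End LinearMaps.

(** * Memoryless feedback instruments run on product outputs *)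

Section Feedback.
Variable R : realType.
Local Notation C := R[i].
Variables (B Bb Z1 Z2 : finType) (G : Z1 -> Z2 -> op R B -> op R Bb).
Hypothesis hG : instrument G.

Definition tinit (A : finType) i (s : tup A i.+1) : tup A i := [ffun t => s (widen_ord (leqnSn i) t)].
Definition tlast (A : finType) i (s : tup A i.+1) : A := s ord_max.

Lemma unlift_max_widen i (t : 'I_i) : unlift ord_max (widen_ord (leqnSn i) t) = Some t.
Proof.
have -> : widen_ord (leqnSn i) t = lift ord_max t by apply: val_inj; rewrite /= /bump leqNgt ltn_ord.
by rewrite liftK.
Qed.

Lemma tinit_snoc (A : finType) i (s : tup A i) a : tinit (snoc s a) = s.
Proof. by apply/ffunP => t; rewrite !ffunE unlift_max_widen. Qed.

Lemma tlast_snoc (A : finType) i (s : tup A i) a : tlast (snoc s a) = a.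
Proof. by rewrite /tlast ffunE unlift_none. Qed.

Lemma snoc_tinit (A : finType) i (s : tup A i.+1) : snoc (tinit s) (tlast s) = s.
Proof.
apply/ffunP => t; rewrite ffunE; case: unliftP => [j ->|->] //.
by rewrite ffunE; congr (s _); apply: val_inj; rewrite /= /bump leqNgt ltn_ord.
Qed.

Lemma snoc_bij (A : finType) i : bijective (fun p : tup A i * A => snoc p.1 p.2).
Proof.
exists (fun s => (tinit s, tlast s)) => [[s a]|s] /=; first by rewrite tinit_snoc tlast_snoc.
exact: snoc_tinit.
Qed.

(** The stored systems are left alone: all collective processing is deferred to the decoding
    POVM. *)
Definition memoryless (j : nat) (z1 : Z1) (z2 : Z2) (X : op R (tup Bb j * B)) : op R (tup Bb j.+1) :=
  fun p q => applyR (G z1 z2) X (tinit p, tlast p) (tinit q, tlast q).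

Lemma sum_snoc (V : nmodType) (A : finType) i (F : tup A i.+1 -> V) :
  \sum_s F s = \sum_s \sum_a F (snoc s a).
Proof.
rewrite pair_bigA /= (reindex (fun p : tup A i * A => snoc p.1 p.2)) //=.
by apply: onW_bij; exact: snoc_bij.
Qed.

Lemma trace_memoryless j z1 z2 X : trace (memoryless z1 z2 (j := j) X) =
  \sum_s trace (G z1 z2 (fun b b' => X (s, b) (s, b'))).
Proof.
rewrite /trace sum_snoc; apply: eq_bigr => s _; apply: eq_bigr => a _.
by rewrite /memoryless /applyR /= tinit_snoc tlast_snoc.
Qed.

Lemma sum_pair (V : nmodType) (I J : finType) (F : I * J -> V) :
  \sum_p F p = \sum_i \sum_j F (i, j).
Proof. by rewrite pair_bigA; apply: eq_bigr => -[]. Qed.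

Lemma trace_pair (I J : finType) (X : op R (I * J)) :
  trace X = \sum_s trace (fun b b' => X (s, b) (s, b')).
Proof. by rewrite /trace pair_bigA; apply: eq_bigr => -[]. Qed.

Lemma psd_block (I J : finType) (X : op R (I * J)) s : psd X ->
  psd (fun b b' => X (s, b) (s, b')).
Proof.
move=> hX v; have := hX (fun p => if p.1 == s then v p.2 else 0); congr (0 <= _).
rewrite sum_pair /= (bigD1 s) //= [X in _ + X]big1 ?addr0; last first.
  by move=> i /negbTE hi; rewrite big1 // => j _; rewrite hi big1 // => q _; rewrite cj0 !mul0r.
apply: eq_bigr => k _; rewrite eqxx sum_pair /= (bigD1 s) //= [X in _ + X]big1 ?addr0; last first.
  by move=> i /negbTE hi; rewrite big1 // => j _; rewrite hi mulr0.
by apply: eq_bigr => l _; rewrite eqxx.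
Qed.

Lemma memoryless_instrument j : instrument (@memoryless j).
Proof.
have [h1 h2 h3 h4] := hG; split.
- move=> z1 z2 a X Y; apply: opP => p q; rewrite /memoryless /applyR /=.
  by rewrite h1.
- move=> z1 z2 K X hX.
  pose f (p : K * tup Bb j.+1) := (p.1, tinit p.2, tlast p.2).
  have hf : bijective f.
    exists (fun q => (q.1.1, snoc q.1.2 q.2)) => [[a s]|[[a s] b]] /=.
      by rewrite /f /= snoc_tinit.
    by rewrite /f /= tinit_snoc tlast_snoc.
  pose g (q : K * tup Bb j * B) := (q.1.1, (q.1.2, q.2)).
  have hg : bijective g by exists (fun p => (p.1, p.2.1, p.2.2)) => [[[a s] b]|[a [s b]]].
  exact: (psd_reindex hf (h2 z1 z2 _ _ (psd_reindex hg hX))).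
- move=> z1 z2 X hX; rewrite trace_memoryless trace_pair; apply: ler_sum => s _.
  by apply: h3; exact: psd_block.
- move=> X; rewrite /trace exchange_big /=.
  transitivity (\sum_z1 \sum_z2 trace (memoryless z1 z2 X)).
    by apply: eq_bigr => z1 _; rewrite exchange_big.
  transitivity (\sum_s \sum_z1 \sum_z2 trace (G z1 z2 (fun b b' => X (s, b) (s, b')))).
    rewrite [RHS]exchange_big /=; apply: eq_bigr => z1 _; rewrite [RHS]exchange_big /=.
    by apply: eq_bigr => z2 _; rewrite trace_memoryless.
  rewrite -/(trace X) trace_pair; apply: eq_bigr => s _.
  rewrite -[RHS]h4 /trace [RHS]exchange_big /=; apply: eq_bigr => z1 _.
  by rewrite [RHS]exchange_big.
Qed.

Variables (k : nat) (h1 : tup Z1 k) (h2 : tup Z2 k) (sg : nat -> op R B).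

(** The zero default concerns [t >= k] only, where no instrument acts. *)
Definition outst (t : nat) : op R Bb :=
  if insub t is Some t' then G (h1 t') (h2 t') (sg t) else fun _ _ => 0.

(** Invariant of the recursion: [j] sites are processed, the others are still raw channel outputs.
    One step applies [G] to the next output and moves it to the left factor; the last output stays
    raw, as no instrument follows it. *)
Lemma run_prod r j : (r + j <= k)%N ->
  run memoryless h1 h2 (r := r) (j := j)
    (fun p q => (\prod_(t < j) outst t (p.1 t) (q.1 t)) *
                \prod_(t < r.+1) sg (j + t)%N (p.2 t) (q.2 t)) =
  fun p q => (\prod_(t < r + j) outst t (p.1 t) (q.1 t)) * sg (j + r)%N p.2 q.2.
Proof.
elim: r j => [|r IH] j hj.
  apply: opP => p q; rewrite /= /collapse1 /= big_ord_recl big_ord0 mulr1 !ffunE.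
  by rewrite addn0.
have hj' : (r + j.+1 <= k)%N by rewrite addnS.
rewrite /=; set X := applyL _ _.
have -> : X = fun p q => (\prod_(t < j.+1) outst t (p.1 t) (q.1 t)) *
                \prod_(t < r.+1) sg (j.+1 + t)%N (p.2 t) (q.2 t).
  apply: opP => p q; rewrite /X /applyL /splitHead /=.
  have jk : (j < k)%N by rewrite (leq_trans _ hj) // addSn ltnS leq_addl.
  rewrite /Dat insubT /= /memoryless /applyR /=.
  set cst := \prod_(t < r.+1) sg (j.+1 + t)%N (p.2 t) (q.2 t).
  set cj := \prod_(t < j) outst t (tinit p.1 t) (tinit q.1 t).
  have -> : (fun i i' : B => (\prod_(t < j) outst t (tinit p.1 t) (tinit q.1 t)) *
     \prod_(t < r.+2) sg (j + t)%N (cons_tup i p.2 t) (cons_tup i' q.2 t)) =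
     (fun i i' => (cj * cst) * sg j i i').
    apply: opP => i i'; rewrite big_ord_recl /= !ffunE unlift_none addn0 -/cj.
    rewrite (eq_bigr (fun t : 'I_r.+1 => sg (j.+1 + t)%N (p.2 t) (q.2 t))) => [|t _].
      by rewrite -/cst; ring.
    by rewrite !ffunE liftK /= /bump addSnnS.
  have [l1 _ _ _] := hG; rewrite (lin_scale _ _ (l1 _ _)) [in RHS]big_ord_recr /=.
  have -> : \prod_(i < j) outst i (p.1 (widen_ord (leqnSn j) i)) (q.1 (widen_ord (leqnSn j) i)) = cj.
    by apply: eq_bigr => t _; rewrite !ffunE.
  by rewrite [outst j]/outst insubT /= /tlast; ring.
rewrite (IH _ hj'); apply: opP => p q; rewrite /castop /=; congr (_ * _); last by rewrite addSnnS.
rewrite [RHS](reindex (cast_ord (addnS r j))) /=; last first.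
  by apply: onW_bij; exists (cast_ord (esym (addnS r j))) => t; [exact: cast_ordK|exact: cast_ordKV].
by apply: eq_bigr => t _; rewrite !ffunE.
Qed.
End Feedback.

(** * Tests embedded into blocks *)

Section Embedding.
Variable R : realType.
Local Notation C := R[i].
Variables (I : finType) (k m : nat) (kap : 'I_m -> 'I_k).
Hypothesis kapI : injective kap.

Definition agree (y y' : tup I k) := [forall t, (t \notin codom kap) ==> (y t == y' t)].
Definition restr (A : finType) (y : tup A k) : tup A m := [ffun t => y (kap t)].
(* [T] acts on the sites in the range of [kap], the identity on the others. *)
Definition emb (T : op R (tup I m)) : op R (tup I k) :=
  fun y y' => (agree y y')%:R * T (restr y) (restr y').
Definition merge (y : tup I k) (z : tup I m) : tup I k :=
  [ffun t => if [pick s | kap s == t] is Some s then z s else y t].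

Lemma agreeP (y y' : tup I k) : reflect (forall t, t \notin codom kap -> y t = y' t) (agree y y').
Proof.
apply: (iffP forallP) => h t; first by move=> ht; have /implyP/(_ ht)/eqP := h t.
by apply/implyP => ht; apply/eqP/h.
Qed.

Lemma merge_in y z s : merge y z (kap s) = z s.
Proof. by rewrite ffunE; case: pickP => [s' /eqP /kapI ->//|/(_ s)]; rewrite eqxx. Qed.

Lemma merge_out y z t : t \notin codom kap -> merge y z t = y t.
Proof.
move=> ht; rewrite ffunE; case: pickP => [s /eqP hs|//].
by case/negP: ht; rewrite -hs codom_f.
Qed.

Lemma restr_merge y z : restr (merge y z) = z.
Proof. by apply/ffunP => s; rewrite ffunE merge_in. Qed.

Lemma agree_sym y y' : agree y y' = agree y' y.
Proof. by apply/agreeP/agreeP => h t ht; rewrite h. Qed.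

Lemma agree_trans y y' y'' : agree y y'' -> agree y'' y' = agree y y'.
Proof. by move/agreeP => h; apply/agreeP/agreeP => h' t ht; rewrite -?h' ?h //; rewrite -?h // h'. Qed.

Lemma merge_restr y y' : agree y y' -> merge y (restr y') = y'.
Proof.
move=> /agreeP h; apply/ffunP => t; case: (boolP (t \in codom kap)) => [/codomP[s ->]|ht].
  by rewrite merge_in ffunE.
by rewrite merge_out // h.
Qed.

Lemma sum_agree (V : nmodType) y (F : tup I m -> V) :
  \sum_(y' | agree y y') F (restr y') = \sum_z F z.
Proof.
rewrite (reindex_onto (merge y) (@restr I)) /= => [|y' hy']; last exact: merge_restr.
apply: eq_big => [z|z _]; last by rewrite restr_merge.
rewrite restr_merge eqxx andbT; apply/agreeP => t ht; by rewrite merge_out.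
Qed.

Lemma emb_mul S T : emb (opmul S T) = opmul (emb S) (emb T).
Proof.
apply: opP => y y'; rewrite /emb /opmul.
transitivity (\sum_(y'' | agree y y'') (agree y y')%:R * (S (restr y) (restr y'') * T (restr y'') (restr y'))).
  by rewrite (sum_agree y (fun z => (agree y y')%:R * (S (restr y) z * T z (restr y')))) mulr_sumr.
rewrite big_mkcond; apply: eq_bigr => y'' _; case: (boolP (agree y y'')) => [/agree_trans ->|_] /=; first by ring.
by rewrite !mul0r.
Qed.

Lemma emb_adj T : adj (emb T) = emb (adj T).
Proof. by apply: opP => y y'; rewrite /emb /adj cjM cjn agree_sym. Qed.

Lemma emb_id : emb (@idop R _) = @idop R _.
Proof.
apply: opP => y y'; rewrite /emb /idop -natrM mulnb; congr ((nat_of_bool _)%:R).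
apply/andP/eqP => [[ha /eqP hr]|->]; last by split => //; apply/agreeP.
by rewrite -(merge_restr ha) -hr; apply/esym/merge_restr/agreeP.
Qed.

Lemma emb_compl T : emb (compl T) = compl (emb T).
Proof.
apply: opP => y y'; rewrite /compl /opB -emb_id /emb; exact: mulrBr.
Qed.

Lemma isproj_emb T : isproj T -> isproj (emb T).
Proof. by move=> [h1 h2]; split; rewrite ?emb_adj ?h1 // -emb_mul h2. Qed.

Lemma prod_split (V : comPzSemiRingType) (F : 'I_k -> V) :
  \prod_t F t = (\prod_s F (kap s)) * \prod_(t | t \notin codom kap) F t.
Proof.
rewrite (bigID (mem (codom kap))) /=; congr (_ * _).
rewrite -(big_uniq _ (_ : uniq (codom kap))); first by rewrite big_map big_enum.
by rewrite map_inj_uniq ?enum_uniq.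
Qed.

(** The sites outside the block sum out. The auxiliary [phi z] pins the sites of the block to [z],
    which makes the sum over all words a product of sums over sites. *)
Lemma sum_restr (H : tup I m -> C) (g : 'I_k -> I -> C) : (forall t, \sum_x g t x = 1) ->
  \sum_y H (restr y) * \prod_(t | t \notin codom kap) g t (y t) = \sum_z H z.
Proof.
move=> hg.
pose phi (z : tup I m) (t : 'I_k) (x : I) : C :=
  if [pick s | kap s == t] is Some s then (x == z s)%:R else g t x.
have phi_in z s x : phi z (kap s) x = (x == z s)%:R.
  by rewrite /phi; case: pickP => [s' /eqP /kapI ->//|/(_ s)]; rewrite eqxx.
have phi_out z t x : t \notin codom kap -> phi z t x = g t x.
  move=> ht; rewrite /phi; case: pickP => [s /eqP hs|//].
  by case/negP: ht; rewrite -hs codom_f.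
transitivity (\sum_z H z * \sum_(y : tup I k) \prod_t phi z t (y t)); last first.
  apply: eq_bigr => z _; rewrite (sum_tup_prod (phi z)) prod_split !big1 ?mulr1 //.
    by move=> t ht; under eq_bigr do rewrite phi_out //.
  move=> s _; under eq_bigr do rewrite phi_in.
  by rewrite (bigD1 (z s)) //= eqxx big1 ?addr0 // => x /negbTE ->.
under [RHS]eq_bigr do rewrite mulr_sumr.
rewrite exchange_big /=; apply: eq_bigr => y _.
have hphi z : \prod_t phi z t (y t) = (restr y == z)%:R * \prod_(t | t \notin codom kap) g t (y t).
  rewrite prod_split -prod_eqb; congr (_ * _).
    by apply: eq_bigr => s _; rewrite phi_in ffunE.
  by apply: eq_bigr => t ht; rewrite phi_out.
rewrite [RHS](bigD1 (restr y)) //= hphi eqxx mul1r [X in _ = _ + X]big1 ?addr0 // => z hz.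
by rewrite hphi eq_sym (negbTE hz) mul0r mulr0.
Qed.

(** Outside the block the test is the identity and the states have unit trace, so a test embedded in
    a block sees the state of that block only. *)
Lemma trmul_emb T (r : 'I_k -> op R I) : (forall t, trace (r t) = 1) ->
  trmul (emb T) (prodop r) = trmul T (prodop (fun s => r (kap s))).
Proof.
move=> hr; rewrite /trmul.
pose H z := \sum_z' T z z' * \prod_s r (kap s) (z' s) (z s).
rewrite -/(\sum_z H z) -(sum_restr H (g := fun t x => r t x x)) //.
apply: eq_bigr => y _; rewrite /H -(sum_agree y) mulr_suml [RHS]big_mkcond.
apply: eq_bigr => y' _; rewrite /emb; case: (boolP (agree y y')) => [/agreeP h|_] /=; last by rewrite !mul0r.
rewrite mul1r -mulrA; congr (_ * _); rewrite /prodop prod_split; congr (_ * _).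
  by apply: eq_bigr => s _; rewrite !ffunE.
by apply: eq_bigr => t ht; rewrite h.
Qed.

Lemma ptr_emb T (r : 'I_k -> op R I) : (forall t, trace (r t) = 1) ->
  ptr (prodop r) (emb T) = ptr (prodop (fun s => r (kap s))) T.
Proof. by move=> h; rewrite /ptr trmul_emb. Qed.
End Embedding.

Section Diagonal.
Variable R : realType.
Local Notation C := R[i].
Implicit Types (I J : finType).

Definition diagop I (A : pred I) : op R I := fun y y' => ((y == y') && A y)%:R.

Lemma isproj_diagop I (A : pred I) : isproj (diagop A).
Proof.
split; apply: opP => y y'; rewrite /adj /opmul /diagop.
  by rewrite cjn eq_sym; case: eqP => [->|].
rewrite (bigD1 y) //= big1 => [|z hz]; last by rewrite eq_sym (negbTE hz) mul0r.
by rewrite eqxx addr0 -natrM mulnb; congr ((nat_of_bool _)%:R); case: (A y); rewrite ?andbF.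
Qed.

Lemma ptr_diagop I (A : pred I) r : ptr r (diagop A) = prb r A.
Proof.
rewrite /ptr /trmul /prb -cRe_sum [in RHS]big_mkcond; congr complex.Re; apply: eq_bigr => y _.
rewrite (bigD1 y) //= big1 => [|z hz]; last by rewrite /diagop eq_sym (negbTE hz) mul0r.
by rewrite /diagop eqxx addr0 /=; case: (A y); rewrite ?mul1r ?mul0r.
Qed.

Lemma compl_diagop I (A : pred I) : compl (diagop A) = diagop (fun y => ~~ A y).
Proof.
apply: opP => y y'; rewrite /compl /opB /idop /diagop; case: eqP => _ /=; last by rewrite subrr.
by case: (A y); rewrite ?subrr ?subr0.
Qed.

Lemma emb_diagop I k m (kap : 'I_m -> 'I_k) (A : pred (tup I m)) : injective kap ->
  emb kap (diagop A) = diagop (fun y => A (restr kap y)).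
Proof.
move=> hk; apply: opP => y y'; have e := congr1 (fun X : op R (tup I k) => X y y') (@emb_id R I k m kap hk).
move: e; rewrite /emb /diagop /idop -!natrM !mulnb; case: (agree _ _ _) => /=.
  case: (restr kap y == restr kap y'); case: (y == y') => //= /eqP; by rewrite ?oner_eq0 // eq_sym oner_eq0.
by case: (y == y') => //= /eqP; rewrite eq_sym oner_eq0.
Qed.

Lemma prb_restr I k m (kap : 'I_m -> 'I_k) (A : pred (tup I m)) (r : 'I_k -> op R I) :
  injective kap -> (forall t, trace (r t) = 1) ->
  prb (prodop r) (fun y => A (restr kap y)) = prb (prodop (fun s => r (kap s))) A.
Proof. by move=> hk hr; rewrite -!ptr_diagop -emb_diagop // ptr_emb. Qed.

Lemma psd_diag_ge0 I (r : op R I) y : psd r -> 0 <= complex.Re (r y y).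
Proof.
move=> h; apply: cRe_ge0; have := psd_form2 y y 1 0 h.
by rewrite cj1 cj0 !mul1r !mulr1 !mul0r !mulr0 !addr0.
Qed.

(** The test vector is pushed forward along [f], which may be any map, injective or not. *)
Lemma psd_compress I J (f : J -> I) (X : op R I) : psd X -> psd (fun p q => X (f p) (f q)).
Proof.
move=> hX v; have := hX (fun i => \sum_p (f p == i)%:R * v p); congr (0 <= _).
have sel (g : I -> C) (q : I) : \sum_i (q == i)%:R * g i = g q.
  rewrite (bigD1 q) //= eqxx mul1r big1 ?addr0 // => i; rewrite eq_sym => /negbTE ->.
  by rewrite mul0r.
transitivity (\sum_i \sum_p \sum_j \sum_q (f p == i)%:R * ((f q == j)%:R * ((v p)^* * X i j * v q))).
  apply: eq_bigr => i _; rewrite [RHS]exchange_big /=; apply: eq_bigr => j _.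
  rewrite cj_sum !mulr_suml; apply: eq_bigr => p _; rewrite mulr_sumr; apply: eq_bigr => q _.
  by rewrite cjM cjn; ring.
rewrite exchange_big /=; apply: eq_bigr => p _.
transitivity (\sum_i (f p == i)%:R * (\sum_q (v p)^* * X i (f q) * v q)).
  apply: eq_bigr => i _; rewrite exchange_big /= mulr_sumr; apply: eq_bigr => q _.
  by rewrite -mulr_sumr sel.
by rewrite sel.
Qed.

Lemma ptr_psd_ge0 I (rho P : op R I) : psd rho -> psd P -> 0 <= ptr rho P.
Proof.
move=> hr hP; have [la [e he]] := eigd_exists hr; rewrite (ptr_eigd _ he).
apply: sumr_ge0 => y _; apply: mulr_ge0; first exact: psd_eigd_ge0 hr he.
apply: cRe_ge0; have := hP (e y); congr (0 <= _); rewrite /dotv; apply: eq_bigr => k _.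
by rewrite /ap mulr_sumr; apply: eq_bigr => l _; rewrite mulrA.
Qed.
End Diagonal.

(** * The block-Markov feedback code *)

Section Union.
Variable R : realType.
Implicit Types (I J : finType).

Lemma prb_le I (r : op R I) (A D : pred I) : psd r -> (forall y, A y -> D y) -> prb r A <= prb r D.
Proof.
move=> hr h; rewrite /prb big_mkcond [leRHS]big_mkcond; apply: ler_sum => y _.
have := psd_diag_ge0 y hr; have := h y; case: (A y); case: (D y) => //.
by move=> /(_ isT).
Qed.

Lemma prbU I (r : op R I) (A D : pred I) : psd r ->
  prb r (fun y => A y || D y) <= prb r A + prb r D.
Proof.
move=> hr; rewrite /prb big_mkcond [X in _ <= X + _]big_mkcond [X in _ <= _ + X]big_mkcond -big_split /=; apply: ler_sum => y _.
by have := psd_diag_ge0 y hr; case: (A y); case: (D y) => /=; lra.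
Qed.

Lemma prb_exists I J (r : op R I) (Q : pred J) (A : J -> pred I) : psd r ->
  prb r (fun y => [exists j, Q j && A j y]) <= \sum_(j | Q j) prb r (A j).
Proof.
move=> hr; rewrite /prb; under [leRHS]eq_bigr do rewrite big_mkcond.
rewrite exchange_big /= big_mkcond; apply: ler_sum => y _.
have hy := psd_diag_ge0 y hr.
have h0 : 0 <= \sum_(j | Q j) (if A j y then complex.Re (r y y) else 0).
  by apply: sumr_ge0 => j _; case: ifP.
case: existsP => // -[j /andP[hj hA]]; rewrite (bigD1 j) //= hA lerDl.
by apply: sumr_ge0 => i _; case: ifP.
Qed.
End Union.

Section ZipSums.
Variable R : realType.
Local Notation C := R[i].

Lemma sum_inj_split (V : nmodType) (P J : finType) (f : P -> J) (F : J -> V) : injective f ->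
  \sum_j F j = \sum_p F (f p) + \sum_(j | j \notin codom f) F j.
Proof.
move=> hf; rewrite (bigID (mem (codom f))) /=; congr (_ + _).
rewrite -(big_uniq _ (_ : uniq (codom f))); first by rewrite big_map big_enum.
by rewrite map_inj_uniq ?enum_uniq.
Qed.

Lemma trmul_tens1 (I J : finType) (X Y : op R I) (Z : op R J) :
  trmul (tens X (@idop R J)) (tens Y Z) = trmul X Y * trace Z.
Proof.
rewrite /trmul /tens sum_pair /= mulr_suml; apply: eq_bigr => k _.
under eq_bigr do rewrite sum_pair /=.
rewrite exchange_big /= mulr_suml; apply: eq_bigr => l _.
rewrite /trace mulr_sumr; apply: eq_bigr => a _.
rewrite (bigD1 a) //= big1 => [|c hc]; last by rewrite /idop eq_sym (negbTE hc) mulr0 mul0r.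
by rewrite /idop /= eqxx /= addr0 mulr1 mulrA.
Qed.

Lemma diag_sandwich (I : finType) (A : pred I) (X : op R I) y y' :
  opmul (diagop R A) (opmul X (diagop R A)) y y' = (A y && A y')%:R * X y y'.
Proof.
rewrite /opmul (bigD1 y) //= [X in _ + X]big1 ?addr0 => [|z hz]; last first.
  by rewrite /diagop eq_sym (negbTE hz) mul0r.
rewrite (bigD1 y') //= [X in _ * (_ + X)]big1 ?addr0 => [|z hz]; last first.
  by rewrite /diagop (negbTE hz) mulr0.
by rewrite /diagop !eqxx /= -mulnb natrM; ring.
Qed.
End ZipSums.

(** * Encoders, decoder and error of the code over all blocks *)

Section Assembly.
Variable R : realType.
Local Notation C := R[i].
Variables (HA HB B Bb Z1 Z2 : finType) (N : op R (HA * HB) -> op R B)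
  (G : Z1 -> Z2 -> op R B -> op R Bb).
Hypotheses (hN : channel N) (hG : instrument G).
Variables (X1 X2 : finType) (th : X1 -> op R HA) (ph : X2 -> op R HB).
Hypotheses (hth : forall x, density (th x)) (hph : forall x, density (ph x)).

Definition site : finType := (Bb * Z1 * Z2)%type.
Definition outB x1 x2 : op R B := N (tens (th x1) (ph x2)).
(** One channel use followed by the instrument, with both outcomes kept as diagonal registers.
    Together these form a classical-quantum channel from the input letters to [site]. *)
Definition Wst x1 x2 : op R site := fun p q =>
  ((p.1.2 == q.1.2) && (p.2 == q.2))%:R * G p.1.2 p.2 (outB x1 x2) p.1.1 q.1.1.

Lemma density_outB x1 x2 : density (outB x1 x2).
Proof.
have [_ h2 h3] := hN; have [h4 h5] := density_tens (hth x1) (hph x2).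
by split; [exact: compos_psd|rewrite h3].
Qed.

Lemma density_Wst x1 x2 : density (Wst x1 x2).
Proof.
have [_ g2 _ g4] := hG; have [b1 b2] := density_outB x1 x2; split; last first.
  rewrite -b2 -[RHS]g4 /trace !sum_pair; apply: eq_bigr => b _; apply: eq_bigr => z1 _.
  by apply: eq_bigr => z2 _; rewrite /Wst /= !eqxx mul1r.
(* The state is a sum over outcomes of positive blocks, each a compression of the output of a
   completely positive map. *)
pose F (z : Z1 * Z2) : op R site := fun p q =>
  ((p.1.2, p.2) == z)%:R * ((q.1.2, q.2) == z)%:R * G z.1 z.2 (outB x1 x2) p.1.1 q.1.1.
have -> : Wst x1 x2 = opsum (index_enum (Z1 * Z2)%type) F.
  apply: opP => p q; rewrite /opsum (bigD1 (p.1.2, p.2)) //= big1 => [|z hz]; last first.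
    by rewrite /F eq_sym (negbTE hz) !mul0r.
  rewrite /F eqxx mul1r addr0 /Wst; congr (_%:R * _).
  by rewrite xpair_eqE eq_sym [in X in _ && X]eq_sym.
apply: psd_sum => z v.
have := psd_compress (fun p : site => p.1.1) (compos_psd (g2 z.1 z.2) b1)
  (fun p => ((p.1.2, p.2) == z)%:R * v p).
congr (0 <= _); apply: eq_bigr => p _; apply: eq_bigr => q _.
by rewrite /F cjM cjn; ring.
Qed.

Definition z1of n (y : tup site n) : tup Z1 n := [ffun t => (y t).1.2].
Definition z2of n (y : tup site n) : tup Z2 n := [ffun t => (y t).2].
Definition zipk n (b : tup Bb n) (h1 : tup Z1 n) (h2 : tup Z2 n) : tup site n :=
  [ffun t => (b t, h1 t, h2 t)].

Variables (m : nat) (U V1 V2 XA W0 A1 A2 Sa Sb S2 F1 F2 : finType).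
Local Notation XB1 := (tup X1 m.+1).
Local Notation XB2 := (tup X2 m.+1).
Local Notation Y := (tup site m.+1).
Definition rhoB (x1 : XB1) (x2 : XB2) : op R Y := prodop (fun t => Wst (x1 t) (x2 t)).

Lemma density_rhoB x1 x2 : density (rhoB x1 x2).
Proof. by apply: density_prodop => t; exact: density_Wst. Qed.

Variables (T0 : U -> V1 -> V2 -> op R Y) (T1 : U -> V1 -> V2 -> XA -> op R Y)
  (T2 : U -> V1 -> V2 -> XA -> XB2 -> op R Y) (T3 : U -> V1 -> V2 -> XA -> XB2 -> XB1 -> op R Y)
  (D2 : U -> V2 -> XB2 -> V1 -> pred (tup Z2 m.+1))
  (D1 : U -> V1 -> XA -> XB1 -> V2 -> pred (tup Z1 m.+1)).
Hypotheses (pT0 : forall u v1 v2, isproj (T0 u v1 v2))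
  (pT1 : forall u v1 v2 xa, isproj (T1 u v1 v2 xa))
  (pT2 : forall u v1 v2 xa x2, isproj (T2 u v1 v2 xa x2))
  (pT3 : forall u v1 v2 xa x2 x1, isproj (T3 u v1 v2 xa x2 x1)).
Variable cd : book U V1 V2 XA XB1 XB2 W0 A1 A2 Sa Sb S2.
Variables (e0 : A1 * A2 -> W0) (ea : A1 * A2 -> F1 -> Sa) (eb : A1 * A2 -> F1 -> Sb)
  (e2 : A1 * A2 -> F2 -> S2).
(** The cooperative pair is spread over the cloud index and the spare parts of the three upper
    indices. Injectivity lets the receiver read off from the four decoded indices both the pair and
    the fresh symbols of the X-layers. *)
Definition ejoin (q : A1 * A2 * F1 * F2) : W0 * Sa * S2 * Sb :=
  (e0 q.1.1, ea q.1.1 q.1.2, e2 q.1.1 q.2, eb q.1.1 q.1.2).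
Hypothesis ejoin_inj : injective ejoin.
Variables (L k : nat) (hk : (L.+1 * m.+1 <= k)%N) (M1 M2 : nat).
Variables (d1 : A1) (d2 : A2) (x1d : X1) (x2d : X2).
Variables (g1 : 'I_M1 -> nat -> A1 * F1) (g2 : 'I_M2 -> nat -> A2 * F2).
Hypotheses (g1L : forall i, (g1 i L).1 = d1) (g2L : forall i, (g2 i L).1 = d2)
  (g1_inj : forall i j, (forall b, (b < L)%N -> g1 i b = g1 j b) -> i = j)
  (g2_inj : forall i j, (forall b, (b < L)%N -> g2 i b = g2 j b) -> i = j).

(* In block [b] both senders cooperate to resend the pair [wmsg i j b] that each of them learnt
   from the feedback of the previous block. *)
Definition wmsg i j b : A1 * A2 :=
  if b is b'.+1 then ((g1 i b').1, (g2 j b').1) else (d1, d2).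
Definition jdx i j b : W0 * Sa * S2 * Sb := ejoin (wmsg i j b, (g1 i b).2, (g2 j b).2).
Definition enc1 w a f : XB1 := cx1 cd (e0 w) a (ea w f) (eb w f).
Definition enc2 w a f : XB2 := cx2 cd (e0 w) a (e2 w f).

Let k_gt0 : (0 < k)%N. Proof. by apply: leq_trans hk; rewrite mulSn. Qed.
(** Site of letter [s] of block [b]. By [hk] the default is never taken for [b <= L]; having the
    index [b] in [nat] keeps the recursions over blocks free of ordinals. *)
Definition kap (b : nat) (s : 'I_m.+1) : 'I_k := insubd (Ordinal k_gt0) (b * m.+1 + s)%N.

Lemma kapE b s : (b <= L)%N -> kap b s = (b * m.+1 + s)%N :> nat.
Proof.
move=> hb; rewrite /kap val_insubd ifT //.
have h : (b.+1 * m.+1 <= L.+1 * m.+1)%N by rewrite leq_mul2r ltnS hb orbT.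
by apply: leq_trans hk; apply: leq_trans h; rewrite mulSn [ltnRHS]addnC ltn_add2l.
Qed.

Lemma kap_inj b : (b <= L)%N -> injective (kap b).
Proof.
move=> hb s s' /(congr1 val) /=; rewrite !kapE // => /addnI h; exact: val_inj.
Qed.

(** Sites beyond block [L], and with them the last channel use, carry the filler [a0]. *)
Definition letters (A : Type) (a0 : A) (c : nat -> 'I_m.+1 -> A) (t : nat) : A :=
  if (t %/ m.+1 <= L)%N then c (t %/ m.+1)%N (inord (t %% m.+1)) else a0.

Lemma letters_kap (A : Type) (a0 : A) c b s : (b <= L)%N -> letters a0 c (kap b s) = c b s.
Proof.
move=> hb; rewrite /letters kapE // divnMDl // divn_small // addn0 hb.
by rewrite modnMDl modn_small // inord_val.
Qed.

(** The intended inputs, which use the correct pair [wmsg] in every block. The inputs really sent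
    depend on the feedback and are only shown to agree with these on [good] histories. *)
Definition xg1 i j := letters x1d (fun b => enc1 (wmsg i j b) (g1 i b).1 (g1 i b).2).
Definition xg2 i j := letters x2d (fun b => enc2 (wmsg i j b) (g2 j b).1 (g2 j b).2).
Definition rhoM i j : op R (tup site k) := prodop (fun t : 'I_k => Wst (xg1 i j t) (xg2 i j t)).

Lemma density_rhoM i j : density (rhoM i j).
Proof. by apply: density_prodop => t; exact: density_Wst. Qed.

Lemma trace_sites i j (t : 'I_k) : trace (Wst (xg1 i j t) (xg2 i j t)) = 1.
Proof. by case: (density_Wst (xg1 i j t) (xg2 i j t)). Qed.

Definition rhob i j b := rhoB (enc1 (wmsg i j b) (g1 i b).1 (g1 i b).2)
  (enc2 (wmsg i j b) (g2 j b).1 (g2 j b).2).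

Lemma rhoM_block i j b : (b <= L)%N ->
  prodop (fun s => Wst (xg1 i j (kap b s)) (xg2 i j (kap b s))) = rhob i j b.
Proof.
by move=> hb; rewrite /rhob /rhoB; congr prodop; apply/funext => s; rewrite /xg1 /xg2 !letters_kap.
Qed.

(* The receiver decodes the blocks backwards: [a] is the pair first sent in block [b], known
   from block [b.+1]. *)
Definition Lblk b (a : A1 * A2) (j : W0 * Sa * S2 * Sb) : seq (op R (tup site k)) :=
  let: (w, sa, s2, sb) := j in
  let u := bu cd w in let v1 := cv1 cd w a.1 in let v2 := cv2 cd w a.2 in
  let xa := cxa cd w a.1 sa in let x2 := cx2 cd w a.2 s2 in
  ((scan (fun w => emb (kap b) (T0 (bu cd w) (cv1 cd w a.1) (cv2 cd w a.2))) (index_enum W0) w ++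
   scan (fun s => emb (kap b) (T1 u v1 v2 (cxa cd w a.1 s))) (index_enum Sa) sa) ++
   scan (fun s => emb (kap b) (T2 u v1 v2 xa (cx2 cd w a.2 s))) (index_enum S2) s2) ++
   scan (fun s => emb (kap b) (T3 u v1 v2 xa x2 (cx1 cd w a.1 sa s))) (index_enum Sb) sb.

(** Off the range of [ejoin] the value is arbitrary: the measurement must be defined for every
    decoded tuple, but such tuples come from no message. *)
Definition wdec (j : W0 * Sa * S2 * Sb) : A1 * A2 :=
  if [pick q | ejoin q == j] is Some q then q.1.1 else (d1, d2).

Lemma wdecE i j b : wdec (jdx i j b) = wmsg i j b.
Proof.
rewrite /wdec /jdx; case: pickP => [q /eqP /ejoin_inj -> //|/(_ (wmsg i j b, (g1 i b).2, (g2 j b).2))].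
by rewrite eqxx.
Qed.

(** The head of a tuple belongs to the latest block, the one decoded first. In [Ldec] the argument
    [a] is the pair first sent in that block; [wdec] of the indices decoded there is the pair first
    sent one block earlier. *)
Fixpoint JT (n : nat) : finType :=
  if n is n'.+1 then ((W0 * Sa * S2 * Sb) * JT n')%type else unit.
Fixpoint Ldec (n : nat) (a : A1 * A2) : JT n -> seq (op R (tup site k)) :=
  match n return JT n -> seq (op R (tup site k)) with
  | 0 => fun _ => [::]
  | n'.+1 => fun js => Lblk n' a js.1 ++ @Ldec n' (wdec js.1) js.2
  end.
Fixpoint jmsg i j (n : nat) : JT n :=
  match n return JT n with
  | 0 => tt
  | n'.+1 => (jdx i j n', jmsg i j n')
  end.

Lemma Lblk_gram b a : (b <= L)%N ->
  psd (opB (@idop R _) (gram (index_enum (W0 * Sa * S2 * Sb)%type) (Lblk b a))).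
Proof.
move=> hb; have hi := kap_inj hb.
pose l1 w := scan (fun w => emb (kap b) (T0 (bu cd w) (cv1 cd w a.1) (cv2 cd w a.2))) (index_enum W0) w.
pose l2 w sa := scan (fun s => emb (kap b) (T1 (bu cd w) (cv1 cd w a.1) (cv2 cd w a.2)
  (cxa cd w a.1 s))) (index_enum Sa) sa.
pose l3 w sa s2 := scan (fun s => emb (kap b) (T2 (bu cd w) (cv1 cd w a.1) (cv2 cd w a.2)
  (cxa cd w a.1 sa) (cx2 cd w a.2 s))) (index_enum S2) s2.
pose l4 w sa s2 sb := scan (fun s => emb (kap b) (T3 (bu cd w) (cv1 cd w a.1) (cv2 cd w a.2)
  (cxa cd w a.1 sa) (cx2 cd w a.2 s2) (cx1 cd w a.1 sa s))) (index_enum Sb) sb.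
have -> : Lblk b a = fun q => ((l1 q.1.1.1 ++ l2 q.1.1.1 q.1.1.2) ++ l3 q.1.1.1 q.1.1.2 q.1.2) ++
    l4 q.1.1.1 q.1.1.2 q.1.2 q.2 by apply/funext => -[[[w sa] s2] sb].
apply: (gram_compose (L1 := fun q => (l1 q.1.1 ++ l2 q.1.1 q.1.2) ++ l3 q.1.1 q.1.2 q.2)
  (L2 := fun q => l4 q.1.1 q.1.2 q.2)); last first.
  by move=> q; apply: scan_gram; [exact: index_enum_uniq|move=> s; exact: isproj_emb].
apply: (gram_compose (L1 := fun q => l1 q.1 ++ l2 q.1 q.2) (L2 := fun q => l3 q.1 q.2)); last first.
  by move=> q; apply: scan_gram; [exact: index_enum_uniq|move=> s; exact: isproj_emb].
apply: (gram_compose (L1 := l1) (L2 := l2)) => [|q].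
  by apply: scan_gram; [exact: index_enum_uniq|move=> s; exact: isproj_emb].
by apply: scan_gram; [exact: index_enum_uniq|move=> s; exact: isproj_emb].
Qed.

Lemma Lblk_proj b a j : (b <= L)%N -> List.Forall (@isproj R _) (Lblk b a j).
Proof.
move=> hb; have hi := kap_inj hb; case: j => [[[w sa] s2] sb].
by rewrite /Lblk; do !(apply/List.Forall_app; split); apply: scan_proj => s; exact: isproj_emb.
Qed.

Lemma Ldec_gram n a : (n <= L.+1)%N ->
  psd (opB (@idop R _) (gram (index_enum (JT n)) (@Ldec n a))).
Proof.
elim: n a => [|n IH] a hn.
  have -> : opB (@idop R _) (gram (index_enum (JT 0)) (@Ldec 0 a)) = fun _ _ => 0.
    apply: opP => p q; rewrite /opB /gram /opsum /= (big_pred1 tt) => [|[]//].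
    by rewrite adj1 op1mul subrr.
  exact: psd0.
by apply: (gram_compose (L1 := Lblk n a) (L2 := fun q => @Ldec n (wdec q)));
  [exact: Lblk_gram|move=> j; apply: IH; exact: ltnW].
Qed.

Lemma Ldec_proj n a js : (n <= L.+1)%N -> List.Forall (@isproj R _) (@Ldec n a js).
Proof.
elim: n a js => [|n IH] a js hn; first exact: List.Forall_nil.
by apply/List.Forall_app; split; [exact: Lblk_proj|apply: IH; exact: ltnW].
Qed.

Definition qerrb i j b := let w := wmsg i j b in
  qerr rhoB T0 T1 T2 T3 cd (e0 w) (g1 i b).1 (g2 j b).1
    (ea w (g1 i b).2) (eb w (g1 i b).2) (e2 w (g2 j b).2).
Definition cerrb i j b := let w := wmsg i j b in
  cerr rhoB (@z1of m.+1) (@z2of m.+1) D2 D1 cd (e0 w) (g1 i b).1 (g2 j b).1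
    (ea w (g1 i b).2) (eb w (g1 i b).2) (e2 w (g2 j b).2).

Lemma Lblk_error i j b : (b <= L)%N ->
  \sum_(Q <- Lblk b ((g1 i b).1, (g2 j b).1) (jdx i j b)) ptr (rhoM i j) (compl Q) <= qerrb i j b.
Proof.
move=> hb; have hi := kap_inj hb; have [hr _] := density_rhoM i j.
have emE T : ptr (rhoM i j) (emb (kap b) T) = ptr (rhob i j b) T.
  by rewrite /rhoM ptr_emb ?rhoM_block //; exact: trace_sites.
rewrite /Lblk /jdx /ejoin /qerrb /qerr /= !big_cat /=.
have step (S : finType) (T : S -> op R Y) (s : S) : (forall s, isproj (T s)) ->
  \sum_(Q <- scan (fun s => emb (kap b) (T s)) (index_enum S) s) ptr (rhoM i j) (compl Q) <=
  ptr (rhob i j b) (compl (T s)) + \sum_(s' | s' != s) ptr (rhob i j b) (T s').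
  move=> hT; apply: le_trans (scan_error _ hr _) _; first by move=> s'; exact: isproj_emb.
  by rewrite -emb_compl // emE; under eq_bigr do rewrite emE.
by do ![apply: lerD]; apply: step.
Qed.

Lemma Ldec_error i j n : (n <= L.+1)%N ->
  \sum_(Q <- @Ldec n (wmsg i j n) (jmsg i j n)) ptr (rhoM i j) (compl Q) <=
  \sum_(b < n) qerrb i j b.
Proof.
elim: n => [|n IH] hn; first by rewrite big_nil big_ord0.
rewrite /= big_cat /= big_ord_recr /= addrC; apply: lerD; last exact: Lblk_error.
by rewrite wdecE; apply: IH; exact: ltnW.
Qed.

(** Requiring that no other candidate pass makes the [pick] in [guess2] return the right symbol
    whatever the order of enumeration. *)
Definition gd2 i j b (z : tup Z2 m.+1) : bool :=
  let w := e0 (wmsg i j b) in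
  let D v1 := D2 (bu cd w) (cv2 cd w (g2 j b).1) (enc2 (wmsg i j b) (g2 j b).1 (g2 j b).2) v1 z in
  D (cv1 cd w (g1 i b).1) && ~~ [exists a, (a != (g1 i b).1) && D (cv1 cd w a)].
Definition gd1 i j b (z : tup Z1 m.+1) : bool :=
  let w := e0 (wmsg i j b) in
  let D v2 := D1 (bu cd w) (cv1 cd w (g1 i b).1) (cxa cd w (g1 i b).1 (ea (wmsg i j b) (g1 i b).2))
    (enc1 (wmsg i j b) (g1 i b).1 (g1 i b).2) v2 z in
  D (cv2 cd w (g2 j b).1) && ~~ [exists a, (a != (g2 j b).1) && D (cv2 cd w a)].
Definition good i j (h1 : tup Z1 k) (h2 : tup Z2 k) : bool :=
  [forall b : 'I_L.+1, gd2 i j b (restr (kap b) h2) && gd1 i j b (restr (kap b) h1)].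

Lemma good_error i j :
  prb (rhoM i j) (fun y => ~~ good i j (z1of y) (z2of y)) <= \sum_(b < L.+1) cerrb i j b.
Proof.
have [hr _] := density_rhoM i j.
apply: (@le_trans _ _ (prb (rhoM i j) (fun y => [exists b : 'I_L.+1, true &&
    ~~ (gd2 i j b (restr (kap b) (z2of y)) && gd1 i j b (restr (kap b) (z1of y)))]))).
  by apply: prb_le.
apply: le_trans (prb_exists _ _ hr) _; apply: ler_sum => b _.
have hb : (b <= L)%N by rewrite -ltnS.
have hi := kap_inj hb.
pose A (y : Y) := ~~ (gd2 i j b (z2of y) && gd1 i j b (z1of y)).
have -> : prb (rhoM i j) (fun y => ~~ (gd2 i j b (restr (kap b) (z2of y)) &&
    gd1 i j b (restr (kap b) (z1of y)))) = prb (rhob i j b) A.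
  rewrite -rhoM_block // -(prb_restr A hi (trace_sites i j)); congr prb; apply/funext => y.
  by rewrite /A; congr (~~ (gd2 i j b _ && gd1 i j b _)); apply/ffunP => s; rewrite !ffunE.
have [hrb _] : density (rhob i j b) := density_rhoB _ _.
rewrite /cerrb /cerr.
set t1 := prb _ (fun y => ~~ D2 _ _ _ _ _); set t2 := \sum_(a | _) _; set t3 := prb _ (fun y => ~~ D1 _ _ _ _ _ _); set t4 := \sum_(a | _) _.
pose B1 (y : Y) := ~~ gd2 i j b (z2of y); pose B2 (y : Y) := ~~ gd1 i j b (z1of y).
have h1 : prb (rhob i j b) A <= prb (rhob i j b) B1 + prb (rhob i j b) B2.
  by apply: le_trans (prbU _ _ hrb); apply: prb_le => // y; rewrite /A negb_and.
apply: (le_trans h1); apply: lerD.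
  apply: (@le_trans _ _ (t1 + prb (rhob i j b) (fun y => [exists a, (a != (g1 i b).1) &&
    D2 (bu cd (e0 (wmsg i j b))) (cv2 cd (e0 (wmsg i j b)) (g2 j b).1)
     (enc2 (wmsg i j b) (g2 j b).1 (g2 j b).2) (cv1 cd (e0 (wmsg i j b)) a) (z2of y)]))).
    by apply: le_trans (prbU _ _ hrb); apply: prb_le => // y; rewrite /B1 /gd2 negb_and negbK.
  by apply: lerD => //; apply: prb_exists.
apply: (@le_trans _ _ (t3 + prb (rhob i j b) (fun y => [exists a, (a != (g2 j b).1) &&
    D1 (bu cd (e0 (wmsg i j b))) (cv1 cd (e0 (wmsg i j b)) (g1 i b).1)
     (cxa cd (e0 (wmsg i j b)) (g1 i b).1 (ea (wmsg i j b) (g1 i b).2))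
     (enc1 (wmsg i j b) (g1 i b).1 (g1 i b).2) (cv2 cd (e0 (wmsg i j b)) a) (z1of y)]))).
  by apply: le_trans (prbU _ _ hrb); apply: prb_le => // y; rewrite /B2 /gd1 negb_and negbK.
by apply: lerD => //; apply: prb_exists.
Qed.

Definition guess2 w a f (z : tup Z2 m.+1) : A1 :=
  odflt d1 [pick a1 | D2 (bu cd (e0 w)) (cv2 cd (e0 w) a) (enc2 w a f) (cv1 cd (e0 w) a1) z].
Definition guess1 w a f (z : tup Z1 m.+1) : A2 :=
  odflt d2 [pick a2 | D1 (bu cd (e0 w)) (cv1 cd (e0 w) a) (cxa cd (e0 w) a (ea w f))
                        (enc1 w a f) (cv2 cd (e0 w) a2) z].

Lemma guess2E i j b z : gd2 i j b z -> guess2 (wmsg i j b) (g2 j b).1 (g2 j b).2 z = (g1 i b).1.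
Proof.
move=> /andP[h1 h2]; rewrite /guess2; case: pickP => [a ha|/(_ (g1 i b).1)]; last by rewrite h1.
by apply/eqP; apply: contraNT h2 => hne; apply/existsP; exists a; rewrite hne.
Qed.

Lemma guess1E i j b z : gd1 i j b z -> guess1 (wmsg i j b) (g1 i b).1 (g1 i b).2 z = (g2 j b).1.
Proof.
move=> /andP[h1 h2]; rewrite /guess1; case: pickP => [a ha|/(_ (g2 j b).1)]; last by rewrite h1.
by apply/eqP; apply: contraNT h2 => hne; apply/existsP; exists a; rewrite hne.
Qed.

(** The pair that sender 1 believes to be resent in block [b]: its own component is exact, the other
    is guessed from the feedback of the previous block on the basis of the previous belief. *)
Fixpoint st1 i (h : tup Z1 k) b : A1 * A2 :=
  if b is b'.+1 then
    ((g1 i b').1, guess1 (st1 i h b') (g1 i b').1 (g1 i b').2 (restr (kap b') h))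
  else (d1, d2).
Fixpoint st2 j (h : tup Z2 k) b : A1 * A2 :=
  if b is b'.+1 then
    (guess2 (st2 j h b') (g2 j b').1 (g2 j b').2 (restr (kap b') h), (g2 j b').1)
  else (d1, d2).
Definition xh1 i h := letters x1d (fun b => enc1 (st1 i h b) (g1 i b).1 (g1 i b).2).
Definition xh2 j h := letters x2d (fun b => enc2 (st2 j h b) (g2 j b).1 (g2 j b).2).
Definition enc_st1 (n : nat) i h : op R (tup HA n) := prodop (fun t : 'I_n => th (xh1 i h t)).
Definition enc_st2 (n : nat) j h : op R (tup HB n) := prodop (fun t : 'I_n => ph (xh2 j h t)).

(** Once the beliefs in block [b] are correct, the guesses use the very tests that occur in [gd1]
    and [gd2], and a good history yields correct beliefs in the next block. *)
Lemma st_good i j h1 h2 b : good i j h1 h2 -> (b <= L)%N ->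
  st1 i h1 b = wmsg i j b /\ st2 j h2 b = wmsg i j b.
Proof.
move=> /forallP hg; elim: b => [//|b IH] hb; have [e1 e2'] := IH (ltnW hb).
have /andP[hg2 hg1] := hg (Ordinal (ltnW hb : (b < L.+1)%N)).
by rewrite /= e1 e2' (guess1E hg1) (guess2E hg2).
Qed.

Lemma xh_good i j h1 h2 t : good i j h1 h2 -> xh1 i h1 t = xg1 i j t /\ xh2 j h2 t = xg2 i j t.
Proof.
move=> hg; rewrite /xh1 /xh2 /xg1 /xg2 /letters; case: ifP => // hb.
by have [-> ->] := st_good hg hb.
Qed.

Lemma st1_causal i (h h' : tup Z1 k) b : (b <= L)%N ->
  (forall t : 'I_k, (t < b * m.+1)%N -> h t = h' t) -> st1 i h b = st1 i h' b.
Proof.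
elim: b => [//|b IH] hb hh /=.
have e : restr (kap b) h = restr (kap b) h'.
  apply/ffunP => s; rewrite !ffunE hh // kapE; last exact: ltnW.
  by rewrite mulSn addnC ltn_add2r.
by rewrite e IH // ?(ltnW hb) // => t ht; apply: hh; apply: leq_trans ht _; rewrite leq_mul2r leqnSn orbT.
Qed.

Lemma st2_causal j (h h' : tup Z2 k) b : (b <= L)%N ->
  (forall t : 'I_k, (t < b * m.+1)%N -> h t = h' t) -> st2 j h b = st2 j h' b.
Proof.
elim: b => [//|b IH] hb hh /=.
have e : restr (kap b) h = restr (kap b) h'.
  apply/ffunP => s; rewrite !ffunE hh // kapE; last exact: ltnW.
  by rewrite mulSn addnC ltn_add2r.
by rewrite e IH // ?(ltnW hb) // => t ht; apply: hh; apply: leq_trans ht _; rewrite leq_mul2r leqnSn orbT.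
Qed.

Lemma ptrace_last_prodop (A : finType) n (r : nat -> op R A) : (forall t, trace (r t) = 1) ->
  ptrace_last (prodop (fun t : 'I_n.+1 => r t)) = prodop (fun t : 'I_n => r t).
Proof.
move=> hr; apply: opP => s s'; rewrite /ptrace_last /prodop.
transitivity (\sum_a (\prod_(t < n) r t (s t) (s' t)) * r n a a).
  apply: eq_bigr => a _; rewrite big_ord_recr /= !ffunE !unlift_none; congr (_ * _).
  by apply: eq_bigr => t _; rewrite !ffunE !unlift_max_widen.
by rewrite -mulr_sumr; have := hr n; rewrite /trace => ->; rewrite mulr1.
Qed.

Lemma encoder1 : @encoder R HA Z1 k M1 enc_st1.
Proof.
split.
- by move=> n i h _; apply: density_prodop => t; exact: hth.
- move=> n i h h' _ hh; rewrite /enc_st1; congr prodop; apply/funext => t.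
  congr th; rewrite /xh1 /letters; case: ifP => // hb.
  (* The letter at site [t] reads feedback from before the start of its block only, and that start
     is at most [t]. *)
  rewrite (@st1_causal i h h') // => s hs; apply: hh; apply: leq_ltn_trans (ltn_ord t).
  by apply: leq_trans hs _; rewrite leq_trunc_div.
- move=> n i h _; apply: (@ptrace_last_prodop HA n (fun t => th (xh1 i h t))) => t.
  by case: (hth (xh1 i h t)).
Qed.

Lemma encoder2 : @encoder R HB Z2 k M2 enc_st2.
Proof.
split.
- by move=> n i h _; apply: density_prodop => t; exact: hph.
- move=> n i h h' _ hh; rewrite /enc_st2; congr prodop; apply/funext => t.
  congr ph; rewrite /xh2 /letters; case: ifP => // hb.
  rewrite (@st2_causal i h h') // => s hs; apply: hh; apply: leq_ltn_trans (ltn_ord t).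
  by apply: leq_trans hs _; rewrite leq_trunc_div.
- move=> n i h _; apply: (@ptrace_last_prodop HB n (fun t => ph (xh2 i h t))) => t.
  by case: (hph (xh2 i h t)).
Qed.

Lemma sum_zipk (V : nmodType) (F : tup site k -> V) :
  \sum_y F y = \sum_h1 \sum_h2 \sum_b F (zipk b h1 h2).
Proof.
rewrite pair_bigA pair_bigA /=.
rewrite (reindex (fun q : tup Z1 k * tup Z2 k * tup Bb k => zipk q.2 q.1.1 q.1.2)) //=.
apply: onW_bij; exists (fun y => (z1of y, z2of y, [ffun t => (y t).1.1])) => [[[h1 h2] b]|y] /=.
  by congr (_, _, _); apply/ffunP => t; rewrite !ffunE.
by apply/ffunP => t; rewrite !ffunE /=; case: (y t) => [[]].
Qed.

Lemma rhoM_offdiag i j b b' h1 h2 h1' h2' : (h1, h2) != (h1', h2') ->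
  rhoM i j (zipk b h1 h2) (zipk b' h1' h2') = 0.
Proof.
move=> hne; suff [t ht] : exists t, ((h1 t == h1' t) && (h2 t == h2' t)) = false.
  by rewrite /rhoM /prodop (bigD1 t) //= /Wst !ffunE /= ht !mul0r.
apply: contrapT => hn; case/negP: hne; apply/eqP; congr pair; apply/ffunP => t;
  apply/eqP; apply/negPn/negP => /negbTE hh; apply: hn; exists t; by rewrite hh ?andbF.
Qed.

Definition Kdec i j : op R (tup site k) := prodK (Ldec (d1, d2) (jmsg i j L.+1)).
Definition PK i j := opmul (adj (Kdec i j)) (Kdec i j).
(** The effect of all outcomes that point to no message pair; [PM] gives it to the fixed pair
    [(i0, j0)] to complete the POVM. *)
Definition leftover : op R (tup site k) :=
  opB (@idop R _) (opsum (index_enum ('I_M1 * 'I_M2)%type) (fun p => PK p.1 p.2)).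

(** The V-symbols of block [b < L] are read off the pair resent in block [b.+1], the other fresh
    symbols off block [b] itself; [g1_inj] and [g2_inj] then give the messages. *)
Lemma jmsg_inj : injective (fun p : 'I_M1 * 'I_M2 => jmsg p.1 p.2 L.+1).
Proof.
move=> [i j] [i' j'] /= hjm.
have key n : jmsg i j n = jmsg i' j' n -> forall b, (b < n)%N -> jdx i j b = jdx i' j' b.
  elim: n => [//|n IH] /= [ea1 ea2 ea3 ea4 e] b; rewrite ltnS leq_eqVlt => /orP[/eqP ->|hb]; last exact: IH.
  by rewrite /jdx /ejoin /=; congr (_, _, _, _).
have key2 b : (b < L.+1)%N -> wmsg i j b = wmsg i' j' b /\ (g1 i b).2 = (g1 i' b).2 /\ (g2 j b).2 = (g2 j' b).2.
  move=> hb; have hj : ejoin (wmsg i j b, (g1 i b).2, (g2 j b).2) =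
    ejoin (wmsg i' j' b, (g1 i' b).2, (g2 j' b).2) := key L.+1 hjm b hb.
  by have [e1 e2' e3] := ejoin_inj hj.
congr pair.
  apply: g1_inj => b hb; have [_ [e _]] := key2 b (ltnW hb); have [/= e' _] := key2 b.+1 hb.
  by move: e e'; case: (g1 i b) => x y; case: (g1 i' b) => x' y' /= -> [->].
apply: g2_inj => b hb; have [_ [_ e]] := key2 b (ltnW hb); have [/= e' _] := key2 b.+1 hb.
by move: e e'; case: (g2 j b) => x y; case: (g2 j' b) => x' y' /= -> [_ ->].
Qed.

(** It is the deficiency [1 - gram] of the sequential measurement plus the effects of the index
    tuples that belong to no message pair. *)
Lemma psd_leftover : psd leftover.
Proof.
pose F (js : JT L.+1) := opmul (adj (prodK (Ldec (d1, d2) js))) (prodK (Ldec (d1, d2) js)).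
pose f (p : 'I_M1 * 'I_M2) := jmsg p.1 p.2 L.+1.
have h := psdD (Ldec_gram (d1, d2) (leqnn L.+1))
  (psd_sum [seq js <- index_enum (JT L.+1) | js \notin codom f] (fun js => psd_adjmul (prodK (Ldec (d1, d2) js)))).
suff -> : leftover = (fun p q => opB (@idop R _) (gram (index_enum (JT L.+1)) (@Ldec L.+1 (d1, d2))) p q +
  opsum [seq js <- index_enum (JT L.+1) | js \notin codom f] F p q) by [].
apply: opP => p q; rewrite /leftover /opB /gram /opsum.
rewrite (sum_inj_split (fun js => F js p q) jmsg_inj) big_filter /PK /Kdec.
by rewrite opprD addrA addrNK.
Qed.

Variables (i0 : 'I_M1) (j0 : 'I_M2).
Definition PM i j : op R (tup site k) := fun p q =>
  PK i j p q + ((i == i0) && (j == j0))%:R * leftover p q.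

Lemma psd_PM i j : psd (PM i j).
Proof.
rewrite /PM; apply: psdD; first exact: psd_adjmul.
case: (_ && _).
  have -> : (fun p q => true%:R * leftover p q) = leftover by apply: opP => p q; rewrite mul1r.
  exact: psd_leftover.
have -> : (fun p q => false%:R * leftover p q) = (fun _ _ => 0) by apply: opP => p q; rewrite mul0r.
exact: psd0.
Qed.

Lemma sum_PM p q : \sum_i \sum_j PM i j p q = @idop R _ p q.
Proof.
rewrite /PM; under eq_bigr do rewrite big_split /=.
rewrite big_split /= [X in _ + X](_ : _ = leftover p q); last first.
  rewrite (bigD1 i0) //= (bigD1 j0) //= !eqxx mul1r big1 => [|j /negbTE ->]; last by rewrite mul0r.
  rewrite big1 ?addr0 // => i /negbTE ->; rewrite big1 // => j _; exact: mul0r.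
by rewrite /leftover /opB /opsum sum_pair /= addrC subrK.
Qed.

(** The diagonal block of [PM] at the observed histories. The last output carries filler only, hence
    the identity on it. *)
Definition Dec h1 h2 i j : op R (tup Bb k * B) :=
  tens (fun b b' => PM i j (zipk b h1 h2) (zipk b' h1 h2)) (@idop R B).

Lemma povm_Dec h1 h2 : povm (Dec h1 h2).
Proof.
split; first by move=> i j; apply: psd_tens; [apply: (psd_compress (fun b => zipk b h1 h2)); exact: psd_PM|exact: psd_id].
apply: opP => p q; rewrite /Dec /tens; under eq_bigr do rewrite -mulr_suml.
rewrite -mulr_suml sum_PM /idop -natrM mulnb; congr ((nat_of_bool _)%:R).
case: p => p1 p2; case: q => q1 q2; rewrite xpair_eqE /=; congr (_ && _).
apply/eqP/eqP => [/ffunP h|->//]; apply/ffunP => t; have := h t; rewrite !ffunE; by case.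
Qed.

Definition sgh i j h1 h2 (t : nat) : op R B := outB (xh1 i h1 t) (xh2 j h2 t).
Definition fst_state i j h1 h2 : op R (tup Bb k) :=
  prodop (fun t : 'I_k => outst G h1 h2 (sgh i j h1 h2) t).

Lemma final_stateE i j h1 h2 : final_state N enc_st1 enc_st2 (@memoryless R B Bb Z1 Z2 G) i j h1 h2 =
  tens (fst_state i j h1 h2) (sgh i j h1 h2 k).
Proof.
have [hl _ _] := hN.
rewrite /final_state /enc_st1 /enc_st2 (chan_n_prodop _ _ hl).
have hr := @run_prod R B Bb Z1 Z2 G hG k h1 h2 (sgh i j h1 h2) k 0.
set X := (fun p q => _); have -> : X = fun p q =>
   (\prod_(t < 0) outst G h1 h2 (sgh i j h1 h2) t (p.1 t) (q.1 t)) *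
      \prod_(t < k.+1) sgh i j h1 h2 (0 + t)%N (p.2 t) (q.2 t).
  by apply: opP => p q; rewrite /X big_ord0 mul1r.
rewrite hr ?addn0 //; apply: opP => p q; rewrite /castop /tens /fst_state /prodop /=; congr (_ * _).
rewrite (reindex (cast_ord (addn0 k))) /=; last first.
  by apply: onW_bij; exists (cast_ord (esym (addn0 k))) => t; [exact: cast_ordK|exact: cast_ordKV].
by apply: eq_bigr => t _; rewrite !ffunE.
Qed.

Lemma outstE i j h1 h2 (t : 'I_k) :
  outst G h1 h2 (sgh i j h1 h2) t = G (h1 t) (h2 t) (sgh i j h1 h2 t).
Proof. by rewrite /outst valK. Qed.

Lemma psd_fst i j h1 h2 : psd (fst_state i j h1 h2).
Proof.
apply: psd_prodop => t; rewrite outstE; have [_ g2' _ _] := hG.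
by apply: compos_psd => //; case: (density_outB (xh1 i h1 t) (xh2 j h2 t)).
Qed.

(** On a good history the senders use the intended letters, so the unnormalized final state is the
    corresponding block of [rhoM]. On other histories, and for the [leftover] part, nonnegativity of
    the probability is enough. *)
Lemma success_ge i j h1 h2 :
  (if good i j h1 h2 then complex.Re (\sum_b \sum_b' PK i j (zipk b h1 h2) (zipk b' h1 h2) *
       rhoM i j (zipk b' h1 h2) (zipk b h1 h2)) else 0) <=
  complex.Re (trmul (Dec h1 h2 i j)
    (final_state N enc_st1 enc_st2 (@memoryless R B Bb Z1 Z2 G) i j h1 h2)).
Proof.
rewrite final_stateE trmul_tens1.
have [_ ->] : density (sgh i j h1 h2 k) by exact: density_outB.
rewrite mulr1; have hps := psd_fst i j h1 h2.
case: ifP => hg; last first.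
  by apply: (ptr_psd_ge0 hps); apply: (psd_compress (fun b => zipk b h1 h2)); exact: psd_PM.
have hst b b' : fst_state i j h1 h2 b b' = rhoM i j (zipk b h1 h2) (zipk b' h1 h2).
  rewrite /fst_state /rhoM /prodop; apply: eq_bigr => t _; rewrite outstE /Wst !ffunE /= !eqxx mul1r.
  by rewrite /sgh; have [-> ->] := xh_good t hg.
have -> : trmul (fun b b' => PM i j (zipk b h1 h2) (zipk b' h1 h2)) (fst_state i j h1 h2) =
  \sum_b \sum_b' PK i j (zipk b h1 h2) (zipk b' h1 h2) * rhoM i j (zipk b' h1 h2) (zipk b h1 h2) +
  ((i == i0) && (j == j0))%:R * trmul (fun b b' => leftover (zipk b h1 h2) (zipk b' h1 h2)) (fst_state i j h1 h2).
  rewrite /trmul mulr_sumr -big_split /=; apply: eq_bigr => b _; rewrite mulr_sumr -big_split /=.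
  by apply: eq_bigr => b' _; rewrite /PM hst; ring.
rewrite cReD lerDl; case: (_ && _); last by rewrite mul0r.
by rewrite mul1r; apply: (ptr_psd_ge0 hps); apply: (psd_compress (fun b => zipk b h1 h2)); exact: psd_leftover.
Qed.

Definition gop i j : op R (tup site k) := diagop R (fun y => good i j (z1of y) (z2of y)).

(** [rhoM] is block diagonal in the histories, so summing its good blocks amounts to applying the
    projector [gop] before the receiver's tests. *)
Lemma success_bform i j :
  bform (rhoM i j) (opmul (Kdec i j) (gop i j)) (opmul (Kdec i j) (gop i j)) <=
  \sum_h1 \sum_h2 complex.Re (trmul (Dec h1 h2 i j)
    (final_state N enc_st1 enc_st2 (@memoryless R B Bb Z1 Z2 G) i j h1 h2)).
Proof.
apply: (@le_trans _ _ (\sum_h1 \sum_h2 (if good i j h1 h2 then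
   complex.Re (\sum_b \sum_b' PK i j (zipk b h1 h2) (zipk b' h1 h2) *
       rhoM i j (zipk b' h1 h2) (zipk b h1 h2)) else 0))); last first.
  by apply: ler_sum => h1 _; apply: ler_sum => h2 _; exact: success_ge.
have [hD _] := isproj_diagop R (fun y : tup site k => good i j (z1of y) (z2of y)).
rewrite /bform /gop adjM hD opmulA -(opmulA (adj _) (Kdec i j)) /trmul sum_zipk.
have z1K b (h1 : tup Z1 k) (h2 : tup Z2 k) : z1of (zipk b h1 h2) = h1 by apply/ffunP => t; rewrite !ffunE.
have z2K b (h1 : tup Z1 k) (h2 : tup Z2 k) : z2of (zipk b h1 h2) = h2 by apply/ffunP => t; rewrite !ffunE.
rewrite cRe_sum le_eqVlt; apply/orP; left; apply/eqP; apply: eq_bigr => h1 _.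
rewrite cRe_sum; apply: eq_bigr => h2 _.
transitivity (complex.Re ((good i j h1 h2)%:R * \sum_b \sum_b' PK i j (zipk b h1 h2) (zipk b' h1 h2) *
       rhoM i j (zipk b' h1 h2) (zipk b h1 h2))); last first.
  by case: (good _ _ _ _); rewrite ?mul1r ?mul0r.
congr complex.Re; rewrite mulr_sumr; apply: eq_bigr => b _; rewrite sum_zipk.
rewrite (bigD1 h1) //= (bigD1 h2) //= [X in _ + X + _]big1 ?addr0; last first.
  move=> h2' hne; rewrite big1 // => b' _; rewrite rhoM_offdiag ?mulr0 //.
  by rewrite xpair_eqE negb_and hne orbT.
rewrite [X in _ + X]big1 ?addr0; last first.
  move=> h1' hne; rewrite big1 // => h2' _; rewrite big1 // => b' _; rewrite rhoM_offdiag ?mulr0 //.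
  by rewrite xpair_eqE negb_and hne.
rewrite mulr_sumr; apply: eq_bigr => b' _; rewrite -/(PK i j) diag_sandwich !z1K !z2K andbb.
by rewrite mulrA.
Qed.

(** Gao's bound for the list of tests with [gop] in front: the failure of [gop] is the feedback
    error, the remaining terms are the decoding errors of the blocks. *)
Lemma error_le i j :
  1 - \sum_h1 \sum_h2 complex.Re (trmul (Dec h1 h2 i j)
    (final_state N enc_st1 enc_st2 (@memoryless R B Bb Z1 Z2 G) i j h1 h2)) <=
  4 * \sum_(b < L.+1) (qerrb i j b + cerrb i j b).
Proof.
have [hr ht] := density_rhoM i j.
have hl : List.Forall (@isproj R _) (gop i j :: Ldec (d1, d2) (jmsg i j L.+1)).
  by constructor; [exact: isproj_diagop|exact: Ldec_proj].
have := gao_union_bound hr ht hl; rewrite big_cons /= -/(Kdec i j).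
have := success_bform i j; rewrite big_split /=.
have := good_error i j; rewrite -ptr_diagop -compl_diagop -/(gop i j).
have := Ldec_error i j (leqnn L.+1).
(* Block [L] sends the fixed symbols [d1] and [d2], so backward decoding starts from a known
   pair. *)
have -> : wmsg i j L.+1 = (d1, d2) by rewrite /= g1L g2L.
lra.
Qed.

Lemma assembly (eps : R) :
  (M1 * M2)%:R^-1 * \sum_i \sum_j (4 * \sum_(b < L.+1) (qerrb i j b + cerrb i j b)) <= eps ->
  fb_code_exists N k M1 M2 eps.
Proof.
move=> heps; exists Bb, Z1, Z2, enc_st1, enc_st2, (@memoryless R B Bb Z1 Z2 G), Dec.
split; [exact: encoder1|exact: encoder2| | |].
- by move=> j _; exact: memoryless_instrument.
- exact: povm_Dec.
have M10 : (0 < M1)%N by apply: leq_ltn_trans (ltn_ord i0).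
have M20 : (0 < M2)%N by apply: leq_ltn_trans (ltn_ord j0).
have Mne : ((M1 * M2)%:R : R) != 0 by rewrite pnatr_eq0 -lt0n muln_gt0 M10.
apply: le_trans heps; rewrite /err_prob.
have -> : ((M1 * M2)%:R^-1 : C) = real_complex R ((M1 * M2)%:R^-1) by rewrite fmorphV rmorph_nat.
rewrite cReM.
have h1 : (M1 * M2)%:R^-1 * \sum_(i : 'I_M1) \sum_(j : 'I_M2) 1 = 1 :> R.
  by under eq_bigr do rewrite sumr_const card_ord; rewrite sumr_const card_ord -mulrnA [(M2 * M1)%N]mulnC mulVf.
rewrite -[X in X - _]h1 -mulrBr; apply: ler_wpM2l; first by rewrite invr_ge0.
rewrite cRe_sum -sumrB; apply: ler_sum => i _; rewrite cRe_sum -sumrB; apply: ler_sum => j _.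
rewrite cRe_sum; under [X in _ - X]eq_bigr do rewrite cRe_sum.
exact: error_le.
Qed.
End Assembly.

(** * Asymptotics of the block tests *)

Section BlockTests.
Variable R : realType.
Local Notation C := R[i].
Local Notation rc := (real_complex R).

Definition holevo (I J K : finType) (p : J -> R) (k : J -> K -> R) (rho : J -> K -> op R I) : R :=
  \sum_c p c * vN (mixop (k c) (rho c)) - \sum_c p c * \sum_x k c x * vN (rho c x).
Definition cinfo (J K Z : finType) (p : J -> R) (k : J -> K -> R) (Q : J -> K -> Z -> R) : R :=
  centropy p (fun c z => \sum_x k c x * Q c x z) - \sum_c p c * \sum_x k c x * \sum_z etaf (Q c x z).

Lemma tzipK (I J : finType) n (w : tup (I * J)%type n) : tzip (tfst w) (tsnd w) = w.
Proof. by apply/ffunP => t; rewrite !ffunE; case: (w t). Qed.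

Lemma sum_tup_pair (V : nmodType) (I J : finType) n (F : tup (I * J)%type n -> V) :
  \sum_w F w = \sum_a \sum_b F (tzip a b).
Proof. by rewrite sum_tzip; apply: eq_bigr => w _; rewrite tzipK. Qed.

Lemma Re_prod_ge0 (T : Type) (r : seq T) (F : T -> C) : (forall t, 0 <= F t) ->
  complex.Re (\prod_(t <- r) F t) = \prod_(t <- r) complex.Re (F t).
Proof.
move=> h; suff -> : \prod_(t <- r) F t = rc (\prod_(t <- r) complex.Re (F t)) by [].
by rewrite rc_prod; apply: eq_bigr => t _; rewrite RRe_real // ger0_real.
Qed.

Lemma prb_letters (I Z : finType) n (zf : I -> Z) (r : 'I_n -> op R I) (A : pred (tup Z n)) :
  (forall t, psd (r t)) ->
  prb (prodop r) (fun y => A [ffun t => zf (y t)]) =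
  \sum_(z | A z) \prod_t prb (r t) (fun y => zf y == z t).
Proof.
move=> hr; rewrite /prb.
have d0 t y : 0 <= r t y y.
  have := psd_form2 y y 1 0 (hr t).
  by rewrite cj1 cj0 !mul1r !mulr1 !mul0r !mulr0 !addr0.
transitivity (\sum_(z | A z) \sum_(y : tup I n) \prod_t ((zf (y t) == z t)%:R * complex.Re (r t (y t) (y t)))); last first.
  apply: eq_bigr => z _; rewrite (sum_tup_prod (fun t y => (zf y == z t)%:R * complex.Re (r t y y))).
  apply: eq_bigr => t _; rewrite [RHS]big_mkcond; apply: eq_bigr => y _.
  by case: ifP => _; rewrite ?mul1r ?mul0r.
rewrite exchange_big /= big_mkcond; apply: eq_bigr => y _; rewrite /prodop Re_prod_ge0 //.
set zy := [ffun t => zf (y t)].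
have hz (z : tup Z n) : \prod_t ((zf (y t) == z t)%:R * complex.Re (r t (y t) (y t))) =
    if z == zy then \prod_t complex.Re (r t (y t) (y t)) else 0.
  case: eqP => [->|hne].
    by apply: eq_bigr => t _; rewrite ffunE eqxx mul1r.
  have [t ht] : exists t, zf (y t) != z t.
    apply: contrapT => hn; apply: hne; apply/ffunP => t; rewrite ffunE; apply/esym/eqP/negPn/negP => ht.
    by apply: hn; exists t.
  by rewrite (bigD1 t) //= (negbTE ht) !mul0r.
under [RHS]eq_bigr do rewrite hz.
rewrite -big_mkcondr /=; case: ifP => hA.
  by rewrite (big_pred1 zy) // => z /=; case: eqP => [->|_]; rewrite ?hA ?andbF.
by rewrite big1 // => z /andP[hz1 /eqP hz2]; move: hz1; rewrite hz2 hA.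
Qed.

Variables (I : finType) (Z1 Z2 : finType) (zf1 : I -> Z1) (zf2 : I -> Z2).
Variables (U V1 V2 XA X1 X2 : finType).
Variables (pu : U -> R) (k1 : U -> V1 -> R) (k2 : U -> V2 -> R) (ka : U -> V1 -> XA -> R)
  (kx1 : U -> V1 -> XA -> X1 -> R) (kx2 : U -> V2 -> X2 -> R) (W : X1 -> X2 -> op R I).
Hypotheses (hpu : distr pu) (hk1 : forall u, distr (k1 u)) (hk2 : forall u, distr (k2 u))
  (hka : forall u v1, distr (ka u v1)) (hkx1 : forall u v1 xa, distr (kx1 u v1 xa))
  (hkx2 : forall u v2, distr (kx2 u v2)) (hW : forall x1 x2, density (W x1 x2)).

Definition puB n (u : tup U n) : R := \prod_t pu (u t).
Definition k1B n (u : tup U n) (v : tup V1 n) : R := \prod_t k1 (u t) (v t).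
Definition k2B n (u : tup U n) (v : tup V2 n) : R := \prod_t k2 (u t) (v t).
Definition kaB n (u : tup U n) (v : tup V1 n) (x : tup XA n) : R := \prod_t ka (u t) (v t) (x t).
Definition kx1B n (u : tup U n) (v : tup V1 n) (xa : tup XA n) (x : tup X1 n) : R :=
  \prod_t kx1 (u t) (v t) (xa t) (x t).
Definition kx2B n (u : tup U n) (v : tup V2 n) (x : tup X2 n) : R := \prod_t kx2 (u t) (v t) (x t).
Definition WB n (x1 : tup X1 n) (x2 : tup X2 n) : op R (tup I n) := prodop (fun t => W (x1 t) (x2 t)).

Lemma distr_prod (J : finType) n (p : 'I_n -> J -> R) : (forall t, distr (p t)) ->
  distr (fun c : tup J n => \prod_t p t (c t)).
Proof.
move=> h; split; first by move=> c; apply: prodr_ge0 => t _; case: (h t).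
by rewrite sum_tup_prod big1 // => t _; case: (h t).
Qed.

(** The block laws are products, so mixing commutes with tensoring ([prodop_mix]). By the same
    argument every state met in a block is a product of single-letter states. *)
Lemma m3B n u v1 xa x2 : m3 (@kx1B n) (@WB n) u v1 xa x2 =
  prodop (fun t => m3 kx1 W (u t) (v1 t) (xa t) (x2 t)).
Proof. exact: esym (prodop_mix (fun t => kx1 (u t) (v1 t) (xa t)) (fun t x1 => W x1 (x2 t))). Qed.

Lemma m2B n u v1 v2 xa : m2 (@kx1B n) (@kx2B n) (@WB n) u v1 v2 xa =
  prodop (fun t => m2 kx1 kx2 W (u t) (v1 t) (v2 t) (xa t)).
Proof.
rewrite [RHS](prodop_mix (fun t => kx2 (u t) (v2 t)) (fun t => m3 kx1 W (u t) (v1 t) (xa t))).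
by congr mixop; apply/funext => x2; rewrite m3B.
Qed.

Lemma m1B n u v1 v2 : m1 (@kaB n) (@kx1B n) (@kx2B n) (@WB n) u v1 v2 =
  prodop (fun t => m1 ka kx1 kx2 W (u t) (v1 t) (v2 t)).
Proof.
rewrite [RHS](prodop_mix (fun t => ka (u t) (v1 t)) (fun t => m2 kx1 kx2 W (u t) (v1 t) (v2 t))).
by congr mixop; apply/funext => x2; rewrite m2B.
Qed.

Lemma mu0B n u : mu0 (@k1B n) (@k2B n) (@kaB n) (@kx1B n) (@kx2B n) (@WB n) u =
  prodop (fun t => mu0 k1 k2 ka kx1 kx2 W (u t)).
Proof.
rewrite [RHS](prodop_mix (fun t => k1 (u t))
  (fun t v1 => mixop (k2 (u t)) (m1 ka kx1 kx2 W (u t) v1))).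
congr mixop; apply/funext => v1.
rewrite (prodop_mix (fun t => k2 (u t)) (fun t => m1 ka kx1 kx2 W (u t) (v1 t))).
by congr mixop; apply/funext => v2; rewrite m1B.
Qed.

Lemma m0B n : m0 (@puB n) (@k1B n) (@k2B n) (@kaB n) (@kx1B n) (@kx2B n) (@WB n) =
  prodop (fun t : 'I_n => m0 pu k1 k2 ka kx1 kx2 W).
Proof.
rewrite [RHS](prodop_mix (fun t => pu) (fun t => mu0 k1 k2 ka kx1 kx2 W)).
by congr mixop; apply/funext => u; rewrite mu0B.
Qed.

Lemma n2B n u v1 x2 : n2 (@kaB n) (@kx1B n) (@WB n) u v1 x2 =
  prodop (fun t => n2 ka kx1 W (u t) (v1 t) (x2 t)).
Proof.
rewrite [RHS](prodop_mix (fun t => ka (u t) (v1 t)) (fun t xa => m3 kx1 W (u t) (v1 t) xa (x2 t))).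
by congr mixop; apply/funext => xa; rewrite m3B.
Qed.

Lemma n2'B n u x2 : n2' (@k1B n) (@kaB n) (@kx1B n) (@WB n) u x2 =
  prodop (fun t => n2' k1 ka kx1 W (u t) (x2 t)).
Proof.
rewrite [RHS](prodop_mix (fun t => k1 (u t)) (fun t v1 => n2 ka kx1 W (u t) v1 (x2 t))).
by congr mixop; apply/funext => xa; rewrite n2B.
Qed.

Lemma n1B n u v2 x1 : n1 (@kx2B n) (@WB n) u v2 x1 =
  prodop (fun t => n1 kx2 W (u t) (v2 t) (x1 t)).
Proof. exact: esym (prodop_mix (fun t => kx2 (u t) (v2 t)) (fun t x2 => W (x1 t) x2)). Qed.

Lemma n1'B n u x1 : n1' (@k2B n) (@kx2B n) (@WB n) u x1 =
  prodop (fun t => n1' k2 kx2 W (u t) (x1 t)).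
Proof.
rewrite [RHS](prodop_mix (fun t => k2 (u t)) (fun t v2 => n1 kx2 W (u t) v2 (x1 t))).
by congr mixop; apply/funext => xa; rewrite n1B.
Qed.

Lemma d3 u v1 xa x2 : density (m3 kx1 W u v1 xa x2).
Proof. by apply: density_mix. Qed.
Lemma d2 u v1 v2 xa : density (m2 kx1 kx2 W u v1 v2 xa).
Proof. by apply: density_mix => // x2; exact: d3. Qed.
Lemma d1 u v1 v2 : density (m1 ka kx1 kx2 W u v1 v2).
Proof. by apply: density_mix => // x2; exact: d2. Qed.
Lemma dn2 u v1 x2 : density (n2 ka kx1 W u v1 x2).
Proof. by apply: density_mix => // xa; exact: d3. Qed.
Lemma dn1 u v2 x1 : density (n1 kx2 W u v2 x1).
Proof. by apply: density_mix. Qed.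
Lemma dn2' u x2 : density (n2' k1 ka kx1 W u x2).
Proof. by apply: density_mix => // xa; exact: dn2. Qed.
Lemma dn1' u x1 : density (n1' k2 kx2 W u x1).
Proof. by apply: density_mix => // xa; exact: dn1. Qed.

Definition law (Z : finType) (zf : I -> Z) (r : op R I) (z : Z) : R := prb r (fun y => zf y == z).

Lemma distr_law (Z : finType) (zf : I -> Z) r : density r -> distr (law zf r).
Proof.
move=> [h1 h2]; split; first by move=> z; apply: sumr_ge0 => y _; exact: psd_diag_ge0.
rewrite /law /prb; under eq_bigr do rewrite big_mkcond.
rewrite exchange_big /= -[RHS](_ : complex.Re (trace r) = 1); last by rewrite h2.
rewrite /trace cRe_sum; apply: eq_bigr => y _; rewrite (bigD1 (zf y)) //= eqxx big1 ?addr0 // => z.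
by rewrite eq_sym => /negbTE ->.
Qed.

Lemma law_mix (Z J : finType) (zf : I -> Z) (w : J -> R) (r : J -> op R I) z :
  law zf (mixop w r) z = \sum_x w x * law zf (r x) z.
Proof. exact: mixlinear_prb. Qed.

(* [I0], ..., [I3] are the rates of the receiver's tests of the cloud, of [xa], of [x2] and of [x1],
   in decoding order; [J2] (resp. [J1]) is the rate at which [z2] (resp. [z1]) reveals [v1] (resp. [v2]). *)
Definition pUV (c : U * V1 * V2) := pu c.1.1 * k1 c.1.1 c.1.2 * k2 c.1.1 c.2.
Definition I0 := holevo (fun _ : unit => 1) (fun _ => pUV) (fun _ c => m1 ka kx1 kx2 W c.1.1 c.1.2 c.2).
Definition I1 := holevo pUV (fun c => ka c.1.1 c.1.2) (fun c => m2 kx1 kx2 W c.1.1 c.1.2 c.2).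
Definition pUVA (c : U * V1 * V2 * XA) := pUV c.1 * ka c.1.1.1 c.1.1.2 c.2.
Definition I2 := holevo pUVA (fun c => kx2 c.1.1.1 c.1.2) (fun c => m3 kx1 W c.1.1.1 c.1.1.2 c.2).
Definition pUVAX (c : U * V1 * V2 * XA * X2) := pUVA c.1 * kx2 c.1.1.1.1 c.1.1.2 c.2.
Definition I3 := holevo pUVAX (fun c => kx1 c.1.1.1.1 c.1.1.1.2 c.1.2) (fun c x1 => W x1 c.2).
Definition pUVX2 (c : U * V2 * X2) := pu c.1.1 * k2 c.1.1 c.1.2 * kx2 c.1.1 c.1.2 c.2.
Definition J2 := cinfo pUVX2 (fun c => k1 c.1.1) (fun c v1 => law zf2 (n2 ka kx1 W c.1.1 v1 c.2)).
Definition pUVAX1 (c : U * V1 * XA * X1) :=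
  pu c.1.1.1 * k1 c.1.1.1 c.1.1.2 * ka c.1.1.1 c.1.1.2 c.1.2 * kx1 c.1.1.1 c.1.1.2 c.1.2 c.2.
Definition J1 := cinfo pUVAX1 (fun c => k2 c.1.1.1) (fun c v2 => law zf1 (n1 kx2 W c.1.1.1 v2 c.2)).

Definition zmap (Z : finType) (zf : I -> Z) n (y : tup I n) : tup Z n := [ffun t => zf (y t)].

Lemma distr_pUV : distr pUV.
Proof. exact: (distr_joint (mu := fun c => k2 c.1) (distr_joint hpu hk1) (fun c => hk2 c.1)). Qed.
Lemma distr_pUVA : distr pUVA.
Proof. exact: (distr_joint (mu := fun c => ka c.1.1 c.1.2) distr_pUV (fun c => hka c.1.1 c.1.2)). Qed.
Lemma distr_pUVAX : distr pUVAX.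
Proof.
exact: (distr_joint (mu := fun c => kx2 c.1.1.1 c.1.2) distr_pUVA (fun c => hkx2 c.1.1.1 c.1.2)).
Qed.
Lemma distr_pUVX2 : distr pUVX2.
Proof.
exact: (distr_joint (mu := fun c => kx2 c.1 c.2) (distr_joint hpu hk2) (fun c => hkx2 c.1 c.2)).
Qed.
Lemma distr_pUVAX1 : distr pUVAX1.
Proof.
exact: (distr_joint (mu := fun c => kx1 c.1.1 c.1.2 c.2)
  (distr_joint (mu := fun c => ka c.1 c.2) (distr_joint hpu hk1) (fun c => hka c.1 c.2))
  (fun c => hkx1 c.1.1 c.1.2 c.2)).
Qed.

(** Nothing is known beforehand, hence the trivial conditioning alphabet [unit]; the triple
    [(u, v1, v2)] is tested as one letter, because a wrong cloud index changes all three words. *)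
Lemma cloud_test (d e : R) : 0 < d -> 0 < e -> exists N0 : nat, forall n, (N0 <= n)%N ->
  exists T0 : tup U n -> tup V1 n -> tup V2 n -> op R (tup I n),
  [/\ forall u v1 v2, isproj (T0 u v1 v2),
   forall u v1 v2, ptr (m0 (@puB n) (@k1B n) (@k2B n) (@kaB n) (@kx1B n) (@kx2B n) (@WB n)) (T0 u v1 v2) <=
      expR (- (n%:R * (ln 2 * (I0 - d)))) &
   \sum_u puB u * \sum_v1 k1B u v1 * \sum_v2 k2B u v2 *
      ptr (m1 (@kaB n) (@kx1B n) (@kx2B n) (@WB n) u v1 v2) (compl (T0 u v1 v2)) <= e].
Proof.
move=> d0 e0; have h1 : distr (fun _ : unit => (1 : R)).
  by split=> //; rewrite (big_pred1 tt) => [|[]].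
have [m0' h] := quantum_tests h1 (fun _ => distr_pUV) (fun _ c => d1 c.1.1 c.1.2 c.2) d0 e0.
exists m0' => n /h [T [hT1 hT2 hT3]].
pose ct : tup unit n := [ffun _ => tt].
exists (fun u v1 v2 => T ct (tzip (tzip u v1) v2)); split => //.
- move=> u v1 v2; have := hT2 ct (tzip (tzip u v1) v2); congr (_ <= _).
  rewrite m0B; congr ptr; congr prodop; apply/funext => t.
  rewrite /m0 /mu0 /mixop; apply: opP => a b; rewrite !sum_pair /=; apply: eq_bigr => u' _.
  rewrite mulr_sumr; apply: eq_bigr => v1' _; rewrite !mulr_sumr; apply: eq_bigr => v2' _.
  by rewrite /pUV /= !rmorphM /=; ring.
move: hT3; rewrite (big_pred1 ct) => [|c]; last first.
  by rewrite /= [RHS]eq_sym; apply/esym/eqP/ffunP => t; case: (c t); rewrite ffunE.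
apply: le_trans; rewrite !sum_tup_pair le_eqVlt; apply/orP; left; apply/eqP.
apply: eq_bigr => u _; rewrite mulr_sumr; apply: eq_bigr => v1 _; rewrite !mulr_sumr; apply: eq_bigr => v2 _.
rewrite big1 ?mul1r // !mulrA; congr (_ * _); last first.
  by congr ptr; rewrite m1B; congr prodop; apply/funext => t; rewrite !ffunE.
by rewrite /puB /k1B /k2B -!big_split /=; apply: eq_bigr => t _; rewrite /pUV !ffunE.
Qed.

Lemma split_test (d e : R) : 0 < d -> 0 < e -> exists N0 : nat, forall n, (N0 <= n)%N ->
  exists T1 : tup U n -> tup V1 n -> tup V2 n -> tup XA n -> op R (tup I n),
  [/\ forall u v1 v2 xa, isproj (T1 u v1 v2 xa),
   forall u v1 v2 xa, ptr (m1 (@kaB n) (@kx1B n) (@kx2B n) (@WB n) u v1 v2) (T1 u v1 v2 xa) <=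
      expR (- (n%:R * (ln 2 * (I1 - d)))) &
   \sum_u puB u * \sum_v1 k1B u v1 * \sum_v2 k2B u v2 * \sum_xa kaB u v1 xa *
      ptr (m2 (@kx1B n) (@kx2B n) (@WB n) u v1 v2 xa) (compl (T1 u v1 v2 xa)) <= e].
Proof.
move=> d0 e0.
have [N0 h] := quantum_tests distr_pUV (fun c => hka c.1.1 c.1.2) (fun c => d2 c.1.1 c.1.2 c.2) d0 e0.
exists N0 => n /h [T [hT1 hT2 hT3]].
exists (fun u v1 v2 xa => T (tzip (tzip u v1) v2) xa); split => //.
- move=> u v1 v2 xa; have := hT2 (tzip (tzip u v1) v2) xa; congr (_ <= _).
  by rewrite m1B; congr ptr; congr prodop; apply/funext => t; rewrite !ffunE.
move: hT3; apply: le_trans; rewrite !sum_tup_pair le_eqVlt; apply/orP; left; apply/eqP.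
apply: eq_bigr => u _; rewrite mulr_sumr; apply: eq_bigr => v1 _; rewrite !mulr_sumr; apply: eq_bigr => v2 _.
rewrite !mulr_sumr; apply: eq_bigr => xa _; rewrite !mulrA; congr (_ * _); last first.
  by congr ptr; rewrite m2B; congr prodop; apply/funext => t; rewrite !ffunE.
by rewrite /puB /k1B /k2B /kaB -!big_split /=; apply: eq_bigr => t _; rewrite /pUV !ffunE.
Qed.

Lemma x2_test (d e : R) : 0 < d -> 0 < e -> exists N0 : nat, forall n, (N0 <= n)%N ->
  exists T2 : tup U n -> tup V1 n -> tup V2 n -> tup XA n -> tup X2 n -> op R (tup I n),
  [/\ forall u v1 v2 xa x2, isproj (T2 u v1 v2 xa x2),
   forall u v1 v2 xa x2, ptr (m2 (@kx1B n) (@kx2B n) (@WB n) u v1 v2 xa) (T2 u v1 v2 xa x2) <=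
      expR (- (n%:R * (ln 2 * (I2 - d)))) &
   \sum_u puB u * \sum_v1 k1B u v1 * \sum_v2 k2B u v2 * \sum_xa kaB u v1 xa * \sum_x2 kx2B u v2 x2 *
      ptr (m3 (@kx1B n) (@WB n) u v1 xa x2) (compl (T2 u v1 v2 xa x2)) <= e].
Proof.
move=> d0 e0.
have [N0 h] := quantum_tests distr_pUVA (fun c => hkx2 c.1.1.1 c.1.2) (fun c => d3 c.1.1.1 c.1.1.2 c.2) d0 e0.
exists N0 => n /h [T [hT1 hT2 hT3]].
exists (fun u v1 v2 xa x2 => T (tzip (tzip (tzip u v1) v2) xa) x2); split => //.
- move=> u v1 v2 xa x2; have := hT2 (tzip (tzip (tzip u v1) v2) xa) x2; congr (_ <= _).
  by rewrite m2B; congr ptr; congr prodop; apply/funext => t; rewrite !ffunE.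
move: hT3; apply: le_trans; rewrite !sum_tup_pair le_eqVlt; apply/orP; left; apply/eqP.
apply: eq_bigr => u _; rewrite mulr_sumr; apply: eq_bigr => v1 _; rewrite !mulr_sumr; apply: eq_bigr => v2 _.
rewrite !mulr_sumr; apply: eq_bigr => xa _; rewrite !mulr_sumr; apply: eq_bigr => x2 _.
rewrite !mulrA; congr (_ * _); last first.
  by congr ptr; rewrite m3B; congr prodop; apply/funext => t; rewrite !ffunE.
rewrite /puB /k1B /k2B /kaB /kx2B -!big_split /=; apply: eq_bigr => t _.
by rewrite /pUVA /pUV !ffunE.
Qed.

Lemma x1_test (d e : R) : 0 < d -> 0 < e -> exists N0 : nat, forall n, (N0 <= n)%N ->
  exists T3 : tup U n -> tup V1 n -> tup V2 n -> tup XA n -> tup X2 n -> tup X1 n -> op R (tup I n),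
  [/\ forall u v1 v2 xa x2 x1, isproj (T3 u v1 v2 xa x2 x1),
   forall u v1 v2 xa x2 x1, ptr (m3 (@kx1B n) (@WB n) u v1 xa x2) (T3 u v1 v2 xa x2 x1) <=
      expR (- (n%:R * (ln 2 * (I3 - d)))) &
   \sum_u puB u * \sum_v1 k1B u v1 * \sum_v2 k2B u v2 * \sum_xa kaB u v1 xa * \sum_x2 kx2B u v2 x2 *
     \sum_x1 kx1B u v1 xa x1 * ptr (WB x1 x2) (compl (T3 u v1 v2 xa x2 x1)) <= e].
Proof.
move=> d0 e0.
have [N0 h] := quantum_tests distr_pUVAX (fun c => hkx1 c.1.1.1.1 c.1.1.1.2 c.1.2) (fun c x1 => hW x1 c.2) d0 e0.
exists N0 => n /h [T [hT1 hT2 hT3]].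
exists (fun u v1 v2 xa x2 x1 => T (tzip (tzip (tzip (tzip u v1) v2) xa) x2) x1); split => //.
- move=> u v1 v2 xa x2 x1; have := hT2 (tzip (tzip (tzip (tzip u v1) v2) xa) x2) x1; congr (_ <= _).
  by rewrite m3B; congr ptr; congr prodop; apply/funext => t; rewrite !ffunE.
move: hT3; apply: le_trans; rewrite !sum_tup_pair le_eqVlt; apply/orP; left; apply/eqP.
apply: eq_bigr => u _; rewrite mulr_sumr; apply: eq_bigr => v1 _; rewrite !mulr_sumr; apply: eq_bigr => v2 _.
rewrite !mulr_sumr; apply: eq_bigr => xa _; rewrite !mulr_sumr; apply: eq_bigr => x2 _.
rewrite !mulr_sumr; apply: eq_bigr => x1 _.
rewrite !mulrA; congr (_ * _); last first.
  by congr ptr; congr prodop; apply/funext => t; rewrite !ffunE.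
rewrite /puB /k1B /k2B /kaB /kx2B /kx1B -!big_split /=; apply: eq_bigr => t _.
by rewrite /pUVAX /pUVA /pUV !ffunE.
Qed.

(** The conditioning word [(u, v2, x2)] is what sender 2 knows. The test reads recorded outcomes
    only and does not disturb the receiver's systems. *)
Lemma feedback_test2 (d e : R) : 0 < d -> 0 < e -> exists N0 : nat, forall n, (N0 <= n)%N ->
  exists D2 : tup U n -> tup V2 n -> tup X2 n -> tup V1 n -> pred (tup Z2 n),
  (forall u v2 x2 v1, prb (n2' (@k1B n) (@kaB n) (@kx1B n) (@WB n) u x2)
      (fun y => D2 u v2 x2 v1 (zmap zf2 y)) <= expR (- (n%:R * (ln 2 * (J2 - d))))) /\
   \sum_u puB u * \sum_v1 k1B u v1 * \sum_v2 k2B u v2 * \sum_x2 kx2B u v2 x2 *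
      prb (n2 (@kaB n) (@kx1B n) (@WB n) u v1 x2) (fun y => ~~ D2 u v2 x2 v1 (zmap zf2 y)) <= e.
Proof.
move=> d0 e0.
have [N0 h] := classical_tests distr_pUVX2 (fun c => hk1 c.1.1) (fun c v1 => distr_law zf2 (dn2 c.1.1 v1 c.2)) d0 e0.
exists N0 => n /h [S [hS1 hS2]].
exists (fun u v2 x2 v1 => S (tzip (tzip u v2) x2) v1); split.
  move=> u v2 x2 v1; have := hS1 (tzip (tzip u v2) x2) v1; congr (_ <= _).
  rewrite n2'B (prb_letters zf2 (S (tzip (tzip u v2) x2) v1)) => [|t]; last by case: (dn2' (u t) (x2 t)).
  apply: eq_bigr => z _; apply: eq_bigr => t _; rewrite !ffunE /=.
  by rewrite -law_mix.
move: hS2; apply: le_trans; rewrite !sum_tup_pair le_eqVlt; apply/orP; left; apply/eqP.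
apply: eq_bigr => u _; rewrite mulr_sumr; under eq_bigr do rewrite !mulr_sumr.
rewrite exchange_big /=; apply: eq_bigr => v2 _; under eq_bigr do rewrite !mulr_sumr.
rewrite exchange_big /=; apply: eq_bigr => x2 _; apply: eq_bigr => v1 _.
rewrite n2B (prb_letters zf2 (fun z => ~~ S (tzip (tzip u v2) x2) v1 z)) => [|t]; last by case: (dn2 (u t) (v1 t) (x2 t)).
have -> : \prod_t pUVX2 (tzip (tzip u v2) x2 t) = puB u * k2B u v2 * kx2B u v2 x2.
  by rewrite /puB /k2B /kx2B -!big_split /=; apply: eq_bigr => t _; rewrite /pUVX2 !ffunE.
have -> : \prod_t k1 (tzip (tzip u v2) x2 t).1.1 (v1 t) = k1B u v1.
  by apply: eq_bigr => t _; rewrite !ffunE.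
rewrite (eq_bigr (fun z : tup Z2 n => \prod_t law zf2 (n2 ka kx1 W (tzip (tzip u v2) x2 t).1.1 (v1 t) (tzip (tzip u v2) x2 t).2) (z t))).
  by ring.
by move=> z _; apply: eq_bigr => t _; rewrite !ffunE.
Qed.

Lemma feedback_test1 (d e : R) : 0 < d -> 0 < e -> exists N0 : nat, forall n, (N0 <= n)%N ->
  exists D1 : tup U n -> tup V1 n -> tup XA n -> tup X1 n -> tup V2 n -> pred (tup Z1 n),
  (forall u v1 xa x1 v2, prb (n1' (@k2B n) (@kx2B n) (@WB n) u x1)
      (fun y => D1 u v1 xa x1 v2 (zmap zf1 y)) <= expR (- (n%:R * (ln 2 * (J1 - d))))) /\
   \sum_u puB u * \sum_v1 k1B u v1 * \sum_v2 k2B u v2 * \sum_xa kaB u v1 xa *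
     \sum_x1 kx1B u v1 xa x1 *
      prb (n1 (@kx2B n) (@WB n) u v2 x1) (fun y => ~~ D1 u v1 xa x1 v2 (zmap zf1 y)) <= e.
Proof.
move=> d0 e0.
have [N0 h] := classical_tests distr_pUVAX1 (fun c => hk2 c.1.1.1) (fun c v2 => distr_law zf1 (dn1 c.1.1.1 v2 c.2)) d0 e0.
exists N0 => n /h [S [hS1 hS2]].
exists (fun u v1 xa x1 v2 => S (tzip (tzip (tzip u v1) xa) x1) v2); split.
  move=> u v1 xa x1 v2; have := hS1 (tzip (tzip (tzip u v1) xa) x1) v2; congr (_ <= _).
  rewrite n1'B (prb_letters zf1 (S (tzip (tzip (tzip u v1) xa) x1) v2)) => [|t]; last by case: (dn1' (u t) (x1 t)).
  apply: eq_bigr => z _; apply: eq_bigr => t _; rewrite !ffunE /=.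
  by rewrite -law_mix.
move: hS2; apply: le_trans; rewrite !sum_tup_pair le_eqVlt; apply/orP; left; apply/eqP.
apply: eq_bigr => u _; rewrite mulr_sumr; apply: eq_bigr => v1 _; rewrite !mulr_sumr.
under eq_bigr do rewrite !mulr_sumr.
rewrite exchange_big /=; apply: eq_bigr => xa _; under eq_bigr do rewrite !mulr_sumr.
rewrite exchange_big /=; apply: eq_bigr => x1 _; apply: eq_bigr => v2 _.
rewrite n1B (prb_letters zf1 (fun z => ~~ S (tzip (tzip (tzip u v1) xa) x1) v2 z)) => [|t]; last by case: (dn1 (u t) (v2 t) (x1 t)).
have -> : \prod_t pUVAX1 (tzip (tzip (tzip u v1) xa) x1 t) = puB u * k1B u v1 * kaB u v1 xa * kx1B u v1 xa x1.
  by rewrite /puB /k1B /kaB /kx1B -!big_split /=; apply: eq_bigr => t _; rewrite /pUVAX1 !ffunE.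
have -> : \prod_t k2 (tzip (tzip (tzip u v1) xa) x1 t).1.1.1 (v2 t) = k2B u v2.
  by apply: eq_bigr => t _; rewrite !ffunE.
rewrite (eq_bigr (fun z : tup Z1 n => \prod_t law zf1 (n1 kx2 W (tzip (tzip (tzip u v1) xa) x1 t).1.1.1 (v2 t) (tzip (tzip (tzip u v1) xa) x1 t).2) (z t))).
  by ring.
by move=> z _; apply: eq_bigr => t _; rewrite !ffunE.
Qed.
End BlockTests.

(** * Concavity of the entropy *)

Section Entropy.
Variable R : realType.
Local Notation C := R[i].
Local Notation rc := (real_complex R).
Implicit Types (I J K : finType).

(** For [A] positive of trace [t > 0] this is [t] times the entropy of [A / t]. It is homogeneous of
    degree one, the form in which concavity passes to unnormalized blocks. *)
Definition scaled_vN I (A : op R I) : R := vN A - etaf (complex.Re (trace A)).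

Lemma ln_ge1V (x : R) : 0 < x -> 1 - x^-1 <= ln x.
Proof.
move=> x0; have := expR_ge1Dx (- ln x); rewrite expRN lnK ?posrE //; lra.
Qed.

(* Superadditivity of [vN A - etaf (tr A)], i.e. concavity of the entropy for unnormalized states:
   sum over the overlaps of the eigenbases and use [ln x >= 1 - 1/x]. *)
Lemma scaled_vN_concave I J (w : J -> R) (A : J -> op R I) : (forall v, 0 <= w v) -> (forall v, psd (A v)) ->
  \sum_v w v * scaled_vN (A v) <= scaled_vN (mixop w A).
Proof.
move=> w0 hA; have hB : psd (mixop w A) by exact: psd_mix.
have /choice [la hla] v := eigd_exists (hA v).
have /choice [e he] := hla.
have [mu [f hf]] := eigd_exists hB.
have la0 v y : 0 <= la v y by exact: psd_eigd_ge0 (hA v) (he v).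
have mu0' y : 0 <= mu y by exact: psd_eigd_ge0 hB hf.
(* Squared overlaps of the two eigenbases, doubly stochastic in [(y, k)] for every [v]. *)
pose D v y k := complex.Re (dotv (f k) (e v y) * dotv (e v y) (f k)).
have D0 v y k : 0 <= D v y k.
  apply: cRe_ge0; have -> : dotv (f k) (e v y) = (dotv (e v y) (f k))^*.
    by rewrite /dotv cj_sum; apply: eq_bigr => i _; rewrite cjM conjCK mulrC.
  by rewrite mulrC; exact: mul_conjC_ge0.
have parse (g h : I -> I -> C) (u : I -> C) : (forall k l, \sum_y g y k * (g y l)^* = (k == l)%:R) ->
   \sum_y dotv u (g y) * dotv (g y) u = dotv u u.
  move=> hg; transitivity (\sum_k \sum_l (u k)^* * u l * \sum_y g y k * (g y l)^*).
    transitivity (\sum_y \sum_k \sum_l (u k)^* * u l * (g y k * (g y l)^*)).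
      apply: eq_bigr => y _; rewrite /dotv mulr_suml; apply: eq_bigr => k _.
      by rewrite mulr_sumr; apply: eq_bigr => l _; ring.
    rewrite exchange_big /=; apply: eq_bigr => k _; rewrite exchange_big /=.
    by apply: eq_bigr => l _; rewrite mulr_sumr.
  apply: eq_bigr => k _; rewrite (bigD1 k) //= hg eqxx mulr1 big1 ?addr0 // => l hl.
  by rewrite hg eq_sym (negbTE hl) mulr0.
have Dk v y : \sum_k D v y k = 1.
  have [_ f2 _] := hf; rewrite /D -cRe_sum -(nrm_eigd y (he v)) /nrm -(parse f f (e v y) f2).
  by congr complex.Re; apply: eq_bigr => k _; rewrite mulrC.
have Dy v k : \sum_y D v y k = 1.
  have [_ e2 _] := he v; rewrite /D -cRe_sum -(nrm_eigd k hf) /nrm.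
  by rewrite -(parse (e v) (e v) (f k) e2).
have muE k : mu k = \sum_v w v * \sum_y la v y * D v y k.
  have -> : mu k = qv (mixop w A) (f k).
    have [f1 f2 f3] := hf.
    transitivity (complex.Re (\sum_y rc (mu y) * (dotv (f k) (f y) * dotv (f y) (f k)))).
      rewrite (bigD1 k) //= big1 => [|y hy]; first by rewrite /dotv !f1 eqxx !mulr1 addr0.
      by rewrite /dotv !f1 eq_sym (negbTE hy) mul0r mulr0.
    congr complex.Re; rewrite /dotv /ap; under [RHS]eq_bigr do rewrite mulr_sumr.
    transitivity (\sum_i \sum_l \sum_y rc (mu y) * ((f k i)^* * f y i * ((f y l)^* * f k l))).
      under [RHS]eq_bigr do rewrite exchange_big /=.
      rewrite [RHS]exchange_big /=; apply: eq_bigr => y _; rewrite mulr_suml mulr_sumr.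
      by apply: eq_bigr => i _; rewrite !mulr_sumr.
    apply: eq_bigr => i _; apply: eq_bigr => l _; rewrite f3 mulr_suml mulr_sumr.
    by apply: eq_bigr => y _; ring.
  transitivity (\sum_v w v * qv (A v) (f k)).
    rewrite /qv -(eq_bigr _ (fun v _ => cReM _ _)) -cRe_sum; congr complex.Re.
    rewrite /dotv /ap /mixop; under [RHS]eq_bigr do rewrite mulr_sumr.
    rewrite [RHS]exchange_big /=; apply: eq_bigr => i _.
    transitivity (\sum_l \sum_x rc (w x) * ((f k i)^* * (A x i l * f k l))).
      rewrite mulr_sumr; apply: eq_bigr => l _; rewrite mulr_suml mulr_sumr.
      by apply: eq_bigr => x _; ring.
    by rewrite exchange_big /=; apply: eq_bigr => x _; rewrite !mulr_sumr.
  apply: eq_bigr => v _; congr (_ * _); have [e1 e2 e3] := he v.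
  transitivity (complex.Re (\sum_y rc (la v y) * (dotv (f k) (e v y) * dotv (e v y) (f k)))); last first.
    by rewrite cRe_sum; apply: eq_bigr => y _; rewrite cReM.
  congr complex.Re; rewrite /dotv /ap; under eq_bigr do rewrite mulr_sumr.
  transitivity (\sum_i \sum_l \sum_y rc (la v y) * ((f k i)^* * e v y i * ((e v y l)^* * f k l))).
    apply: eq_bigr => i _; apply: eq_bigr => l _; rewrite e3 mulr_suml mulr_sumr.
    by apply: eq_bigr => y _; ring.
  under eq_bigr do rewrite exchange_big /=.
  rewrite exchange_big /=; apply: eq_bigr => y _; rewrite mulr_suml mulr_sumr.
  by apply: eq_bigr => i _; rewrite !mulr_sumr.
pose t v := \sum_y la v y; pose T := \sum_k mu k.
have t0 v : 0 <= t v by apply: sumr_ge0.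
have T0 : 0 <= T by apply: sumr_ge0.
have TE : T = \sum_v w v * t v.
  rewrite /T; under eq_bigr do rewrite muE.
  rewrite exchange_big /=; apply: eq_bigr => v _; rewrite -mulr_sumr exchange_big /=; congr (_ * _).
  by apply: eq_bigr => y _; rewrite -mulr_sumr Dk mulr1.
rewrite /scaled_vN (vN_eigd hf) (trace_eigd hf) -/T.
under eq_bigr do rewrite (vN_eigd (he _)) (trace_eigd (he _)) -/(t _).
have ln2p := ln2_gt0 R.
rewrite -(ler_pM2l ln2p).
have etaln (x : R) : ln 2 * etaf x = - (x * ln x) by rewrite etafE; field; rewrite gt_eqF.
have lhsE : ln 2 * (\sum_v w v * (\sum_y etaf (la v y) - etaf (t v))) =
  \sum_v \sum_y \sum_k w v * la v y * D v y k * (ln (t v) - ln (la v y)).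
  rewrite mulr_sumr; apply: eq_bigr => v _; rewrite mulrCA mulrBr etaln mulr_sumr.
  have -> : \sum_y ln 2 * etaf (la v y) - - (t v * ln (t v)) = \sum_y la v y * (ln (t v) - ln (la v y)).
    rewrite opprK /t mulr_suml -big_split /=; apply: eq_bigr => y _; rewrite etaln; ring.
  rewrite mulr_sumr; apply: eq_bigr => y _; rewrite -mulr_suml -mulr_sumr Dk; ring.
have rhsE : ln 2 * (\sum_k etaf (mu k) - etaf T) =
  \sum_v \sum_y \sum_k w v * la v y * D v y k * (ln T - ln (mu k)).
  rewrite mulrBr etaln opprK mulr_sumr /T mulr_suml -big_split /=.
  transitivity (\sum_k mu k * (ln T - ln (mu k))).
    by apply: eq_bigr => k _; rewrite etaln; ring.
  under [RHS]eq_bigr do rewrite exchange_big /=.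
  rewrite [RHS]exchange_big /=; apply: eq_bigr => k _; rewrite {1}muE mulr_suml.
  apply: eq_bigr => v _; rewrite mulr_sumr mulr_suml; apply: eq_bigr => y _; ring.
rewrite lhsE rhsE -subr_ge0 -sumrB.
have -> : \sum_v (\sum_y \sum_k w v * la v y * D v y k * (ln T - ln (mu k)) -
    \sum_y \sum_k w v * la v y * D v y k * (ln (t v) - ln (la v y))) =
  \sum_v \sum_y \sum_k w v * la v y * D v y k * (ln T - ln (mu k) - ln (t v) + ln (la v y)).
  apply: eq_bigr => v _; rewrite -sumrB; apply: eq_bigr => y _; rewrite -sumrB.
  by apply: eq_bigr => k _; ring.
case: (eqVneq T 0) => [Tz|Tnz].
  have hz v y : w v * la v y = 0.
    have : \sum_v w v * t v = 0 by rewrite -TE.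
    move/eqP; rewrite psumr_eq0 => [/allP /(_ v (mem_index_enum v))|v' _]; last exact: mulr_ge0.
    rewrite /= mulf_eq0 => /orP[/eqP ->|]; first by rewrite mul0r.
    by rewrite psumr_eq0 => [/allP /(_ y (mem_index_enum y)) /eqP ->|//]; rewrite mulr0.
  rewrite big1 // => v _; rewrite big1 // => y _; rewrite big1 // => k _.
  by rewrite hz !mul0r.
have Tp : 0 < T by rewrite lt_neqAle eq_sym Tnz.
(* The bound [1 - 1/x] for each logarithm; by double stochasticity the bounds add up to [T - T]. *)
apply: (@le_trans _ _ (\sum_v \sum_y \sum_k (w v * la v y * D v y k - w v * t v / T * (D v y k * mu k)))).
  have -> : \sum_v \sum_y \sum_k (w v * la v y * D v y k - w v * t v / T * (D v y k * mu k)) = T - T.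
    under eq_bigr => v _ do under eq_bigr => y _ do rewrite sumrB -!mulr_sumr Dk mulr1.
    under eq_bigr => v _ do rewrite sumrB -!mulr_sumr -/(t v) exchange_big /=.
    have hmu v : \sum_k \sum_y D v y k * mu k = T.
      by apply: eq_bigr => k _; rewrite -mulr_suml Dy mul1r.
    under eq_bigr => v _ do rewrite hmu mulfVK //.
    by rewrite sumrB -TE.
  by rewrite subrr.
apply: ler_sum => v _; apply: ler_sum => y _; apply: ler_sum => k _.
have [h0|h0] := eqVneq (w v * la v y * D v y k) 0.
  rewrite h0 mul0r sub0r oppr_le0; do ![apply: mulr_ge0 => //]; by rewrite invr_ge0.
have pos : 0 < w v * la v y * D v y k.
  by rewrite lt_neqAle eq_sym h0 /= !mulr_ge0.
move: h0; rewrite !mulf_eq0 !negb_or -andbA => /and3P[hw hl hD].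
have wp : 0 < w v by rewrite lt_neqAle eq_sym hw w0.
have lp : 0 < la v y by rewrite lt_neqAle eq_sym hl la0.
have Dp : 0 < D v y k by rewrite lt_neqAle eq_sym hD D0.
have tp : 0 < t v.
  rewrite /t (bigD1 y) //=; apply: ltr_wpDr => //; exact: sumr_ge0.
have mp : 0 < mu k.
  rewrite muE (bigD1 v) //= (bigD1 y) //=; apply: ltr_wpDr.
    by apply: sumr_ge0 => v' _; apply: mulr_ge0 => //; apply: sumr_ge0 => *; exact: mulr_ge0.
  apply: mulr_gt0 => //; apply: ltr_wpDr; last exact: mulr_gt0.
  by apply: sumr_ge0 => *; exact: mulr_ge0.
have -> : ln T - ln (mu k) - ln (t v) + ln (la v y) = ln (T * la v y / (mu k * t v)).
  rewrite ln_div ?posrE ?mulr_gt0 // !lnM ?posrE //; ring.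
apply: le_trans (ler_wpM2l (ltW pos) (ln_ge1V (divr_gt0 (mulr_gt0 Tp lp) (mulr_gt0 mp tp)))).
rewrite le_eqVlt; apply/orP; left; apply/eqP; field.
by rewrite !gt_eqF.
Qed.

Lemma vN_concave I J (w : J -> R) (r : J -> op R I) : distr w -> (forall v, density (r v)) ->
  \sum_v w v * vN (r v) <= vN (mixop w r).
Proof.
move=> hw hr; have [w0 w1] := hw; have := scaled_vN_concave w0 (fun v => (hr v).1).
have e1 : etaf (1 : R) = 0 by rewrite etafE ln1 mulr0 oppr0 mul0r.
rewrite /scaled_vN; have [_ ->] := density_mix hw hr; rewrite [etaf _]e1 subr0.
apply: le_trans; apply: ler_sum => v _; have [_ ->] := hr v; rewrite [etaf _]e1 subr0.
exact: lexx.
Qed.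

Lemma eigd_scale I (X : op R I) la e a : eigd X la e ->
  eigd (fun k l => rc a * X k l) (fun y => a * la y) e.
Proof.
move=> [h1 h2 h3]; split=> // k l; rewrite h3 mulr_sumr; apply: eq_bigr => y _.
by rewrite rmorphM /=; ring.
Qed.

Lemma scaled_vNE I (X : op R I) a : density X -> 0 <= a ->
  scaled_vN (fun k l => rc a * X k l) = a * vN X.
Proof.
move=> [hX tX] a0; have [la [e he]] := eigd_exists hX.
have hs := eigd_scale a he; rewrite /scaled_vN (vN_eigd he) (vN_eigd hs) (trace_eigd hs).
have tl : \sum_y la y = 1 by rewrite -(trace_eigd he) tX.
rewrite -mulr_sumr tl mulr1; have [->|an0] := eqVneq a 0.
  rewrite mul0r; under eq_bigr do rewrite mul0r.
  by rewrite etafE mul0r oppr0 mul0r big1 // subr0.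
have ap : 0 < a by rewrite lt_neqAle eq_sym an0.
have hy y : etaf (a * la y) = la y * etaf a + a * etaf (la y).
  rewrite !etafE; have [->|ln0] := eqVneq (la y) 0; first by rewrite !(mulr0, mul0r, oppr0, addr0).
  have lp : 0 < la y by rewrite lt_neqAle eq_sym ln0 (psd_eigd_ge0 y hX he).
  by rewrite lnM ?posrE //; ring.
under eq_bigr do rewrite hy.
by rewrite big_split /= -mulr_suml tl mul1r addrAC subrr add0r -mulr_sumr.
Qed.

Lemma vN_block (S I T : finType) (phi : S * I -> T) (X : op R T) (A : S -> op R I) :
  bijective phi -> (forall s, psd (A s)) ->
  (forall s i s' i', X (phi (s, i)) (phi (s', i')) = (s == s')%:R * A s i i') ->
  vN X = \sum_s vN (A s).
Proof.
move=> [psi fK gK] hA hX; have /choice [la hla] s := eigd_exists (hA s).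
have /choice [e he] := hla.
have rei (F : T -> C) : \sum_t F t = \sum_s \sum_i F (phi (s, i)).
  by rewrite (reindex phi) /= ?sum_pair //; apply: onW_bij; exists psi.
pose E (t t' : T) := ((psi t).1 == (psi t').1)%:R * e (psi t).1 (psi t).2 (psi t').2.
have hE : eigd X (fun t => la (psi t).1 (psi t).2) E.
  split.
  - move=> y y'; rewrite rei /E.
    transitivity (\sum_s ((psi y).1 == s)%:R * (((psi y').1 == s)%:R *
        \sum_i (e (psi y).1 (psi y).2 i)^* * e (psi y').1 (psi y').2 i)).
      apply: eq_bigr => s _; rewrite !mulr_sumr; apply: eq_bigr => i _.
      by rewrite fK /= cjM cjn; ring.
    rewrite (bigD1 (psi y).1) //= eqxx mul1r [X in _ + X]big1 ?addr0 => [|s hs]; last first.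
      by rewrite eq_sym (negbTE hs) mul0r.
    have -> : (y == y') = ((psi y').1 == (psi y).1) && ((psi y).2 == (psi y').2).
      by rewrite -(inj_eq (can_inj gK)) -pair_eqE /= /pair_eq /= [in X in X && _]eq_sym.
    case: eqP => [->|_]; last by rewrite mul0r.
    by rewrite mul1r; case: (he (psi y).1) => ->.
  - move=> k l; rewrite rei /E.
    transitivity (\sum_s (s == (psi k).1)%:R * ((s == (psi l).1)%:R *
        \sum_i e s i (psi k).2 * (e s i (psi l).2)^*)).
      apply: eq_bigr => s _; rewrite !mulr_sumr; apply: eq_bigr => i _.
      by rewrite fK /= cjM cjn; ring.
    rewrite (bigD1 (psi k).1) //= eqxx mul1r [X in _ + X]big1 ?addr0 => [|s hs]; last first.
      by rewrite (negbTE hs) mul0r.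
    case: (he (psi k).1) => _ -> _; rewrite -natrM mulnb; congr ((nat_of_bool _)%:R).
    by rewrite -[RHS](inj_eq (can_inj gK)) -pair_eqE.
  - move=> k l; rewrite -{1}(gK k) -{1}(gK l) [psi k]surjective_pairing [psi l]surjective_pairing hX rei.
    transitivity (\sum_s (s == (psi k).1)%:R * ((s == (psi l).1)%:R *
        \sum_i rc (la s i) * (e s i (psi k).2 * (e s i (psi l).2)^*))); last first.
      apply: eq_bigr => s _; rewrite !mulr_sumr; apply: eq_bigr => i _.
      by rewrite /E !fK /= cjM cjn; ring.
    rewrite (bigD1 (psi k).1) //= eqxx mul1r [X in _ + X]big1 ?addr0 => [|s hs]; last first.
      by rewrite (negbTE hs) mul0r.
    by case: (he (psi k).1) => _ _ ->.
rewrite (vN_eigd hE) (reindex phi) /=; last by apply: onW_bij; exists psi.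
rewrite sum_pair; apply: eq_bigr => s _; rewrite (vN_eigd (he s)).
by apply: eq_bigr => i _; rewrite fK.
Qed.

Lemma vN_diag (T : finType) (X : op R T) (q : T -> R) :
  (forall t t', X t t' = (t == t')%:R * rc (q t)) -> vN X = \sum_t etaf (q t).
Proof.
move=> hX; apply: (vN_eigd (e := fun t t' => (t == t')%:R)).
have sel (F : T -> C) t : \sum_i (t == i)%:R * F i = F t.
  rewrite (bigD1 t) //= eqxx mul1r big1 ?addr0 // => i hi; by rewrite eq_sym (negbTE hi) mul0r.
split.
- move=> y y'; under eq_bigr do rewrite cjn; by rewrite sel eq_sym.
- move=> k l; under eq_bigr do rewrite cjn eq_sym; by rewrite sel.
- move=> k l; rewrite hX; under eq_bigr do rewrite cjn mulrCA eq_sym.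
  by rewrite sel eq_sym; ring.
Qed.
End Entropy.

(** * Entropies of the classical-quantum state *)

Section HsubFormulas.
Variable R : realType.
Local Notation C := R[i].
Local Notation rc := (real_complex R).
Variables (U V1 X1 V2 X2 Bb Z1 Z2 : finType).
Local Notation cl := (U * V1 * X1 * V2 * X2)%type.
Local Notation sys := (Bb * Z1 * Z2)%type.
Local Notation reg := (reg8 U V1 X1 V2 X2 Bb Z1 Z2).

(** Eight explicit flags instead of a mask function: the types of the kept registers compute once
    the flags are known, and [Hsub_flags] is a conversion. *)
Definition proj_flags (b0 b1 b2 b3 b4 b5 b6 b7 : bool) (t : reg) :
  (sel b0 U * sel b1 V1 * sel b2 X1 * sel b3 V2 * sel b4 X2 * sel b5 Bb * sel b6 Z1 * sel b7 Z2)%type :=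
  let: (u, v1, x1, v2, x2, b, z1, z2) := t in
  (selp b0 u, selp b1 v1, selp b2 x1, selp b3 v2, selp b4 x2, selp b5 b, selp b6 z1, selp b7 z2).
Definition class_flags (b0 b1 b2 b3 b4 : bool) (c : cl) :
  (sel b0 U * sel b1 V1 * sel b2 X1 * sel b3 V2 * sel b4 X2)%type :=
  let: (u, v1, x1, v2, x2) := c in (selp b0 u, selp b1 v1, selp b2 x1, selp b3 v2, selp b4 x2).

Definition flags_entropy (w : op R reg) b0 b1 b2 b3 b4 b5 b6 b7 : R :=
  vN (reduce (proj_flags b0 b1 b2 b3 b4 b5 b6 b7)
    (proj_flags (~~ b0) (~~ b1) (~~ b2) (~~ b3) (~~ b4) (~~ b5) (~~ b6) (~~ b7)) w).

Lemma Hsub_flags w (S : seq nat) : Hsub w S =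
  flags_entropy w (0%N \in S) (1%N \in S) (2%N \in S) (3%N \in S) (4%N \in S) (5%N \in S) (6%N \in S) (7%N \in S).
Proof. by []. Qed.

Variables (w : op R reg) (P : cl -> R) (Wc : cl -> op R sys).
Hypotheses (P0 : forall c, 0 <= P c) (dW : forall c, density (Wc c))
  (zW : forall c y y', (y.1.2 == y'.1.2) && (y.2 == y'.2) = false -> Wc c y y' = 0)
  (hw : forall c b z1 z2 c' b' z1' z2',
    w (c, b, z1, z2) (c', b', z1', z2') = (c == c')%:R * (rc (P c) * Wc c (b, z1, z2) (b', z1', z2'))).

Definition reg_of (c : cl) (y : sys) : reg := (c, y.1.1, y.1.2, y.2).

Lemma sum_reg_of (V : nmodType) (F : reg -> V) : \sum_t F t = \sum_c \sum_y F (reg_of c y).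
Proof.
rewrite pair_bigA /= (reindex (fun q : cl * sys => reg_of q.1 q.2)) //=.
apply: onW_bij; exists (fun t : reg => (t.1.1.1, (t.1.1.2, t.1.2, t.2))) => [[c [[b z1] z2]]|[[[c b] z1] z2]] //.
Qed.

Lemma reduce_reg_of (T E : finType) (f : reg -> T) (g : reg -> E) s s' :
  reduce f g w s s' = \sum_c rc (P c) * \sum_y \sum_y'
    ((f (reg_of c y) == s) && (f (reg_of c y') == s') && (g (reg_of c y) == g (reg_of c y')))%:R * Wc c y y'.
Proof.
rewrite /reduce sum_reg_of; apply: eq_bigr => c _; rewrite mulr_sumr; apply: eq_bigr => -[[b z1] z2] _.
rewrite sum_reg_of (bigD1 c) //= [X in _ + X]big1 ?addr0 => [|c' hc]; last first.
  rewrite big1 // => -[[b' z1'] z2'] _.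
  by rewrite /reg_of hw [c == c']eq_sym (negbTE hc) mul0r mulr0.
rewrite mulr_sumr; apply: eq_bigr => -[[b' z1'] z2'] _.
by rewrite /reg_of hw eqxx mul1r; ring.
Qed.

Variables (b0 b1 b2 b3 b4 : bool).
Local Notation kap := (@class_flags b0 b1 b2 b3 b4).
Local Notation ST := (sel b0 U * sel b1 V1 * sel b2 X1 * sel b3 V2 * sel b4 X2)%type.

Definition cond_weight s (c : cl) : R := (kap c == s)%:R * P c.
(** Unnormalized output on the event that the kept classical registers show [s]. *)
Definition cond_op s : op R sys := mixop (cond_weight s) Wc.
Definition cond_mass s : R := \sum_c cond_weight s c.

Lemma cond_weight_ge0 s c : 0 <= cond_weight s c.
Proof. by apply: mulr_ge0. Qed.

Lemma psd_cond_op s : psd (cond_op s).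
Proof. by apply: psd_mix => c; [exact: cond_weight_ge0|case: (dW c)]. Qed.

Lemma flags_entropy_quantum : flags_entropy w b0 b1 b2 b3 b4 true true true = \sum_s vN (cond_op s).
Proof.
pose phi (q : ST * sys) : (ST * Bb * Z1 * Z2)%type := (q.1, q.2.1.1, q.2.1.2, q.2.2).
have hphi : bijective phi.
  by exists (fun t => (t.1.1.1, (t.1.1.2, t.1.2, t.2))) => [[c [[b z1] z2]]|[[[c b] z1] z2]].
apply: (vN_block hphi psd_cond_op) => s y s' y'.
rewrite reduce_reg_of /cond_op /mixop.
have fE c z : proj_flags b0 b1 b2 b3 b4 true true true (reg_of c z) = phi (kap c, z).
  by case: c => [[[[u v1] x1] v2] x2].
have gE c z z' : proj_flags (~~ b0) (~~ b1) (~~ b2) (~~ b3) (~~ b4) false false false (reg_of c z) =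
  proj_flags (~~ b0) (~~ b1) (~~ b2) (~~ b3) (~~ b4) false false false (reg_of c z').
  by case: c => [[[[u v1] x1] v2] x2].
rewrite mulr_sumr; apply: eq_bigr => c _.
transitivity (rc (P c) * ((kap c == s)%:R * (kap c == s')%:R * Wc c y y')).
  congr (_ * _); transitivity (\sum_z \sum_z' ((z == y)%:R * (z' == y')%:R) *
      ((kap c == s)%:R * (kap c == s')%:R * Wc c z z')).
    apply: eq_bigr => z _; apply: eq_bigr => z' _.
    rewrite !fE !(inj_eq (bij_inj hphi)) !xpair_eqE (gE c z z') eqxx andbT.
    by rewrite -!mulnb !natrM; ring.
  rewrite (bigD1 y) //= [X in _ + X]big1 ?addr0 => [|z hz]; last first.
    by rewrite big1 // => z' _; rewrite (negbTE hz) !mul0r.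
  rewrite (bigD1 y') //= [X in _ + X]big1 ?addr0 => [|z hz]; last first.
    by rewrite (negbTE hz) mulr0 mul0r.
  by rewrite !eqxx !mul1r.
rewrite /cond_weight rmorphM /= rmorph_nat; case: (eqVneq s s') => [->|hs].
  by case: (kap c == s') => /=; ring.
by case: (eqVneq (kap c) s) hs => [->|_ _]; [move=> /negbTE -> /=; ring|rewrite /=; ring].
Qed.

Definition selected_outcomes (b6 b7 : bool) (y : sys) := (selp b6 y.1.2, selp b7 y.2).

Lemma flags_entropy_classical b6 b7 : flags_entropy w b0 b1 b2 b3 b4 false b6 b7 =
  \sum_s \sum_z etaf (\sum_c cond_weight s c * prb (Wc c) (fun y => selected_outcomes b6 b7 y == z)).
Proof.
pose f := proj_flags b0 b1 b2 b3 b4 false b6 b7.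
pose q t := \sum_c P c * prb (Wc c) (fun y => f (reg_of c y) == t).
have hq : flags_entropy w b0 b1 b2 b3 b4 false b6 b7 = \sum_t etaf (q t).
  apply: vN_diag => t t'; rewrite reduce_reg_of /q rc_sum mulr_sumr; apply: eq_bigr => c _.
  rewrite rmorphM /= mulrCA; congr (_ * _).
  rewrite /prb rc_sum mulr_sumr [RHS]big_mkcond; apply: eq_bigr => y _.
  have hre : rc (complex.Re (Wc c y y)) = Wc c y y.
    rewrite RRe_real // ger0_real //; have := psd_form2 y y 1 0 (dW c).1.
    by rewrite cj1 cj0 !mul1r !mulr1 !mul0r !mulr0 !addr0.
  rewrite (bigD1 y) //= [X in _ + X]big1 ?addr0 => [|y' hy]; last first.
    (* Off the diagonal either the outcomes agree, and then the traced-out [Bb] parts differ, or the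
       outcomes differ and [Wc] vanishes. *)
    case: (boolP ((y.1.2 == y'.1.2) && (y.2 == y'.2))) => [/andP[/eqP e1 /eqP e2]|/negbTE hz].
      have -> : (proj_flags (~~ b0) (~~ b1) (~~ b2) (~~ b3) (~~ b4) (~~ false) (~~ b6) (~~ b7) (reg_of c y) ==
        proj_flags (~~ b0) (~~ b1) (~~ b2) (~~ b3) (~~ b4) (~~ false) (~~ b6) (~~ b7) (reg_of c y')) = false.
        apply: contraNF hy; move: e1 e2; clear hre; case: c => [[[[u v1] x1] v2] x2].
        case: y => [[b z1] z2]; case: y' => [[b' z1'] z2'] /= -> ->.
        by rewrite /reg_of /= !xpair_eqE => /andP[/andP[/andP[_ /eqP ->]] _ _]; rewrite !eqxx.
      by rewrite andbF mul0r.
    by rewrite zW // mulr0.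
  rewrite eqxx andbT -/f; case: (eqVneq t t') => [->|hne].
    by case: ifP => _ /=; rewrite ?mul1r ?mul0r.
  have -> : (f (reg_of c y) == t) && (f (reg_of c y) == t') = false.
    by apply/andP => -[/eqP e /eqP e']; move: hne; rewrite -e -e' eqxx.
  by rewrite !mul0r; case: ifP => _; rewrite ?rmorph0 ?mulr0.
pose phi (p : ST * (sel b6 Z1 * sel b7 Z2)) : (ST * unit * sel b6 Z1 * sel b7 Z2)%type :=
  (p.1, tt, p.2.1, p.2.2).
have hphi : bijective phi.
  by exists (fun t => (t.1.1.1, (t.1.2, t.2))) => [[a [z1 z2]]|[[[a []] z1] z2]].
rewrite hq (reindex phi) /=; last exact: onW_bij.
rewrite sum_pair; apply: eq_bigr => s _; apply: eq_bigr => z _; congr etaf; rewrite /q.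
apply: eq_bigr => c _; rewrite /cond_weight /prb.
rewrite [_ * P c]mulrC -mulrA; congr (_ * _); rewrite mulr_sumr big_mkcond [RHS]big_mkcond.
apply: eq_bigr => y _.
have -> : (f (reg_of c y) == phi (s, z)) = (kap c == s) && (selected_outcomes b6 b7 y == z).
  have -> : f (reg_of c y) = phi (kap c, selected_outcomes b6 b7 y) by case: c => [[[[u v1] x1] v2] x2].
  by rewrite (inj_eq (bij_inj hphi)).
by case: (kap c == s) => /=; case: ifP => _; rewrite ?mul1r ?mul0r.
Qed.

Section Average.
Variable r : cl -> op R sys.
Hypotheses (dr : forall c, density (r c)) (rinv : forall c c', kap c = kap c' -> r c = r c')
  (ravg : forall s, cond_op s = mixop (cond_weight s) r).

Lemma cond_opE s c : kap c = s -> cond_op s = fun a b => rc (cond_mass s) * r c a b.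
Proof.
move=> hc; rewrite ravg; apply: opP => a b; rewrite /mixop /cond_mass rc_sum mulr_suml.
apply: eq_bigr => c' _; case: (eqVneq (kap c') s) => [e|ne]; first by rewrite (rinv (etrans hc (esym e))).
by rewrite /cond_weight (negbTE ne) !mul0r.
Qed.

Lemma cond_mass_empty s : (forall c, kap c <> s) -> cond_mass s = 0.
Proof. by move=> h; rewrite /cond_mass big1 // => c _; rewrite /cond_weight; case: eqP => [/h //|_]; rewrite mul0r. Qed.

Lemma trace_cond_op s : complex.Re (trace (cond_op s)) = cond_mass s.
Proof.
have := ptr_mix (cond_weight s) Wc (@idop R _); rewrite /ptr trmul1l => ->.
by apply: eq_bigr => c _; rewrite trmul1l; case: (dW c) => _ ->; rewrite mulr1.
Qed.

(** Chain rule: the difference is the sum of [scaled_vN] over the blocks [cond_op s], and each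
    nonempty block is [cond_mass s] times a state of the family [r]. Values [s] attained by no [c]
    contribute zero. *)
Lemma cond_entropy_quantum : flags_entropy w b0 b1 b2 b3 b4 true true true - flags_entropy w b0 b1 b2 b3 b4 false false false =
  \sum_c P c * vN (r c).
Proof.
rewrite flags_entropy_quantum flags_entropy_classical.
have -> : \sum_s \sum_z etaf (\sum_c cond_weight s c * prb (Wc c) (fun y => selected_outcomes false false y == z)) =
    \sum_s etaf (complex.Re (trace (cond_op s))).
  apply: eq_bigr => s _; rewrite trace_cond_op (big_pred1 (tt, tt)) => [|[[] []]//]; congr etaf.
  apply: eq_bigr => c _.
  have -> : prb (Wc c) (fun y => selected_outcomes false false y == (tt, tt)) = 1.
    by case: (dW c) => _; rewrite /prb -cRe_sum /trace => ->.
  by rewrite mulr1.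
rewrite -sumrB; transitivity (\sum_s \sum_c cond_weight s c * vN (r c)).
  apply: eq_bigr => s _; rewrite -/(scaled_vN (cond_op s)).
  have [[c hc]|hn] := pselect (exists c, kap c = s).
    rewrite (cond_opE hc) scaled_vNE //; last by apply: sumr_ge0 => c' _; exact: cond_weight_ge0.
    rewrite /cond_mass mulr_suml; apply: eq_bigr => c' _; case: (eqVneq (kap c') s) => [e|ne].
      by rewrite (rinv (etrans hc (esym e))).
    by rewrite /cond_weight (negbTE ne) !mul0r.
  have hn' c : kap c <> s by move=> e; apply: hn; exists c.
  have hw0 c : cond_weight s c = 0 by rewrite /cond_weight; case: eqP => [/hn' //|_]; rewrite mul0r.
  rewrite [RHS]big1 => [|c _]; last by rewrite hw0 mul0r.
  have -> : cond_op s = fun t t' => (t == t')%:R * rc 0.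
    by apply: opP => a b; rewrite mulr0 /cond_op /mixop big1 // => c _; rewrite hw0 rmorph0 mul0r.
  have e0 : etaf (0 : R) = 0 by rewrite etafE mul0r oppr0 mul0r.
  rewrite /scaled_vN (vN_diag (q := fun=> 0)) // big1 // /trace big1 ?e0 ?subrr //.
  by move=> y _; rewrite mulr0.
rewrite exchange_big /=; apply: eq_bigr => c _; rewrite -mulr_suml; congr (_ * _).
by rewrite (bigD1 (kap c)) //= /cond_weight eqxx mul1r big1 ?addr0 // => s hs; rewrite eq_sym (negbTE hs) mul0r.
Qed.

Lemma cond_entropy_classical b6 b7 :
  flags_entropy w b0 b1 b2 b3 b4 false b6 b7 - flags_entropy w b0 b1 b2 b3 b4 false false false =
  \sum_c P c * \sum_z etaf (prb (r c) (fun y => selected_outcomes b6 b7 y == z)).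
Proof.
rewrite !flags_entropy_classical.
have -> : \sum_s \sum_z etaf (\sum_c cond_weight s c * prb (Wc c) (fun y => selected_outcomes false false y == z)) =
    \sum_s etaf (cond_mass s).
  apply: eq_bigr => s _; rewrite (big_pred1 (tt, tt)) => [|[[] []]//]; congr etaf.
  apply: eq_bigr => c _.
  have -> : prb (Wc c) (fun y => selected_outcomes false false y == (tt, tt)) = 1.
    by case: (dW c) => _; rewrite /prb -cRe_sum /trace => ->.
  by rewrite mulr1.
pose H c := \sum_z etaf (prb (r c) (fun y => selected_outcomes b6 b7 y == z)).
rewrite -sumrB; transitivity (\sum_s \sum_c cond_weight s c * H c).
  apply: eq_bigr => s _.
  under eq_bigr do rewrite -(mixlinear_prb _ (cond_weight s) Wc).
  have [[c hc]|hn] := pselect (exists c, kap c = s); last first.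
    have hn' c : kap c <> s by move=> e; apply: hn; exists c.
    have hw0 c : cond_weight s c = 0 by rewrite /cond_weight; case: eqP => [/hn' //|_]; rewrite mul0r.
    have e0 : etaf (0 : R) = 0 by rewrite etafE mul0r oppr0 mul0r.
    rewrite (cond_mass_empty hn') e0 subr0 [RHS]big1 => [|c _]; last by rewrite hw0 mul0r.
    rewrite big1 // => z _; rewrite (mixlinear_prb _ (cond_weight s) Wc) big1 // => c _; by rewrite hw0 mul0r.
  have -> : \sum_c0 cond_weight s c0 * H c0 = cond_mass s * H c.
    rewrite /cond_mass mulr_suml; apply: eq_bigr => c' _; case: (eqVneq (kap c') s) => [e|ne].
      by rewrite /H (rinv (etrans hc (esym e))).
    by rewrite /cond_weight (negbTE ne) !mul0r.
  rewrite -/(cond_op s) (cond_opE hc).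
  have prE z : prb (fun a b => rc (cond_mass s) * r c a b) (fun y => selected_outcomes b6 b7 y == z) =
     cond_mass s * prb (r c) (fun y => selected_outcomes b6 b7 y == z).
    by rewrite /prb mulr_sumr; apply: eq_bigr => y _; rewrite cReM.
  under eq_bigr do rewrite prE.
  have q0 : 0 <= cond_mass s by apply: sumr_ge0 => c' _; exact: cond_weight_ge0.
  have l1 : \sum_z prb (r c) (fun y => selected_outcomes b6 b7 y == z) = 1.
    by case: (distr_law (selected_outcomes b6 b7) (dr c)).
  have l0 z : 0 <= prb (r c) (fun y => selected_outcomes b6 b7 y == z).
    by case: (distr_law (selected_outcomes b6 b7) (dr c)) => h _; exact: h.
  have eM (a x : R) : 0 <= a -> 0 <= x -> etaf (a * x) = x * etaf a + a * etaf x.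
    move=> a0 x0; rewrite !etafE; have [->|an] := eqVneq a 0; first by rewrite !(mulr0, mul0r, oppr0, addr0).
    have [->|xn] := eqVneq x 0; first by rewrite !(mulr0, mul0r, oppr0, addr0).
    have ap : 0 < a by rewrite lt_neqAle eq_sym an.
    have xp : 0 < x by rewrite lt_neqAle eq_sym xn.
    by rewrite lnM ?posrE //; ring.
  under eq_bigr do rewrite eM //.
  by rewrite big_split /= -mulr_suml l1 mul1r addrAC subrr add0r -mulr_sumr.
rewrite exchange_big /=; apply: eq_bigr => c _; rewrite -mulr_suml; congr (_ * _).
by rewrite (bigD1 (kap c)) //= /cond_weight eqxx mul1r big1 ?addr0 // => s hs; rewrite eq_sym (negbTE hs) mul0r.
Qed.
End Average.
End HsubFormulas.

(** * Entropy of measurement outcomes and entropy conditional on them *)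

Section OutcomeEntropy.
Variable R : realType.
Local Notation C := R[i].
Local Notation rc := (real_complex R).

Definition outcome_entropy (I Z : finType) (zf : I -> Z) (r : op R I) : R := \sum_z etaf (law zf r z).

(** A law is the spectrum of a diagonal operator, so this is the concavity of [vN]. *)
Lemma outcome_entropy_concave (I Z J : finType) (zf : I -> Z) (w : J -> R) (r : J -> op R I) : distr w ->
  (forall v, density (r v)) -> \sum_v w v * outcome_entropy zf (r v) <= outcome_entropy zf (mixop w r).
Proof.
move=> hw hr; pose D (q : Z -> R) : op R Z := fun z z' => (z == z')%:R * rc (q z).
have vD q : vN (D q) = \sum_z etaf (q z) by exact: vN_diag.
have dD q : distr q -> density (D q).
  move=> [q0 q1]; split=> [v|].
    apply: sumr_ge0 => k _; rewrite (bigD1 k) //= big1 ?addr0 => [|l hl].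
      by rewrite /D eqxx mul1r mulrAC [_^* * _]mulrC mulr_ge0 ?mul_conjC_ge0 // ler0c.
    by rewrite /D eq_sym (negbTE hl) mul0r mulr0 mul0r.
  rewrite /trace /D; under eq_bigr do rewrite eqxx mul1r.
  by rewrite -rc_sum q1.
have := vN_concave hw (fun v => dD _ (distr_law zf (hr v))).
under eq_bigr do rewrite vD.
suff -> : mixop w (fun v => D (law zf (r v))) = D (law zf (mixop w r)) by rewrite vD.
apply: opP => z z'; rewrite /D law_mix rc_sum mulr_sumr; apply: eq_bigr => v _.
by rewrite rmorphM /=; ring.
Qed.

(** [vN - outcome_entropy] is the entropy conditional on the outcome, a sum of [scaled_vN] over
    diagonal blocks; each block is superadditive by itself. *)
Lemma block_concave (S I T J : finType) (phi : S * I -> T) (zf : T -> S) (w : J -> R) (r : J -> op R T) :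
  bijective phi -> (forall p, zf (phi p) = p.1) ->
  (forall v y y', zf y != zf y' -> r v y y' = 0) ->
  distr w -> (forall v, density (r v)) ->
  \sum_v w v * (vN (r v) - outcome_entropy zf (r v)) <= vN (mixop w r) - outcome_entropy zf (mixop w r).
Proof.
move=> hphi hz h0 hw hr; pose blk (X : op R T) s : op R I := fun i i' => X (phi (s, i)) (phi (s, i')).
have hE X : psd X -> (forall y y', zf y != zf y' -> X y y' = 0) ->
    vN X - outcome_entropy zf X = \sum_s scaled_vN (blk X s).
  move=> hX hX0; rewrite (vN_block (A := blk X) hphi); first last.
  - move=> s i s' i'; rewrite /blk; case: eqVneq => [->|hs]; first by rewrite mul1r.
    by rewrite mul0r hX0 // !hz.
  - by move=> s; exact: psd_compress.
  rewrite /outcome_entropy -sumrB; apply: eq_bigr => s _; congr (_ - etaf _).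
  rewrite /law /prb /trace cRe_sum /blk big_mkcond (reindex phi) /=; last exact: onW_bij.
  rewrite sum_pair /= (bigD1 s) //= [X in _ + X]big1 ?addr0 => [|s' hs'].
    by apply: eq_bigr => i _; rewrite hz eqxx.
  by rewrite big1 // => i _; rewrite hz (negbTE hs').
have [w0 w1] := hw.
rewrite [leRHS]hE; first last.
- by move=> y y' hy; rewrite /mixop big1 // => v _; rewrite h0 ?mulr0.
- by apply: psd_mix => // v; case: (hr v).
have -> : \sum_v w v * (vN (r v) - outcome_entropy zf (r v)) = \sum_s \sum_v w v * scaled_vN (blk (r v) s).
  rewrite [RHS]exchange_big /=; apply: eq_bigr => v _; rewrite -mulr_sumr hE //; last exact: h0.
  by case: (hr v).
apply: ler_sum => s _; apply: scaled_vN_concave => // v; apply: psd_compress; by case: (hr v).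
Qed.
End OutcomeEntropy.

(** * Single-letter conditional entropies and the informations of the region *)

Section LetterEntropies.
Variable R : realType.
Local Notation C := R[i].
Local Notation rc := (real_complex R).
Variables (U V1 X1 V2 X2 Bb Z1 Z2 : finType).
Local Notation cl := (U * V1 * X1 * V2 * X2)%type.
Local Notation sys := (Bb * Z1 * Z2)%type.
Local Notation reg := (reg8 U V1 X1 V2 X2 Bb Z1 Z2).
Variables (pu : U -> R) (k1 : U -> V1 -> R) (k2 : U -> V2 -> R)
  (kx1 : U -> V1 -> X1 -> R) (kx2 : U -> V2 -> X2 -> R) (W : X1 -> X2 -> op R sys).
Hypotheses (hpu : distr pu) (hk1 : forall u, distr (k1 u)) (hk2 : forall u, distr (k2 u))
  (hkx1 : forall u v1, distr (kx1 u v1)) (hkx2 : forall u v2, distr (kx2 u v2))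
  (dW : forall x1 x2, density (W x1 x2))
  (zW : forall x1 x2 y y', (y.1.2 == y'.1.2) && (y.2 == y'.2) = false -> W x1 x2 y y' = 0).

(** The target ring is a parameter so that the same averaging rules apply to real entropies and to
    the complex entries of states. *)
Definition avg (S : comNzRingType) (j : {rmorphism R -> S}) (F : U -> V1 -> V2 -> X1 -> X2 -> S) : S :=
  \sum_u j (pu u) * \sum_v1 j (k1 u v1) * \sum_v2 j (k2 u v2) *
    \sum_x1 j (kx1 u v1 x1) * \sum_x2 j (kx2 u v2 x2) * F u v1 v2 x1 x2.

Definition Pcl (c : cl) : R :=
  let: (u, v1, x1, v2, x2) := c in pu u * (k1 u v1 * kx1 u v1 x1) * (k2 u v2 * kx2 u v2 x2).

Section AvgTheory.
Variables (S : comNzRingType) (j : {rmorphism R -> S}).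

Lemma sum_cl (F : cl -> S) :
  \sum_c j (Pcl c) * F c = avg j (fun u v1 v2 x1 x2 => F (u, v1, x1, v2, x2)).
Proof.
rewrite !sum_pair /avg /=; apply: eq_bigr => u _.
rewrite mulr_sumr; apply: eq_bigr => v1 _; rewrite exchange_big /= !mulr_sumr.
apply: eq_bigr => v2 _; rewrite !mulr_sumr; apply: eq_bigr => x1 _; rewrite !mulr_sumr.
by apply: eq_bigr => x2 _; rewrite !rmorphM; ring.
Qed.

(** Tower rule: the factor [f] does not see [x1], so [F] may be replaced by its conditional mean.
    With [f] the indicator of the kept registers this computes conditional states. *)
Lemma avg_x1 (f : U -> V1 -> V2 -> X2 -> S) F :
  avg j (fun u v1 v2 x1 x2 => f u v1 v2 x2 * F u v1 v2 x1 x2) =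
  avg j (fun u v1 v2 x1 x2 => f u v1 v2 x2 * \sum_y1 j (kx1 u v1 y1) * F u v1 v2 y1 x2).
Proof.
apply: eq_bigr => u _; congr (_ * _); apply: eq_bigr => v1 _; congr (_ * _).
apply: eq_bigr => v2 _; congr (_ * _).
rewrite -[RHS]mulr_suml -rmorph_sum (hkx1 u v1).2 rmorph1 mul1r.
under eq_bigr do rewrite mulr_sumr.
rewrite exchange_big /=; apply: eq_bigr => x2 _.
by rewrite !mulr_sumr; apply: eq_bigr => x1 _; ring.
Qed.

Lemma avg_x2 (f : U -> V1 -> V2 -> X1 -> S) F :
  avg j (fun u v1 v2 x1 x2 => f u v1 v2 x1 * F u v1 v2 x1 x2) =
  avg j (fun u v1 v2 x1 x2 => f u v1 v2 x1 * \sum_y2 j (kx2 u v2 y2) * F u v1 v2 x1 y2).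
Proof.
apply: eq_bigr => u _; congr (_ * _); apply: eq_bigr => v1 _; congr (_ * _).
apply: eq_bigr => v2 _; congr (_ * _); apply: eq_bigr => x1 _; congr (_ * _).
rewrite -[RHS]mulr_suml -rmorph_sum (hkx2 u v2).2 rmorph1 mul1r mulr_sumr.
by apply: eq_bigr => x2 _; ring.
Qed.

Lemma wsum1 (J : finType) (k : J -> R) c : distr k -> \sum_x j (k x) * c = c.
Proof. by move=> [_ k1']; rewrite -mulr_suml -rmorph_sum k1' rmorph1 mul1r. Qed.

Lemma avg_v1 (f : U -> V2 -> X2 -> S) F :
  avg j (fun u v1 v2 x1 x2 => f u v2 x2 * F u v1 v2 x2) =
  avg j (fun u v1 v2 x1 x2 => f u v2 x2 * \sum_w1 j (k1 u w1) * F u w1 v2 x2).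
Proof.
apply: eq_bigr => u _; congr (_ * _).
under eq_bigr => v1 _ do under eq_bigr => v2 _ do rewrite wsum1 //.
under [RHS]eq_bigr => v1 _ do under eq_bigr => v2 _ do rewrite wsum1 //.
rewrite [RHS]wsum1 //; under eq_bigr do rewrite mulr_sumr.
rewrite exchange_big /=; apply: eq_bigr => v2 _.
rewrite mulr_sumr; under eq_bigr do rewrite !mulr_sumr.
rewrite exchange_big /=; apply: eq_bigr => x2 _; rewrite !mulr_sumr.
by apply: eq_bigr => v1 _; ring.
Qed.

Lemma avg_v2 (f : U -> V1 -> X1 -> S) F :
  avg j (fun u v1 v2 x1 x2 => f u v1 x1 * F u v1 v2 x1) =
  avg j (fun u v1 v2 x1 x2 => f u v1 x1 * \sum_w2 j (k2 u w2) * F u v1 w2 x1).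
Proof.
apply: eq_bigr => u _; congr (_ * _); apply: eq_bigr => v1 _; congr (_ * _).
under eq_bigr => v2 _ do under eq_bigr => x1 _ do rewrite wsum1 //.
under [RHS]eq_bigr => v2 _ do under eq_bigr => x1 _ do rewrite wsum1 //.
rewrite [RHS]wsum1 //; under eq_bigr do rewrite mulr_sumr.
rewrite exchange_big /=; apply: eq_bigr => x1 _; rewrite !mulr_sumr.
by apply: eq_bigr => v2 _; ring.
Qed.

Lemma avg_const c : avg j (fun u v1 v2 x1 x2 => c) = c.
Proof.
rewrite /avg -[RHS](wsum1 _ hpu); apply: eq_bigr => u _; congr (_ * _).
rewrite -[RHS](wsum1 _ (hk1 u)); apply: eq_bigr => v1 _; congr (_ * _).
rewrite -[RHS](wsum1 _ (hk2 u)); apply: eq_bigr => v2 _; congr (_ * _).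
rewrite -[RHS](wsum1 _ (hkx1 u v1)); apply: eq_bigr => x1 _; congr (_ * _).
by rewrite wsum1.
Qed.
End AvgTheory.

Definition rhoV1X2 u v1 x2 := mixop (kx1 u v1) (fun x1 => W x1 x2).
Definition rhoV2X1 u v2 x1 := mixop (kx2 u v2) (W x1).
Definition rhoX2 u x2 := mixop (k1 u) (fun v1 => rhoV1X2 u v1 x2).
Definition rhoX1 u x1 := mixop (k2 u) (fun v2 => rhoV2X1 u v2 x1).
Definition rhoV1V2 u v1 v2 := mixop (kx1 u v1) (fun x1 => rhoV2X1 u v2 x1).
Definition rho_out := mixop pu (fun u => mixop (k1 u) (fun v1 => mixop (k2 u) (rhoV1V2 u v1))).

Lemma density_rhoV1X2 u v1 x2 : density (rhoV1X2 u v1 x2).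
Proof. by apply: density_mix. Qed.
Lemma density_rhoV2X1 u v2 x1 : density (rhoV2X1 u v2 x1).
Proof. by apply: density_mix. Qed.
Lemma density_rhoX2 u x2 : density (rhoX2 u x2).
Proof. by apply: density_mix => // v1; exact: density_rhoV1X2. Qed.
Lemma density_rhoX1 u x1 : density (rhoX1 u x1).
Proof. by apply: density_mix => // v1; exact: density_rhoV2X1. Qed.
Lemma density_rhoV1V2 u v1 v2 : density (rhoV1V2 u v1 v2).
Proof. by apply: density_mix => // x1; exact: density_rhoV2X1. Qed.
Lemma density_rho_out : density rho_out.
Proof. by do 3 apply: density_mix => // ?; exact: density_rhoV1V2. Qed.

Local Notation avgR := (avg (@idfun R)).
Definition Wcl (c : cl) : op R sys := let: (u, v1, x1, v2, x2) := c in W x1 x2.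

(** These are entropies conditional on [U] and the variables in the subscript: of the whole output
    for the first four, of one outcome register for those with [Z1] or [Z2] in front. *)
Definition HX1X2 := avgR (fun u v1 v2 x1 x2 => vN (W x1 x2)).
Definition HV2X1 := avgR (fun u v1 v2 x1 x2 => vN (rhoV2X1 u v2 x1)).
Definition HV1X2 := avgR (fun u v1 v2 x1 x2 => vN (rhoV1X2 u v1 x2)).
Definition HV1V2 := avgR (fun u v1 v2 x1 x2 => vN (rhoV1V2 u v1 v2)).
Definition HZ2_V1X2 := avgR (fun u v1 v2 x1 x2 => outcome_entropy (fun y => y.2) (rhoV1X2 u v1 x2)).
Definition HZ2_X2 := avgR (fun u v1 v2 x1 x2 => outcome_entropy (fun y => y.2) (rhoX2 u x2)).
Definition HZ1_V2X1 := avgR (fun u v1 v2 x1 x2 => outcome_entropy (fun y => y.1.2) (rhoV2X1 u v2 x1)).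
Definition HZ1_X1 := avgR (fun u v1 v2 x1 x2 => outcome_entropy (fun y => y.1.2) (rhoX1 u x1)).

Lemma avg_le F G : (forall u v1 v2 x1 x2, F u v1 v2 x1 x2 <= G u v1 v2 x1 x2) -> avgR F <= avgR G.
Proof.
move=> h; rewrite /avg /=; apply: ler_sum => u _; apply: ler_wpM2l; first by case: hpu.
apply: ler_sum => v1 _; apply: ler_wpM2l; first by case: (hk1 u).
apply: ler_sum => v2 _; apply: ler_wpM2l; first by case: (hk2 u).
apply: ler_sum => x1 _; apply: ler_wpM2l; first by case: (hkx1 u v1).
by apply: ler_sum => x2 _; apply: ler_wpM2l => //; case: (hkx2 u v2).
Qed.

Lemma avg_sub F G : avgR F - avgR G = avgR (fun u v1 v2 x1 x2 => F u v1 v2 x1 x2 - G u v1 v2 x1 x2).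
Proof.
have le (J : finType) (p f g : J -> R) : \sum_x p x * (f x - g x) = \sum_x p x * f x - \sum_x p x * g x.
  by rewrite -sumrB; apply: eq_bigr => x _; rewrite mulrBr.
rewrite /avg /= -le; apply: eq_bigr => u _; congr (_ * _).
rewrite -le; apply: eq_bigr => v1 _; congr (_ * _).
rewrite -le; apply: eq_bigr => v2 _; congr (_ * _).
rewrite -le; apply: eq_bigr => x1 _; congr (_ * _).
by rewrite -le.
Qed.

Lemma avg_concave (r : U -> V1 -> V2 -> X1 -> X2 -> op R sys) : (forall u v1 v2 x1 x2, density (r u v1 v2 x1 x2)) ->
  avgR (fun u v1 v2 x1 x2 => vN (r u v1 v2 x1 x2)) <= vN (fun a b => avg rc (fun u v1 v2 x1 x2 => r u v1 v2 x1 x2 a b)).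
Proof.
move=> dr; pose r4 u v1 v2 x1 := mixop (kx2 u v2) (r u v1 v2 x1).
pose r3 u v1 v2 := mixop (kx1 u v1) (r4 u v1 v2).
pose r2 u v1 := mixop (k2 u) (r3 u v1).
pose r1 u := mixop (k1 u) (r2 u).
have d4 u v1 v2 x1 : density (r4 u v1 v2 x1) by apply: density_mix.
have d3 u v1 v2 : density (r3 u v1 v2) by apply: density_mix.
have d2 u v1 : density (r2 u v1) by apply: density_mix.
have d1 u : density (r1 u) by apply: density_mix.
have le (J : finType) (p : J -> R) (f : J -> R) (q : J -> op R sys) : distr p ->
    (forall x, density (q x)) -> (forall x, f x <= vN (q x)) -> \sum_x p x * f x <= vN (mixop p q).
  move=> hp hq hf; apply: le_trans (vN_concave hp hq); apply: ler_sum => x _.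
  by apply: ler_wpM2l; [case: hp => ->|].
rewrite /avg /=; apply: (le _ _ _ r1) => // u; apply: (le _ _ _ (r2 u)) => // v1; apply: (le _ _ _ (r3 u v1)) => // v2.
by apply: (le _ _ _ (r4 u v1 v2)) => // x1; apply: le.
Qed.

Lemma rhoV1V2C u v1 v2 : rhoV1V2 u v1 v2 = mixop (kx2 u v2) (rhoV1X2 u v1).
Proof.
apply: opP => a b; rewrite /rhoV1V2 /rhoV1X2 /rhoV2X1 /mixop; under eq_bigr do rewrite mulr_sumr.
rewrite exchange_big /=; apply: eq_bigr => x2 _; rewrite mulr_sumr.
by apply: eq_bigr => x1 _; ring.
Qed.

Let one_avg (j : {rmorphism R -> R}) F : avg j F = avg j (fun u v1 v2 x1 x2 => 1 * F u v1 v2 x1 x2).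
Proof. by congr avg; do 5 apply/funext => ?; rewrite mul1r. Qed.

Lemma HV2X1_le : HV2X1 <= HV1V2.
Proof.
rewrite /HV2X1 one_avg (avg_x1 _ (fun _ _ _ _ => 1)); apply: avg_le => u v1 v2 x1 x2; rewrite mul1r.
by apply: vN_concave => [|y]; [exact: hkx1|exact: density_rhoV2X1].
Qed.
Lemma HV1X2_le : HV1X2 <= HV1V2.
Proof.
rewrite /HV1X2 one_avg (avg_x2 _ (fun _ _ _ _ => 1)); apply: avg_le => u v1 v2 x1 x2; rewrite mul1r rhoV1V2C.
by apply: vN_concave => [|y]; [exact: hkx2|exact: density_rhoV1X2].
Qed.
Lemma HX1X2_le_V1X2 : HX1X2 <= HV1X2.
Proof.
rewrite /HX1X2 one_avg (avg_x1 _ (fun _ _ _ _ => 1)); apply: avg_le => u v1 v2 x1 x2; rewrite mul1r.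
by apply: vN_concave => [|y]; [exact: hkx1|exact: dW].
Qed.
Lemma HX1X2_le_V2X1 : HX1X2 <= HV2X1.
Proof.
rewrite /HX1X2 one_avg (avg_x2 _ (fun _ _ _ _ => 1)); apply: avg_le => u v1 v2 x1 x2; rewrite mul1r.
by apply: vN_concave => [|y]; [exact: hkx2|exact: dW].
Qed.
Lemma HZ2_le : HZ2_V1X2 <= HZ2_X2.
Proof.
rewrite /HZ2_V1X2 one_avg (avg_v1 _ (fun _ _ _ => 1)); apply: avg_le => u v1 v2 x1 x2; rewrite mul1r.
by apply: outcome_entropy_concave => [|y]; [exact: hk1|exact: density_rhoV1X2].
Qed.
Lemma HZ1_le : HZ1_V2X1 <= HZ1_X1.
Proof.
rewrite /HZ1_V2X1 one_avg (avg_v2 _ (fun _ _ _ => 1)); apply: avg_le => u v1 v2 x1 x2; rewrite mul1r.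
by apply: outcome_entropy_concave => [|y]; [exact: hk2|exact: density_rhoV2X1].
Qed.

Let one_avgC F : avg rc F = avg rc (fun u v1 v2 x1 x2 => 1 * F u v1 v2 x1 x2).
Proof. by congr avg; do 5 apply/funext => ?; rewrite mul1r. Qed.

Lemma sB_avg : rho_out = fun a b => avg rc (fun u v1 v2 x1 x2 => W x1 x2 a b).
Proof. by []. Qed.
Lemma sB_avg0 : rho_out = fun a b => avg rc (fun u v1 v2 x1 x2 => rhoV1V2 u v1 v2 a b).
Proof.
rewrite sB_avg; apply: opP => a b.
rewrite one_avgC (avg_x2 _ (fun _ _ _ _ => 1)) (avg_x1 _ (fun _ _ _ _ => 1)).
by congr avg; do 5 apply/funext => ?; rewrite mul1r.
Qed.
Lemma sB_avg1 : rho_out = fun a b => avg rc (fun u v1 v2 x1 x2 => rhoX2 u x2 a b).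
Proof.
rewrite sB_avg; apply: opP => a b.
rewrite one_avgC (avg_x1 _ (fun _ _ _ _ => 1)) (avg_v1 _ (fun _ _ _ => 1)).
by congr avg; do 5 apply/funext => ?; rewrite mul1r.
Qed.
Lemma sB_avg2 : rho_out = fun a b => avg rc (fun u v1 v2 x1 x2 => rhoX1 u x1 a b).
Proof.
rewrite sB_avg; apply: opP => a b.
rewrite one_avgC (avg_x2 _ (fun _ _ _ _ => 1)) (avg_v2 _ (fun _ _ _ => 1)).
by congr avg; do 5 apply/funext => ?; rewrite mul1r.
Qed.

Lemma HV1V2_le : HV1V2 <= vN rho_out.
Proof. by rewrite sB_avg0; apply: (avg_concave (r := fun u v1 v2 x1 x2 => rhoV1V2 u v1 v2)) => *; exact: density_rhoV1V2. Qed.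

(** Given [(U, X2)], the entropy of the output is that of [Z2] plus the entropy conditional on [Z2],
    and the latter decreases when [V1] is also given. In the end this bounds the rate of sender 1
    alone by the last sum-rate bound, which is what allows a negative second rate to be replaced by
    zero. *)
Lemma chain_Z2 : (HZ2_X2 - HZ2_V1X2) + HV1X2 <= vN rho_out.
Proof.
have h : HV1X2 - HZ2_V1X2 <= avgR (fun u v1 v2 x1 x2 => vN (rhoX2 u x2)) - HZ2_X2.
  rewrite /HV1X2 /HZ2_V1X2 [leLHS]avg_sub /HZ2_X2 [leRHS]avg_sub; pose F u v1 (v2 : V2) x2 := vN (rhoV1X2 u v1 x2) - outcome_entropy (fun y => y.2) (rhoV1X2 u v1 x2).
  rewrite [leLHS](etrans (one_avg _ _) (avg_v1 _ (fun _ _ _ => 1) F)).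
  apply: avg_le => u v1 v2 x1 x2; rewrite mul1r /F.
  have hb : bijective (fun p : Z2 * (Bb * Z1) => (p.2.1, p.2.2, p.1) : sys).
    by exists (fun y => (y.2, (y.1.1, y.1.2))) => [[z [b z1]]|[[b z1] z2]].
  apply: (block_concave (w := k1 u) hb _ _ (hk1 u) (fun v => density_rhoV1X2 u v x2)) => //.
  move=> v y y' /negbTE hy; rewrite /rhoV1X2 /mixop big1 // => z _; by rewrite zW ?mulr0 // hy andbF.
have : avgR (fun u v1 v2 x1 x2 => vN (rhoX2 u x2)) <= vN rho_out.
  by rewrite sB_avg1; apply: (avg_concave (r := fun u v1 v2 x1 x2 => rhoX2 u x2)) => *; exact: density_rhoX2.
lra.
Qed.

Lemma chain_Z1 : (HZ1_X1 - HZ1_V2X1) + HV2X1 <= vN rho_out.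
Proof.
have h : HV2X1 - HZ1_V2X1 <= avgR (fun u v1 v2 x1 x2 => vN (rhoX1 u x1)) - HZ1_X1.
  rewrite /HV2X1 /HZ1_V2X1 [leLHS]avg_sub /HZ1_X1 [leRHS]avg_sub; pose F u (v1 : V1) v2 x1 := vN (rhoV2X1 u v2 x1) - outcome_entropy (fun y => y.1.2) (rhoV2X1 u v2 x1).
  rewrite [leLHS](etrans (one_avg _ _) (avg_v2 _ (fun _ _ _ => 1) F)).
  apply: avg_le => u v1 v2 x1 x2; rewrite mul1r /F.
  have hb : bijective (fun p : Z1 * (Bb * Z2) => (p.2.1, p.1, p.2.2) : sys).
    by exists (fun y => (y.1.2, (y.1.1, y.2))) => [[z [b z1]]|[[b z1] z2]].
  apply: (block_concave (w := k2 u) hb _ _ (hk2 u) (fun v => density_rhoV2X1 u v x1)) => //.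
  move=> v y y' /negbTE hy; rewrite /rhoV2X1 /mixop big1 // => z _; by rewrite zW ?mulr0 // hy.
have : avgR (fun u v1 v2 x1 x2 => vN (rhoX1 u x1)) <= vN rho_out.
  by rewrite sB_avg2; apply: (avg_concave (r := fun u v1 v2 x1 x2 => rhoX1 u x1)) => *; exact: density_rhoX1.
lra.
Qed.

Variable w : op R reg.
Hypothesis hw : forall c b z1 z2 c' b' z1' z2',
  w (c, b, z1, z2) (c', b', z1', z2') = (c == c')%:R * (rc (Pcl c) * Wcl c (b, z1, z2) (b', z1', z2')).

Lemma Pcl_ge0 c : 0 <= Pcl c.
Proof.
case: c => [[[[u v1] x1] v2] x2] /=; have ge0 (T : finType) (p : T -> R) t : distr p -> 0 <= p t.
  by move=> [h _]; exact: h.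
by rewrite !mulr_ge0 // ge0.
Qed.
Lemma dWcl c : density (Wcl c).
Proof. by case: c => [[[[u v1] x1] v2] x2]; exact: dW. Qed.
Lemma zWcl c y y' : (y.1.2 == y'.1.2) && (y.2 == y'.2) = false -> Wcl c y y' = 0.
Proof. by case: c => [[[[u v1] x1] v2] x2]; exact: zW. Qed.

Definition rcl (T : Type) (r : U -> V1 -> V2 -> X1 -> X2 -> T) (c : cl) : T :=
  let: (u, v1, x1, v2, x2) := c in r u v1 v2 x1 x2.

Lemma mixop_cond_weight b0 b1 b2 b3 b4 s (r : U -> V1 -> V2 -> X1 -> X2 -> op R sys) :
  mixop (@cond_weight _ _ _ _ _ _ Pcl b0 b1 b2 b3 b4 s) (rcl r) = fun a b =>
  avg rc (fun u v1 v2 x1 x2 => (class_flags b0 b1 b2 b3 b4 (u, v1, x1, v2, x2) == s)%:R * r u v1 v2 x1 x2 a b).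
Proof.
apply: opP => a b; rewrite /mixop -(sum_cl rc (fun c => (class_flags b0 b1 b2 b3 b4 c == s)%:R * rcl r c a b)).
by apply: eq_bigr => c _; rewrite /cond_weight rmorphM /= rmorph_nat; ring.
Qed.

Section Mask.
Variables (b0 b1 b2 b3 b4 : bool) (r : U -> V1 -> V2 -> X1 -> X2 -> op R sys).
Hypotheses (dr : forall u v1 v2 x1 x2, density (r u v1 v2 x1 x2))
  (rinv : forall c c', class_flags b0 b1 b2 b3 b4 c = class_flags b0 b1 b2 b3 b4 c' -> rcl r c = rcl r c')
  (ravg : forall s a b,
    avg rc (fun u v1 v2 x1 x2 => (class_flags b0 b1 b2 b3 b4 (u, v1, x1, v2, x2) == s)%:R * W x1 x2 a b) =
    avg rc (fun u v1 v2 x1 x2 => (class_flags b0 b1 b2 b3 b4 (u, v1, x1, v2, x2) == s)%:R * r u v1 v2 x1 x2 a b)).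

Let drcl c : density (rcl r c). Proof. by case: c => [[[[u v1] x1] v2] x2]; exact: dr. Qed.
Let cond_op_avg s : cond_op Pcl Wcl s = mixop (@cond_weight _ _ _ _ _ _ Pcl b0 b1 b2 b3 b4 s) (rcl r).
Proof.
rewrite mixop_cond_weight; apply: etrans (mixop_cond_weight s (fun u v1 v2 x1 x2 => W x1 x2)) _.
by apply: opP => a b; exact: ravg.
Qed.

Lemma entropy_mask : flags_entropy w b0 b1 b2 b3 b4 true true true - flags_entropy w b0 b1 b2 b3 b4 false false false =
  avgR (fun u v1 v2 x1 x2 => vN (r u v1 v2 x1 x2)).
Proof.
rewrite (cond_entropy_quantum Pcl_ge0 dWcl zWcl hw drcl rinv cond_op_avg).
exact: (sum_cl (@idfun R) (fun c => vN (rcl r c))).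
Qed.

Lemma outcome_entropy_mask b6 b7 : flags_entropy w b0 b1 b2 b3 b4 false b6 b7 - flags_entropy w b0 b1 b2 b3 b4 false false false =
  avgR (fun u v1 v2 x1 x2 => outcome_entropy (@selected_outcomes _ _ _ b6 b7) (r u v1 v2 x1 x2)).
Proof.
rewrite (cond_entropy_classical Pcl_ge0 dWcl zWcl hw drcl rinv cond_op_avg).
exact: (sum_cl (@idfun R) (fun c => outcome_entropy (@selected_outcomes _ _ _ b6 b7) (rcl r c))).
Qed.
End Mask.

Lemma outcome_entropy_Z2 (r : op R sys) : outcome_entropy (@selected_outcomes Bb Z1 Z2 false true) r = outcome_entropy (fun y => y.2) r.
Proof.
rewrite /outcome_entropy -(pair_bigA _ (fun (a : unit) z => etaf (law (@selected_outcomes Bb Z1 Z2 false true) r (a, z)))) /=.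
by rewrite (big_pred1 tt) => [|[]//].
Qed.
Lemma outcome_entropy_Z1 (r : op R sys) : outcome_entropy (@selected_outcomes Bb Z1 Z2 true false) r = outcome_entropy (fun y => y.1.2) r.
Proof.
rewrite /outcome_entropy -(pair_bigA _ (fun z (a : unit) => etaf (law (@selected_outcomes Bb Z1 Z2 true false) r (z, a)))) /=.
apply: eq_bigr => z _; rewrite (big_pred1 tt) => [|[]//]; congr etaf; rewrite /law /prb.
by apply: eq_bigl => y; rewrite /selected_outcomes /= xpair_eqE andbT.
Qed.

(** The output depends on [x1] and [x2] alone, so the flags of [u], [v1] and [v2] are free; one
    lemma supplies the subtracted entropy of four informations. *)
Lemma entropy_X1X2 b0 b1 b3 : flags_entropy w b0 b1 true b3 true true true true - flags_entropy w b0 b1 true b3 true false false false = HX1X2.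
Proof.
apply: (entropy_mask (fun _ _ _ _ _ => dW _ _)) => //.
by move=> [[[[u v1] x1] v2] x2] [[[[u' v1'] x1'] v2'] x2'] [_ _ -> _ ->].
Qed.

Lemma avg_W_x1 (f : U -> V1 -> V2 -> X2 -> C) a b :
  avg rc (fun u v1 v2 x1 x2 => f u v1 v2 x2 * W x1 x2 a b) =
  avg rc (fun u v1 v2 x1 x2 => f u v1 v2 x2 * rhoV1X2 u v1 x2 a b).
Proof. exact: avg_x1. Qed.
Lemma avg_W_x2 (f : U -> V1 -> V2 -> X1 -> C) a b :
  avg rc (fun u v1 v2 x1 x2 => f u v1 v2 x1 * W x1 x2 a b) =
  avg rc (fun u v1 v2 x1 x2 => f u v1 v2 x1 * rhoV2X1 u v2 x1 a b).
Proof. exact: avg_x2. Qed.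

Section Masks.
Let r1 u (v1 : V1) (v2 : V2) (x1 : X1) x2 := rhoV1X2 u v1 x2.
Let inv1 c c' : class_flags true true false false true c = class_flags true true false false true c' -> rcl r1 c = rcl r1 c'.
Proof. by move: c c' => [[[[u v1] x1] v2] x2] [[[[u' v1'] x1'] v2'] x2'] [-> -> ->]. Qed.
Let avg1 s a b :
    avg rc (fun u v1 v2 x1 x2 => (class_flags true true false false true (u, v1, x1, v2, x2) == s)%:R * W x1 x2 a b) =
    avg rc (fun u v1 v2 x1 x2 => (class_flags true true false false true (u, v1, x1, v2, x2) == s)%:R * r1 u v1 v2 x1 x2 a b).
Proof. exact: (avg_W_x1 (fun u v1 v2 x2 => ((u, v1, tt, tt, x2) == s)%:R) a b). Qed.
Lemma entropy_V1X2 : flags_entropy w true true false false true true true true - flags_entropy w true true false false true false false false = HV1X2.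
Proof. exact: (entropy_mask (fun _ _ _ _ _ => density_rhoV1X2 _ _ _) inv1 avg1). Qed.
Lemma outcome_V1X2 : flags_entropy w true true false false true false false true - flags_entropy w true true false false true false false false = HZ2_V1X2.
Proof.
rewrite (outcome_entropy_mask (fun _ _ _ _ _ => density_rhoV1X2 _ _ _) inv1 avg1); congr avgR.
by do 5 apply/funext => ?; rewrite outcome_entropy_Z2.
Qed.

Let r2 u (v1 : V1) (v2 : V2) (x1 : X1) (x2 : X2) := rhoV2X1 u v2 x1.
Let inv2 c c' : class_flags true false true true false c = class_flags true false true true false c' -> rcl r2 c = rcl r2 c'.
Proof. by move: c c' => [[[[u v1] x1] v2] x2] [[[[u' v1'] x1'] v2'] x2'] [-> -> ->]. Qed.
Let avg2 s a b :
    avg rc (fun u v1 v2 x1 x2 => (class_flags true false true true false (u, v1, x1, v2, x2) == s)%:R * W x1 x2 a b) =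
    avg rc (fun u v1 v2 x1 x2 => (class_flags true false true true false (u, v1, x1, v2, x2) == s)%:R * r2 u v1 v2 x1 x2 a b).
Proof. exact: (avg_W_x2 (fun u v1 v2 x1 => ((u, tt, x1, v2, tt) == s)%:R) a b). Qed.
Lemma entropy_V2X1 : flags_entropy w true false true true false true true true - flags_entropy w true false true true false false false false = HV2X1.
Proof. exact: (entropy_mask (fun _ _ _ _ _ => density_rhoV2X1 _ _ _) inv2 avg2). Qed.
Lemma outcome_V2X1 : flags_entropy w true false true true false false true false - flags_entropy w true false true true false false false false = HZ1_V2X1.
Proof.
rewrite (outcome_entropy_mask (fun _ _ _ _ _ => density_rhoV2X1 _ _ _) inv2 avg2); congr avgR.
by do 5 apply/funext => ?; rewrite outcome_entropy_Z1.
Qed.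

Let r0 u (v1 : V1) (v2 : V2) (x1 : X1) (x2 : X2) := rhoV1V2 u v1 v2.
Lemma entropy_V1V2 : flags_entropy w true true false true false true true true - flags_entropy w true true false true false false false false = HV1V2.
Proof.
apply: (entropy_mask (r := r0) (fun _ _ _ _ _ => density_rhoV1V2 _ _ _)).
  by move=> [[[[u v1] x1] v2] x2] [[[[u' v1'] x1'] v2'] x2'] [-> -> ->].
move=> s a b; apply: etrans (avg_W_x2 (fun u v1 v2 x1 => ((u, v1, tt, v2, tt) == s)%:R) a b) _.
exact: (avg_x1 _ (fun u v1 v2 x2 => ((u, v1, tt, v2, tt) == s)%:R) (fun u v1 v2 x1 x2 => rhoV2X1 u v2 x1 a b)).
Qed.

Let r1' u (v1 : V1) (v2 : V2) (x1 : X1) x2 := rhoX2 u x2.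
Lemma outcome_X2 : flags_entropy w true false false false true false false true - flags_entropy w true false false false true false false false = HZ2_X2.
Proof.
rewrite (outcome_entropy_mask (r := r1') (fun _ _ _ _ _ => density_rhoX2 _ _)); first by congr avgR; do 5 apply/funext => ?; rewrite outcome_entropy_Z2.
  by move=> [[[[u v1] x1] v2] x2] [[[[u' v1'] x1'] v2'] x2'] [-> ->].
move=> s a b; apply: etrans (avg_W_x1 (fun u v1 v2 x2 => ((u, tt, tt, tt, x2) == s)%:R) a b) _.
exact: (avg_v1 _ (fun u v2 x2 => ((u, tt, tt, tt, x2) == s)%:R) (fun u v1 v2 x2 => rhoV1X2 u v1 x2 a b)).
Qed.

Let r2' u (v1 : V1) (v2 : V2) (x1 : X1) (x2 : X2) := rhoX1 u x1.
Lemma outcome_X1 : flags_entropy w true false true false false false true false - flags_entropy w true false true false false false false false = HZ1_X1.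
Proof.
rewrite (outcome_entropy_mask (r := r2') (fun _ _ _ _ _ => density_rhoX1 _ _)); first by congr avgR; do 5 apply/funext => ?; rewrite outcome_entropy_Z1.
  by move=> [[[[u v1] x1] v2] x2] [[[[u' v1'] x1'] v2'] x2'] [-> ->].
move=> s a b; apply: etrans (avg_W_x2 (fun u v1 v2 x1 => ((u, tt, x1, tt, tt) == s)%:R) a b) _.
exact: (avg_v2 _ (fun u v1 x1 => ((u, tt, x1, tt, tt) == s)%:R) (fun u v1 v2 x1 => rhoV2X1 u v2 x1 a b)).
Qed.

Lemma entropy_out : flags_entropy w false false false false false true true true - flags_entropy w false false false false false false false false = vN rho_out.
Proof.
rewrite (entropy_mask (r := fun _ _ _ _ _ => rho_out) (fun _ _ _ _ _ => density_rho_out)); first exact: avg_const.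
  by move=> [[[[u v1] x1] v2] x2] [[[[u' v1'] x1'] v2'] x2'].
move=> s a b; have -> : s = (tt, tt, tt, tt, tt) by case: s => [[[[[] []] []] []] []].
have e1 u v1 v2 x1 x2 : (class_flags false false false false false (u, v1, x1, v2, x2) == (tt, tt, tt, tt, tt))%:R = 1 :> C by [].
transitivity (avg rc (fun u v1 v2 x1 x2 => W x1 x2 a b)).
  by congr avg; do 5 apply/funext => ?; rewrite e1 mul1r.
transitivity (rho_out a b); first by [].
rewrite -[LHS](avg_const rc); congr avg; do 5 apply/funext => ?; by rewrite e1 mul1r.
Qed.
End Masks.

(** With the four entropies regrouped as [(H(BC) - H(C)) - (H(ABC) - H(AC))], each information is a
    difference of two conditional entropies computed above. *)
Lemma CMI_X1 : CMI w [:: 2%N] [:: 5%N; 6%N; 7%N] [:: 0%N; 1%N; 4%N] = HV1X2 - HX1X2.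
Proof. by rewrite -entropy_V1X2 -(entropy_X1X2 true true false) /CMI !Hsub_flags /=; ring. Qed.
Lemma CMI_X2 : CMI w [:: 4%N] [:: 5%N; 6%N; 7%N] [:: 0%N; 3%N; 2%N] = HV2X1 - HX1X2.
Proof. by rewrite -entropy_V2X1 -(entropy_X1X2 true false true) /CMI !Hsub_flags /=; ring. Qed.
Lemma CMI_X1X2 : CMI w [:: 2%N; 4%N] [:: 5%N; 6%N; 7%N] [:: 0%N; 1%N; 3%N] = HV1V2 - HX1X2.
Proof. by rewrite -entropy_V1V2 -(entropy_X1X2 true true true) /CMI !Hsub_flags /=; ring. Qed.
Lemma CMI_X1X2_out : CMI w [:: 2%N; 4%N] [:: 5%N; 6%N; 7%N] [::] = vN rho_out - HX1X2.
Proof. by rewrite -entropy_out -(entropy_X1X2 false false false) /CMI !Hsub_flags /=; ring. Qed.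
Lemma CMI_V1 s : s = [:: 0%N; 4%N] \/ s = [:: 4%N; 0%N] -> CMI w [:: 1%N] [:: 7%N] s = HZ2_X2 - HZ2_V1X2.
Proof. by rewrite -outcome_V1X2 -outcome_X2 => -[] ->; rewrite /CMI !Hsub_flags /=; ring. Qed.
Lemma CMI_V2 s : s = [:: 0%N; 2%N] \/ s = [:: 2%N; 0%N] -> CMI w [:: 3%N] [:: 6%N] s = HZ1_X1 - HZ1_V2X1.
Proof. by rewrite -outcome_V2X1 -outcome_X1 => -[] ->; rewrite /CMI !Hsub_flags /=; ring. Qed.
End LetterEntropies.

(** * Rate splitting *)

Section RateSplitting.
Variable R : realType.
Local Notation C := R[i].
Local Notation rc := (real_complex R).

Lemma sum_option (X : finType) (V : nmodType) (F : option X -> V) :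
  \sum_xa F xa = F None + \sum_x F (Some x).
Proof.
by rewrite -big_enum /= enumT [Finite.enum]unlock /= big_cons big_map.
Qed.

Lemma wsum_cst (J : finType) (p : J -> R) c : distr p -> \sum_x p x * c = c.
Proof. exact: (wsum1 (@idfun R)). Qed.

Variables (U V1 X1 V2 X2 Bb Z1 Z2 : finType).
Local Notation sys := (Bb * Z1 * Z2)%type.
Variables (pu : U -> R) (k1 : U -> V1 -> R) (k2 : U -> V2 -> R)
  (kx1 : U -> V1 -> X1 -> R) (kx2 : U -> V2 -> X2 -> R) (W : X1 -> X2 -> op R sys) (lam : R).
Hypotheses (hpu : distr pu) (hk1 : forall u, distr (k1 u)) (hk2 : forall u, distr (k2 u))
  (hkx1 : forall u v1, distr (kx1 u v1)) (hkx2 : forall u v2, distr (kx2 u v2))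
  (lam01 : 0 <= lam <= 1).

(* [XA = option X1] reveals [x1] with probability [lam] and nothing otherwise. *)
Definition ksplit u v1 (xa : option X1) : R := if xa is Some x then lam * kx1 u v1 x else 1 - lam.
Definition kjoin u v1 (xa : option X1) : X1 -> R :=
  if xa is Some x then fun y => (y == x)%:R else kx1 u v1.

Lemma distr_ksplit u v1 : distr (ksplit u v1).
Proof.
have /andP[l0 l1] := lam01; split.
  by move=> [x|] /=; [apply: mulr_ge0 => //; case: (hkx1 u v1)|rewrite subr_ge0].
by rewrite sum_option /= -mulr_sumr (hkx1 u v1).2; ring.
Qed.
Lemma distr_kjoin u v1 xa : distr (kjoin u v1 xa).
Proof.
case: xa => [x|] //=; split=> [y|]; first exact: ler0n.
by rewrite (bigD1 x) //= eqxx big1 ?addr0 // => y /negbTE ->.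
Qed.

Local Notation rhoV1X2 := (rhoV1X2 kx1 W).
Local Notation rhoV2X1 := (rhoV2X1 kx2 W).
Local Notation rhoV1V2 := (rhoV1V2 kx1 kx2 W).

Lemma mixop_dirac (I J : finType) (x : J) (r : J -> op R I) : mixop (fun y => (y == x)%:R) r = r x.
Proof.
apply: opP => a b; rewrite /mixop (bigD1 x) //= eqxx rmorph1 mul1r big1 ?addr0 // => y /negbTE ->.
by rewrite rmorph0 mul0r.
Qed.

Lemma mixop_split (I : finType) u v1 (r : option X1 -> op R I) : mixop (ksplit u v1) r =
  fun a b => rc lam * mixop (kx1 u v1) (fun x => r (Some x)) a b + rc (1 - lam) * r None a b.
Proof.
apply: opP => a b; rewrite /mixop sum_option /= addrC; congr (_ + _); rewrite mulr_sumr.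
by apply: eq_bigr => x _; rewrite rmorphM /= mulrA.
Qed.

Lemma m3_split u v1 xa x2 : m3 kjoin W u v1 xa x2 = if xa is Some x1 then W x1 x2 else rhoV1X2 u v1 x2.
Proof. by case: xa => [x1|] //; exact: mixop_dirac. Qed.
Lemma m2_split u v1 v2 xa : m2 kjoin kx2 W u v1 v2 xa = if xa is Some x1 then rhoV2X1 u v2 x1 else rhoV1V2 u v1 v2.
Proof.
rewrite /m2; case: xa => [x1|] /=.
  by congr mixop; apply/funext => x2; rewrite m3_split.
by rewrite rhoV1V2C; congr mixop; apply/funext => x2; rewrite m3_split.
Qed.
Lemma split_same (I : finType) (X : op R I) : (fun a b => rc lam * X a b + rc (1 - lam) * X a b) = X.
Proof. by apply: opP => a b; rewrite -mulrDl -rmorphD /= addrC subrK mul1r. Qed.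
Lemma m1_split u v1 v2 : m1 ksplit kjoin kx2 W u v1 v2 = rhoV1V2 u v1 v2.
Proof.
rewrite /m1 mixop_split -[RHS]split_same; apply: opP => a b.
by rewrite m2_split; congr (_ * _ a b + _); congr mixop; apply/funext => x; rewrite m2_split.
Qed.
Lemma n2_split u v1 x2 : n2 ksplit kjoin W u v1 x2 = rhoV1X2 u v1 x2.
Proof.
rewrite /n2 mixop_split -[RHS]split_same; apply: opP => a b.
by rewrite m3_split; congr (_ * _ a b + _); congr mixop; apply/funext => x; rewrite m3_split.
Qed.

Definition avgUV (f : U -> V1 -> V2 -> R) := \sum_u pu u * \sum_v1 k1 u v1 * \sum_v2 k2 u v2 * f u v1 v2.

Lemma sum_pUV f : \sum_c pUV pu k1 k2 c * f c = avgUV (fun u v1 v2 => f (u, v1, v2)).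
Proof.
rewrite !sum_pair /avgUV; apply: eq_bigr => u _; rewrite mulr_sumr; apply: eq_bigr => v1 _.
by rewrite !mulr_sumr; apply: eq_bigr => v2 _; rewrite /pUV /=; ring.
Qed.
Lemma sum_ksplit u v1 (F : option X1 -> R) : \sum_xa ksplit u v1 xa * F xa =
  lam * (\sum_x1 kx1 u v1 x1 * F (Some x1)) + (1 - lam) * F None.
Proof.
rewrite sum_option /= [LHS]addrC mulr_sumr; congr (_ + _).
by apply: eq_bigr => x1 _; rewrite mulrA.
Qed.
Lemma sum_pUVA (f : U * V1 * V2 * option X1 -> R) : \sum_c pUVA pu k1 k2 ksplit c * f c =
  avgUV (fun u v1 v2 => lam * (\sum_x1 kx1 u v1 x1 * f (u, v1, v2, Some x1)) + (1 - lam) * f (u, v1, v2, None)).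
Proof.
rewrite -(sum_pUV (fun c => lam * (\sum_x1 kx1 c.1.1 c.1.2 x1 * f (c, Some x1)) + (1 - lam) * f (c, None))) sum_pair.
apply: eq_bigr => c _; rewrite -(sum_ksplit c.1.1 c.1.2 (fun xa => f (c, xa))) mulr_sumr.
by apply: eq_bigr => xa _; rewrite /pUVA /= mulrA.
Qed.
Lemma avgUV_lin a b f g : avgUV (fun u v1 v2 => a * f u v1 v2 + b * g u v1 v2) = a * avgUV f + b * avgUV g.
Proof.
have e h : avgUV h = \sum_c pUV pu k1 k2 c * h c.1.1 c.1.2 c.2.
  exact: esym (sum_pUV (fun c => h c.1.1 c.1.2 c.2)).
by rewrite !e !mulr_sumr -big_split; apply: eq_bigr => c _ /=; ring.
Qed.

Notation HV1V2 := (HV1V2 pu k1 k2 kx1 kx2 W).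
Notation HV2X1 := (HV2X1 pu k1 k2 kx1 kx2 W).
Notation HV1X2 := (HV1X2 pu k1 k2 kx1 kx2 W).
Notation HX1X2 := (HX1X2 pu k1 k2 kx1 kx2 W).
Lemma HV1V2E : HV1V2 = avgUV (fun u v1 v2 => vN (rhoV1V2 u v1 v2)).
Proof.
rewrite /HV1V2 /avg /avgUV /=; apply: eq_bigr => u _; congr (_ * _).
apply: eq_bigr => v1 _; congr (_ * _); apply: eq_bigr => v2 _; congr (_ * _).
under eq_bigr do rewrite wsum_cst //.
by rewrite wsum_cst.
Qed.
Lemma HV2X1E : HV2X1 = avgUV (fun u v1 v2 => \sum_x1 kx1 u v1 x1 * vN (rhoV2X1 u v2 x1)).
Proof.
rewrite /HV2X1 /avg /avgUV /=; apply: eq_bigr => u _; congr (_ * _).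
apply: eq_bigr => v1 _; congr (_ * _); apply: eq_bigr => v2 _; congr (_ * _).
by apply: eq_bigr => x1 _; rewrite wsum_cst.
Qed.
Lemma HV1X2E : HV1X2 = avgUV (fun u v1 v2 => \sum_x2 kx2 u v2 x2 * vN (rhoV1X2 u v1 x2)).
Proof.
rewrite /HV1X2 /avg /avgUV /=; apply: eq_bigr => u _; congr (_ * _).
apply: eq_bigr => v1 _; congr (_ * _); apply: eq_bigr => v2 _; congr (_ * _).
by rewrite wsum_cst.
Qed.
Lemma HX1X2E : HX1X2 = avgUV (fun u v1 v2 => \sum_x1 kx1 u v1 x1 * \sum_x2 kx2 u v2 x2 * vN (W x1 x2)).
Proof. by []. Qed.

Lemma eq_avgUV f g : (forall u v1 v2, f u v1 v2 = g u v1 v2) -> avgUV f = avgUV g.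
Proof. by move=> h; congr avgUV; do 3 apply/funext => ?; exact: h. Qed.

Lemma holevoE (I J K : finType) (p : J -> R) (k : J -> K -> R) (rho : J -> K -> op R I) A B :
  \sum_c p c * vN (mixop (k c) (rho c)) = A -> \sum_c p c * (\sum_x k c x * vN (rho c x)) = B ->
  holevo p k rho = A - B.
Proof. by move=> <- <-. Qed.

Lemma eq_wsum (J : finType) (p f g : J -> R) : (forall x, f x = g x) -> \sum_x p x * f x = \sum_x p x * g x.
Proof. by move=> h; apply: eq_bigr => x _; rewrite h. Qed.

Lemma eq_split (p f f' : X1 -> R) g g' : (forall x, f x = f' x) -> g = g' ->
  lam * (\sum_x p x * f x) + (1 - lam) * g = lam * (\sum_x p x * f' x) + (1 - lam) * g'.
Proof. by move=> h ->; rewrite (eq_wsum p h). Qed.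

Lemma mixop_pUV : mixop (pUV pu k1 k2) (fun c => m1 ksplit kjoin kx2 W c.1.1 c.1.2 c.2) =
  rho_out pu k1 k2 kx1 kx2 W.
Proof.
apply: opP => a b; rewrite /mixop /rho_out !sum_pair /mixop; apply: eq_bigr => u _.
rewrite mulr_sumr; apply: eq_bigr => v1 _; rewrite !mulr_sumr; apply: eq_bigr => v2 _.
by rewrite m1_split /pUV !rmorphM /=; ring.
Qed.

Lemma I0E : I0 pu k1 k2 ksplit kjoin kx2 W = vN (rho_out pu k1 k2 kx1 kx2 W) - HV1V2.
Proof.
rewrite HV1V2E; apply: holevoE; (rewrite (big_pred1 tt); last by case); rewrite mul1r.
  exact: congr1 mixop_pUV.
apply: etrans (sum_pUV _) _; apply: eq_avgUV => u v1 v2.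
exact: congr1 (m1_split _ _ _).
Qed.
(** The split symbol shows [x1] with probability [lam] and is void otherwise, so every term of the
    split information is a [lam]-mixture. The sum of [I1], [I2] and [I3] is [HV1V2 - HX1X2] for
    every [lam]. *)
Lemma I1E : I1 pu k1 k2 ksplit kjoin kx2 W = lam * (HV1V2 - HV2X1).
Proof.
have -> : lam * (HV1V2 - HV2X1) = HV1V2 - (lam * HV2X1 + (1 - lam) * HV1V2) by ring.
rewrite HV1V2E HV2X1E -avgUV_lin; apply: holevoE; apply: etrans (sum_pUV _) _; apply: eq_avgUV => u v1 v2.
  exact: congr1 (m1_split _ _ _).
apply: etrans (sum_ksplit _ _ _) _; apply: eq_split; last exact: congr1 (m2_split u v1 v2 None).
by move=> x1; exact: congr1 (m2_split u v1 v2 (Some x1)).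
Qed.
Lemma I2E : I2 pu k1 k2 ksplit kjoin kx2 W = lam * (HV2X1 - HX1X2) + (1 - lam) * (HV1V2 - HV1X2).
Proof.
have -> : lam * (HV2X1 - HX1X2) + (1 - lam) * (HV1V2 - HV1X2) =
  lam * HV2X1 + (1 - lam) * HV1V2 - (lam * HX1X2 + (1 - lam) * HV1X2) by ring.
rewrite HV1V2E HV2X1E HV1X2E HX1X2E -!avgUV_lin; apply: holevoE; apply: etrans (sum_pUVA _) _; apply: eq_avgUV => u v1 v2.
  apply: eq_split; last exact: congr1 (m2_split u v1 v2 None).
  by move=> x1; exact: congr1 (m2_split u v1 v2 (Some x1)).
apply: eq_split => [x1|]; apply: eq_wsum => x2; last exact: congr1 (m3_split u v1 None x2).
exact: congr1 (m3_split u v1 (Some x1) x2).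
Qed.
Lemma sum_pUVAX (f : U * V1 * V2 * option X1 * X2 -> R) : \sum_c pUVAX pu k1 k2 ksplit kx2 c * f c =
  avgUV (fun u v1 v2 => lam * (\sum_x1 kx1 u v1 x1 * \sum_x2 kx2 u v2 x2 * f (u, v1, v2, Some x1, x2)) +
    (1 - lam) * \sum_x2 kx2 u v2 x2 * f (u, v1, v2, None, x2)).
Proof.
rewrite -(sum_pUVA (fun c => \sum_x2 kx2 c.1.1.1 c.1.2 x2 * f (c, x2))) sum_pair.
by apply: eq_bigr => c _; rewrite mulr_sumr; apply: eq_bigr => x2 _; rewrite /pUVAX /= mulrA.
Qed.
Lemma I3E : I3 pu k1 k2 ksplit kjoin kx2 W = (1 - lam) * (HV1X2 - HX1X2).
Proof.
have -> : (1 - lam) * (HV1X2 - HX1X2) = lam * HX1X2 + (1 - lam) * HV1X2 - (lam * HX1X2 + (1 - lam) * HX1X2) by ring.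
rewrite HV1X2E HX1X2E -!avgUV_lin; apply: holevoE; apply: etrans (sum_pUVAX _) _; apply: eq_avgUV => u v1 v2.
  apply: eq_split => [x1|]; apply: eq_wsum => x2; last exact: congr1 (m3_split u v1 None x2).
  exact: congr1 (m3_split u v1 (Some x1) x2).
apply: eq_split => [x1|].
  apply: eq_wsum => x2; rewrite (bigD1 x1) //= eqxx mul1r big1 ?addr0 // => y /negbTE ->; exact: mul0r.
under eq_bigr do rewrite mulr_sumr.
rewrite exchange_big /=; apply: eq_bigr => x1 _; rewrite mulr_sumr.
by apply: eq_bigr => x2 _; ring.
Qed.

Lemma sum_pUVX2 (f : U * V2 * X2 -> R) : \sum_c pUVX2 pu k2 kx2 c * f c =
  \sum_u pu u * \sum_v2 k2 u v2 * \sum_x2 kx2 u v2 x2 * f (u, v2, x2).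
Proof.
rewrite !sum_pair; apply: eq_bigr => u _; rewrite mulr_sumr; apply: eq_bigr => v2 _.
by rewrite !mulr_sumr; apply: eq_bigr => x2 _; rewrite /pUVX2 /=; ring.
Qed.
Lemma sum_pUVAX1 (f : U * V1 * option X1 * X1 -> R) (g : U -> V1 -> X1 -> R) :
  (forall u v1 xa x1, f (u, v1, xa, x1) = g u v1 x1) ->
  \sum_c pUVAX1 pu k1 ksplit kjoin c * f c =
  \sum_u pu u * \sum_v1 k1 u v1 * \sum_x1 kx1 u v1 x1 * g u v1 x1.
Proof.
move=> hf; rewrite !sum_pair; apply: eq_bigr => u _; rewrite mulr_sumr; apply: eq_bigr => v1 _.
transitivity (pu u * (k1 u v1 * \sum_xa ksplit u v1 xa * \sum_x1 kjoin u v1 xa x1 * g u v1 x1)).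
  rewrite !mulr_sumr; apply: eq_bigr => xa _; rewrite !mulr_sumr; apply: eq_bigr => x1 _.
  by rewrite hf /pUVAX1 /=; ring.
congr (_ * (_ * _)); rewrite sum_ksplit /=.
rewrite (eq_wsum (kx1 u v1) (f := fun x1 => \sum_y (y == x1)%:R * g u v1 y) (g := g u v1)); first by ring.
by move=> x1; rewrite (bigD1 x1) //= eqxx mul1r big1 ?addr0 // => y /negbTE ->; exact: mul0r.
Qed.

Lemma cinfoE (J K Z : finType) (p : J -> R) (k : J -> K -> R) (Q : J -> K -> Z -> R) A B :
  \sum_c p c * (\sum_z etaf (\sum_x k c x * Q c x z)) = A ->
  \sum_c p c * (\sum_x k c x * \sum_z etaf (Q c x z)) = B -> cinfo p k Q = A - B.
Proof. by move=> <- <-. Qed.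

Lemma J2E : J2 (fun y : sys => y.2) pu k1 k2 ksplit kjoin kx2 W =
  HZ2_X2 pu k1 k2 kx1 kx2 W - HZ2_V1X2 pu k1 k2 kx1 kx2 W.
Proof.
rewrite /HZ2_X2 /HZ2_V1X2 /avg /=; apply: cinfoE; rewrite sum_pUVX2.
  apply: eq_wsum => u; apply: etrans (esym (wsum_cst _ (hk1 u))) _.
  apply: eq_wsum => v1; apply: eq_wsum => v2; rewrite [RHS]wsum_cst //; apply: eq_wsum => x2.
  apply: eq_bigr => z _; apply: congr1; rewrite law_mix; apply: eq_wsum => w1.
  exact: (congr1 (fun r => law _ r z) (n2_split u w1 x2)).
apply: eq_wsum => u; under [RHS]eq_bigr do rewrite mulr_sumr.
rewrite [RHS]exchange_big /=; apply: eq_bigr => v2 _.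
transitivity (k2 u v2 * \sum_v1 k1 u v1 * \sum_x2 kx2 u v2 x2 * outcome_entropy (fun y => y.2) (rhoV1X2 u v1 x2)).
  congr (_ * _); under [RHS]eq_bigr do rewrite mulr_sumr.
  rewrite [RHS]exchange_big /=; apply: eq_bigr => x2 _; rewrite mulr_sumr; apply: eq_bigr => v1 _.
  rewrite mulrCA; do 2 apply: (congr1 (fun x => _ * x)); apply: eq_bigr => z _.
  exact: (congr1 (fun r => etaf (law _ r z)) (n2_split u v1 x2)).
rewrite mulr_sumr; apply: eq_bigr => v1 _; rewrite mulrCA [in RHS]wsum_cst //.
Qed.

Lemma J1E : J1 (fun y : sys => y.1.2) pu k1 k2 ksplit kjoin kx2 W =
  HZ1_X1 pu k1 k2 kx1 kx2 W - HZ1_V2X1 pu k1 k2 kx1 kx2 W.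
Proof.
pose g u (v1 : V1) x1 := \sum_z etaf (\sum_v2 k2 u v2 * law (fun y : sys => y.1.2) (rhoV2X1 u v2 x1) z).
pose g' u (v1 : V1) x1 := \sum_v2 k2 u v2 * outcome_entropy (fun y : sys => y.1.2) (rhoV2X1 u v2 x1).
rewrite /HZ1_X1 /HZ1_V2X1 /avg /=; apply: cinfoE; [rewrite (sum_pUVAX1 (g := g)) //|rewrite (sum_pUVAX1 (g := g')) //];
  apply: eq_wsum => u; apply: eq_wsum => v1.
  apply: etrans (esym (wsum_cst _ (hk2 u))) _; apply: eq_wsum => v2; apply: eq_wsum => x1.
  rewrite [RHS]wsum_cst //; apply: eq_bigr => z _; apply: congr1; rewrite law_mix.
  by apply: eq_wsum => w2.
under [RHS]eq_bigr do rewrite mulr_sumr.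
rewrite [RHS]exchange_big /=; apply: eq_bigr => x1 _; rewrite mulr_sumr; apply: eq_bigr => v2 _.
by rewrite wsum_cst // mulrCA.
Qed.
End RateSplitting.

(** * Achievable rates *)

Section CodeExistence.
Variable R : realType.
Variables (HA HB B Bb Z1 Z2 : finType) (N : op R (HA * HB) -> op R B) (G : Z1 -> Z2 -> op R B -> op R Bb).
Hypotheses (hN : channel N) (hG : instrument G).
Variables (U V1 V2 XA X1 X2 : finType) (th : X1 -> op R HA) (ph : X2 -> op R HB).
Hypotheses (hth : forall x, density (th x)) (hph : forall x, density (ph x)).
Variables (pu : U -> R) (k1 : U -> V1 -> R) (k2 : U -> V2 -> R) (ka : U -> V1 -> XA -> R)
  (kx1 : U -> V1 -> XA -> X1 -> R) (kx2 : U -> V2 -> X2 -> R).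
Hypotheses (hpu : distr pu) (hk1 : forall u, distr (k1 u)) (hk2 : forall u, distr (k2 u))
  (hka : forall u v1, distr (ka u v1)) (hkx1 : forall u v1 xa, distr (kx1 u v1 xa))
  (hkx2 : forall u v2, distr (kx2 u v2)).
Local Notation W := (Wst N G th ph).
Local Notation q0 := (I0 pu k1 k2 ka kx1 kx2 W).
Local Notation q1 := (I1 pu k1 k2 ka kx1 kx2 W).
Local Notation q2 := (I2 pu k1 k2 ka kx1 kx2 W).
Local Notation q3 := (I3 pu k1 k2 ka kx1 kx2 W).
Local Notation j1 := (J1 (fun y : site Bb Z1 Z2 => y.1.2) pu k1 k2 ka kx1 kx2 W).
Local Notation j2 := (J2 (fun y : site Bb Z1 Z2 => y.2) pu k1 k2 ka kx1 kx2 W).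

Lemma distr_inh (J : finType) (p : J -> R) : distr p -> exists x : J, True.
Proof.
move=> [_ h]; case: (pickP (fun _ : J => true)) => [x _|h0]; first by exists x.
by move: h; rewrite big_pred0 // => /eqP; rewrite eq_sym oner_eq0.
Qed.

(** Bounds the expected number of wrong indices accepted. Counting [#|T|.-1] of them matters when
    [q = 0]: the exponent has the wrong sign then, but a single index leaves nothing to confuse. *)
Definition wrong (n : nat) (d q : R) (T : finType) : R := (#|T|.-1)%:R * expR (- (n%:R * (ln 2 * (q - d)))).

Lemma sum_uniform (M1 M2 L : nat) (c : R) : (0 < M1)%N -> (0 < M2)%N ->
  \sum_(i < M1) (M1 * M2)%:R^-1 * \sum_(j < M2) 4 * \sum_(b < L) 1 * c = 4 * L%:R * c.
Proof.
move=> h1 h2; have n1 : (M1%:R : R) != 0 by rewrite pnatr_eq0 -lt0n.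
have n2 : (M2%:R : R) != 0 by rewrite pnatr_eq0 -lt0n.
have sc n (x : R) : \sum_(i < n) x = n%:R * x by rewrite sumr_const card_ord mulr_natl.
rewrite !sc mul1r natrM.
by field; rewrite n1 n2.
Qed.

Lemma code_exists (d e : R) : 0 < d -> 0 < e -> exists N0 : nat, forall m, (N0 <= m.+1)%N ->
  forall (W0 A1 A2 Sa Sb S2 F1 F2 : finType) (e0 : A1 * A2 -> W0) (ea : A1 * A2 -> F1 -> Sa)
    (eb : A1 * A2 -> F1 -> Sb) (e2 : A1 * A2 -> F2 -> S2), injective (ejoin e0 ea eb e2) ->
  forall (L k : nat), (L.+1 * m.+1 <= k)%N ->
  forall (M1 M2 : nat) (d1 : A1) (d2 : A2) (g1 : 'I_M1 -> nat -> A1 * F1) (g2 : 'I_M2 -> nat -> A2 * F2),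
  (forall i, (g1 i L).1 = d1) -> (forall i, (g2 i L).1 = d2) ->
  (forall i j, (forall b, (b < L)%N -> g1 i b = g1 j b) -> i = j) ->
  (forall i j, (forall b, (b < L)%N -> g2 i b = g2 j b) -> i = j) -> 'I_M1 -> 'I_M2 ->
  fb_code_exists N k M1 M2 (4 * L.+1%:R * (6 * e +
    (wrong m.+1 d q0 W0 + wrong m.+1 d q1 Sa + wrong m.+1 d q2 S2 + wrong m.+1 d q3 Sb) +
    (wrong m.+1 d j2 A1 + wrong m.+1 d j1 A2))).
Proof.
move=> d0 e0; have dW := density_Wst hN hG hth hph.
have [n0 h0] := cloud_test hpu hk1 hk2 hka hkx1 hkx2 dW d0 e0.
have [n1 h1] := split_test hpu hk1 hk2 hka hkx1 hkx2 dW d0 e0.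
have [n2 h2] := x2_test hpu hk1 hk2 hka hkx1 hkx2 dW d0 e0.
have [n3 h3] := x1_test hpu hk1 hk2 hka hkx1 hkx2 dW d0 e0.
have [n4 h4] := feedback_test2 (fun y : site Bb Z1 Z2 => y.2) hpu hk1 hk2 hka hkx1 hkx2 dW d0 e0.
have [n5 h5] := feedback_test1 (fun y : site Bb Z1 Z2 => y.1.2) hpu hk1 hk2 hka hkx1 hkx2 dW d0 e0.
(* A law on an alphabet makes it inhabited; [x1i] and [x2i] fill the sites outside the blocks. *)
have [ui _] := distr_inh hpu; have [v1i _] := distr_inh (hk1 ui); have [v2i _] := distr_inh (hk2 ui).
have [xai _] := distr_inh (hka ui v1i).
have [x1i _] := distr_inh (hkx1 ui v1i xai); have [x2i _] := distr_inh (hkx2 ui v2i).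
exists (maxn n0 (maxn n1 (maxn n2 (maxn n3 (maxn n4 n5))))) => m.
rewrite !geq_max => /andP[/h0 [T0 [pT0 b0 c0]] /andP[/h1 [T1 [pT1 b1 c1]] /andP[/h2 [T2 [pT2 b2 c2]]
  /andP[/h3 [T3 [pT3 b3 c3]] /andP[/h4 [D2 [b4 c4]] /h5 [D1 [b5 c5]]]]]]].
move=> W0 A1 A2 Sa Sb S2 F1 F2 e0' ea eb e2 einj L k hk M1 M2 d1 d2 g1 g2 g1L g2L i1 i2 i0 j0.
have hpuB : distr (@puB R U pu m.+1) := @distr_prod R U m.+1 (fun=> pu) (fun=> hpu).
have hk1B u : distr (@k1B R U V1 k1 m.+1 u) := @distr_prod R V1 m.+1 (fun t => k1 (u t)) (fun t => hk1 (u t)).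
have hk2B u : distr (@k2B R U V2 k2 m.+1 u) := @distr_prod R V2 m.+1 (fun t => k2 (u t)) (fun t => hk2 (u t)).
have hkaB u v : distr (@kaB R U V1 XA ka m.+1 u v) :=
  @distr_prod R XA m.+1 (fun t => ka (u t) (v t)) (fun t => hka (u t) (v t)).
have hkx1B u v xa : distr (@kx1B R U V1 XA X1 kx1 m.+1 u v xa) :=
  @distr_prod R X1 m.+1 (fun t => kx1 (u t) (v t) (xa t)) (fun t => hkx1 (u t) (v t) (xa t)).
have hkx2B u v : distr (@kx2B R U V2 X2 kx2 m.+1 u v) :=
  @distr_prod R X2 m.+1 (fun t => kx2 (u t) (v t)) (fun t => hkx2 (u t) (v t)).
set bnd := 6 * e + _ + _.
have herr w0 a1 a2 sa sb s2 := E6_err hpuB hk1B hk2B hkaB hkx1B hkx2B b0 b1 b2 b3 b4 b5 c0 c1 c2 c3 c4 c5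
  (w0 : W0) (a1 : A1) (a2 : A2) (sa : Sa) (sb : Sb) (s2 : S2).
pose Q cd i j b := qerrb N G th ph T0 T1 T2 T3 cd e0' ea eb e2 d1 d2 g1 g2 i j b +
   cerrb N G th ph D2 D1 cd e0' ea eb e2 d1 d2 g1 g2 i j b.
pose F cd := (M1 * M2)%:R^-1 * \sum_i \sum_j (4 * \sum_(b < L.+1) Q cd i j b).
(* One book is chosen for all messages and blocks: [F] is linear in the block errors, each of which
   has expectation at most [bnd]. *)
have [cd hcd] := E6_exists hpuB hk1B hk2B hkaB hkx1B hkx2B F.
apply: (assembly hN hG hth hph pT0 pT1 pT2 pT3 einj hk x1i x2i g1L g2L i1 i2 i0 j0).
apply: le_trans hcd _.
have -> : F = fun cd => \sum_i (M1 * M2)%:R^-1 * \sum_j 4 * \sum_(b < L.+1) 1 * Q cd i j b.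
  apply/funext => cd'; rewrite /F mulr_sumr; apply: eq_bigr => i _; congr (_ * _); apply: eq_bigr => j _.
  by congr (_ * _); apply: eq_bigr => b _; rewrite mul1r.
rewrite E6_sum; under eq_bigr do rewrite E6_sum.
under eq_bigr do under eq_bigr do rewrite E6_sum.
have M10 : (0 < M1)%N by apply: leq_ltn_trans (ltn_ord i0).
have M20 : (0 < M2)%N by apply: leq_ltn_trans (ltn_ord j0).
rewrite -(sum_uniform _ _ M10 M20).
apply: ler_sum => i _; apply: ler_wpM2l; first by rewrite invr_ge0.
apply: ler_sum => j _; apply: ler_wpM2l => //; apply: ler_sum => b _; rewrite !mul1r.
exact: herr.
Qed.
End CodeExistence.

(** * Sizes of index sets and the choice of the rates *)

Section Sizes.
Variable R : realType.

Lemma inj_card (A B : finType) : (#|A| <= #|B|)%N -> exists f : A -> B, injective f.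
Proof.
move=> h; exists (fun a => enum_val (widen_ord h (enum_rank a))) => a a' /enum_val_inj /(congr1 val) /= e.
by apply: enum_rank_inj; apply: val_inj.
Qed.

Lemma card_bits a : #|{: tup bool a}| = (2 ^ a)%N.
Proof. by rewrite card_ffun card_bool card_ord. Qed.

(** Filling a test of rate [q] up to [s q] leaves the margin [(1 - s) q]; the slack [d] uses at most
    half of it. The bound [d0] is given before the length, so that one [d] can be chosen for all six
    tests. If [q = 0] no bits are sent. *)
Lemma wrong_small (q s e : R) : 0 <= q -> 0 <= s < 1 -> 0 < e -> exists2 d0, 0 < d0 &
  forall d, 0 < d <= d0 -> exists n0 : nat, forall n, (n0 <= n)%N -> forall b (T : finType),
    #|T| = (2 ^ b)%N -> b%:R <= n%:R * s * q -> wrong n d q T <= e.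
Proof.
move=> q0 /andP[s0 s1] e0; have l2 := ln2_gt0 R; have [->|qn] := eqVneq q 0.
  exists 1 => // d _; exists 0%N => n _ b T hT; rewrite mulr0 lern0 => /eqP hb.
  by rewrite /wrong hT hb expn0 mul0r ltW.
have qp : 0 < q by rewrite lt_neqAle eq_sym qn.
have c0 : 0 < (1 - s) * q / 2 by rewrite !mulr_gt0 ?subr_gt0 // invr_gt0.
exists ((1 - s) * q / 2) => // d /andP[d0 hd].
have [m0 hm] := exp_decay (mulr_gt0 l2 c0) e0; exists m0 => n /hm hn b T hT hb; apply: le_trans hn.
rewrite /wrong; apply: (@le_trans _ _ ((2 ^ b)%:R * expR (- (n%:R * (ln 2 * (q - d)))))).
  by apply: ler_wpM2r; [exact: expR_ge0|rewrite ler_nat hT leq_pred].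
have -> : ((2 ^ b)%:R : R) = expR (b%:R * ln 2).
  by rewrite expRM_natl lnK ?posrE // natrX.
rewrite -expRD ler_expR.
have n0 : 0 <= n%:R :> R by exact: ler0n.
have : b%:R * ln 2 <= n%:R * s * q * ln 2 by apply: ler_wpM2r => //; exact: ltW.
have : n%:R * ln 2 * d <= n%:R * ln 2 * ((1 - s) * q / 2).
  by apply: ler_wpM2l => //; rewrite mulr_ge0 // ltW.
lra.
Qed.

(** Greedy choice: the X-layers take as much of [R1] and [R2] as they can as fresh rate, the
    V-layers take the rest, and the capacity that the X-layers leave free goes to the cooperative
    pair. *)
Lemma rates_split (a1 a2 c0 q1 q2 q3 R1 R2 : R) :
  0 <= a1 -> 0 <= a2 -> 0 <= c0 -> 0 <= q1 -> 0 <= q2 -> 0 <= q3 -> 0 <= R1 -> 0 <= R2 ->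
  R1 <= a1 + q1 + q3 -> R2 <= a2 + q2 -> R1 + R2 <= c0 + (q1 + q2 + q3) ->
  exists r1 ra rb r2 rc ta tb tc,
  [/\ [/\ 0 <= r1, 0 <= ra, 0 <= rb, 0 <= r2 & 0 <= rc], [/\ 0 <= ta, 0 <= tb & 0 <= tc],
    [/\ r1 <= a1, r2 <= a2, ta + ra <= q1, tc + rc <= q2 & tb + rb <= q3],
    r1 + r2 <= c0 + ta + tb + tc & R1 <= r1 + ra + rb /\ R2 <= r2 + rc].
Proof.
move=> ha1 ha2 hc0 q10 q20 q30 hR1 hR2 h1 h2 h3.
have [rc [rc1 rc2 rc3 rc4]] : exists rc, [/\ 0 <= rc, rc <= q2, rc <= R2 & R2 - rc <= a2].
  clear -hR2 q20 ha2 h2; by case: (lerP R2 q2) => h; [exists R2|exists q2]; split; lra.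
have [ra [rb [[ra0 rb0] raq rbq rab1 rab2]]] : exists ra rb,
    [/\ 0 <= ra /\ 0 <= rb, ra <= q1, rb <= q3, ra + rb <= R1 & R1 - (ra + rb) <= a1].
  clear -hR1 q10 q30 ha1 h1; case: (lerP R1 q1) => h; first by exists R1, 0; split; lra.
  case: (lerP R1 (q1 + q3)) => h'; first by exists q1, (R1 - q1); split; lra.
  by exists q1, q3; split; lra.
exists (R1 - (ra + rb)), ra, rb, (R2 - rc), rc, (q1 - ra), (q3 - rb), (q2 - rc).
have r10 : 0 <= R1 - (ra + rb) by rewrite subr_ge0.
have r20 : 0 <= R2 - rc by rewrite subr_ge0.
have ta0 : 0 <= q1 - ra by rewrite subr_ge0.
have tb0 : 0 <= q3 - rb by rewrite subr_ge0.
have tc0 : 0 <= q2 - rc by rewrite subr_ge0.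
split => //; first by rewrite !subrK.
  by clear -h3; lra.
by rewrite !subrK -addrA subrK.
Qed.

(** Here [a1], [a2] are the feedback rates of [V1], [V2], and [c0] is the cloud rate; [b1], [b2] are
    the informations on [X1], [X2] when the other input is given, [d1], [d2] those when only the
    V-layers are. The equality [d1 + b2 = d2 + b1] is the chain rule in both decoding orders. *)
Lemma rates_selection (a1 a2 b1 b2 d1 d2 c0 R1 R2 : R) :
  0 <= a1 -> 0 <= a2 -> 0 <= b1 -> 0 <= b2 -> 0 <= d1 -> 0 <= d2 -> 0 <= c0 -> 0 <= R1 -> 0 <= R2 ->
  d1 + b2 = d2 + b1 -> R1 <= b1 + a1 -> R2 <= b2 + a2 -> R1 + R2 <= a1 + a2 + (d1 + b2) ->
  R1 + R2 <= c0 + (d1 + b2) ->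
  exists lam, 0 <= lam <= 1 /\ exists r1 ra rb r2 rc ta tb tc,
  [/\ [/\ 0 <= r1, 0 <= ra, 0 <= rb, 0 <= r2 & 0 <= rc], [/\ 0 <= ta, 0 <= tb & 0 <= tc],
    [/\ r1 <= a1, r2 <= a2, ta + ra <= lam * d1, tc + rc <= lam * b2 + (1 - lam) * d2 & tb + rb <= (1 - lam) * b1],
    r1 + r2 <= c0 + ta + tb + tc & R1 <= r1 + ra + rb /\ R2 <= r2 + rc].
Proof.
move=> ha1 ha2 hb1 hb2 hd1 hd2 hc0 hR1 hR2 e12 h1 h2 h3 h4.
have [lam [hl l1 l2]] : exists lam, [/\ 0 <= lam <= 1, R1 <= a1 + lam * d1 + (1 - lam) * b1 &
    R2 <= a2 + lam * b2 + (1 - lam) * d2].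
  case: (lerP R2 (a2 + d2)) => [h5|h5].
    by exists 0; split; [rewrite lexx ler01|lra|lra].
  case: (lerP R1 (a1 + d1)) => [h6|h6].
    by exists 1; split; [rewrite lexx ler01|lra|lra].
  have bd : 0 < b1 - d1 by lra.
  (* Chosen to make the bound on [R1] tight. Since [b2 - d2 = b1 - d1], the sum-rate bound then
     gives the one on [R2]. *)
  pose lam := (b1 - (R1 - a1)) / (b1 - d1); have el : lam * (b1 - d1) = b1 - (R1 - a1).
    by rewrite /lam mulfVK // gt_eqF.
  exists lam; split.
  - apply/andP; split; first by rewrite divr_ge0 //; lra.
    by rewrite ler_pdivrMr //; lra.
  - lra.
  - have : lam * (b2 - d2) = lam * (b1 - d1) by congr (_ * _); lra.
    lra.
exists lam; split => //; have /andP[lm0 lm1] := hl.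
apply: rates_split => //; try by rewrite ?addr_ge0 // mulr_ge0 // subr_ge0.
  by clear -l2; lra.
have e2 : (1 - lam) * (d2 + b1) = (1 - lam) * (d1 + b2) by rewrite e12.
by clear -h4 e2; lra.
Qed.
End Sizes.

(** * Rounding of rates to bits *)

Section RateBookkeeping.
Variable R : realType.

Lemma close_to_one (S d : R) : 0 < S -> 0 < d -> exists s, 0 < s < 1 /\ (1 - s ^+ 2) * S <= d / 2.
Proof.
move=> S0 d0; pose x := Num.min (2^-1) (d / (4 * S)).
have x0 : 0 < x by rewrite lt_min invr_gt0 ltr0n divr_gt0 // mulr_gt0.
have x1 : x <= 2^-1 by rewrite ge_min lexx.
have xS : x * (4 * S) <= d by rewrite -ler_pdivlMr ?mulr_gt0 // ge_min lexx orbT.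
exists (1 - x); split; first by apply/andP; split; lra.
have -> : (1 - (1 - x) ^+ 2) * S = 2 * (x * S) - x * (x * S) by ring.
have : 0 <= x * (x * S) by rewrite !mulr_ge0 // ltW.
lra.
Qed.

(** One half of [d] pays for the filling factor [s ^+ 2]. By [S + 1 <= L * (d / 2)] the other half
    pays for the block without fresh symbols and leaves a surplus of order [n], which covers the
    floors (at most three, whence the 3) and the sites outside the blocks. *)
Lemma message_count (n L k bits : nat) (s S d r r' : R) : 0 <= r -> r <= S -> r' <= r -> 0 < d ->
  (1 - s ^+ 2) * S <= d / 2 -> s ^+ 2 <= 1 ->
  S + 1 <= L%:R * (d / 2) -> 3 * L%:R + L.+1%:R * S <= n%:R -> (k <= n.+1 * L.+1)%N ->
  n%:R * (s ^+ 2 * r) - 3 <= bits%:R -> (msgsize k (r' - d) <= 2 ^ (L * bits))%N.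
Proof.
move=> r0 rS r'r d0 hs s1 hL hn hk hb.
rewrite /msgsize leq_exp2l //.
have key : k%:R * (r' - d) <= (L * bits)%:R.
  apply: (@le_trans _ _ (k%:R * (r - d))); first by apply: ler_wpM2l => //; lra.
  case: (lerP (r - d) 0) => hr; first by apply: le_trans (_ : 0 <= _) => //; apply: mulr_ge0_le0.
  apply: (@le_trans _ _ ((n.+1 * L.+1)%:R * (r - d))).
    by apply: ler_wpM2r; [exact: ltW|rewrite ler_nat].
  rewrite !natrM -!natr1; have L0 : 0 <= L%:R :> R by [].
  have hL' : L%:R * (n%:R * (s ^+ 2 * r) - 3) <= L%:R * bits%:R by apply: ler_wpM2l.
  apply: le_trans hL'.
  have h1 : (1 - s ^+ 2) * r <= (1 - s ^+ 2) * S by apply: ler_wpM2l => //; rewrite subr_ge0.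
  have h2 : L%:R * (d / 2) <= L%:R * (d - (1 - s ^+ 2) * r) by apply: ler_wpM2l => //; lra.
  have n0 : 0 <= n%:R :> R by [].
  have h3 : n%:R * 1 <= n%:R * (L%:R * (d - (1 - s ^+ 2) * r) - (r - d)) by apply: ler_wpM2l => //; lra.
  have h4 : (L%:R + 1) * (r - d) <= (L%:R + 1) * S by apply: ler_wpM2l; lra.
  move: hn; rewrite -natr1; lra.
have : Num.max 0%R (Num.ceil (k%:R * (r' - d))) <= (L * bits)%:Z.
  by rewrite ge_max lez_nat /= ceil_le_int ?num_real.
have : (0 : int) <= Num.max 0%R (Num.ceil (k%:R * (r' - d))) by rewrite le_max lexx.
by case: (Num.max _ _).
Qed.

(** The V-layers are filled to [s ^+ 2], the resending indices to [s]; the gap between the two grows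
    with [n] and absorbs the four floors on the right, whence the 4. If the total rate [T] vanishes
    there is no gap, but both sides are zero. *)
Lemma cooperation_size (s r1 r2 t0 ta tb tc : R) : 0 < s < 1 -> 0 <= r1 -> 0 <= r2 ->
  0 <= t0 -> 0 <= ta -> 0 <= tb -> 0 <= tc -> r1 + r2 <= t0 + ta + tb + tc ->
  exists n0 : nat, forall n, (n0 <= n)%N ->
   (Num.truncn (n%:R * s ^+ 2 * r1) + Num.truncn (n%:R * s ^+ 2 * r2) <=
    Num.truncn (n%:R * s * t0) + Num.truncn (n%:R * s * ta) + Num.truncn (n%:R * s * tb) + Num.truncn (n%:R * s * tc))%N.
Proof.
move=> /andP[s0 s1] r10 r20 t00 ta0 tb0 tc0 hT; set T := t0 + ta + tb + tc in hT.
have T0 : 0 <= T by rewrite !addr_ge0.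
have [T00|Tn] := eqVneq T 0.
  exists 0%N => n _; have -> : r1 = 0 by lra.
  have -> : r2 = 0 by lra.
  by rewrite mulr0 truncn0.
have Tp : 0 < T by rewrite lt_neqAle eq_sym Tn.
have c0 : 0 < s * (1 - s) * T by rewrite !mulr_gt0 // subr_gt0.
exists (Num.truncn (4 / (s * (1 - s) * T))).+1 => n hn.
have hn4 : 4 <= n%:R * (s * (1 - s) * T).
  rewrite -ler_pdivrMr //; apply: le_trans (ltW (truncnS_gt _)) _; by rewrite ler_nat.
have n0 : 0 <= n%:R :> R by [].
have tr x : 0 <= x -> (Num.truncn x)%:R <= x :> R by rewrite truncn_le.
have tg (x : R) : x - 1 <= (Num.truncn x)%:R.
  by rewrite lerBlDr natr1 ltW // truncnS_gt.
rewrite -(ler_nat R) !natrD.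
have ns : 0 <= n%:R * s ^+ 2 by rewrite mulr_ge0 // sqr_ge0.
have k1 := tr _ (mulr_ge0 ns r10); have k2 := tr _ (mulr_ge0 ns r20).
have g0 := tg (n%:R * s * t0); have ga := tg (n%:R * s * ta).
have gb := tg (n%:R * s * tb); have gc := tg (n%:R * s * tc).
have := ler_wpM2l ns hT.
rewrite /T in hn4 *; clear -k1 k2 g0 ga gb gc hn4; lra.
Qed.
Lemma rounding3 (a x y z : R) (p q r : nat) : a * x - 1 <= p%:R -> a * y - 1 <= q%:R -> a * z - 1 <= r%:R ->
  a * (x + y + z) - 3 <= (p + (q + r))%:R.
Proof. rewrite !natrD; lra. Qed.

Lemma rounding2 (a x y : R) (p q : nat) : a * x - 1 <= p%:R -> a * y - 1 <= q%:R ->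
  a * (x + y) - 3 <= (p + q)%:R.
Proof. rewrite !natrD; lra. Qed.
End RateBookkeeping.

(** * From admissible rates to codes of every large length *)

Section AchievableRates.
Variable R : realType.
Variables (HA HB B Bb Z1 Z2 : finType) (N : op R (HA * HB) -> op R B) (G : Z1 -> Z2 -> op R B -> op R Bb).
Hypotheses (hN : channel N) (hG : instrument G).
Variables (U V1 V2 XA X1 X2 : finType) (th : X1 -> op R HA) (ph : X2 -> op R HB).
Hypotheses (hth : forall x, density (th x)) (hph : forall x, density (ph x)).
Variables (pu : U -> R) (k1 : U -> V1 -> R) (k2 : U -> V2 -> R) (ka : U -> V1 -> XA -> R)
  (kx1 : U -> V1 -> XA -> X1 -> R) (kx2 : U -> V2 -> X2 -> R).
Hypotheses (hpu : distr pu) (hk1 : forall u, distr (k1 u)) (hk2 : forall u, distr (k2 u))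
  (hka : forall u v1, distr (ka u v1)) (hkx1 : forall u v1 xa, distr (kx1 u v1 xa))
  (hkx2 : forall u v2, distr (kx2 u v2)).
Local Notation W := (Wst N G th ph).
Local Notation q0 := (I0 pu k1 k2 ka kx1 kx2 W).
Local Notation q1 := (I1 pu k1 k2 ka kx1 kx2 W).
Local Notation q2 := (I2 pu k1 k2 ka kx1 kx2 W).
Local Notation q3 := (I3 pu k1 k2 ka kx1 kx2 W).
Local Notation j1 := (J1 (fun y : site Bb Z1 Z2 => y.1.2) pu k1 k2 ka kx1 kx2 W).
Local Notation j2 := (J2 (fun y : site Bb Z1 Z2 => y.2) pu k1 k2 ka kx1 kx2 W).

Lemma fb_code_le (k M1 M2 : nat) (eps eps' : R) : eps <= eps' ->
  fb_code_exists N k M1 M2 eps -> fb_code_exists N k M1 M2 eps'.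
Proof.
move=> h [Bb' [Z1' [Z2' [F1 [F2 [D [Dec [h1 h2 h3 h4 h5]]]]]]]].
by exists Bb', Z1', Z2', F1, F2, D, Dec; split=> //; exact: le_trans h.
Qed.

(* Fresh message symbols are sent in blocks [b < L]; block [L] carries none. *)
Lemma message_books (L M : nat) (A F : finType) (d : A * F) : (M <= #|{: A * F}| ^ L)%N ->
  exists g : 'I_M -> nat -> A * F, (forall i, (g i L).1 = d.1) /\
    (forall i j, (forall b, (b < L)%N -> g i b = g j b) -> i = j).
Proof.
move=> hM; have hc : (#|'I_M| <= #|{ffun 'I_L -> (A * F)%type}|)%N by rewrite card_ffun !card_ord.
have [h hinj] := inj_card hc.
exists (fun i b => if insub b is Some t then h i t else d); split=> [i|i j hij].
  by rewrite insubF // ltnn.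
apply: hinj; apply/ffunP => t; have := hij t (ltn_ord t).
by rewrite !insubT //= => ht; congr (h _ _ = h _ _); apply: val_inj.
Qed.

Lemma achievable_rates (r1 ra rb r2 rc t0 ta tb tc R1 R2 : R) :
  [/\ 0 <= r1, 0 <= ra, 0 <= rb, 0 <= r2 & 0 <= rc] -> [/\ 0 <= t0, 0 <= ta, 0 <= tb & 0 <= tc] ->
  r1 <= j2 -> r2 <= j1 -> t0 <= q0 -> ta + ra <= q1 -> tc + rc <= q2 -> tb + rb <= q3 ->
  r1 + r2 <= t0 + ta + tb + tc -> R1 <= r1 + ra + rb -> R2 <= r2 + rc -> achievable N R1 R2.
Proof.
move=> [r10 ra0 rb0 r20 rc0] [t00 ta0 tb0 tc0] c1 c2 c0 ca cc cb ct hR1 hR2 eps delta eps0 delta0.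
pose S := r1 + ra + rb + r2 + rc + 1.
have S0 : 0 < S by rewrite ltr_wpDl // !addr_ge0.
have [s [s01 hs]] := close_to_one S0 delta0; have /andP[s0 s1] := s01.
have s01' : 0 <= s < 1 by rewrite ltW.
pose L := (Num.truncn ((S + 1) / (delta / 2))).+1.
have hL : S + 1 <= L%:R * (delta / 2).
  by rewrite -ler_pdivrMr ?divr_gt0 //; exact: ltW (truncnS_gt _).
(* The bound of [code_exists] counts [6 + 4 + 2] terms of size [e], times [4 * L.+1]. *)
pose e := eps / (48 * L.+1%:R).
have e0 : 0 < e by rewrite divr_gt0 // mulr_gt0 // ltr0n.
have q00 : 0 <= q0 by apply: le_trans c0.
have q10 : 0 <= q1 by apply: le_trans ca; exact: addr_ge0.
have q20 : 0 <= q2 by apply: le_trans cc; exact: addr_ge0.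
have q30 : 0 <= q3 by apply: le_trans cb; exact: addr_ge0.
have j10 : 0 <= j1 by apply: le_trans c2.
have j20 : 0 <= j2 by apply: le_trans c1.
have [d0 d0p w0] := wrong_small q00 s01' e0.
have [d1 d1p w1] := wrong_small q10 s01' e0.
have [d2 d2p w2] := wrong_small q20 s01' e0.
have [d3 d3p w3] := wrong_small q30 s01' e0.
have [d4 d4p w4] := wrong_small j20 s01' e0.
have [d5 d5p w5] := wrong_small j10 s01' e0.
have [d [dp le0 le1 le2 [le3 le4 le5]]] : exists d, [/\ 0 < d, d <= d0, d <= d1, d <= d2 & [/\ d <= d3, d <= d4 & d <= d5]].
  exists (Num.min d0 (Num.min d1 (Num.min d2 (Num.min d3 (Num.min d4 d5))))).
  by split; rewrite ?lt_min ?ge_min ?d0p ?d1p ?d2p ?d3p ?d4p ?d5p ?lexx ?orbT //; split;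
    rewrite ?ge_min ?lexx ?orbT.
have [n0 {}w0] := w0 d (introT andP (conj dp le0)).
have [n1 {}w1] := w1 d (introT andP (conj dp le1)).
have [n2 {}w2] := w2 d (introT andP (conj dp le2)).
have [n3 {}w3] := w3 d (introT andP (conj dp le3)).
have [n4 {}w4] := w4 d (introT andP (conj dp le4)).
have [n5 {}w5] := w5 d (introT andP (conj dp le5)).
have [n6 hcode] := code_exists hN hG hth hph hpu hk1 hk2 hka hkx1 hkx2 dp e0.
have [n7 hcoop] := cooperation_size s01 r10 r20 t00 ta0 tb0 tc0 ct.
pose n8 := (Num.truncn (3 * L%:R + L.+1%:R * S)).+1.
pose nm := (maxn n0 (maxn n1 (maxn n2 (maxn n3 (maxn n4 (maxn n5 (maxn n6 (maxn n7 n8))))))))%N.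
exists (nm.+1 * L.+1).+1 => k; rewrite ltnS => hk.
have nmk : (nm < k %/ L.+1)%N by rewrite leq_divRL.
(* The code has [k.+1] channel uses. The last one has no feedback, so the [L.+1] blocks of length
   [n] are fitted into the first [k]. *)
pose m := (k %/ L.+1).-1; pose n := m.+1.
have hm : n = (k %/ L.+1)%N by rewrite /n /m prednK // (leq_ltn_trans _ nmk).
have hnm' : (nm <= n)%N by rewrite hm ltnW.
have kn : (L.+1 * n <= k)%N by rewrite mulnC hm leq_trunc_div.
have nk : (k.+1 <= n.+1 * L.+1)%N by rewrite hm -ltn_divLR.
move: hnm'; rewrite !geq_max => /andP[l0 /andP[l1 /andP[l2 /andP[l3 /andP[l4 /andP[l5 /andP[l6 /andP[l7 l8]]]]]]]].
pose b1 := Num.truncn (n%:R * s ^+ 2 * r1); pose b2 := Num.truncn (n%:R * s ^+ 2 * r2).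
pose fa := Num.truncn (n%:R * s * ra); pose fb := Num.truncn (n%:R * s * rb); pose fc := Num.truncn (n%:R * s * rc).
pose v0 := Num.truncn (n%:R * s * t0); pose va := Num.truncn (n%:R * s * ta).
pose vb := Num.truncn (n%:R * s * tb); pose vc := Num.truncn (n%:R * s * tc).
pose bits a : finType := tup bool a.
have cbits a : #|bits a| = (2 ^ a)%N by exact: card_bits.
have cpair a b : #|{: bits a * bits b}| = (2 ^ (a + b))%N by rewrite card_prod !cbits expnD.
(* By [cooperation_size] a pair of V-symbols fits into the cloud index and the three spare parts
   together. *)
have [J Jinj] : exists J : bits b1 * bits b2 -> bits v0 * bits va * bits vb * bits vc, injective J.
  by apply: inj_card; rewrite !card_prod !cbits -!expnD leq_exp2l //; exact: hcoop.
pose f0 w := (J w).1.1.1; pose fa' w (f : bits fa * bits fb) : bits va * bits fa := ((J w).1.1.2, f.1).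
pose fb' w (f : bits fa * bits fb) : bits vb * bits fb := ((J w).1.2, f.2).
pose fc' w (f : bits fc) : bits vc * bits fc := ((J w).2, f).
have einj : injective (ejoin f0 fa' fb' fc').
  move=> [[w [f f']] g] [[w' [h h']] g']; rewrite /ejoin /f0 /fa' /fb' /fc' /= => -[E0 Ea -> Ec -> Eb ->].
  congr (_, _, _); apply: Jinj; move: E0 Ea Ec Eb.
  by case: (J w) => [[[? ?] ?] ?]; case: (J w') => [[[? ?] ?] ?] /= -> -> -> ->.
have n0R : 0 <= n%:R :> R by [].
have ns0 : 0 <= n%:R * s by rewrite mulr_ge0 // ltW.
have ns20 : 0 <= n%:R * s ^+ 2 by rewrite mulr_ge0 // sqr_ge0.
have s2s : s ^+ 2 <= s by rewrite expr2 ler_piMr // ltW.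
have ns2s : n%:R * s ^+ 2 <= n%:R * s by apply: ler_wpM2l.
have up x y : 0 <= x -> 0 <= y -> (Num.truncn (x * y))%:R <= x * y :> R.
  by move=> x0 y0; rewrite truncn_le mulr_ge0.
have lo (x y : R) : n%:R * s ^+ 2 <= x -> 0 <= y -> n%:R * s ^+ 2 * y - 1 <= (Num.truncn (x * y))%:R.
  move=> hx y0; rewrite lerBlDr natr1; apply: le_trans (ltW (truncnS_gt _)).
  exact: ler_wpM2r.
have hn8 : 3 * L%:R + L.+1%:R * S <= n%:R.
  by apply: le_trans (ltW (truncnS_gt _)) _; rewrite ler_nat.
have s21 : s ^+ 2 <= 1 by apply: le_trans s2s (ltW s1).
have hM1 : (msgsize k.+1 (R1 - delta) <= #|{: bits b1 * (bits fa * bits fb)}| ^ L)%N.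
  have -> : #|{: bits b1 * (bits fa * bits fb)}| = (2 ^ (b1 + (fa + fb)))%N by rewrite card_prod cpair cbits [RHS]expnD.
  rewrite -expnM mulnC; apply: (message_count (r := r1 + ra + rb) (S := S) (s := s) (n := n)) => //.
  - by rewrite !addr_ge0.
  - by rewrite /S -[leRHS]addrA -[leRHS]addrA lerDl !addr_ge0.
  - by rewrite mulrA; apply: rounding3; apply: lo.
have hM2 : (msgsize k.+1 (R2 - delta) <= #|{: bits b2 * bits fc}| ^ L)%N.
  rewrite cpair -expnM mulnC; apply: (message_count (r := r2 + rc) (S := S) (s := s) (n := n)) => //.
  - by rewrite !addr_ge0.
  - have -> : S = r2 + rc + (r1 + ra + rb + 1) by rewrite /S; ring.
    by rewrite lerDl !addr_ge0.
  - by rewrite mulrA; apply: rounding2; apply: lo.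
pose z a : bits a := [ffun=> true].
have [g1 [g1L g1i]] := @message_books L _ (bits b1) (bits fa * bits fb)%type (z b1, (z fa, z fb)) hM1.
have [g2 [g2L g2i]] := @message_books L _ (bits b2) (bits fc) (z b2, z fc) hM2.
have pos (x : R) : (0 < msgsize k.+1 x)%N by rewrite expn_gt0.
have := hcode m l6 _ _ _ _ _ _ _ _ _ _ _ _ einj L k kn _ _ (z b1) (z b2) g1 g2 g1L g2L g1i g2i
  (Ordinal (pos _)) (Ordinal (pos _)); apply: fb_code_le.
have nsq t q : t <= q -> n%:R * s * t <= n%:R * s * q by apply: ler_wpM2l.
have W0 : wrong n d q0 (bits v0) <= e.
  by apply: (w0 n l0 _ _ (cbits _)); apply: le_trans (up _ _ ns0 t00) (nsq _ _ c0).
have W1 : wrong n d q1 (bits va * bits fa)%type <= e.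
  apply: (w1 n l1 _ _ (cpair _ _)); rewrite natrD.
  by apply: le_trans (lerD (up _ _ ns0 ta0) (up _ _ ns0 ra0)) _; rewrite -mulrDr nsq.
have W2 : wrong n d q2 (bits vc * bits fc)%type <= e.
  apply: (w2 n l2 _ _ (cpair _ _)); rewrite natrD.
  by apply: le_trans (lerD (up _ _ ns0 tc0) (up _ _ ns0 rc0)) _; rewrite -mulrDr nsq.
have W3 : wrong n d q3 (bits vb * bits fb)%type <= e.
  apply: (w3 n l3 _ _ (cpair _ _)); rewrite natrD.
  by apply: le_trans (lerD (up _ _ ns0 tb0) (up _ _ ns0 rb0)) _; rewrite -mulrDr nsq.
have W4 : wrong n d j2 (bits b1) <= e.
  apply: (w4 n l4 _ _ (cbits _)); apply: le_trans (up _ _ ns20 r10) _.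
  by apply: le_trans (nsq _ _ c1); apply: ler_wpM2r.
have W5 : wrong n d j1 (bits b2) <= e.
  apply: (w5 n l5 _ _ (cbits _)); apply: le_trans (up _ _ ns20 r20) _.
  by apply: le_trans (nsq _ _ c2); apply: ler_wpM2r.
have -> : eps = 4 * L.+1%:R * (6 * e + (e + e + e + e) + (e + e)).
  rewrite /e; have : L.+1%:R != 0 :> R by rewrite pnatr_eq0.
  by move: (L.+1%:R : R) => l hl; field.
apply: ler_wpM2l; first by rewrite mulr_ge0.
by rewrite !lerD.
Qed.
End AchievableRates.

Lemma conditional_kernels (R : realType) (U V X : finType) (p : U -> V -> X -> R) : cdistr p ->
  exists (kv : U -> V -> R) (kx : U -> V -> X -> R),
    [/\ forall u, distr (kv u), forall u v, distr (kx u v) & forall u v x, p u v x = kv u v * kx u v x].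
Proof.
move=> hp; pose kv u v := \sum_x p u v x.
have p0 u v x : 0 <= p u v x by case: (hp u).
have kv0 u v : 0 <= kv u v by apply: sumr_ge0.
(* Where [v] has probability zero any law will do; the marginal of [x] given [u] is one that exists
   without a choice of letter. *)
exists kv, (fun u v x => if kv u v == 0 then \sum_v' p u v' x else p u v x / kv u v); split.
- by move=> u; split; [exact: kv0|case: (hp u)].
- move=> u v; split=> [x|].
    by case: ifP => _; [exact: sumr_ge0|rewrite divr_ge0].
  case: (eqVneq (kv u v) 0) => [_|h]; first by rewrite exchange_big /=; case: (hp u).
  by rewrite -mulr_suml divff.
move=> u v x; case: ifPn => [/eqP h|h]; last by rewrite mulrC mulfVK.
rewrite h mul0r; apply/eqP; rewrite eq_le p0 andbT -h /kv (bigD1 x) //= lerDl.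
by apply: sumr_ge0.
Qed.

(* A negative rate is replaced by [0]: [g8] and [g9] show that this keeps the sum-rate bounds. *)
Lemma entropy_rates (R : realType) (hB hUV hA hBb hW z1 z1' z2 z2' R1 R2 : R) :
  hUV <= hB -> z1 <= z1' -> z2 <= z2' -> hW <= hA -> hW <= hBb -> hBb <= hUV -> hA <= hUV ->
  z1' - z1 + hA <= hB -> z2' - z2 + hBb <= hB ->
  R1 <= hBb - hW + (z2' - z2) -> R2 <= hA - hW + (z1' - z1) ->
  R1 + R2 <= z2' - z2 + (z1' - z1) + (hUV - hW) -> R1 + R2 <= hB - hW ->
  exists lam, 0 <= lam <= 1 /\ exists r1 ra rb r2 rc ta tb tc,
  [/\ [/\ 0 <= r1, 0 <= ra, 0 <= rb, 0 <= r2 & 0 <= rc], [/\ 0 <= ta, 0 <= tb & 0 <= tc],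
    [/\ r1 <= z2' - z2, r2 <= z1' - z1, ta + ra <= lam * (hUV - hA),
      tc + rc <= lam * (hA - hW) + (1 - lam) * (hUV - hBb) & tb + rb <= (1 - lam) * (hBb - hW)],
    r1 + r2 <= hB - hUV + ta + tb + tc & R1 <= r1 + ra + rb /\ R2 <= r2 + rc].
Proof.
move=> g1 g2 g3 g4 g5 g6 g7 g8 g9 h1 h2 h3 h4.
have [S1 [S2 [[s1 s2 s3 s4] [s5 s6 s7 s8]]]] : exists S1 S2, [/\ 0 <= S1, 0 <= S2, R1 <= S1 & R2 <= S2] /\
    [/\ S1 <= hBb - hW + (z2' - z2), S2 <= hA - hW + (z1' - z1),
      S1 + S2 <= z2' - z2 + (z1' - z1) + (hUV - hW) & S1 + S2 <= hB - hW].
  case: (lerP R1 0) => k1; case: (lerP R2 0) => k2.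
  - by exists 0, 0; do 2 split; lra.
  - by exists 0, R2; do 2 split; lra.
  - by exists R1, 0; do 2 split; lra.
  - by exists R1, R2; do 2 split; lra.
have e : hUV - hA + (hA - hW) = hUV - hW by ring.
have [||||||||||||||lam [l01 [r1 [ra [rb [r2 [rc [ta [tb [tc [p q c s [hR1 hR2]]]]]]]]]]]] :=
  @rates_selection R (z2' - z2) (z1' - z1) (hBb - hW) (hA - hW) (hUV - hA) (hUV - hBb) (hB - hUV) S1 S2;
  rewrite ?subr_ge0 ?e //; first by ring.
  by have -> : hB - hUV + (hUV - hW) = hB - hW by ring.
exists lam; split=> //; exists r1, ra, rb, r2, rc, ta, tb, tc; split=> //.
by split; [exact: le_trans hR1|exact: le_trans hR2].
Qed.

(* C_cl-fb(N) contains R_in(N), for every quantum MAC N_{A1 A2 -> B} *)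
Theorem theorem2 (R : realType) (A1 A2 B : finType)
  (N : op R (A1 * A2) -> op R B) :
  channel N ->
  forall R1 R2 : R, Rin N R1 R2 -> cap_fb N (R1, R2).
Proof.
move=> hN R1 R2 [U [V1 [X1 [V2 [X2 [Bb [Z1 [Z2 [pU [p1 [p2 [th [ph [G]]]]]]]]]]]]]].
move=> [[hU /conditional_kernels [k1 [kx1 [hk1 hkx1 e1]]] /conditional_kernels [k2 [kx2 [hk2 hkx2 e2]]] hth hph]].
move=> [hG]; set w := omega N pU p1 p2 th ph G; cbv zeta => -[].
have dW := density_Wst hN hG hth hph.
have zW x1 x2 (y y' : Bb * Z1 * Z2) : (y.1.2 == y'.1.2) && (y.2 == y'.2) = false ->
    Wst N G th ph x1 x2 y y' = 0 by rewrite /Wst => ->; rewrite mul0r.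
have hw c b z1 z2 c' b' z1' z2' : w (c, b, z1, z2) (c', b', z1', z2') = (c == c')%:R *
    (real_complex R (Pcl pU k1 k2 kx1 kx2 c) * Wcl (Wst N G th ph) c (b, z1, z2) (b', z1', z2')).
  case: c => [[[[u v1] x1] v2] x2]; case: c' => [[[[u' v1'] x1'] v2'] x2'].
  rewrite /w /omega /Pcl /Wcl /Wst /= !xpair_eqE e1 e2 -!mulnb !natrM; ring.
rewrite (CMI_X1 hU hk1 hk2 hkx1 hkx2 dW zW hw) (CMI_X2 hU hk1 hk2 hkx1 hkx2 dW zW hw).
rewrite (CMI_X1X2 hU hk1 hk2 hkx1 hkx2 dW zW hw) (CMI_X1X2_out hU hk1 hk2 hkx1 hkx2 dW zW hw).
rewrite !(CMI_V1 hU hk1 hk2 hkx1 hkx2 dW zW hw) ?(CMI_V2 hU hk1 hk2 hkx1 hkx2 dW zW hw); try by [left|right].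
have := chain_Z2 hU hk1 hk2 hkx1 hkx2 dW zW; have := chain_Z1 hU hk1 hk2 hkx1 hkx2 dW zW.
have := HV2X1_le hU hk1 hk2 hkx1 hkx2 dW; have := HV1X2_le hU hk1 hk2 hkx1 hkx2 dW.
have := HX1X2_le_V1X2 hU hk1 hk2 hkx1 hkx2 dW; have := HX1X2_le_V2X1 hU hk1 hk2 hkx1 hkx2 dW.
have := HZ2_le hU hk1 hk2 hkx1 hkx2 dW; have := HZ1_le hU hk1 hk2 hkx1 hkx2 dW.
have := HV1V2_le hU hk1 hk2 hkx1 hkx2 dW.
move=> g1 g2 g3 g4 g5 g6 g7 g8 g9 h1 h2 h3 h4.
have [lam [l01 [r1 [ra [rb [r2 [rc [ta [tb [tc [pos [ta0 tb0 tc0] [c1 c2 c3 c4 c5] cs [hR1 hR2]]]]]]]]]]]] :=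
  entropy_rates g1 g2 g3 g4 g5 g6 g7 g8 g9 h1 h2 h3 h4.
(* The pair itself is achievable: the slack [delta] in [achievable] absorbs all rate losses of the
   construction. *)
apply: subset_closure; rewrite /mkset /=.
(* The cloud index carries no fresh message, so its whole rate [I0] is given to resending through
   [t0]. *)
apply: (achievable_rates hN hG hth hph hU hk1 hk2 (distr_ksplit hkx1 l01) (distr_kjoin hkx1) hkx2 pos
  (t0 := vN (rho_out pU k1 k2 kx1 kx2 (Wst N G th ph)) - HV1V2 pU k1 k2 kx1 kx2 (Wst N G th ph)) (ta := ta) (tb := tb) (tc := tc)).
- by split; [rewrite subr_ge0; exact: g1|exact: ta0|exact: tb0|exact: tc0].
- rewrite J2E; [exact: c1|..]; by [].
- rewrite J1E; [exact: c2|..]; by [].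
- rewrite I0E; [exact: lexx|..]; by [].
- rewrite I1E; [exact: c3|..]; by [].
- rewrite I2E; [exact: c4|..]; by [].
- rewrite I3E; [exact: c5|..]; by [].
- exact: cs.
- exact: hR1.
- exact: hR2.
Qed.
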